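(* Let $V:\mathbb{R}^d\to\mathbb{R}$ be smooth, let $(P_t)_{t\ge 0}$ denote the Markov semigroup corresponding to the Langevin diffusion $\mathrm{d}X_t=-\nabla V(X_t)\,\mathrm{d}t+\sqrt2\,\mathrm{d}B_t$ with potential $V$, and let $\beta>0$. For exponents $p,q>1$, consider the following properties. (CurvBdd) The two-sided curvature bound $-\beta I\preceq\nabla^2V\preceq\beta I$ holds on $\mathbb{R}^d$. (LGE) The local gradient-entropy bound $$\frac{\|P_t\nabla f\|^2}{P_tf}\le\frac{2\beta}{1-\exp(-2\beta t)}\,\bigl\{P_t(f\log f)-P_tf\,\log P_tf\bigr\}$$ holds (pointwise on $\mathbb{R}^d$) for all $t>0$ and all smooth $f:\mathbb{R}^d\to\mathbb{R}_{>0}$. (SH$_p$) The shift Harnack inequality $$\bigl(P_t(f(\cdot+v))\bigr)^p\le\exp\Bigl(\frac{\beta p\,\|v\|^2}{2\,(p-1)\,(1-\exp(-2\beta t))}\Bigr)\,P_t(f^p)$$ holds (pointwise on $\mathbb{R}^d$) for all $v\in\mathbb{R}^d$, all $t>0$, and all $f:\mathbb{R}^d\to\mathbb{R}_{>0}$. (SRT$_q$) The shift reverse transport inequality $$\mathsf{R}_q(\delta_xP_t*\delta_v\,\|\,\delta_xP_t)\le\frac{\beta q\,\|v\|^2}{2\,(1-\exp(-2\beta t))}$$ holds for all $x,v\in\mathbb{R}^d$ and all $t>0$. (SH$_{\log}$) The shift log-Harnack inequality $$P_t(f(\cdot+v))\le\log P_t(\exp f)+\frac{\beta\,\|v\|^2}{2\,(1-\exp(-2\beta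 t))}$$ holds (pointwise on $\mathbb{R}^d$) for all $v\in\mathbb{R}^d$, all $t>0$, and all $f:\mathbb{R}^d\to\mathbb{R}_{>0}$. (SRT$_1$) The shift reverse transport inequality $$\mathsf{KL}(\delta_xP_t*\delta_v\,\|\,\delta_xP_t)\le\frac{\beta\,\|v\|^2}{2\,(1-\exp(-2\beta t))}$$ holds for all $x,v\in\mathbb{R}^d$ and all $t>0$. (CurvUB) The curvature upper bound $\nabla^2V\preceq\beta I$ holds on $\mathbb{R}^d$. Then the following implications hold: 1. (CurvBdd) $\Rightarrow$ (LGE); 2. (LGE) $\Leftrightarrow$ [(SH$_p$) for all $p>1$]; 3. [(SH$_p$) for all $p>1$] $\Rightarrow$ [(SH$_p$) for some $p>1$]; 4. [(SH$_p$) for some $p>1$] $\Rightarrow$ (SH$_{\log}$); 5. (SH$_{\log}$) $\Rightarrow$ (CurvUB); 6. [(SH$_p$) for all $p>1$] $\Leftrightarrow$ [(SRT$_q$) for all $q>1$]; 7. [(SH$_p$) for some $p>1$] $\Leftrightarrow$ [(SRT$_q$) for some $q>1$]; 8. (SH$_{\log}$) $\Leftrightarrow$ (SRT$_1$); 9. [(SRT$_q$) for all $q>1$] $\Rightarrow$ [(SRT$_q$) for some $q>1$] $\Rightarrow$ (SRT$_1$).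
   Context: $(B_t)_{t\ge0}$ is a standard Brownian motion on $\mathbb{R}^d$. It is assumed that the Langevin SDE has, for every initial point, a unique non-exploding strong solution, so that $P_tf(x)=\mathbb{E}[f(X_t)\mid X_0=x]$ defines a Markov semigroup; $P_t$ acts coordinatewise on vector-valued functions. Functions $f$ are measurable, and expectations of non-negative functions take values in $[0,\infty]$; in (LGE), the inequality is required for those smooth positive $f$ for which $P_t\|\nabla f\|$, $P_tf$ and $P_t(f|\log f|)$ are finite, so that all terms are well defined. $\delta_xP_t$ denotes the law of $X_t$ started at $X_0=x$, $*$ denotes convolution of measures, and $\delta_v$ is the Dirac mass at $v$, so $\delta_xP_t*\delta_v$ is the translate of $\delta_xP_t$ by $v$. For probability measures $\mu,\nu$ and $q>1$, the Rényi divergence is $\mathsf{R}_q(\mu\,\|\,\nu)=\frac{1}{q-1}\log\int(\frac{\mathrm{d}\mu}{\mathrm{d}\nu})^q\,\mathrm{d}\nu$ if $\mu\ll\nu$ and $+\infty$ otherwise; $\mathsf{KL}(\mu\,\|\,\nu)=\mathsf{R}_1(\mu\,\|\,\nu)=\int\frac{\mathrm{d}\mu}{\mathrm{d}\nu}\log\frac{\mathrm{d}\mu}{\mathrm{d}\nu}\,\mathrm{d}\nu$ if $\mu\ll\nu$ and $+\infty$ otherwise. *)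

(* Defs.v *)
From HB Require Import structures.
From mathcomp Require Import all_boot all_order all_algebra.
From mathcomp Require Import all_classical all_reals all_analysis.
From mathcomp Require Import measurable_realfun.

Set Implicit Arguments.
Unset Strict Implicit.
Unset Printing Implicit Defensive.

Import Order.TTheory GRing.Theory Num.Theory.
Import numFieldNormedType.Exports.

Local Open Scope classical_set_scope.
Local Open Scope ring_scope.
Local Open Scope charge_scope.

(** R^d is ['rV[R]_d]. The library norm on matrices is the sup norm, so the
    Euclidean norm is introduced separately; the two topologies coincide. *)

(* The sigma-algebra generated by the coordinate maps (as the library does for
   tuples); on R^d this is the Borel sigma-algebra, see [measurable_rVE]. *)
Definition measure_rV_display : measure_display -> measure_display.
Proof. exact. Qed.

Section measurable_rV.
Variables (R : realType) (d : nat).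

Let coors : 'I_d -> 'rV[R]_d -> R := fun i x => x 0 i.

Let rV_set0 : g_sigma_preimage coors set0.
Proof. exact: sigma_algebra0. Qed.

Let rV_setC A : g_sigma_preimage coors A -> g_sigma_preimage coors (~` A).
Proof. exact: sigma_algebraC. Qed.

Let rV_bigcup (F : (set 'rV[R]_d)^nat) :
  (forall i, g_sigma_preimage coors (F i)) ->
  g_sigma_preimage coors (\bigcup_i (F i)).
Proof. exact: sigma_algebra_bigcup. Qed.

HB.instance Definition _ :=
  @isMeasurable.Build (measure_rV_display R.-ocitv.-measurable.-sigma) 'rV[R]_d
    (g_sigma_preimage coors) rV_set0 rV_setC rV_bigcup.

Lemma measurable_coord (i : 'I_d) :
  measurable_fun [set: 'rV[R]_d] (fun x : 'rV[R]_d => x 0 i).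
Proof.
move=> _ Y mY; rewrite setTI; apply: sub_sigma_algebra => /=.
rewrite -bigcup_seq/=; exists i => /=; first by rewrite mem_index_enum.
by exists Y => //; rewrite setTI.
Qed.

Lemma measurable_fun_rV d' (T : measurableType d') (f : T -> 'rV[R]_d) :
  (forall i, measurable_fun [set: T] (fun w => f w 0 i)) ->
  measurable_fun [set: T] f.
Proof.
move=> mf _ A mA.
suff: g_sigma_preimage coors `<=` [set B | measurable (setT `&` f @^-1` B)].
  by move=> /(_ _ mA).
apply: smallest_sub.
- split => /=.
  + by rewrite preimage_set0 setI0.
  + by move=> B; rewrite !setTI setTD preimage_setC => /measurableC.
  + move=> F mF; rewrite setTI preimage_bigcup.
    by apply: bigcup_measurable => k _; rewrite -[X in measurable X]setTI.
- move=> B; rewrite -bigcup_seq/= => -[i _ [C mC <-]].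
  by rewrite /= setTI; exact: mf.
Qed.

Definition rV_add (z : 'rV[R]_d * 'rV[R]_d) : 'rV[R]_d := z.1 + z.2.

Lemma measurable_rV_add : measurable_fun setT rV_add.
Proof.
apply: measurable_fun_rV => i.
rewrite /rV_add; under eq_fun do rewrite mxE.
apply: measurable_funD.
- by apply: (measurableT_comp (measurable_coord i)); exact: measurable_fst.
- by apply: (measurableT_comp (measurable_coord i)); exact: measurable_snd.
Qed.

HB.instance Definition _ := 
  isMeasurableFun.Build _ _ _ _ rV_add measurable_rV_add.

Lemma measurable_rVE : (measurable : set (set 'rV[R]_d)) = <<s open >>.
Proof.
apply/seteqP; split.
- apply: smallest_sub; first exact: smallest_sigma_algebra.
  move=> B; rewrite -bigcup_seq/= => -[i _ [C mC <-]].
  have : [set D : set R | <<s (@open 'rV[R]_d) >> (setT `&` coors i @^-1` D)] C.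
    have {}mC : <<s (@RGenOpens.G R) >> C.
      by have := mC; rewrite -[measurable]/(R.-ocitv.-measurable.-sigma.-measurable)
        RGenOpens.measurableE.
    apply: smallest_sub mC.
      exact/sigma_algebra_image/smallest_sigma_algebra.
    move=> D [x [y ->]]; rewrite /= setTI; apply: sub_sigma_algebra.
    apply: open_comp; last exact: interval_open.
    by move=> z _; exact: coord_continuous.
  exact.
- apply: smallest_sub; first exact: sigma_algebra_measurable.
  move=> U oU.
  pose I := ('rV[rat]_d * nat)%type.
  pose bx (a : I) : set 'rV[R]_d :=
    [set y | forall i, ball (ratr (a.1 0 i) : R) (a.2.+1%:R^-1) (y 0 i)].
  pose F a := if `[< bx a `<=` U >] then bx a else set0.
  have -> : U = \bigcup_a F a.
    apply/seteqP; split=> [x Ux|x [a _]]; last first.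
      by rewrite /F; case: asboolP => // baU /baU.
    have /nbhs_ballP[e /= e0 exU] : nbhs x U by exact: open_nbhs_nbhs.
    have [n] : exists n, (n.+1%:R^-1 < e / 2 :> R).
      have /ltr_add_invr[k] : 0 < e / 2 by rewrite divr_gt0.
      by rewrite add0r => ke; exists k.
    move=> ne.
    have n0 : 0 < (n.+1%:R^-1 : R) by rewrite invr_gt0.
    have [q qx] : exists q : 'rV[rat]_d,
        forall i, `|ratr (q 0 i) - x 0 i| < n.+1%:R^-1 :> R.
      have /choice[f fP] : forall i : 'I_d, exists r : rat,
          `|ratr r - x 0 i| < n.+1%:R^-1 :> R.
        move=> i.
        have : x 0 i - n.+1%:R^-1 < x 0 i + n.+1%:R^-1.
          by rewrite ltrD2l gtrN.
        move=> /rat_in_itvoo[r]; rewrite in_itv/= => rx; exists r.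
        by rewrite ltr_distl.
      by exists (\row_i f i) => i; rewrite mxE.
    exists (q, n) => //; rewrite /F; case: asboolP => [_ i|].
      by rewrite /ball/= qx.
    case=> y /= yq; apply: exU; split => // j i; rewrite !ord1.
    rewrite /ball/=.
    rewrite (le_lt_trans (ler_distD (ratr (q 0 i)) _ _))//.
    rewrite (splitr e) ltrD// (lt_trans _ ne)//; last exact: yq.
    by rewrite distrC.
  apply: countable_bigcupT_measurable; first exact: countableP.
  move=> a; rewrite /F; case: asboolP => // _.
  rewrite (_ : bx a = \bigcap_(i in [set: 'I_d])
      (coors i @^-1` ball (ratr (a.1 0 i) : R) a.2.+1%:R^-1)).
    apply: @fin_bigcap_measurable => // i _.
    rewrite -[X in measurable X]setTI; apply: measurable_coord => //.
    exact: measurable_ball.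
  by apply/seteqP; split=> y /= h i; [move=> _|]; exact: h.
Qed.

End measurable_rV.

Section calculus.
Variables (R : realType) (d : nat).
Implicit Types (f : 'rV[R]_d -> R) (x : 'rV[R]_d).

Definition euclid_norm x : R := Num.sqrt (\sum_(i < d) x 0 i ^+ 2).

Definition partial (i : 'I_d) f : 'rV[R]_d -> R :=
  fun x => 'D_(delta_mx 0 i) f x.

(* C^oo: all iterated partial derivatives exist and are continuous. *)
Definition smooth f : Prop :=
  forall s : seq 'I_d,
    continuous (foldr partial f s) /\
    forall (i : 'I_d) x, derivable (foldr partial f s) x (delta_mx 0 i).

Definition grad f x : 'rV[R]_d := \row_i partial i f x.

Definition hessian f x : 'M[R]_d := \matrix_(i, j) partial i (partial j f) x.

(* Loewner order: [B - A] is positive semidefinite *)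
Definition loewner_le (A B : 'M[R]_d) : Prop :=
  forall u : 'rV[R]_d, 0 <= (u *m (B - A) *m u^T) 0 0.

End calculus.

Section divergences.
Local Open Scope ereal_scope.
Variables (R : realType) (d : nat).
Implicit Types mu nu : probability 'rV[R]_d R.

Definition convolution mu nu : probability 'rV[R]_d R :=
  distribution (mu \x nu) (@rV_add R d).

Lemma convolution_dirac mu v (A : set 'rV[R]_d) : measurable A ->
  convolution mu (\d_v) A = mu [set x | A (x + v)%R].
Proof.
move=> mA; rewrite /convolution /distribution /pushforward /product_measure1 /=.
transitivity (\int[mu]_x (\1_[set x | A (x + v)%R] x)%:E).
  apply: eq_integral => x _.
  rewrite /dirac /= !indicE; congr ((_%:R)%:E); congr nat_of_bool.
  by apply/idP/idP; rewrite !inE /xsection/= !inE.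
rewrite integral_indic ?setIT//.
rewrite -[X in measurable X]setTI.
have -> : [set x : 'rV[R]_d | A (x + v)%R] =
    (fun x => (rV_add (x, v))) @^-1` A by [].
have m : measurable_fun setT (fun x : 'rV[R]_d => rV_add (x, v)).
  apply: measurableT_comp; first exact: measurable_rV_add.
  exact: measurable_fun_pair.
exact: m.
Qed.

(* The Radon-Nikodym derivative of the library is everywhere finite when
   [mu `<< nu]. *)
Definition density mu nu : 'rV[R]_d -> R :=
  fun y => fine (('d (charge_of_finite_measure mu) '/d nu) y).

(* [lne] is the logarithm on \bar R, with [lne +oo = +oo]. *)
Definition renyi (q : R) mu nu : \bar R :=
  if `[< mu `<< nu >] then
    ((q - 1)^-1)%:E * lne (\int[nu]_y (density mu nu y `^ q)%:E)
  else +oo.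

(* [ln 0 = 0] in the library, whence the convention 0 log 0 = 0. *)
Definition KL mu nu : \bar R :=
  if `[< mu `<< nu >] then
    \int[nu]_y (density mu nu y * ln (density mu nu y))%:E
  else +oo.

End divergences.

Section langevin.
Context {R : realType} {d : nat} {dO : measure_display}
  {Omega : measurableType dO}.
Variable P : probability Omega R.

Definition mutually_independent (J : finType) d' (T : measurableType d')
    (Y : J -> Omega -> T) : Prop :=
  forall A : J -> set T, (forall j, measurable (A j)) ->
    P [set w | forall j, A j (Y j w)] = (\prod_(j : J) P (Y j @^-1` A j))%E.

(* Processes are indexed by all of [R]; only times [t >= 0] are relevant. *)
Implicit Types (B X : R -> {RV P >-> 'rV[R]_d}).

Definition continuous_paths X : Prop :=
  {ae P, forall w, {within [set t : R | 0 <= t], continuous (fun t => X t w)}}.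

(* The second parameter of [normal_prob] is the standard deviation: the third
   clause says that [B t - B s] has law N(0, (t - s) I_d). *)
Definition brownian B : Prop :=
  [/\ {ae P, forall w, B 0 w = 0},
      (forall (n : nat) (t : nat -> R), 0 <= t 0%N ->
        (forall k, t k < t k.+1) ->
        mutually_independent (fun (k : 'I_n) w => B (t k.+1) w - B (t k) w)),
      (forall s t, 0 <= s -> s < t ->
        forall A : 'I_d -> set R, (forall i, measurable (A i)) ->
          P [set w | forall i, A i ((B t w - B s w) 0 i)] =
          (\prod_(i < d) normal_prob 0 (Num.sqrt (t - s)) (A i))%E) &
      continuous_paths B].

(* sigma(B_s, 0 <= s <= t), completed by the null sets of [P] *)
Definition brownian_filtration B (t : R) : set (set Omega) :=
  <<s [set A | exists2 s, 0 <= s <= t &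
                 exists2 U, measurable U & A = B s @^-1` U]
      `|` [set N | measurable N /\ P N = 0%E] >>.

Definition adapted_to B X : Prop :=
  forall t, 0 <= t -> forall U : set 'rV[R]_d, measurable U ->
    brownian_filtration B t (X t @^-1` U).

(* The noise being additive, the stochastic integral of the constant sqrt 2 is
   [sqrt 2 * B t], and dX = - grad V(X) dt + sqrt 2 dB amounts to a pathwise
   integral equation.  Non-explosion: [X] is defined at all times. *)
Definition langevin_solution B (V : 'rV[R]_d -> R) (x : 'rV[R]_d) X : Prop :=
  [/\ continuous_paths X,
      adapted_to B X &
      {ae P, forall w, forall t, 0 <= t -> forall i : 'I_d,
        X t w 0 i = x 0 i
          - \int[lebesgue_measure]_(s in `[0, t]) grad V (X s w) 0 i
          + Num.sqrt 2 * B t w 0 i}].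

(* [X x] is the unique (up to indistinguishability) strong solution from [x] *)
Definition langevin_flow B (V : 'rV[R]_d -> R)
    (X : 'rV[R]_d -> R -> {RV P >-> 'rV[R]_d}) : Prop :=
  forall x, langevin_solution B V x (X x) /\
    forall Y, langevin_solution B V x Y ->
      {ae P, forall w, forall t, 0 <= t -> Y t w = X x t w}.

End langevin.

Section properties.
Context {R : realType} {d : nat} {dO : measure_display}
  {Omega : measurableType dO} {P : probability Omega R}.
Variables (X : 'rV[R]_d -> R -> {RV P >-> 'rV[R]_d}) (beta : R).

Definition Psg (t : R) (f : 'rV[R]_d -> R) (x : 'rV[R]_d) : \bar R :=
  'E_P[f \o X x t].

(* [Psg] on functions for which it is finite *)
Definition Psgr (t : R) (f : 'rV[R]_d -> R) (x : 'rV[R]_d) : R :=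
  fine (Psg t f x).

Definition Psgv (t : R) (F : 'rV[R]_d -> 'rV[R]_d) (x : 'rV[R]_d) : 'rV[R]_d :=
  \row_i Psgr t (fun y => F y 0 i) x.

Definition law (x : 'rV[R]_d) (t : R) : probability 'rV[R]_d R :=
  distribution P (X x t).

Definition CurvBdd (V : 'rV[R]_d -> R) : Prop :=
  forall x, loewner_le (- beta)%:M (hessian V x) /\
            loewner_le (hessian V x) beta%:M.

Definition CurvUB (V : 'rV[R]_d -> R) : Prop :=
  forall x, loewner_le (hessian V x) beta%:M.

Definition LGE : Prop :=
  forall (t : R) (f : 'rV[R]_d -> R), 0 < t -> smooth f -> (forall x, 0 < f x) ->
    (forall x, Psg t (fun y => euclid_norm (grad f y)) x < +oo)%E ->
    (forall x, Psg t f x < +oo)%E ->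
    (forall x, Psg t (fun y => f y * `|ln (f y)|)%R x < +oo)%E ->
    forall x,
      euclid_norm (Psgv t (grad f) x) ^+ 2 / Psgr t f x <=
      2 * beta / (1 - expR (- (2 * beta * t))) *
      (Psgr t (fun y => f y * ln (f y)) x - Psgr t f x * ln (Psgr t f x)).

Definition SH (p : R) : Prop :=
  forall (v : 'rV[R]_d) (t : R) (f : 'rV[R]_d -> R), 0 < t -> measurable_fun [set: 'rV[R]_d] f ->
    (forall x, 0 < f x) ->
    forall x,
      (Psg t (fun y => f (y + v)%R) x `^ p <=
       (expR (beta * p * euclid_norm v ^+ 2 /
              (2 * (p - 1) * (1 - expR (- (2 * beta * t))))))%:E *
       Psg t (fun y => f y `^ p)%R x)%E.

Definition SRT (q : R) : Prop :=
  forall (x v : 'rV[R]_d) (t : R), 0 < t ->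
    (renyi q (convolution (law x t) (\d_v)) (law x t) <=
     (beta * q * euclid_norm v ^+ 2 /
      (2 * (1 - expR (- (2 * beta * t)))))%:E)%E.

Definition SHlog : Prop :=
  forall (v : 'rV[R]_d) (t : R) (f : 'rV[R]_d -> R), 0 < t -> measurable_fun [set: 'rV[R]_d] f ->
    (forall x, 0 < f x) ->
    forall x,
      (Psg t (fun y => f (y + v)%R) x <=
       lne (Psg t (fun y => expR (f y)) x) +
       (beta * euclid_norm v ^+ 2 /
        (2 * (1 - expR (- (2 * beta * t)))))%:E)%E.

Definition SRT1 : Prop :=
  forall (x v : 'rV[R]_d) (t : R), 0 < t ->
    (KL (convolution (law x t) (\d_v)) (law x t) <=
     (beta * euclid_norm v ^+ 2 /
      (2 * (1 - expR (- (2 * beta * t)))))%:E)%E.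

End properties.

(* Main.v *)
From HB Require Import structures.
Require Import Defs.
From mathcomp Require Import all_boot all_order all_algebra.
From mathcomp Require Import all_classical all_reals all_analysis.
From mathcomp Require Import measurable_realfun.
From mathcomp Require Import ring lra.

(** Bounded curvature gives the shift Harnack inequalities by a coupling of the
    Euler scheme with a shifted copy of itself: the shift is turned on gradually,
    each step costs one Gaussian Harnack inequality, and the step size tends to 0.
    The shift Harnack inequalities give (LGE) by letting p tend to 1 along
    infinitesimal shifts, and (LGE) gives them back by integrating along the shift.
    The transport inequalities are the duals of the Harnack inequalities, with
    q = p / (p - 1); iterating (SH_p) gives (SH_(p^k)), whose limit as k tends to
    infinity is (SH_log).

    For the curvature upper bound at x in direction u, (SH_log) is applied to
    2 + a.(y - x), truncated, with a = u / 2, the shift t u and t tending to 0.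
    By the integral equation, a.(X_t - x) + t a.grad V(x) is close to the Gaussian
    variable U = sqrt 2 (a.B_t - int_0^t (Hess V(x) a).B_s ds), whose exponential
    moments are explicit.  The difference enters both sides of (SH_log) in the same
    way to first order, so that O(t^(9/5)) is small enough, and comparing the terms
    of order t^2 bounds the quadratic form of Hess V(x) at u by beta |u|^2.
    Brownian paths are controlled off an event of probability O(t^(11/5)), by
    chaining. *)

Set Implicit Arguments.
Unset Strict Implicit.
Unset Printing Implicit Defensive.

Import Order.TTheory GRing.Theory Num.Theory.
Import numFieldNormedType.Exports.

Local Open Scope classical_set_scope.
Local Open Scope ring_scope.

(** * Integrals with respect to probability measures *)

(** No stochastic calculus enters: neither the generator nor a commutation formula is used, and the
    diffusion is known only through its pathwise integral equation. This is why (LGE) is reached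
    from the curvature bound by way of the Harnack inequalities. (LGE) concerns smooth functions,
    (SH_p) all positive measurable ones; Harnack inequalities are therefore first proved for [tame]
    functions, a class stable under shifts and powers and dense in L^1 of two laws at once.

    For the curvature upper bound V is merely smooth and no moment of X_t is available, which forces
    the truncation and the exceptional event. All scales are powers of q = 2^(-J): t = q^5, the
    Brownian path is at most of order q^2 = t^(2/5) on [0, t], and time integrals are discretized
    with mesh q^10 = t^2, on which the path oscillates by at most order q^4. The expansion error is
    t q^4 = q^9; multiplied by the size q^2 of U it gives q^11, which is also the order of the
    exceptional probability and is negligible against t^2 = q^10. *)

Section integral_toolkit.
Context d (T : measurableType d) (R : realType).
Variable P : probability T R.
Implicit Types f g : T -> R.

Lemma bounded_integrable f M : measurable_fun setT f ->
  (forall x, `|f x| <= M) -> P.-integrable setT (EFin \o f).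
Proof.
move=> mf fM.
apply: (@le_integrable _ _ _ _ _ measurableT _ (cst M%:E)).
- exact/measurable_EFinP.
- by move=> x _ /=; rewrite lee_fin (le_trans (fM x))// ler_norm.
- exact: finite_measure_integrable_cst.
Qed.

Lemma integral_Rintegral f : P.-integrable setT (EFin \o f) ->
  (\int[P]_x (f x)%:E)%E = (\int[P]_x f x)%:E.
Proof. by move=> fi; rewrite /Rintegral fineK//; exact: integrable_fin_num. Qed.

Lemma Rintegral_probability_cst (c : R) : \int[P]_x c = c.
Proof. by rewrite Rintegral_cst// -[X in fine X]/(P setT) probability_setT mulr1. Qed.

Lemma integral_probability_cst (c : R) : (\int[P]_x c%:E = c%:E)%E.
Proof.
have := integral_cst P measurableT c%:E.
by rewrite -[X in (_ * X)%E]/(P setT) probability_setT mule1.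
Qed.

Lemma Rintegral_dominated_cvg (f_ : nat -> T -> R) f g :
  (forall n, measurable_fun setT (f_ n)) -> measurable_fun setT f ->
  {ae P, forall x, f_ ^~ x @ \oo --> f x} ->
  P.-integrable setT (EFin \o g) -> (forall n x, `|f_ n x| <= g x) ->
  (fun n => \int[P]_x f_ n x) @ \oo --> \int[P]_x f x.
Proof.
move=> mf_ mf ff ig fg.
have [||fi _ h] := @dominated_convergence _ _ _ P setT measurableT
  (fun n => EFin \o f_ n) (EFin \o f) (EFin \o g)
  (fun n => (measurable_EFinP _ _).2 (mf_ n)) ((measurable_EFinP _ _).2 mf)
  _ ig _.
- apply: filterS ff => x fx _ /=; apply: cvg_EFin; first exact: nearW.
  exact: fx.
- by apply: aeW => x n _ /=; rewrite lee_fin.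
apply: fine_cvg.
by move: h; rewrite [X in _ --> X -> _]integral_Rintegral.
Qed.

(** Fatou's lemma for truncation arguments: bounds on the truncated integrals pass to an extended
    integral whose finiteness is not known in advance. *)
Lemma fatou_le (g_ : nat -> T -> R) g (K_ : nat -> R) K :
  (forall n, measurable_fun setT (g_ n)) ->
  (forall n x, 0 <= g_ n x) ->
  (forall x, g_ ^~ x @ \oo --> g x) ->
  (forall n, \int[P]_x (g_ n x)%:E <= (K_ n)%:E)%E ->
  K_ @ \oo --> K ->
  (\int[P]_x (g x)%:E <= K%:E)%E.
Proof.
move=> mg g0 gg gK KK.
have := @fatou _ _ _ P setT measurableT (fun n => EFin \o g_ n)
  (fun n => (measurable_EFinP _ _).2 (mg n)) (fun n x _ => g0 n x).
have -> : (\int[P]_x limn_einf ((fun n => EFin \o g_ n)^~ x) =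
           \int[P]_x (g x)%:E)%E.
  apply: eq_integral => x _; apply: (cvg_limn_einf_sup _).1.
  by apply: cvg_EFin; [exact: nearW|exact: gg].
move=> h; apply: (le_trans h).
rewrite limn_einf_lim.
have KE : (EFin \o K_) @ \oo --> K%:E by apply: cvg_EFin; [exact: nearW|].
apply: (lee_cvg_to (@is_cvg_einfs _ _) KE); apply: nearW => n.
apply: le_trans (gK n).
by apply: ereal_inf_lbound; exists n => /=.
Qed.

Lemma ge0_integral_le_integrable f (K : R) : measurable_fun setT f ->
  (forall x, 0 <= f x) -> (\int[P]_x (f x)%:E <= K%:E)%E ->
  P.-integrable setT (EFin \o f).
Proof.
move=> mf f0 fK; apply/integrableP; split; first exact/measurable_EFinP.
apply: le_lt_trans (ltry K); apply: le_trans fK.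
by rewrite le_eqVlt; apply/orP; left; apply/eqP/eq_integral => x _ /=; rewrite ger0_norm.
Qed.

(** The negative part is bounded by [|M|], so an upper bound on the extended integral controls the
    positive part. It serves for rho log rho, which is at least - 1. *)
Lemma bounded_below_integrable f (M K : R) : measurable_fun setT f ->
  (forall x, 0 <= f x + M) -> (\int[P]_x (f x)%:E <= K%:E)%E ->
  P.-integrable setT (EFin \o f).
Proof.
move=> mf fM fK.
have M0 : 0 <= `|M| by [].
have ineg : P.-integrable setT (EFin \o f^\-).
  apply: (@bounded_integrable _ `|M|); first exact: measurable_funrneg.
  move=> x; rewrite ger0_norm; last by rewrite /funrneg le_max lexx orbT.
  rewrite /funrneg ge_max M0 andbT (le_trans _ (ler_norm M))//.
  by have := fM x; lra.
have ipos : P.-integrable setT (EFin \o f^\+).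
  apply/integrableP; split; first by apply/measurable_EFinP; exact: measurable_funrpos.
  move: fK; rewrite integralE funerpos funerneg (integral_Rintegral ineg) => h.
  apply: (@le_lt_trans _ _ (K%:E + (\int[P]_x (f^\- x)%R)%:E)%E); last by rewrite -EFinD ltry.
  rewrite -leeBlDr// (le_trans _ h)// leeB//.
  rewrite le_eqVlt; apply/orP; left; apply/eqP/eq_integral => x _ /=.
  by rewrite ger0_norm// /funrpos le_max lexx orbT.
apply: eq_integrable (integrableB measurableT ipos ineg) => // x _ /=.
by rewrite -EFinB -[in RHS](funrposBneg f).
Qed.

End integral_toolkit.

(** * Duality between Harnack inequalities and divergences *)

Section duality.
Context d (T : measurableType d) (R : realType).
Variables mu nu : probability T R.
Implicit Types (f g rho : T -> R) (p c : R).

(** (SH_p) at a fixed point, time and shift: there [mu] is the law of the diffusion and [nu] its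
    translate. *)
Definition harnack p c := forall f, measurable_fun setT f -> (forall x, 0 < f x) ->
  ((\int[nu]_x (f x)%:E) `^ p <= c%:E * \int[mu]_x (f x `^ p)%:E)%E.

Definition log_harnack c := forall f, measurable_fun setT f -> (forall x, 0 < f x) ->
  (\int[nu]_x (f x)%:E <= lne (\int[mu]_x (expR (f x))%:E) + c%:E)%E.

(** Characterizing the density by its change-of-variables formula fixes a version that is real and
    non-negative everywhere, so that its powers and logarithm can be integrated directly. *)
Definition is_density rho := [/\ measurable_fun setT rho, forall x, 0 <= rho x &
  forall f, measurable_fun setT f -> (forall x, 0 <= f x) ->
    (\int[nu]_x (f x)%:E = \int[mu]_x (f x * rho x)%:E)%E].

Lemma powR_cvg (u : nat -> R) (l p : R) : 0 < p -> (forall n, 0 <= u n) ->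
  u @ \oo --> l -> (fun n => u n `^ p) @ \oo --> l `^ p.
Proof.
move=> p0 u0 ul.
have l0 : 0 <= l by apply: (cvgr_to_ge ul); exact: nearW.
move: l0; rewrite le_eqVlt => /orP[/eqP l0|l0].
  (* At 0 the power need not be differentiable, so convergence is checked by hand; elsewhere
     continuity comes from differentiability. *)
  rewrite -l0 powR0 ?gt_eqF//; apply/cvgrPdist_lt => e e0.
  have e1 : 0 < e `^ p^-1 by rewrite powR_gt0.
  move: ul => /cvgrPdist_lt /(_ _ e1); rewrite -l0; apply: filterS => n.
  rewrite !sub0r !normrN !ger0_norm ?powR_ge0// => h.
  have -> : e = (e `^ p^-1) `^ p by rewrite -powRrM mulVf ?gt_eqF// powRr1// ltW.
  by rewrite gt0_ltr_powR// nnegrE ?u0 ?ltW.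
have : {for l, continuous (fun x : R => x `^ p)}.
  apply: differentiable_continuous; apply/derivable1_diffP.
  by apply: derivable_powR; rewrite in_itv/= l0.
exact: (cvg_comp _ _ ul).
Qed.

(** Adding 1 / (n + 1) makes the function positive, and [M + 1] dominates the limit. Functions that
    vanish are needed as tests: indicators of null sets and powers of truncated densities. *)
Lemma harnack_bounded p c g M : 1 < p -> 0 <= c -> harnack p c ->
  measurable_fun setT g -> (forall x, 0 <= g x) -> (forall x, g x <= M) ->
  (\int[nu]_x g x) `^ p <= c * \int[mu]_x (g x `^ p).
Proof.
move=> p1 c0 H mg g0 gM.
have p0 : 0 < p by rewrite (lt_trans _ p1).
have M0 : 0 <= M by rewrite (le_trans (g0 point)).
pose f n x := g x + n.+1%:R^-1.
have f0 n x : 0 < f n x by rewrite ltr_wpDl// invr_gt0.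
have mf n : measurable_fun setT (f n) by exact: measurable_funD.
have n1 n : n.+1%:R^-1 <= 1 :> R by rewrite invf_le1// ler1n.
have fM n x : f n x <= M + 1 by rewrite lerD.
have fpM n x : `|f n x `^ p| <= (M + 1) `^ p.
  by rewrite ger0_norm ?powR_ge0// ge0_ler_powR ?nnegrE ?(ltW p0)// ?addr_ge0// ltW.
have mfp n : measurable_fun setT (fun x => f n x `^ p).
  exact: measurableT_comp (@measurable_powR R p) (mf n).
have mgp : measurable_fun setT (fun x => g x `^ p).
  exact: measurableT_comp (@measurable_powR R p) mg.
have ig : nu.-integrable setT (EFin \o g).
  by apply: (@bounded_integrable _ _ _ _ _ M) => // x; rewrite ger0_norm.
have Hn n : (\int[nu]_x g x) `^ p <= c * \int[mu]_x (f n x `^ p).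
  have := H (f n) (mf n) (f0 n).
  have ifn : nu.-integrable setT (EFin \o f n).
    by apply: (@bounded_integrable _ _ _ _ _ (M + 1)) => // x; rewrite ger0_norm// ltW.
  have ifp : mu.-integrable setT (EFin \o (fun x => f n x `^ p)).
    exact: (@bounded_integrable _ _ _ _ _ ((M + 1) `^ p)).
  rewrite (integral_Rintegral ifn) (integral_Rintegral ifp).
  rewrite poweR_EFin -EFinM lee_fin; apply: le_trans.
  rewrite ge0_ler_powR ?nnegrE ?(ltW p0)//.
  - by rewrite Rintegral_ge0.
  - by rewrite Rintegral_ge0// => x _; rewrite ltW.
  - by apply: le_Rintegral => // x _; rewrite lerDl invr_ge0.
have fc x : f ^~ x @ \oo --> g x.
  rewrite -[g x]addr0; apply: cvgD; first exact: cvg_cst.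
  exact: cvg_harmonic.
have := @Rintegral_dominated_cvg _ _ _ mu (fun n x => f n x `^ p) (fun x => g x `^ p)
   (cst ((M + 1) `^ p)) mfp mgp.
have fgp : {ae mu, forall x, (fun n => f n x `^ p) @ \oo --> g x `^ p}.
  by apply: aeW => x; apply: powR_cvg => // n; exact: ltW.
move=> /(_ fgp (finite_measure_integrable_cst _ _ measurableT) fpM) h.
have {}h : (fun n => c * \int[mu]_x f n x `^ p) @ \oo --> c * \int[mu]_x g x `^ p.
  by apply: cvgM => //; exact: cvg_cst.
by apply: (cvgr_to_ge h); apply: nearW.
Qed.

(** Tested on an indicator, the inequality reads nu(A)^p <= c mu(A). *)
Lemma harnack_dominates p c : 1 < p -> 0 <= c -> harnack p c -> nu `<< mu.
Proof.
move=> p1 c0 H; apply/null_content_dominatesP => A mA A0.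
have p0 : 0 < p by rewrite (lt_trans _ p1).
have := @harnack_bounded p c \1_A 1 p1 c0 H (@measurable_indic _ _ _ setT _ mA).
have -> : \int[mu]_x (\1_A x `^ p) = \int[mu]_x \1_A x.
  apply: eq_Rintegral => x _; rewrite indicE.
  by case: (x \in A); rewrite ?powR1 ?powR0 ?gt_eqF.
rewrite /Rintegral !integral_indic// !setIT A0 mulr0 => h.
have /h : forall x, 0 <= \1_A x :> R by move=> x; rewrite indicE.
have h2 : forall x, \1_A x <= 1 :> R by move=> x; rewrite indicE; case: (_ \in _).
move=> /(_ h2); rewrite -(@powR0 _ p) ?gt_eqF// => h3.
apply/eqP; rewrite eq_le measure_ge0 andbT.
have -> : nu A = (fine (nu A))%:E by rewrite fineK// fin_num_measure.
rewrite lee_fin leNgt; apply/negP => h4.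
by move: h3; rewrite leNgt => /negP; apply; rewrite gt0_ltr_powR// nnegrE// ltW.
Qed.

Lemma le_poweR_powR (x y p : R) : 0 <= x -> 0 < y -> 1 < p ->
  x `^ p <= y * x -> x <= y `^ (p - 1)^-1.
Proof.
move=> x0 y0 p1; have p0 : 0 < p - 1 by rewrite subr_gt0.
move: x0; rewrite le_eqVlt => /orP[/eqP <- _|x0]; first exact: powR_ge0.
rewrite -{1}(subrK 1 p) powRD; last by rewrite subrK (gt_eqF x0) implybT.
rewrite (@powRr1 _ x) ?(ltW x0)// ler_pM2r// => h.
have -> : x = (x `^ (p - 1)) `^ (p - 1)^-1.
  by rewrite -powRrM divff ?gt_eqF// powRr1// ltW.
by rewrite ge0_ler_powR ?nnegrE ?powR_ge0 ?invr_ge0// ltW.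
Qed.

Lemma harnackP p c rho : 1 < p -> 0 < c -> is_density rho ->
  harnack p c <->
  (\int[mu]_x (rho x `^ (p / (p - 1)))%:E <= (c `^ (p - 1)^-1)%:E)%E.
Proof.
move=> p1 c0 [mrho rho0 rhoE].
have p0 : 0 < p by rewrite (lt_trans _ p1).
have p10 : 0 < p - 1 by rewrite subr_gt0.
set q := p / (p - 1).
have q0 : 0 < q by rewrite divr_gt0.
have q1 : q - 1 = (p - 1)^-1.
  by rewrite /q; field; rewrite gt_eqF.
have q1p : (q - 1) * p = q by rewrite q1 mulrC.
split=> [H|H f mf f0]; last first.
  have := @hoelder _ _ _ mu f rho p q mf mrho p0 q0.
  have -> : p^-1 + q^-1 = 1 by rewrite /q; field; rewrite !gt_eqF.
  move=> /(_ erefl); rewrite Lnorm1.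
  have -> : (\int[mu]_x `|(EFin \o (f \* rho)%R) x| = \int[nu]_x (f x)%:E)%E.
    rewrite rhoE//; last by move=> x; exact: ltW.
    by apply: eq_integral => x _ /=; rewrite ger0_norm// mulr_ge0// ltW.
  move=> h.
  have := @gt0_ler_poweR R p (ltW p0) _ _ _ _ h.
  rewrite !in_itv/= !leey !andbT => h2.
  apply: (le_trans (h2 _ _)).
  - by apply: integral_ge0 => x _; rewrite lee_fin ltW.
  - by rewrite mule_ge0// Lnorm_ge0.
  rewrite poweRM ?Lnorm_ge0// powR_Lnorm ?gt_eqF// muleC.
  have -> : (\int[mu]_x `|(EFin \o f) x| `^ p = \int[mu]_x (f x `^ p)%:E)%E.
    by apply: eq_integral => x _ /=; rewrite ger0_norm// ltW.
  apply: lee_wpmul2r.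
    by apply: integral_ge0 => x _; rewrite lee_fin powR_ge0.
  have -> : p = q * (p - 1) by rewrite /q divfK ?gt_eqF.
  rewrite poweRrM powR_Lnorm ?gt_eqF//.
  have -> : (\int[mu]_x `|(EFin \o rho) x| `^ q = \int[mu]_x (rho x `^ q)%:E)%E.
    by apply: eq_integral => x _ /=; rewrite ger0_norm.
  have := @gt0_ler_poweR R (p - 1) (ltW p10) _ _ _ _ H.
  rewrite !in_itv/= !leey !andbT => h3.
  apply: (le_trans (h3 _ _)).
  - by apply: integral_ge0 => x _; rewrite lee_fin powR_ge0.
  - by rewrite lee_fin powR_ge0.
  by rewrite lee_fin -powRrM mulVf ?gt_eqF// powRr1// ltW.
(* Truncation keeps the integral of r^q finite, so that one factor of it can be cancelled by
   [le_poweR_powR]; Fatou's lemma then removes the truncation. *)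
pose r n x := Num.min (rho x) n%:R.
have r0 n x : 0 <= r n x by rewrite le_min rho0 ler0n.
have rn n x : r n x <= n%:R by rewrite ge_min lexx orbT.
have rr n x : r n x <= rho x by rewrite ge_min lexx.
have mr n : measurable_fun setT (r n).
  exact: (@measurable_minr _ _ _ setT rho (cst n%:R)).
have mrq n : measurable_fun setT (fun x => r n x `^ q).
  exact: measurableT_comp (@measurable_powR R q) (mr n).
have mrq1 n : measurable_fun setT (fun x => r n x `^ (q - 1)).
  exact: measurableT_comp (@measurable_powR R _) (mr n).
apply: (@fatou_le _ _ _ mu (fun n x => r n x `^ q) _ (fun=> c `^ (p - 1)^-1)) => //.
- by move=> n x; exact: powR_ge0.
- move=> x; apply: powR_cvg => //.
  apply: cvg_near_cst; apply: filterS (nbhs_infty_gtr (rho x)) => n hn.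
  by apply/min_idPl/ltW.
- move=> n.
  have irq : mu.-integrable setT (EFin \o (fun x => r n x `^ q)).
    apply: (@bounded_integrable _ _ _ _ _ (n%:R `^ q)) => // x.
    by rewrite ger0_norm ?powR_ge0// ge0_ler_powR ?nnegrE// ltW.
  rewrite integral_Rintegral// lee_fin.
  apply: le_poweR_powR => //.
    by rewrite Rintegral_ge0// => x _; rewrite powR_ge0.
  have := @harnack_bounded p c (fun x => r n x `^ (q - 1)) (n%:R `^ (q - 1)) p1
    (ltW c0) H (mrq1 n) (fun x => powR_ge0 _ _).
  have -> : \int[mu]_x ((r n x `^ (q - 1)) `^ p) = \int[mu]_x (r n x `^ q).
    by apply: eq_Rintegral => x _; rewrite -powRrM q1p.
  have q10 : 0 <= q - 1 by rewrite q1 invr_ge0 ltW.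
  have bd x : r n x `^ (q - 1) <= n%:R `^ (q - 1).
    by rewrite ge0_ler_powR ?nnegrE.
  move=> /(_ bd); apply: le_trans.
  rewrite ge0_ler_powR ?nnegrE ?(ltW p0)//.
  + by rewrite Rintegral_ge0// => x _; rewrite powR_ge0.
  + by rewrite Rintegral_ge0// => x _; rewrite powR_ge0.
  rewrite -lee_fin -!integral_Rintegral//; last first.
    apply: (@bounded_integrable _ _ _ _ _ (n%:R `^ (q - 1))) => // x.
    by rewrite ger0_norm ?powR_ge0.
  rewrite rhoE//; last by move=> x; exact: powR_ge0.
  apply: ge0_le_integral => //.
  + by move=> x _; rewrite lee_fin powR_ge0.
  + exact/measurable_EFinP.
  + by apply/measurable_EFinP; exact: measurable_funM.
  + move=> x _; rewrite lee_fin -(@mulr_powRB1 _ (r n x) q)// mulrC.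
    by rewrite ler_wpM2l// powR_ge0.
- exact: cvg_cst.
Qed.

(** The inequality log z <= z - 1 at z = y / x, multiplied by x; the convention [ln 0 = 0] makes it
    true at x = 0 as well. It is the source of the entropy bounds below. *)
Lemma ge_subr_ln_div (x y : R) : 0 <= x -> 0 < y -> x - y <= x * (ln x - ln y).
Proof.
rewrite le_eqVlt => /orP[/eqP <-|x0] y0; first by rewrite mul0r sub0r oppr_le0 ltW.
have -> : x - y = x * (1 - y / x) by rewrite mulrBr mulr1 mulrCA divff ?gt_eqF ?mulr1.
rewrite ler_pM2l//.
have := @le_ln1Dx R (y / x - 1); rewrite [1 + _]addrC subrK ltrBrDr addNr.
rewrite divr_gt0// => /(_ isT); rewrite ln_div ?posrE//; lra.
Qed.

(** For a [mu]-null set A the function n 1_A + 1 equals 1 almost surely under [mu], so the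
    right-hand side does not depend on n, while the left-hand side is n nu(A) + 1. The summand 1
    keeps the function positive. *)
Lemma log_harnack_dominates c : log_harnack c -> nu `<< mu.
Proof.
move=> H; apply/null_content_dominatesP => A mA A0.
have Hn n : n%:R * fine (nu A) <= c.
  have := H (fun x => n%:R * \1_A x + 1).
  have mf : measurable_fun setT (fun x => n%:R * \1_A x + 1 : R).
    by apply: measurable_funD => //; apply: measurable_funM.
  have f0 x : 0 < n%:R * \1_A x + 1 :> R by rewrite ltr_wpDl ?mulr_ge0 ?indicE.
  move=> /(_ mf f0).
  have -> : (\int[mu]_x (expR (n%:R * \1_A x + 1))%:E = (expR 1)%:E)%E.
    rewrite -(integral_probability_cst mu (expR 1)).
    apply: ae_eq_integral => //.
    - apply/measurable_EFinP; exact: measurableT_comp (@measurable_expR R) mf.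
    - exists A; split=> // x /=; apply: contra_notP => nA _.
      by rewrite indicE memNset// mulr0 add0r.
  rewrite lne_EFin ?expR_gt0// expRK.
  have in1 : nu.-integrable setT (EFin \o (\1_A : T -> R)).
    exact: integrable_indic.
  have inn : nu.-integrable setT (EFin \o (fun x => n%:R * \1_A x + 1)).
    apply: (@bounded_integrable _ _ _ _ _ (n%:R + 1)) => // x.
    rewrite ger0_norm ?(ltW (f0 x))// lerD2r// indicE.
    by case: (_ \in _); rewrite ?mulr1// mulr0.
  rewrite (integral_Rintegral inn) RintegralD//; last 2 first.
  - apply: (@bounded_integrable _ _ _ _ _ n%:R).
      by apply: measurable_funM => //; exact: measurable_indic.
    by move=> x; rewrite indicE; case: (_ \in _); rewrite ?mulr1 ?mulr0 ?normr0 ?ger0_norm.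
  - exact: finite_measure_integrable_cst.
  rewrite RintegralZl// Rintegral_probability_cst -EFinD lee_fin.
  rewrite /Rintegral integral_indic// setIT; lra.
apply/eqP; rewrite eq_le measure_ge0 andbT.
have -> : nu A = (fine (nu A))%:E by rewrite fineK// fin_num_measure.
rewrite lee_fin leNgt; apply/negP => h4.
have c0 : 0 <= c by have := Hn 0%N; rewrite mul0r.
have [n _ /(_ _ (leqnn n)) /= hn] := nbhs_infty_gtr (c / fine (nu A)).
by have := Hn n; apply/negP; rewrite -ltNge -ltr_pdivrMr.
Qed.

(** The Gibbs variational principle. The extremal function is log rho, which is neither bounded nor
    positive, whence the clamping and the additive constant in the direct implication. The converse
    integrates a pointwise inequality between rho and the normalized density exp f / Z. *)
Lemma log_harnackP c rho : is_density rho ->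
  log_harnack c <-> (\int[mu]_x (rho x * ln (rho x))%:E <= c%:E)%E.
Proof.
move=> [mrho rho0 rhoE].
have rho1 : (\int[mu]_x (rho x)%:E = 1)%E.
  have := rhoE (cst 1) (measurable_cst _) (fun=> ler01).
  rewrite (integral_probability_cst nu 1) => ->.
  by apply: eq_integral => x _ /=; rewrite mul1r.
have irho : mu.-integrable setT (EFin \o rho).
  by apply: (@ge0_integral_le_integrable _ _ _ _ _ 1) => //; rewrite rho1.
have mlnrho : measurable_fun setT (fun x => rho x * ln (rho x)).
  apply: measurable_funM => //.
  exact: measurableT_comp (@measurable_ln R) mrho.
have i1 : mu.-integrable setT (EFin \o cst (1 : R)).
  exact: finite_measure_integrable_cst.
have rl1 x : 0 <= rho x * ln (rho x) + 1.
  have := @ge_subr_ln_div (rho x) 1 (rho0 x) ltr01; rewrite ln1 subr0.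
  by have := rho0 x; lra.
have mrl1 : measurable_fun setT (fun x => rho x * ln (rho x) + 1).
  by apply: measurable_funD.
split=> [H|H].
(* rho clamped to [exp(- n), exp n]. Since y <= rho + exp(- n), its integral is at most 1 + exp(-
   n), an error that vanishes in the limit. *)
- pose y n x := Num.min (Num.max (rho x) (expR (- n%:R))) (expR n%:R).
  have y0 n x : 0 < y n x by rewrite lt_min expR_gt0 lt_max expR_gt0 orbT.
  have my n : measurable_fun setT (y n).
    apply: (@measurable_minr _ _ _ setT (fun x => Num.max (rho x) (expR (- n%:R))) (cst _)) => //.
    exact: (@measurable_maxr _ _ _ setT rho (cst _)).
  have yr n x : y n x <= rho x + expR (- n%:R).
    rewrite ge_min ge_max lerDl expR_ge0 lerDr rho0 //.
  have lny n x : - n%:R <= ln (y n x) <= n%:R.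
    apply/andP; split; rewrite -ler_expR lnK ?posrE// /y.
      rewrite le_min le_max lexx orbT ler_expR /=.
      by rewrite (le_trans _ (ler0n _ n))// oppr_le0.
    by rewrite ge_min lexx orbT.
  have mln n : measurable_fun setT (fun x => ln (y n x)).
    exact: measurableT_comp (@measurable_ln R) (my n).
  have mrln n : measurable_fun setT (fun x => rho x * ln (y n x)).
    exact: measurable_funM.
  (* A lower bound uniform in n, for Fatou's lemma. Where rho exceeds exp n the logarithm is
     non-negative; elsewhere rho <= y and log y >= 1 - 1 / y. *)
  have ge1 n x : 0 <= rho x * ln (y n x) + 1.
    have [yle|] := leP (expR n%:R) (rho x).
      rewrite addr_ge0// mulr_ge0// ln_ge0// /y.
      have e1 : 1 <= expR n%:R :> R by rewrite -[leLHS]expR0 ler_expR ler0n.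
      by rewrite le_min e1 andbT le_max (le_trans e1 yle).
    move=> /ltW rn.
    have ry : rho x <= y n x by rewrite /y le_min rn le_max lexx.
    have := @ge_subr_ln_div 1 (y n x) ler01 (y0 n x).
    rewrite ln1 sub0r mul1r => h.
    have : rho x * (1 - (y n x)^-1) <= rho x * ln (y n x).
      rewrite ler_wpM2l//.
      have := @ge_subr_ln_div 1 (y n x)^-1 ler01; rewrite invr_gt0 => /(_ (y0 n x)).
      by rewrite ln1 sub0r mul1r lnV ?posrE// opprK.
    rewrite mulrBr mulr1.
    have : rho x / y n x <= 1 by rewrite ler_pdivrMr// mul1r.
    have := rho0 x; lra.
  have irln n : mu.-integrable setT (EFin \o (fun x => rho x * ln (y n x))).
    apply: (@le_integrable _ _ _ _ _ measurableT _ (fun x => n%:R%:E * (rho x)%:E)%E).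
    + exact/measurable_EFinP.
    + move=> x _ /=; rewrite lee_fin !normrM mulrC ler_wpM2r//.
      by rewrite [in leRHS]ger0_norm// ler_norml.
    + exact: integrableZl.
  have Hn n : \int[mu]_x (rho x * ln (y n x)) <= c + expR (- n%:R).
    (* Test functions must be positive and the logarithm is at least - n; the constant n + 1
       contributes equally to both sides of the inequality. *)
    pose f x := ln (y n x) + n.+1%:R.
    have mf : measurable_fun setT f by exact: measurable_funD.
    have f0 x : 0 < f x.
      by rewrite /f -ltrBlDr sub0r (lt_le_trans _ (andP (lny n x)).1)// ltrN2 ltr_nat.
    have := H f mf f0.
    have iy : mu.-integrable setT (EFin \o (fun x => expR (f x))).
      apply: (@bounded_integrable _ _ _ _ _ (expR (n%:R + n.+1%:R))).
        exact: measurableT_comp (@measurable_expR R) mf.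
      by move=> x; rewrite ger0_norm ?expR_ge0// ler_expR lerD2r; case/andP: (lny n x).
    have ile : \int[mu]_x expR (f x) <= expR n.+1%:R * (1 + expR (- n%:R)).
      have -> : expR n.+1%:R * (1 + expR (- n%:R)) =
          \int[mu]_x (expR n.+1%:R * (rho x + expR (- n%:R))).
        have irn : mu.-integrable setT (EFin \o (fun x => rho x + expR (- n%:R))).
          apply: eq_integrable (integrableD measurableT irho (finite_measure_integrable_cst mu (expR (- n%:R)) measurableT)) => //.
        rewrite RintegralZl// RintegralD//; last exact: finite_measure_integrable_cst.
        rewrite Rintegral_probability_cst.
        by have -> : \int[mu]_x rho x = 1 by rewrite /Rintegral rho1.
      apply: le_Rintegral => //.
        have irn : mu.-integrable setT (EFin \o (fun x => rho x + expR (- n%:R))).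
          apply: eq_integrable (integrableD measurableT irho (finite_measure_integrable_cst mu (expR (- n%:R)) measurableT)) => //.
        by apply: eq_integrable (integrableZl measurableT (expR n.+1%:R) irn) => //.
      move=> x _; rewrite /f expRD lnK ?posrE// mulrC.
      by rewrite ler_pM2l ?expR_gt0.
    have i0 : 0 < \int[mu]_x expR (f x).
      apply: (@lt_le_trans _ _ (\int[mu]_x 1)).
        by rewrite Rintegral_probability_cst.
      by apply: le_Rintegral => // x _; rewrite -expR0 ler_expR ltW.
    rewrite (integral_Rintegral iy) lne_EFin// -EFinD.
    have ifr : mu.-integrable setT (EFin \o (fun x => f x * rho x)).
      apply: eq_integrable (integrableD measurableT (irln n) (integrableZl measurableT n.+1%:R irho)) => // x _ /=.
      by rewrite -EFinM -EFinD /f mulrDl; congr EFin; ring.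
    rewrite rhoE//; last by move=> x; exact: ltW.
    rewrite (integral_Rintegral ifr) lee_fin.
    have -> : \int[mu]_x (f x * rho x) = \int[mu]_x (rho x * ln (y n x)) + n.+1%:R.
      have -> : \int[mu]_x (f x * rho x) = \int[mu]_x (rho x * ln (y n x) + n.+1%:R * rho x).
        by apply: eq_Rintegral => x _; rewrite /f; ring.
      rewrite RintegralD//; last first.
        by apply: eq_integrable (integrableZl measurableT n.+1%:R irho).
      rewrite RintegralZl//.
      by have -> : \int[mu]_x rho x = 1; [rewrite /Rintegral rho1|rewrite mulr1].
    have : ln (\int[mu]_x expR (f x)) <= n.+1%:R + expR (- n%:R).
      apply: (@le_trans _ _ (ln (expR n.+1%:R * (1 + expR (- n%:R))))).
        by rewrite ler_ln ?posrE// mulr_gt0 ?expR_gt0// addr_gt0 ?expR_gt0.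
      rewrite lnM ?posrE ?expR_gt0 ?addr_gt0 ?expR_gt0// expRK lerD2l.
      by apply: le_ln1Dx; rewrite (lt_trans _ (expR_gt0 _)).
    lra.
  suff : (\int[mu]_x (rho x * ln (rho x) + 1)%:E <= (c + 1)%:E)%E.
    move=> h; have ih := ge0_integral_le_integrable mrl1 rl1 h.
    have ih2 : mu.-integrable setT (EFin \o (fun x => rho x * ln (rho x))).
      apply: eq_integrable (integrableB measurableT ih i1) => // x _ /=.
      by rewrite -EFinB addrK.
    move: h; rewrite (integral_Rintegral ih) RintegralD// Rintegral_probability_cst.
    by rewrite (integral_Rintegral ih2) !lee_fin lerD2r.
  apply: (@fatou_le _ _ _ mu (fun n x => rho x * ln (y n x) + 1) _
     (fun n => c + expR (- n%:R) + 1)).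
  + by move=> n; exact: measurable_funD.
  + exact: ge1.
  + move=> x; apply: cvgD; last exact: cvg_cst.
    have := rho0 x; rewrite le_eqVlt => /orP[/eqP <-|r0].
      by rewrite mul0r; under eq_fun do rewrite mul0r; exact: cvg_cst.
    apply: cvgM; first exact: cvg_cst.
    apply: cvg_near_cst; apply: filterS (nbhs_infty_gtr `|ln (rho x)|) => n.
    rewrite ltr_norml => /andP[h1 h2]; congr ln; rewrite /y.
    have -> : Num.max (rho x) (expR (- n%:R)) = rho x.
      by apply/max_idPl; rewrite -[leRHS]lnK ?posrE// ler_expR ltW.
    by apply/min_idPl; rewrite -[leLHS]lnK ?posrE// ler_expR ltW.
  + move=> n.
    have ih : mu.-integrable setT (EFin \o (fun x => rho x * ln (y n x) + 1)).
      by apply: eq_integrable (integrableD measurableT (irln n) i1).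
    rewrite (integral_Rintegral ih) RintegralD// Rintegral_probability_cst.
    by rewrite lee_fin lerD2r.
  + apply: cvgD; last exact: cvg_cst.
    by rewrite -[c in X in _ --> X]addr0; apply: cvgD; [exact: cvg_cst|exact: cvgn_expR].
- move=> f mf f0.
  have me : measurable_fun setT (fun x => expR (f x)).
    exact: measurableT_comp (@measurable_expR R) mf.
  have mfr : measurable_fun setT (fun x => f x * rho x) by exact: measurable_funM.
  have := leey (\int[mu]_x (expR (f x))%:E)%E.
  rewrite le_eqVlt => /orP[/eqP -> /=|Zy]; first by rewrite leey.
  have ie : mu.-integrable setT (EFin \o (fun x => expR (f x))).
    apply/integrableP; split; first exact/measurable_EFinP.
    apply: le_lt_trans Zy; rewrite le_eqVlt; apply/orP; left; apply/eqP.
    by apply: eq_integral => x _ /=; rewrite ger0_norm ?expR_ge0.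
  rewrite (integral_Rintegral ie).
  set Z := \int[mu]_x expR (f x).
  have Z1 : 1 <= Z.
    rewrite -(Rintegral_probability_cst mu 1); apply: le_Rintegral => // x _.
    by rewrite -expR0 ler_expR ltW.
  have Z0 : 0 < Z by rewrite (lt_le_trans ltr01).
  rewrite lne_EFin// -EFinD rhoE//; last by move=> x; exact: ltW.
  have ih2 : mu.-integrable setT (EFin \o (fun x => rho x * ln (rho x))).
    exact: bounded_below_integrable (fun x => rl1 x) H.
  (* The Gibbs inequality [ge_subr_ln_div] between rho and exp f / Z. Its integral is the claim,
     because rho and exp f / Z both have integral 1. *)
  have ptw x : f x * rho x <= rho x * ln (rho x) - rho x + Z^-1 * expR (f x) + ln Z * rho x.
    have := @ge_subr_ln_div (rho x) (expR (f x) / Z) (rho0 x) (divr_gt0 (expR_gt0 _) Z0).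
    rewrite ln_div ?posrE ?expR_gt0// expRK [_ / Z]mulrC; lra.
  have irhs : mu.-integrable setT (EFin \o (fun x => rho x * ln (rho x) - rho x + Z^-1 * expR (f x) + ln Z * rho x)).
    apply: eq_integrable (integrableD measurableT (integrableD measurableT (integrableB measurableT ih2 irho) (integrableZl measurableT Z^-1 ie)) (integrableZl measurableT (ln Z) irho)) => //.
  apply: (@le_trans _ _ (\int[mu]_x (rho x * ln (rho x) - rho x + Z^-1 * expR (f x) + ln Z * rho x)%:E)%E).
    apply: ge0_le_integral => //.
    + by move=> x _; rewrite lee_fin mulr_ge0// ltW.
    + exact/measurable_EFinP.
    + exact: measurable_int irhs.
    + by move=> x _; rewrite lee_fin.
  rewrite (integral_Rintegral irhs) lee_fin RintegralD//; last 2 first.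
  + by apply: eq_integrable (integrableD measurableT (integrableB measurableT ih2 irho) (integrableZl measurableT Z^-1 ie)).
  + by apply: eq_integrable (integrableZl measurableT (ln Z) irho).
  rewrite RintegralD//; last 2 first.
  + by apply: eq_integrable (integrableB measurableT ih2 irho).
  + by apply: eq_integrable (integrableZl measurableT Z^-1 ie).
  rewrite RintegralB// !RintegralZl// -/Z mulVf ?gt_eqF//.
  have -> : \int[mu]_x rho x = 1 by rewrite /Rintegral rho1.
  by move: H; rewrite (integral_Rintegral ih2) lee_fin; lra.
Qed.

End duality.

(** * Harnack inequalities as bounds on Renyi and Kullback-Leibler divergences *)

Section duality_rV.
Variables (R : realType) (n : nat).
Implicit Types mu nu : probability 'rV[R]_n R.

(** [density] is meaningful only up to null sets; the version chosen here is non-negative and finite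
    everywhere, as [is_density] requires. *)
Lemma exists_density mu nu : nu `<< mu -> exists2 rho, is_density mu nu rho &
  {ae mu, forall y, rho y = density nu mu y}.
Proof.
move=> numu; set F := Radon_Nikodym_SigmaFinite.f nu mu.
have F0 : forall x, (0 <= F x)%E by exact: Radon_Nikodym_SigmaFinite.f_ge0.
have Ff : forall x, F x \is a fin_num by exact: Radon_Nikodym_SigmaFinite.f_fin_num.
have mF : measurable_fun setT F.
  exact: measurable_int (Radon_Nikodym_SigmaFinite.f_integrable numu).
exists (fun x => fine (F x)).
  split.
  - by apply: measurableT_comp mF.
  - by move=> x; rewrite fine_ge0.
  - move=> f mf f0.
    rewrite -(@Radon_Nikodym_SigmaFinite.change_of_variables _ _ _ nu mu numu (EFin \o f))//.
    + by apply: eq_integral => x _; rewrite EFinM fineK.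
    + exact/measurable_EFinP.
have := ae_eq_Radon_Nikodym_SigmaFinite numu measurableT.
by apply: filterS => x /(_ I) h; rewrite /density -h.
Qed.

Lemma measurable_density mu nu : nu `<< mu -> measurable_fun setT (density nu mu).
Proof.
by move=> numu; apply: measurableT_comp.
Qed.

Lemma renyiE mu nu rho q : nu `<< mu -> measurable_fun setT rho ->
  {ae mu, forall y, rho y = density nu mu y} ->
  (renyi q nu mu = ((q - 1)^-1)%:E * lne (\int[mu]_y (rho y `^ q)%:E))%E.
Proof.
move=> numu mrho ae; rewrite /renyi (asboolT numu); congr (_ * lne _)%E.
have md := measurable_density numu.
apply: ae_eq_integral => //.
- by apply/measurable_EFinP; apply: (measurableT_comp (@measurable_powR R q) md).
- by apply/measurable_EFinP; apply: (measurableT_comp (@measurable_powR R q) mrho).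
- by apply: filterS ae => x h _; rewrite h.
Qed.

Lemma KLE mu nu rho : nu `<< mu -> measurable_fun setT rho ->
  {ae mu, forall y, rho y = density nu mu y} ->
  (KL nu mu = \int[mu]_y (rho y * ln (rho y))%:E)%E.
Proof.
move=> numu mrho ae; rewrite /KL (asboolT numu).
have md := measurable_density numu.
apply: ae_eq_integral => //.
- apply/measurable_EFinP; apply: measurable_funM => //.
  exact: measurableT_comp (@measurable_ln R) md.
- apply/measurable_EFinP; apply: measurable_funM => //.
  exact: measurableT_comp (@measurable_ln R) mrho.
- by apply: filterS ae => x h _; rewrite h.
Qed.

(** With q = p / (p - 1) one has 1 / (q - 1) = p - 1, which turns the L^q bound of [harnackP] into a
    bound on the divergence. Absolute continuity follows from either side, so it is established
    before a density is chosen. *)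
Lemma harnack_renyi mu nu p c : 1 < p ->
  harnack mu nu p (expR c) <-> (renyi (p / (p - 1)) nu mu <= c%:E)%E.
Proof.
move=> p1; have p10 : 0 < p - 1 by rewrite subr_gt0.
have q1 : (p / (p - 1) - 1)^-1 = p - 1.
  field; rewrite gt_eqF//=.
  by have -> : p + -1 * (p - 1) = 1 :> R by ring.
have key rho : nu `<< mu -> is_density mu nu rho ->
    {ae mu, forall y, rho y = density nu mu y} ->
    harnack mu nu p (expR c) <-> (renyi (p / (p - 1)) nu mu <= c%:E)%E.
  move=> numu drho ae.
  have [mrho rho0 _] := drho.
  rewrite (harnackP p1 (expR_gt0 c) drho) (renyiE _ numu mrho ae) q1.
  rewrite -expRM -lee_pdivlMl// -EFinM.
  rewrite -[in X in _ <-> X](expRK (_ * c)) -lne_EFin ?expR_gt0// lee_lne; last 2 first.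
  - rewrite in_itv/= leey andbT integral_ge0// => x _; rewrite lee_fin powR_ge0 //.
  - by rewrite in_itv/= leey andbT lee_fin expR_ge0.
  by rewrite (mulrC _ c).
split=> H.
- have numu := harnack_dominates p1 (expR_ge0 c) H.
  have [rho drho ae] := exists_density numu.
  by apply/(key rho).
- have numu : nu `<< mu.
    by move: H; rewrite /renyi; case: asboolP.
  have [rho drho ae] := exists_density numu.
  by apply/(key rho).
Qed.

Lemma log_harnack_KL mu nu c : log_harnack mu nu c <-> (KL nu mu <= c%:E)%E.
Proof.
have key rho : nu `<< mu -> is_density mu nu rho ->
    {ae mu, forall y, rho y = density nu mu y} ->
    log_harnack mu nu c <-> (KL nu mu <= c%:E)%E.
  move=> numu drho ae; have [mrho _ _] := drho.
  by rewrite (KLE numu mrho ae); exact: log_harnackP.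
split=> H.
- have numu := log_harnack_dominates H.
  have [rho drho ae] := exists_density numu.
  by apply/(key rho).
- have numu : nu `<< mu by move: H; rewrite /KL; case: asboolP.
  have [rho drho ae] := exists_density numu.
  by apply/(key rho).
Qed.

End duality_rV.

(** * Shift Harnack inequalities: duality, products of exponents, and the limit (SH_log) *)

Section shifts.
Context {R : realType} {n : nat} {dO : measure_display}
  {Omega : measurableType dO} {P : probability Omega R}.
Variables (X : 'rV[R]_n -> R -> {RV P >-> 'rV[R]_n}) (beta : R).
Implicit Types (x v : 'rV[R]_n) (t : R) (f : 'rV[R]_n -> R).

Lemma measurable_rV_addr v : measurable_fun setT (fun y : 'rV[R]_n => y + v).
Proof.
apply: (measurableT_comp (@measurable_rV_add R n) (g := fun y => (y, v))).
exact: measurable_fun_pair.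
Qed.

Lemma Psg_law x t f : measurable_fun setT f -> (forall y, 0 <= f y) ->
  Psg X t f x = (\int[law X x t]_y (f y)%:E)%E.
Proof.
move=> mf f0; rewrite /Psg unlock (@ge0_integral_distribution _ _ _ _ _ _ _ (EFin \o f))//.
exact/measurable_EFinP.
Qed.

Lemma Psg_shift x t v f : measurable_fun setT f -> (forall y, 0 <= f y) ->
  Psg X t (fun y => f (y + v)) x =
  (\int[convolution (law X x t) (\d_v)]_y (f y)%:E)%E.
Proof.
move=> mf f0; rewrite Psg_law//; last first.
  exact: measurableT_comp mf (measurable_rV_addr v).
rewrite [RHS](eq_measure_integral (pushforward (law X x t) (fun y => y + v))).
  exact: measurable_rV_addr.
  move=> mv.
  rewrite (@ge0_integral_pushforward _ _ _ _ _ _ mv _ setT (EFin \o f))//.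
  - exact/measurable_EFinP.
  - by move=> y _; rewrite lee_fin.
by move=> ? A mA _; exact: (@convolution_dirac _ _ (law X x t) v A mA).
Qed.

(** The factor shared by all the constants: the exponent in (SH_p) is [shift_cost] times p / (p - 1)
    times |v|^2, the factor p / (p - 1) is absent in (SH_log), and the constant in (LGE) is four
    times [shift_cost]. *)
Definition shift_cost t : R := beta / (2 * (1 - expR (- (2 * beta * t)))).

Lemma SHP p : 1 < p -> SH X beta p <->
  forall x v t, 0 < t -> harnack (law X x t) (convolution (law X x t) (\d_v)) p
    (expR (shift_cost t * (p / (p - 1)) * euclid_norm v ^+ 2)).
Proof.
move=> p1.
have E v t : beta * p * euclid_norm v ^+ 2 / (2 * (p - 1) * (1 - expR (- (2 * beta * t)))) =
    shift_cost t * (p / (p - 1)) * euclid_norm v ^+ 2.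
  by rewrite /shift_cost !invfM; ring.
split=> [H x v t t0 f mf f0|H v t f t0 mf f0 x].
- have := H v t f t0 mf f0 x; rewrite E Psg_shift//; last by move=> y; exact: ltW.
  rewrite Psg_law//; last by move=> y; exact: powR_ge0.
  exact: measurableT_comp (@measurable_powR R p) mf.
- have := H x v t t0 f mf f0; rewrite E Psg_shift//; last by move=> y; exact: ltW.
  rewrite Psg_law//; last by move=> y; exact: powR_ge0.
  exact: measurableT_comp (@measurable_powR R p) mf.
Qed.

Lemma SHlogP : SHlog X beta <->
  forall x v t, 0 < t -> log_harnack (law X x t) (convolution (law X x t) (\d_v))
    (shift_cost t * euclid_norm v ^+ 2).
Proof.
have E v t : beta * euclid_norm v ^+ 2 / (2 * (1 - expR (- (2 * beta * t)))) =
    shift_cost t * euclid_norm v ^+ 2.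
  by rewrite /shift_cost; ring.
split=> [H x v t t0 f mf f0|H v t f t0 mf f0 x].
- have := H v t f t0 mf f0 x; rewrite E Psg_shift//; last by move=> y; exact: ltW.
  rewrite Psg_law//; exact: measurableT_comp (@measurable_expR R) mf.
- have := H x v t t0 f mf f0; rewrite E Psg_shift//; last by move=> y; exact: ltW.
  rewrite Psg_law//; exact: measurableT_comp (@measurable_expR R) mf.
Qed.

Lemma SH_SRT p : 1 < p -> SH X beta p <-> SRT X beta (p / (p - 1)).
Proof.
move=> p1; rewrite SHP//.
have E v t : beta * (p / (p - 1)) * euclid_norm v ^+ 2 / (2 * (1 - expR (- (2 * beta * t)))) =
    shift_cost t * (p / (p - 1)) * euclid_norm v ^+ 2.
  by rewrite /shift_cost; ring.
split=> H x v t t0.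
- by rewrite E; apply/harnack_renyi => //; exact: H.
- by apply/harnack_renyi => //; rewrite -E; exact: H.
Qed.

Lemma SHlog_SRT1 : SHlog X beta <-> SRT1 X beta.
Proof.
rewrite SHlogP.
have E v t : beta * euclid_norm v ^+ 2 / (2 * (1 - expR (- (2 * beta * t)))) =
    shift_cost t * euclid_norm v ^+ 2.
  by rewrite /shift_cost; ring.
split=> H x v t t0.
- by rewrite E; apply/log_harnack_KL; exact: H.
- by apply/log_harnack_KL; rewrite -E; exact: H.
Qed.

(** The shift is split as b v + a v: (SH_r) is applied to f(. + b v) with shift a v, then (SH_s) to
    f^r with shift b v. For the best proportion the two costs add up to exactly the cost for r s. *)
Lemma SH_mul r s : 1 < r -> 1 < s -> SH X beta r -> SH X beta s -> SH X beta (r * s).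
Proof.
move=> r1 s1 Hr Hs.
have [r0 s0] : 0 < r /\ 0 < s by rewrite !(lt_trans ltr01).
have rs1 : 1 < r * s by rewrite (lt_trans r1)// ltr_pMr.
have E p v t : 1 < p -> beta * p * euclid_norm v ^+ 2 / (2 * (p - 1) * (1 - expR (- (2 * beta * t)))) =
    shift_cost t * (p / (p - 1)) * euclid_norm v ^+ 2.
  by move=> p1; rewrite /shift_cost !invfM; ring.
move=> v t f t0 mf f0 x; rewrite E//.
(* The weights with a + b = 1 that minimize s r / (r - 1) a^2 + s / (s - 1) b^2. *)
pose b := r * (s - 1) / (r * s - 1) : R.
pose a := (r - 1) / (r * s - 1) : R.
have rsn0 : r * s - 1 != 0 by rewrite gt_eqF// subr_gt0.
have ab1 : a + b = 1 by rewrite /a /b; field.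
have bv : v = b *: v + a *: v by rewrite -scalerDl addrC ab1 scale1r.
have en c : euclid_norm (c *: v) ^+ 2 = c ^+ 2 * euclid_norm v ^+ 2.
  rewrite /euclid_norm !sqr_sqrtr; try by apply: sumr_ge0 => i _; exact: sqr_ge0.
  by rewrite mulr_sumr; apply: eq_bigr => i _; rewrite mxE exprMn.
have mfs (w : 'rV[R]_n) : measurable_fun setT (fun y : 'rV[R]_n => f (y + w)).
  exact: measurableT_comp mf (measurable_rV_addr w).
have mfr : measurable_fun setT (fun y : 'rV[R]_n => f y `^ r).
  exact: measurableT_comp (@measurable_powR R r) mf.
have h1 := Hr (a *: v) t (fun y => f (y + b *: v)) t0 (mfs _) (fun y => f0 _) x.
have h2 := Hs (b *: v) t (fun y => f y `^ r) t0 mfr (fun y => powR_gt0 _ (f0 _)) x.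
rewrite [X in Psg _ _ X](_ : _ = (fun y => f (y + a *: v + b *: v))); last first.
  by apply/funext => y; rewrite -addrA [_ *: v + _]addrC -bv.
rewrite poweRrM.
set K := Psg X t (fun y => f y `^ (r * s)) x.
have K0 : (0 <= K)%E by apply: expectation_ge0 => y; exact: powR_ge0.
have h3 : Psg X t (fun y => (f y `^ r) `^ s) x = K.
  by rewrite /K; congr Psg; apply/funext => y; rewrite powRrM.
rewrite h3 in h2.
have p1 := @gt0_ler_poweR R s (ltW s0) _ _ _ _ h1.
rewrite !in_itv/= !leey !andbT in p1.
apply: (le_trans (p1 _ _)).
- exact: poweR_ge0.
- rewrite mule_ge0 ?lee_fin ?expR_ge0//.
  by apply: expectation_ge0 => y; exact: powR_ge0.
rewrite poweRM ?lee_fin ?expR_ge0//; last first.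
  by apply: expectation_ge0 => y; exact: powR_ge0.
apply: (le_trans (lee_wpmul2l _ h2)); first exact: poweR_ge0.
rewrite muleA; apply: lee_wpmul2r => //.
rewrite poweR_EFin -EFinM lee_fin !E// -expRM -expRD ler_expR !en.
have -> : shift_cost t * (r / (r - 1)) * (a ^+ 2 * euclid_norm v ^+ 2) * s +
   shift_cost t * (s / (s - 1)) * (b ^+ 2 * euclid_norm v ^+ 2) =
   shift_cost t * (r * s / (r * s - 1)) * euclid_norm v ^+ 2; last by [].
rewrite /a /b; field.
by rewrite rsn0 !gt_eqF ?subr_gt0.
Qed.

Lemma SH_exp p k : 1 < p -> SH X beta p -> SH X beta (p ^+ k.+1).
Proof.
move=> p1 Hp; elim: k => [|k IH]; first by rewrite expr1.
by rewrite exprS; apply: SH_mul => //; exact: exprn_egt1.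
Qed.

(** (SH_r) with r = p^(k+1) is applied to exp(f / r), so that the right-hand integral is always that
    of exp f. Jensen's inequality bounds the left-hand integral from below by the exponential of the
    mean of f / r, and r / (r - 1) tends to 1. *)
Lemma SH_SHlog p : 1 < p -> SH X beta p -> SHlog X beta.
Proof.
move=> p1 Hp; apply/SHlogP => x v t t0 f mf f0.
set mu := law X x t; set nu := convolution _ _.
set c := shift_cost t * _.
have me : measurable_fun setT (fun y : 'rV[R]_n => expR (f y)).
  exact: measurableT_comp (@measurable_expR R) mf.
have := leey (\int[mu]_x (expR (f x))%:E)%E.
rewrite le_eqVlt => /orP[/eqP -> /=|Zy]; first by rewrite leey.
have ie : mu.-integrable setT (EFin \o (fun x => expR (f x))).
  apply/integrableP; split; first exact/measurable_EFinP.
  apply: le_lt_trans Zy; rewrite le_eqVlt; apply/orP; left; apply/eqP.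
  by apply: eq_integral => y _ /=; rewrite ger0_norm ?expR_ge0.
rewrite (integral_Rintegral ie).
set Z := \int[mu]_x expR (f x).
have Z0 : 0 < Z.
  apply: (@lt_le_trans _ _ (\int[mu]_x 1)).
    by rewrite Rintegral_probability_cst.
  apply: le_Rintegral => //.
    exact: finite_measure_integrable_cst.
  by move=> y _; rewrite -expR0 ler_expR ltW.
rewrite lne_EFin// -EFinD.
have key k : (\int[nu]_x (f x)%:E <= (ln Z + c * (p ^+ k.+1 / (p ^+ k.+1 - 1)))%:E)%E.
  set r := p ^+ k.+1.
  have r1 : 1 < r by exact: exprn_egt1.
  have r0 : 0 < r by rewrite (lt_trans _ r1).
  have /SHP := SH_exp k p1 Hp; rewrite -/r => /(_ r1 x v t t0).
  rewrite -/mu -/nu => /(_ (fun y => expR (f y / r))).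
  have mfr : measurable_fun setT (fun y : 'rV[R]_n => f y / r) by exact: measurable_funM.
  have mer : measurable_fun setT (fun y : 'rV[R]_n => expR (f y / r)).
    exact: measurableT_comp (@measurable_expR R) mfr.
  move=> /(_ mer (fun y => expR_gt0 _)).
  have -> : (\int[mu]_x (expR (f x / r) `^ r)%:E)%E = Z%:E.
    rewrite -(integral_Rintegral ie); apply: eq_integral => y _.
    by rewrite -expRM divfK ?gt_eqF.
  have E : shift_cost t * (r / (r - 1)) * euclid_norm v ^+ 2 = c * (r / (r - 1)).
    by rewrite /c; ring.
  rewrite E -EFinM => h.
  have Iy : (\int[nu]_x (expR (f x / r))%:E < +oo)%E.
    have := le_lt_trans h (ltry _).
    by move=> /lty_poweRy; apply; rewrite gt_eqF.
  have ier : nu.-integrable setT (EFin \o (fun y => expR (f y / r))).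
    apply/integrableP; split; first exact/measurable_EFinP.
    apply: le_lt_trans Iy; rewrite le_eqVlt; apply/orP; left; apply/eqP.
    by apply: eq_integral => y _ /=; rewrite ger0_norm ?expR_ge0.
  (* Integrability of f under [nu] is inherited from exp(f / r), which exceeds f / r and whose
     integral is finite by (SH_r). *)
  have ifr : nu.-integrable setT (EFin \o (fun y => f y / r)).
    apply: (le_integrable measurableT _ _ ier); first exact/measurable_EFinP.
    move=> y _ /=; rewrite lee_fin !ger0_norm ?expR_ge0 ?divr_ge0 ?ltW//.
    by rewrite (lt_le_trans _ (expR_ge1Dx _))// ltrDr.
  have i_f : nu.-integrable setT (EFin \o f).
    apply: eq_integrable (integrableZl measurableT r ifr) => // y _ /=.
    by rewrite -EFinM mulrC divfK ?gt_eqF.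
  rewrite (integral_Rintegral i_f) lee_fin.
  move: h; rewrite (integral_Rintegral ier) poweR_EFin lee_fin => h.
  pose m := \int[nu]_y (f y / r).
  (* Jensen's inequality through the tangent line of exp at m. *)
  have Jensen : expR m <= \int[nu]_y expR (f y / r).
    have -> : expR m = \int[nu]_y (expR m * (f y / r) + expR m * (1 - m)).
      rewrite RintegralD//; last 2 first.
      - by apply: eq_integrable (integrableZl measurableT (expR m) ifr).
      - exact: finite_measure_integrable_cst.
      rewrite RintegralZl// Rintegral_probability_cst -/m; ring.
    apply: le_Rintegral => //.
      by apply: eq_integrable (integrableD measurableT (integrableZl measurableT (expR m) ifr) (finite_measure_integrable_cst nu (expR m * (1 - m)) measurableT)).
    move=> y _; rewrite -[f y / r in leRHS](subrK m) [leRHS]expRD [leRHS]mulrC addrC -mulrDr.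
    rewrite ler_pM2l ?expR_gt0//; apply: le_trans (expR_ge1Dx _); lra.
  have mE : r * m = \int[nu]_y f y.
    by rewrite /m RintegralZr// mulrC divfK ?gt_eqF.
  have {}h : expR (m * r) <= expR (c * (r / (r - 1))) * Z.
    rewrite (expRM m r); apply: (le_trans _ h).
    rewrite ge0_ler_powR ?nnegrE ?expR_ge0 ?(ltW r0)//.
    by rewrite Rintegral_ge0// => y _; rewrite expR_ge0.
  by rewrite -mE mulrC -ler_expR expRD lnK ?posrE// [leRHS]mulrC.
have cN : (fun k => ln Z + c * (p ^+ k.+1 / (p ^+ k.+1 - 1))) @ \oo --> ln Z + c.
  have -> : (fun k => ln Z + c * (p ^+ k.+1 / (p ^+ k.+1 - 1))) =
      (fun k => ln Z + c * (1 - p^-1 * p^-1 ^+ k)^-1).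
    apply/funext => k; congr (_ + c * _); rewrite -exprS exprVn.
    have pk : 1 < p ^+ k.+1 by exact: exprn_egt1.
    field; rewrite !gt_eqF ?subr_gt0 ?(lt_trans ltr01)//.
  apply: cvgD; first exact: cvg_cst.
  rewrite -[c in X in _ --> X]mulr1; apply: cvgM; first exact: cvg_cst.
  rewrite -[1 in X in _ --> X]invr1; apply: cvgV; first exact: oner_neq0.
  rewrite -[1 in X in _ --> X]subr0; apply: cvgB; first exact: cvg_cst.
  rewrite -[0 in X in _ --> X](mulr0 p^-1); apply: cvgM; first exact: cvg_cst.
  by apply: cvg_expr; rewrite gtr0_norm ?invr_gt0 ?(lt_trans ltr01)// invf_lt1// (lt_trans ltr01).
have cE : (fun k => (ln Z + c * (p ^+ k.+1 / (p ^+ k.+1 - 1)))%:E) @ \oo --> (ln Z + c)%:E.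
  by apply: cvg_EFin; [exact: nearW|].
by apply: (cvge_to_ge cE); apply: nearW.
Qed.

End shifts.

(** * Multivariate calculus *)

Section line_derivative.
Context {R : realType} {V : normedModType R}.
Implicit Types (f : V -> R) (x v : V).

Lemma is_derive_line f x v (s l : R) : is_derive (x + s *: v) v f l ->
  is_derive s 1 (fun s => f (x + s *: v)) l.
Proof.
case=> df dl.
have E : (fun h : R => h^-1 *: (((fun s => f (x + s *: v)) \o shift s) (h *: 1) -
      f (x + s *: v))) =
    (fun h : R => h^-1 *: ((f \o shift (x + s *: v)) (h *: v) - f (x + s *: v))).
  apply/funext => h /=; congr (_ *: (f _ - _)).
  by rewrite [h *: 1]mulr1 scalerDl addrCA.
split; first by rewrite /derivable E.
by rewrite -dl /derive E.
Qed.

Lemma is_derive_cvg f x v (l : R) :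
  (fun h : R => h^-1 *: (f (h *: v + x) - f x)) @ 0^' --> l ->
  is_derive x v f l.
Proof. by move=> h; split; [apply: cvgP h|apply: cvg_lim h]. Qed.

End line_derivative.

Section multivariate.
Context {R : realType} {n : nat}.
Implicit Types (f : 'rV[R]_n -> R) (x y z v : 'rV[R]_n) (i j : 'I_n).

Local Notation e_ i := (delta_mx 0 i : 'rV[R]_n).

Lemma coordE x i (s : R) j : (x + s *: e_ i) 0 j = x 0 j + s * (i == j)%:R.
Proof. by rewrite !mxE eqxx /= eq_sym. Qed.

Lemma coord_MVT f x i (a b : R) : (forall z, derivable f z (e_ i)) -> a <= b ->
  exists2 c, a <= c <= b &
    f (x + b *: e_ i) - f (x + a *: e_ i) = partial i f (x + c *: e_ i) * (b - a).
Proof.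
move=> df ab.
have D (s : R) : is_derive s 1 (fun s => f (x + s *: e_ i)) (partial i f (x + s *: e_ i)).
  by apply: is_derive_line; apply: derivableP.
have [|c] := @MVT_segment R _ _ a b ab (fun s _ => D s); last by rewrite in_itv/=; exists c.
apply: derivable_within_continuous => s _; exact: (@ex_derive _ _ _ _ _ _ _ (D s)).
Qed.

(** Boxes rather than Euclidean balls: exchanging the coordinates of two points one at a time does
    not leave a box. *)
Definition in_box (c : 'rV[R]_n) (r : R) x := forall j, `|x 0 j - c 0 j| <= r.

Lemma in_box_le c (r r' : R) x : r <= r' -> in_box c r x -> in_box c r' x.
Proof. by move=> rr' cx j; apply: (le_trans (cx j)). Qed.

(** The path from x to y changes one coordinate at a time, and the mean value theorem applies to
    each leg; the corner [p k] agrees with y in the first k coordinates and with x in the others. *)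
Lemma box_lipschitz f c (r K : R) x y : (forall z i, derivable f z (e_ i)) ->
  (forall z i, in_box c r z -> `|partial i f z| <= K) ->
  in_box c r x -> in_box c r y ->
  `|f y - f x| <= K * \sum_i `|y 0 i - x 0 i|.
Proof.
move=> df fK xr yr.
pose p k : 'rV[R]_n := \row_j (if (j < k)%N then y 0 j else x 0 j).
have pr k : in_box c r (p k) by move=> j; rewrite mxE; case: ifP.
have p0 : p 0%N = x by apply/rowP => j; rewrite mxE.
have pn : p n = y by apply/rowP => j; rewrite mxE ltn_ord.
have step (k : 'I_n) : `|f (p k.+1) - f (p k)| <= K * `|y 0 k - x 0 k|.
  have E1 : p k.+1 = p k + (y 0 k - x 0 k) *: e_ k.
    apply/rowP => j; rewrite coordE !mxE ltnS leq_eqVlt.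
    have [->|jk] := eqVneq j k; first by rewrite eqxx ltnn mulr1 addrC subrK.
    by rewrite -(inj_eq val_inj) in jk; rewrite (negbTE jk)/= mulr0 addr0.
  have E0 : p k = p k + 0 *: e_ k by rewrite scale0r addr0.
  have inb s : Num.min 0 (y 0 k - x 0 k) <= s <= Num.max 0 (y 0 k - x 0 k) ->
      in_box c r (p k + s *: e_ k).
    move=> /andP[s1 s2] j; rewrite coordE.
    have [kj|jk] := eqVneq k j; last by rewrite mulr0 addr0; exact: pr.
    rewrite kj mulr1 !mxE ltnn.
    have := xr j; have := yr j; rewrite !ler_norml => /andP[? ?] /andP[? ?].
    move: s1 s2; rewrite ge_min le_max kj => /orP s1 /orP s2.
    apply/andP; split.
      by case: s1; lra.
    by case: s2; lra.
  have [yx|/ltW yx] := leP 0 (y 0 k - x 0 k).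
    have [cc /andP[h1 h2] hE] := @coord_MVT f (p k) k _ _ (df^~ k) yx.
    rewrite E1 [X in _ - f X]E0 hE normrM subr0 ler_wpM2r// fK//; apply: inb.
    by rewrite ge_min le_max h1 h2 orbT.
  have [cc /andP[h1 h2] hE] := @coord_MVT f (p k) k _ _ (df^~ k) yx.
  rewrite distrC E1 [X in f X - _]E0 hE normrM sub0r normrN ler_wpM2r// fK//; apply: inb.
  by rewrite ge_min le_max h1 h2 orbT.
rewrite -p0 -[in f y]pn.
have -> : f (p n) - f (p 0%N) = \sum_(k < n) (f (p k.+1) - f (p k)).
  by rewrite -(big_mkord xpredT (fun k => f (p k.+1) - f (p k))) telescope_sumr.
rewrite mulr_sumr p0; apply: (le_trans (ler_norm_sum _ _ _)).
by apply: ler_sum => k _; exact: step.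
Qed.

Lemma derivable_linear (a : 'I_n -> R) z i :
  is_derive z (e_ i) (fun y => \sum_j a j * y 0 j) (a i).
Proof.
apply: is_derive_cvg.
apply: (@cvg_trans _ ((fun=> a i) @ 0^')); last exact: cvg_cst.
apply: near_eq_cvg; near=> h.
have h0 : h != 0 by near: h; exact: nbhs_dnbhs_neq.
rewrite -sumrB (bigD1 i)//= big1 => [|j ji].
  rewrite addr0 -mulrBr !mxE !eqxx mulr1 addrK [_ *: _]mulrCA.
  by rewrite mulVf// mulr1.
by rewrite !mxE !eqxx (negbTE ji) mulr0 add0r subrr.
Unshelve. all: by end_near. Qed.

Definition C1 f := forall i, (forall x, derivable f x (e_ i)) /\ continuous (partial i f).

Lemma continuous_box f x (e : R) : {for x, continuous f} -> 0 < e ->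
  exists2 r, 0 < r & forall z, in_box x r z -> `|f z - f x| <= e.
Proof.
move=> fc e0.
have /cvgrPdist_le /(_ _ e0) := fc.
move=> /nbhs_ballP[r /= r0 h]; exists (r / 2); first by rewrite divr_gt0.
move=> z zr; rewrite distrC; apply: h; split => // i j; rewrite !ord1.
rewrite /ball/= distrC (le_lt_trans (zr j))// ltr_pdivrMr// ltr_pMr// ltrDl //.
Qed.

(** Subtracting the linear map with the same partial derivatives at x leaves a function whose
    partial derivatives are small near x, hence one with a small Lipschitz constant there. *)
Lemma is_derive_C1 f x v : C1 f -> is_derive x v f (\sum_i v 0 i * partial i f x).
Proof.
move=> f1; apply: is_derive_cvg; apply/cvgrPdist_le => e e0.
pose M := \sum_i `|v 0 i|.
have M0 : 0 <= M by apply: sumr_ge0.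
have e1 : 0 < e / (M + 1) by rewrite divr_gt0// ltr_wpDl.
have /choice[r hr] : forall i, exists r, 0 < r /\
    forall z, in_box x r z -> `|partial i f z - partial i f x| <= e / (M + 1).
  by move=> i; have [r r0 h] := continuous_box ((f1 i).2 x) e1; exists r.
have [r0 r00 r0r] : exists2 r0, 0 < r0 & forall i, r0 <= r i.
  exists (\big[Num.min/1]_i r i).
    by elim/big_ind: _ => // [a b a0 b0|i _]; [rewrite lt_min a0|exact: (hr i).1].
  by move=> i; rewrite (bigD1 i)//= ge_min lexx.
near=> h.
have h0 : h != 0 by near: h; exact: nbhs_dnbhs_neq.
have hM : `|h| * (M + 1) <= r0.
  rewrite -ler_pdivlMr ?ltr_wpDl//; near: h.
  apply: nbhs_dnbhs; apply/nbhs_ballP; exists (r0 / (M + 1)); first by rewrite /= divr_gt0// ltr_wpDl.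
  by move=> h /=; rewrite /ball/= sub0r normrN => /ltW.
pose g z := f z - \sum_j partial j f x * z 0 j.
have D z i : is_derive z (e_ i) g (partial i f z - partial i f x).
  exact: (@is_deriveB _ _ _ _ _ _ _ _ _ (derivableP ((f1 i).1 z)) (derivable_linear (fun j => partial j f x) z i)).
have gb : `|g (h *: v + x) - g x| <= e / (M + 1) * \sum_i `|(h *: v + x) 0 i - x 0 i|.
  apply: (@box_lipschitz g x r0).
  - by move=> z i; exact: (@ex_derive _ _ _ _ _ _ _ (D z i)).
  - move=> z i zr; rewrite /partial (@derive_val _ _ _ _ _ _ _ (D z i)).
    by apply: (hr i).2 => j; rewrite (le_trans (zr j)).
  - by move=> j; rewrite subrr normr0 ltW.
  - move=> j; rewrite !mxE addrK normrM (le_trans _ hM)// ler_wpM2l//.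
    by rewrite /M (bigD1 j)//= -addrA lerDl addr_ge0// sumr_ge0.
have E : \sum_i `|(h *: v + x) 0 i - x 0 i| = `|h| * M.
  by rewrite mulr_sumr; apply: eq_bigr => i _; rewrite !mxE addrK normrM.
have E2 : g (h *: v + x) - g x = f (h *: v + x) - f x - h * \sum_i v 0 i * partial i f x.
  rewrite /g.
  have -> : h * (\sum_i v 0 i * partial i f x) =
      \sum_j partial j f x * (h *: v + x) 0 j - \sum_j partial j f x * x 0 j.
    rewrite mulr_sumr -sumrB; apply: eq_bigr => j _; rewrite !mxE; ring.
  ring.
have -> : \sum_i v 0 i * partial i f x - h^-1 *: (f (h *: v + x) - f x) =
    - (h^-1 * (g (h *: v + x) - g x)).
  by rewrite E2 mulrBr mulKf// opprB.
rewrite normrN normrM normfV ler_pdivrMl ?normr_gt0// (le_trans gb)// E mulrCA.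
rewrite ler_wpM2l// -mulrA ger_pMr// mulrC ler_pdivrMr ?ltr_wpDl// mul1r lerDl //.
Unshelve. all: by end_near. Qed.

Lemma is_derive_line_C1 f x v (s : R) : C1 f ->
  is_derive s 1 (fun s => f (x + s *: v)) (\sum_i v 0 i * partial i f (x + s *: v)).
Proof. by move=> f1; apply: is_derive_line; exact: is_derive_C1. Qed.

Lemma smooth_partial f i : smooth f -> smooth (partial i f).
Proof. by move=> fs s; have := fs (rcons s i); rewrite foldr_rcons. Qed.

Lemma smooth_continuous f : smooth f -> continuous f.
Proof. by move=> fs; exact: (fs [::]).1. Qed.

Lemma smooth_C1 f : smooth f -> C1 f.
Proof.
move=> fs i; split; first by move=> x; exact: (fs [::]).2.
exact/smooth_continuous/smooth_partial.
Qed.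

Lemma smooth_derivable f x i : smooth f -> derivable f x (e_ i).
Proof. by move=> fs; exact: (fs [::]).2. Qed.

Lemma partial_shift f i w x : partial i (fun y => f (y + w)) x = partial i f (x + w).
Proof.
rewrite /partial /derive; apply: (congr1 (fun g : R -> R => lim (g @ 0^'))).
by apply/funext => h /=; rewrite !addrA.
Qed.

Lemma derivable_addr f w x v : derivable f (x + w) v -> derivable (fun y => f (y + w)) x v.
Proof.
rewrite /derivable => h.
rewrite (_ : (fun h : R => _) = (fun h : R => h^-1 *: ((f \o shift (x + w)) (h *: v) - f (x + w))))//.
by apply/funext => k /=; rewrite !addrA.
Qed.

Lemma ler_half_half (A B C D a : R) :
  `|A - C| <= a / 2 -> `|B - D| <= a / 2 -> A = B -> `|C - D| <= a.
Proof.
by rewrite !ler_norml => /andP[? ?] /andP[? ?] ?; apply/andP; split; lra.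
Qed.

Lemma subrACA (p q s t : R) : p - q - (s - t) = p - s - (q - t).
Proof. ring. Qed.

(* Both mixed partials are values, at points close to [x], of the same second
   difference quotient. *)
Lemma schwarz f i j x : smooth f -> partial i (partial j f) x = partial j (partial i f) x.
Proof.
move=> fs; have [->//|ij] := eqVneq i j.
apply/eqP; rewrite -subr_eq0 -normr_le0; apply/ler_addgt0Pr => e e0; rewrite add0r.
have e2 : 0 < e / 2 by rewrite divr_gt0.
have c1 := smooth_continuous (smooth_partial i (smooth_partial j fs)).
have c2 := smooth_continuous (smooth_partial j (smooth_partial i fs)).
have [r1 r10 h1] := continuous_box (c1 x) e2.
have [r2 r20 h2] := continuous_box (c2 x) e2.
have r0 : 0 < Num.min r1 r2 by rewrite lt_min r10.
have rr1 : Num.min r1 r2 <= r1 by rewrite ge_min lexx.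
have rr2 : Num.min r1 r2 <= r2 by rewrite ge_min lexx orbT.
set r := Num.min r1 r2 in r0 rr1 rr2.
have key k l : k != l -> exists2 z, in_box x r z &
    (f (x + r *: e_ k + r *: e_ l) - f (x + r *: e_ k)) - (f (x + r *: e_ l) - f x) =
    r * (r * partial l (partial k f) z).
  move=> kl.
  pose g y := f (y + r *: e_ l) - f y.
  have dg z m : is_derive z (e_ m) g (partial m f (z + r *: e_ l) - partial m f z).
    apply: is_deriveB; last exact/derivableP/smooth_derivable.
    rewrite -partial_shift; apply/derivableP/derivable_addr; exact: smooth_derivable.
  have [c1' /andP[c0 cr]] := @coord_MVT g x k 0 r (fun z => @ex_derive _ _ _ _ _ _ _ (dg z k)) (ltW r0).
  have pg z : partial k g z = partial k f (z + r *: e_ l) - partial k f z.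
    exact: (@derive_val _ _ _ _ _ _ _ (dg z k)).
  rewrite subr0 scale0r addr0 pg /g => E.
  have [d1 /andP[d0 dr]] := @coord_MVT (partial k f) (x + c1' *: e_ k) l 0 r
    (fun z => (smooth_C1 (smooth_partial k fs) l).1 z) (ltW r0).
  rewrite subr0 scale0r addr0 => E2.
  exists (x + c1' *: e_ k + d1 *: e_ l).
    move=> m; rewrite !coordE.
    have [km|km] := eqVneq k m; have [lm|lm] := eqVneq l m.
    - by move: kl; rewrite km lm eqxx.
    - by rewrite mulr1 mulr0 addr0 addrC addKr ger0_norm.
    - by rewrite mulr1 mulr0 addr0 addrC addKr ger0_norm.
    - by rewrite !mulr0 !addr0 subrr normr0 ltW.
  by rewrite E E2; ring.
have ji : j != i by rewrite eq_sym.
have [z1 b1 E1] := key j i ji.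
  have [z2 b2 E2] := key i j ij.
  have E : partial i (partial j f) z1 = partial j (partial i f) z2.
    apply: (mulfI (lt0r_neq0 r0)); apply: (mulfI (lt0r_neq0 r0)).
    apply: (eq_trans (esym E1)); apply: (eq_trans _ E2).
    rewrite (addrAC x (r *: e_ j) (r *: e_ i)).
    exact: subrACA.
  exact: (ler_half_half (h1 _ (in_box_le rr1 b1)) (h2 _ (in_box_le rr2 b2)) E).
Qed.

End multivariate.

(** * Euclidean geometry, and the Lipschitz bound for the gradient under bounded curvature *)

Section euclidean.
Context {R : realType} {n : nat}.
Implicit Types (u v w x y : 'rV[R]_n).

Definition dotp u v : R := \sum_i u 0 i * v 0 i.

Lemma euclid_norm_ge0 v : 0 <= euclid_norm v.
Proof. exact: sqrtr_ge0. Qed.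

Lemma sqr_euclid_norm v : euclid_norm v ^+ 2 = dotp v v.
Proof.
rewrite /euclid_norm sqr_sqrtr; last by apply: sumr_ge0 => i _; exact: sqr_ge0.
by apply: eq_bigr => i _; rewrite expr2.
Qed.

Lemma dotpC u v : dotp u v = dotp v u.
Proof. by apply: eq_bigr => i _; rewrite mulrC. Qed.

Lemma dotpDl u v w : dotp (u + v) w = dotp u w + dotp v w.
Proof. by rewrite -big_split; apply: eq_bigr => i _; rewrite mxE mulrDl. Qed.

Lemma dotpZl (a : R) u v : dotp (a *: u) v = a * dotp u v.
Proof. by rewrite mulr_sumr; apply: eq_bigr => i _; rewrite mxE mulrA. Qed.

Lemma euclid_norm0 : euclid_norm (0 : 'rV[R]_n) = 0.
Proof.
apply/eqP; rewrite -sqrf_eq0 sqr_euclid_norm /dotp big1// => i _.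
by rewrite mxE mul0r.
Qed.

Lemma euclid_norm_eq0 v : euclid_norm v = 0 -> v = 0.
Proof.
move=> v0; have : euclid_norm v ^+ 2 = 0 by rewrite v0 expr0n.
rewrite sqr_euclid_norm => /eqP; rewrite psumr_eq0; last by move=> i _; rewrite -expr2 sqr_ge0.
move=> /allP h; apply/rowP => i; rewrite mxE.
by have := h i (mem_index_enum i); rewrite /= mulf_eq0 orbb => /eqP.
Qed.

Lemma euclid_normZ (a : R) v : euclid_norm (a *: v) = `|a| * euclid_norm v.
Proof.
apply/eqP; rewrite -(eqrXn2 (_ : 0 < 2)%N)// ?mulr_ge0 ?euclid_norm_ge0//.
by rewrite exprMn !sqr_euclid_norm dotpZl dotpC dotpZl mulrA real_normK ?num_real// expr2.
Qed.

Lemma cauchy_schwarz u v : dotp u v <= euclid_norm u * euclid_norm v.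
Proof.
have [/euclid_norm_eq0 ->|u0] := eqVneq (euclid_norm u) 0.
  by rewrite euclid_norm0 mul0r /dotp big1// => i _; rewrite mxE mul0r.
have [/euclid_norm_eq0 ->|v0] := eqVneq (euclid_norm v) 0.
  by rewrite euclid_norm0 mulr0 /dotp big1// => i _; rewrite mxE mulr0.
have {}u0 : 0 < euclid_norm u by rewrite lt_def u0 euclid_norm_ge0.
have {}v0 : 0 < euclid_norm v by rewrite lt_def v0 euclid_norm_ge0.
set a := euclid_norm u in u0 *; set b := euclid_norm v in v0 *.
have : 0 <= dotp (b *: u + (- a) *: v) (b *: u + (- a) *: v).
  by apply: sumr_ge0 => i _; rewrite -expr2 sqr_ge0.
rewrite dotpDl !dotpZl [dotp u _]dotpC [dotp v (_ + _)]dotpC !dotpDl !dotpZl.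
rewrite [dotp v u]dotpC -!sqr_euclid_norm -/a -/b => h.
have : a * b * dotp u v <= a * b * (a * b) by nra.
by rewrite ler_pM2l// mulr_gt0.
Qed.

Lemma ler_euclid_normD u v : euclid_norm (u + v) <= euclid_norm u + euclid_norm v.
Proof.
rewrite -(ler_pXn2r (_ : 0 < 2)%N)// ?nnegrE ?addr_ge0 ?euclid_norm_ge0//.
rewrite sqr_euclid_norm dotpDl [dotp u _]dotpC [dotp v (_ + _)]dotpC !dotpDl.
rewrite -!sqr_euclid_norm [dotp v u]dotpC.
have := cauchy_schwarz u v; nra.
Qed.

Lemma coord_le_euclid_norm v i : `|v 0 i| <= euclid_norm v.
Proof.
rewrite -(ler_pXn2r (_ : 0 < 2)%N)// ?nnegrE ?euclid_norm_ge0//.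
rewrite real_normK ?num_real// sqr_euclid_norm /dotp (bigD1 i)//= -expr2 lerDl.
by apply: sumr_ge0 => j _; rewrite -expr2 sqr_ge0.
Qed.

Lemma euclid_norm_le_sum v : euclid_norm v <= \sum_i `|v 0 i|.
Proof.
rewrite -(ler_pXn2r (_ : 0 < 2)%N)// ?nnegrE ?euclid_norm_ge0 ?sumr_ge0//.
rewrite sqr_euclid_norm expr2 mulr_suml; apply: ler_sum => i _.
rewrite (le_trans (ler_norm _))// normrM ler_wpM2l// (bigD1 i)//= lerDl.
by rewrite sumr_ge0.
Qed.

Lemma loewner_scalarE (c : R) (H : 'M[R]_n) u :
  (u *m (H - c%:M) *m u^T) 0 0 =
  \sum_i u 0 i * (\sum_j H i j * u 0 j) - c * euclid_norm u ^+ 2.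
Proof.
rewrite mulmxBr mulmxBl !mxE; congr (_ - _).
  transitivity ((u *m (H *m u^T)) 0 0); first by rewrite mulmxA mxE.
  rewrite mxE; apply: eq_bigr => i _; congr (_ * _).
  by rewrite mxE; apply: eq_bigr => j _; rewrite mxE.
rewrite mul_mx_scalar sqr_euclid_norm -dotpZl; apply: eq_bigr => i _.
by rewrite !mxE.
Qed.

Lemma loewner_scalarEN (c : R) (H : 'M[R]_n) u :
  (u *m (c%:M - H) *m u^T) 0 0 =
  c * euclid_norm u ^+ 2 - \sum_i u 0 i * (\sum_j H i j * u 0 j).
Proof. by rewrite -opprB mulmxN mulNmx mxE loewner_scalarE opprB. Qed.

Variables (V : 'rV[R]_n -> R) (beta : R).
Hypotheses (hV : smooth V) (beta0 : 0 < beta).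

Let quad x u v := \sum_i u 0 i * (\sum_j partial j (partial i V) x * v 0 j).

(** For a symmetric form the bound on the diagonal extends to all pairs. Polarization is applied to
    |v| u and |u| v, which have equal norms, so that the parallelogram identity gives the sharp
    constant beta. *)
Lemma hessian_bilinear_bound x u v : CurvBdd beta V ->
  `|quad x u v| <= beta * euclid_norm u * euclid_norm v.
Proof.
move=> cb.
have qD w1 w2 w : quad x (w1 + w2) w = quad x w1 w + quad x w2 w.
  by rewrite -big_split; apply: eq_bigr => i _; rewrite mxE mulrDl.
have qZ a w1 w : quad x (a *: w1) w = a * quad x w1 w.
  by rewrite mulr_sumr; apply: eq_bigr => i _; rewrite mxE mulrA.
have qC w1 w2 : quad x w1 w2 = quad x w2 w1.
  rewrite /quad; under eq_bigr do rewrite mulr_sumr.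
  rewrite exchange_big; apply: eq_bigr => i _; rewrite mulr_sumr.
  by apply: eq_bigr => j _; rewrite schwarz//; ring.
have qb w : `|quad x w w| <= beta * euclid_norm w ^+ 2.
  have [/(_ w) h1 /(_ w) h2] := cb x.
  have E : quad x w w = \sum_i w 0 i * \sum_j hessian V x i j * w 0 j.
    apply: eq_bigr => i _; congr (_ * _); apply: eq_bigr => j _.
    by rewrite mxE schwarz.
  move: h1 h2; rewrite loewner_scalarE loewner_scalarEN -E ler_norml => h1 h2.
  by apply/andP; split; lra.
have [/euclid_norm_eq0 ->|u0] := eqVneq (euclid_norm u) 0.
  rewrite /quad euclid_norm0 mulr0 mul0r big1 ?normr0// => i _.
  by rewrite mxE mul0r.
have [/euclid_norm_eq0 ->|v0] := eqVneq (euclid_norm v) 0.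
  rewrite qC /quad euclid_norm0 mulr0 big1 ?normr0// => i _.
  by rewrite mxE mul0r.
have {}u0 : 0 < euclid_norm u by rewrite lt_def u0 euclid_norm_ge0.
have {}v0 : 0 < euclid_norm v by rewrite lt_def v0 euclid_norm_ge0.
have sq w : quad x w w = quad x w w by [].
have par w1 w2 : euclid_norm (w1 + w2) ^+ 2 + euclid_norm (w1 + (-1) *: w2) ^+ 2 =
    2 * (euclid_norm w1 ^+ 2 + euclid_norm w2 ^+ 2).
  rewrite !sqr_euclid_norm !dotpDl !dotpZl ![dotp _ (_ + _)]dotpC !dotpDl !dotpZl.
  by rewrite [dotp w2 w1]dotpC; ring.
have pol w1 w2 : quad x (w1 + w2) (w1 + w2) - quad x (w1 + (-1) *: w2) (w1 + (-1) *: w2) =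
    4 * quad x w1 w2.
  rewrite !qD !qZ ![quad x _ (_ + _)]qC !qD !qZ [quad x w2 w1]qC; ring.
set a := euclid_norm u in u0 *; set b := euclid_norm v in v0 *.
have := par (b *: u) (a *: v); have := pol (b *: u) (a *: v).
rewrite qZ [quad x u _]qC qZ [quad x v u]qC !euclid_normZ -/a -/b (gtr0_norm u0) (gtr0_norm v0).
set W1 := b *: u + _; set W2 := b *: u + _.
have := qb W1; have := qb W2; rewrite !ler_norml.
move: (euclid_norm W1 ^+ 2) (euclid_norm W2 ^+ 2) => A1 A2.
move=> /andP[h1 h2] /andP[h3 h4] h5 h6.
have hA : beta * (A1 + A2) = 4 * (a * b) * (beta * a * b) by rewrite h6; ring.
have ab0 : 0 < a * b by rewrite mulr_gt0.
apply/andP; split; rewrite -(ler_pM2l ab0); nra.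
Qed.

(** The mean value theorem for the component of the gradient along w, the increment to be bounded,
    gives |w|^2 as a value of the Hessian form at w and y - x; one factor |w| is then cancelled. *)
Lemma grad_lipschitz x y : CurvBdd beta V ->
  euclid_norm (grad V y - grad V x) <= beta * euclid_norm (y - x).
Proof.
move=> cb; set w := grad V y - grad V x; set z := y - x.
pose phi (s : R) := \sum_i w 0 i * partial i V (x + s *: z).
have D (s : R) : is_derive s 1 phi (quad (x + s *: z) w z).
  have -> : phi = \sum_i (w 0 i \*: (fun s => partial i V (x + s *: z))).
    by apply/funext => s'; rewrite /phi fct_sumE.
  apply: is_derive_sum => i; apply: is_deriveZ.
  have := is_derive_line_C1 x z s (smooth_C1 (smooth_partial i hV)).
  by under eq_bigr do rewrite mulrC.
have [|c _] := @MVT_segment R phi _ 0 1 ler01 (fun s _ => D s).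
  apply: derivable_within_continuous => s _; exact: (@ex_derive _ _ _ _ _ _ _ (D s)).
rewrite subr0 mulr1 => E.
have {}E : euclid_norm w ^+ 2 = quad (x + c *: z) w z.
  rewrite -E /phi -sumrB sqr_euclid_norm; apply: eq_bigr => i _.
  by rewrite scale0r addr0 scale1r [x + z]addrC subrK -mulrBr !mxE.
have := hessian_bilinear_bound (x + c *: z) w z cb.
rewrite -E => /ler_normlW; rewrite expr2.
have := euclid_norm_ge0 w; rewrite le_eqVlt => /orP[/eqP <- _|w0].
  by rewrite mulr_ge0 ?euclid_norm_ge0// ltW.
by rewrite -mulrA mulrCA ler_pM2l.
Qed.

End euclidean.

Lemma ler_Rintegral_dist d (T : measurableType d) (R : realType) (P : probability T R)
    (f g : T -> R) : P.-integrable setT (EFin \o f) -> P.-integrable setT (EFin \o g) ->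
  `|\int[P]_x f x - \int[P]_x g x| <= \int[P]_x `|f x - g x|.
Proof.
move=> fi gi; rewrite -RintegralB//.
have i := integrableB measurableT fi gi.
exact: (@le_normr_Rintegral _ _ _ P setT (fun x => f x - g x) measurableT i).
Qed.

(** * A determining class of smooth functions *)

Section tame_functions.
Context {R : realType} {n : nat}.
Implicit Types (f g : 'rV[R]_n -> R) (x v : 'rV[R]_n) (i : 'I_n).

Local Notation e_ i := (delta_mx 0 i : 'rV[R]_n).

(** The derivative of the logistic function is a polynomial in the function itself, which keeps the
    class below closed under differentiation; steep rescalings of it converge to indicators of
    half-lines. *)
Definition sigmoid (s : R) : R := (1 + expR (- s))^-1.

Lemma sigmoid_gt0 s : 0 < sigmoid s.
Proof. by rewrite invr_gt0 addr_gt0// expR_gt0. Qed.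

Lemma sigmoid_lt1 s : sigmoid s < 1.
Proof. by rewrite invf_lt1 ?ltrDl ?expR_gt0// addr_gt0// expR_gt0. Qed.

Lemma ler_sigmoid_ge s : 1 - expR (- s) <= sigmoid s.
Proof.
rewrite /sigmoid -[leRHS]div1r ler_pdivlMr ?addr_gt0 ?expR_gt0//.
have := expR_gt0 (- s); nra.
Qed.

Lemma ler_sigmoid_le s : sigmoid s <= expR s.
Proof.
rewrite /sigmoid -div1r ler_pdivrMr ?addr_gt0 ?expR_gt0// mulrDr mulr1.
by rewrite -expRD subrr expR0 lerDr expR_ge0.
Qed.

Lemma is_derive_affine (k m s : R) : is_derive s 1 (fun s : R => s * k + m) k.
Proof.
have := @is_deriveD _ _ _ _ _ s 1 _ _
  (@is_deriveZ _ _ _ id k s 1 1 (is_derive_id _ _)) (is_derive_cst m s 1).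
rewrite addr0 [k *: 1]mulr1.
by rewrite (_ : _ + _ = fun s : R => s * k + m)//; apply/funext => y /=; rewrite mulrC.
Qed.

Lemma is_derive_sigmoid (s : R) : is_derive s 1 sigmoid (sigmoid s * (1 - sigmoid s)).
Proof.
have p0 : 1 + expR (- s) != 0 :> R by rewrite gt_eqF// addr_gt0// expR_gt0.
have D1 : is_derive s 1 (fun s => 1 + expR (- s)) (- expR (- s)).
  have D0 : is_derive s 1 (fun s : R => expR (- s)) (- expR (- s)).
    have := @is_derive1_comp R expR (@GRing.opp R) s (expR (- s)) (-1) _ _.
    by rewrite mulrN1; apply.
  have := @is_deriveD _ _ _ (cst (1 : R)) (fun s : R => expR (- s)) s 1 0 _ (is_derive_cst _ _ _) D0.
  by rewrite add0r.
have := @is_deriveV R (fun s => 1 + expR (- s)) s _ 1 p0 D1.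
rewrite /sigmoid; congr (is_derive _ _ _ _).
by rewrite [_ *: _]/GRing.scale/=; field.
Qed.

(* A class of smooth functions with bounded derivatives of all orders, stable
   under the operations needed below and generating the Borel sets. *)
Inductive tame : ('rV[R]_n -> R) -> Prop :=
| tame_cst (c : R) : tame (fun=> c)
| tame_sigmoid i (a b : R) : tame (fun x => sigmoid (a * x 0 i + b))
| tame_add f g : tame f -> tame g -> tame (fun x => f x + g x)
| tame_mul f g : tame f -> tame g -> tame (fun x => f x * g x)
| tame_powR f (c r : R) : 0 < c -> (forall x, c <= f x) -> tame f ->
    tame (fun x => f x `^ r).

Lemma tame_shift f v : tame f -> tame (fun x => f (x + v)).
Proof.
elim=> [c|i a b|g h _ IHg _ IHh|g h _ IHg _ IHh|g c r c0 cg _ IH].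
- exact: tame_cst.
- rewrite (_ : (fun x => _) = (fun x => sigmoid (a * x 0 i + (a * v 0 i + b)))).
    exact: tame_sigmoid.
  by apply/funext => x; rewrite mxE mulrDr addrA.
- exact: tame_add.
- exact: tame_mul.
- by apply: (@tame_powR _ c).
Qed.

Lemma tame_measurable f : tame f -> measurable_fun setT f.
Proof.
elim=> [c|i a b|g h _ IHg _ IHh|g h _ IHg _ IHh|g c r c0 cg _ IH].
- exact: measurable_cst.
- have ml : measurable_fun setT (fun x : 'rV[R]_n => expR (- (a * x 0 i + b))).
    apply: (measurableT_comp (@measurable_expR R)); apply: measurableT_comp => //.
    apply: measurable_funD => //; apply: measurable_funM => //.
    exact: measurable_coord.
  rewrite (_ : (fun x => _) = (fun x => (1 + expR (- (a * x 0 i + b))) `^ (-1))).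
    apply: (measurableT_comp (@measurable_powR R _)).
    exact: measurable_funD.
  by apply/funext => x; rewrite powR_inv1// addr_ge0// expR_ge0.
- exact: measurable_funD.
- exact: measurable_funM.
- exact: (measurableT_comp (@measurable_powR R r) IH).
Qed.

Lemma tame_bounded f : tame f -> exists2 M, 0 < M & forall x, `|f x| <= M.
Proof.
elim=> [c|i a b|g h _ [M M0 gM] _ [N N0 hN]|g h _ [M M0 gM] _ [N N0 hN]|g c r c0 cg _ [M M0 gM]].
- by exists (`|c| + 1) => [|_]; [rewrite ltr_wpDl|rewrite lerDl].
- by exists 1 => // x; rewrite ger0_norm; apply/ltW; [exact: sigmoid_lt1|exact: sigmoid_gt0].
- exists (M + N) => [|x]; first exact: addr_gt0.
  by rewrite (le_trans (ler_normD _ _))// lerD.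
- by exists (M * N) => [|x]; [exact: mulr_gt0|rewrite normrM ler_pM].
- exists (M `^ r + c `^ r) => [|x]; first by rewrite addr_gt0 ?powR_gt0.
  have g0 : 0 < g x by rewrite (lt_le_trans c0).
  have gxM : g x <= M by rewrite (le_trans (ler_norm _)).
  rewrite ger0_norm ?powR_ge0//; have [r0|r0] := leP 0 r.
    rewrite (@le_trans _ _ (M `^ r))// ?lerDl ?powR_ge0//.
    by rewrite ge0_ler_powR ?nnegrE// ltW.
  rewrite (@le_trans _ _ (c `^ r))// ?lerDr ?powR_ge0//.
  rewrite -[r]opprK !(powRN _ (- r)) lef_pV2 ?posrE ?powR_gt0//.
  by rewrite ge0_ler_powR ?nnegrE ?oppr_ge0 ?(ltW c0) ?(ltW g0) ?(ltW r0).
Qed.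

Lemma tame_continuous f : tame f -> continuous f.
Proof.
elim=> [c|i a b|g h _ IHg _ IHh|g h _ IHg _ IHh|g c r c0 cg _ IH] x.
- exact: cst_continuous.
- have : {for a * x 0 i + b, continuous sigmoid}.
    apply: differentiable_continuous; apply/derivable1_diffP.
    exact: (@ex_derive _ _ _ _ _ _ _ (is_derive_sigmoid _)).
  apply: (@continuous_comp _ _ _ (fun x : 'rV[R]_n => a * x 0 i + b)).
  apply: continuousD; last exact: cst_continuous.
  by apply: continuousM; [exact: cst_continuous|exact: coord_continuous].
- exact: continuousD (IHg x) (IHh x).
- exact: continuousM (IHg x) (IHh x).
- have : {for g x, continuous (fun y : R => y `^ r)}.
    apply: differentiable_continuous; apply/derivable1_diffP.
    by apply: derivable_powR; rewrite in_itv/= andbT (lt_le_trans c0).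
  exact: (continuous_comp (IH x)).
Qed.

Lemma is_derive_of_line f x v (l : R) :
  is_derive (0 : R) 1 (fun s => f (x + s *: v)) l -> is_derive x v f l.
Proof.
case=> df dl.
have E : (fun h : R => h^-1 *: ((f \o shift x) (h *: v) - f x)) =
    (fun h : R => h^-1 *: (((fun s => f (x + s *: v)) \o shift 0) (h *: 1) -
      (fun s => f (x + s *: v)) 0)).
  apply/funext => h /=; rewrite scale0r !addr0; congr (_ *: (f _ - _)).
  by rewrite [h *: 1]mulr1 addrC.
split; first by rewrite /derivable E.
by rewrite -dl /derive E.
Qed.

(** Restriction to a line reduces this to the chain rule in one variable. *)
Lemma is_derive_compR f x v (h : R -> R) (l l' : R) :
  is_derive x v f l -> is_derive (f x) 1 h l' -> is_derive x v (h \o f) (l' * l).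
Proof.
move=> fl hl'; apply: is_derive_of_line.
have D : is_derive (0 : R) 1 (fun s => f (x + s *: v)) l.
  by apply: is_derive_line; rewrite scale0r addr0.
apply: (@is_derive1_comp R h (fun s => f (x + s *: v))).
by rewrite scale0r addr0.
Qed.

Lemma tame_derive f i : tame f ->
  exists2 g, tame g & forall x, is_derive x (e_ i) f (g x).
Proof.
elim=> [c|j a b|g h _ [g' tg Dg] _ [h' th Dh]|g h tg [g' tg' Dg] th [h' th' Dh]|g c r c0 cg tg [g' tg' Dg]].
- exists (fun=> 0); first exact: tame_cst.
  move=> x; exact: is_derive_cst.
- pose s x := sigmoid (a * x 0 j + b).
  exists (fun x => (s x * (1 + (-1) * s x)) * (a * (j == i)%:R)).
    apply: tame_mul; last exact: tame_cst.
    apply: tame_mul; first exact: tame_sigmoid.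
    apply: tame_add; first exact: tame_cst.
    apply: tame_mul; first exact: tame_cst.
    exact: tame_sigmoid.
  move=> x.
  have Dl : is_derive x (e_ i) (fun x : 'rV[R]_n => a * x 0 j + b) (a * (j == i)%:R).
    apply: is_derive_of_line.
    rewrite (_ : (fun s0 : R => _) = (fun s0 : R => s0 * (a * (j == i)%:R) + (a * x 0 j + b))).
      exact: is_derive_affine.
    by apply/funext => s0; rewrite coordE eq_sym; ring.
  have := is_derive_compR Dl (is_derive_sigmoid _).
  by rewrite /s mulN1r.
- exists (fun x => g' x + h' x); first exact: tame_add.
  by move=> x; apply: is_deriveD.
- exists (fun x => g x * h' x + h x * g' x).
    by apply: tame_add; apply: tame_mul.
  by move=> x; apply: is_deriveM.
- exists (fun x => (r * g x `^ (r - 1)) * g' x).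
    apply: tame_mul => //; apply: tame_mul; first exact: tame_cst.
    exact: tame_powR cg _.
  move=> x; have gx0 : 0 < g x by rewrite (lt_le_trans c0).
  exact: is_derive_compR (Dg x) (is_derive1_powR _ gx0).
Qed.

Lemma tame_partial f i : tame f -> tame (partial i f).
Proof.
move=> /(tame_derive i)[g tg Dg]; rewrite (_ : partial i f = g)//.
by apply/funext => x; exact: (@derive_val _ _ _ _ _ _ _ (Dg x)).
Qed.

Lemma tame_smooth f : tame f -> smooth f.
Proof.
move=> tf s; have ts : tame (foldr (@partial R n) f s).
  by elim: s => //= i s IH; exact: tame_partial.
split; first exact: tame_continuous.
move=> i x; have [g _ Dg] := tame_derive i ts.
exact: (@ex_derive _ _ _ _ _ _ _ (Dg x)).
Qed.

End tame_functions.

(** The sum is the integer part of r, capped at N. For r a multiple of f(x), this approximates f by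
    an average of indicators of superlevel sets. *)
Lemma count_le (R : realType) (r : R) (N : nat) : 0 <= r ->
  let S := \sum_(k < N) ((k.+1%:R <= r)%R%:R : R) in
  (N%:R <= r -> S = N%:R) /\ (r <= N%:R -> r - 1 <= S <= r).
Proof.
move=> r0; elim: N => [|N [IH1 IH2]] /=.
  by rewrite big_ord0; split=> // h; have -> : r = 0 by [apply/eqP; rewrite eq_le h r0]; rewrite sub0r lexx lerN10.
rewrite big_ord_recr/=; split=> h.
  rewrite h IH1 ?natr1// (le_trans _ h)// ler_nat //.
have [h1|h1] := leP N.+1%:R r.
  rewrite IH1 ?natr1; last by rewrite (le_trans _ h1)// ler_nat.
  by rewrite h1 lerBlDr (le_trans h)// lerDl.
rewrite addr0; have [h2|/ltW h2] := leP r N%:R; first exact: IH2.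
by rewrite IH1// h2 andbT lerBlDr natr1 ltW.
Qed.

(** * Density of tame functions, and extension of Harnack inequalities from them *)

Section tame_density.
Context {R : realType} {n : nat}.
Variables mu nu : probability 'rV[R]_n R.
Implicit Types (f g : 'rV[R]_n -> R).

(** Distance in L^1(mu + nu): a Harnack inequality involves both measures, so one approximant must
    serve for both. *)
Definition l1dist f g : R := \int[mu]_x `|f x - g x| + \int[nu]_x `|f x - g x|.

Definition unit_valued f := measurable_fun setT f /\ forall x, 0 <= f x <= 1.

(** Keeping the approximants in [0, 1] controls their products and supplies the domination in the
    limits. *)
Definition approximable f := forall e : R, 0 < e ->
  exists g, [/\ tame g, forall x, 0 <= g x <= 1 & l1dist g f <= e].

Lemma tame_unit_valued f : tame f -> (forall x, 0 <= f x <= 1) -> unit_valued f.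
Proof. by move=> tf f1; split=> //; exact: tame_measurable. Qed.

Lemma integrable_unit_valued_dist (P : probability 'rV[R]_n R) f g :
  unit_valued f -> unit_valued g -> P.-integrable setT (EFin \o (fun x => `|f x - g x|)).
Proof.
move=> [mf f1] [mg g1]; apply: (@bounded_integrable _ _ _ _ _ 1).
  by apply: measurableT_comp => //; exact: measurable_funB.
move=> x; rewrite normr_id ler_norml.
by have /andP[? ?] := f1 x; have /andP[? ?] := g1 x; apply/andP; split; lra.
Qed.

Lemma l1dist_ptw f g f' g' (h h' : 'rV[R]_n -> R) (a b : R) : unit_valued f -> unit_valued g ->
  unit_valued f' -> unit_valued g' -> l1dist f f' <= a -> l1dist g g' <= b ->
  measurable_fun [set: 'rV[R]_n] h -> measurable_fun [set: 'rV[R]_n] h' ->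
  (forall x, `|h x - h' x| <= `|f x - f' x| + `|g x - g' x|) ->
  l1dist h h' <= a + b.
Proof.
move=> uf ug uf' ug' ffa ggb mh mh' hh.
have T (P : probability 'rV[R]_n R) :
    \int[P]_x `|h x - h' x| <= \int[P]_x `|f x - f' x| + \int[P]_x `|g x - g' x|.
  have i2 := integrableD measurableT (integrable_unit_valued_dist P uf uf')
    (integrable_unit_valued_dist P ug ug').
  rewrite -RintegralD//; [|exact: integrable_unit_valued_dist|exact: integrable_unit_valued_dist].
  apply: le_Rintegral => //.
  apply: (le_integrable measurableT _ _ i2).
    by apply/measurable_EFinP; apply: measurableT_comp => //; exact: measurable_funB.
  move=> x _ /=; rewrite lee_fin normr_id (le_trans (hh x))//.
  exact: ler_norm.
have := T mu; have := T nu; move: ffa ggb; rewrite /l1dist; lra.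
Qed.

Lemma l1distxx f : l1dist f f = 0.
Proof.
rewrite /l1dist; under eq_Rintegral do rewrite subrr normr0.
by under [X in _ + X]eq_Rintegral do rewrite subrr normr0; rewrite !Rintegral_probability_cst addr0.
Qed.

Lemma approximable_tame f : tame f -> (forall x, 0 <= f x <= 1) -> approximable f.
Proof. by move=> tf f1 e e0; exists f; rewrite l1distxx ltW. Qed.

Lemma approximable_mul f g : unit_valued f -> unit_valued g ->
  approximable f -> approximable g -> approximable (fun x => f x * g x).
Proof.
move=> uf ug af ag e e0; have e2 : 0 < e / 2 by rewrite divr_gt0.
have [f' [tf f1 ff]] := af _ e2; have [g' [tg g1 gg]] := ag _ e2.
exists (fun x => f' x * g' x); split; first exact: tame_mul.
  move=> x; have /andP[? ?] := f1 x; have /andP[? ?] := g1 x.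
  by rewrite mulr_ge0//= mulr_ile1.
rewrite (splitr e).
apply: (l1dist_ptw (tame_unit_valued tf f1) (tame_unit_valued tg g1) uf ug ff gg).
- by apply: tame_measurable; exact: tame_mul.
- by apply: measurable_funM; [exact: uf.1|exact: ug.1].
move=> x; rewrite (_ : _ - _ = (f' x - f x) * g' x + f x * (g' x - g x)); last by ring.
rewrite (le_trans (ler_normD _ _))// !normrM lerD//.
  by rewrite ler_piMr// ger0_norm; case/andP: (g1 x).
by rewrite ler_piMl// ger0_norm; case/andP: (uf.2 x).
Qed.

Lemma approximable_onem f : unit_valued f -> approximable f -> approximable (fun x => 1 - f x).
Proof.
move=> uf af e e0; have [f' [tf f1 ff]] := af _ e0.
have t1 : tame (fun x => 1 - f' x).
  rewrite (_ : (fun x => _) = (fun x => 1 + (-1) * f' x)).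
    by apply: tame_add; [exact: tame_cst|apply: tame_mul => //; exact: tame_cst].
  by apply/funext => x; rewrite mulN1r.
exists (fun x => 1 - f' x); split => //.
  by move=> x; have /andP[? ?] := f1 x; apply/andP; split; lra.
have u0 : unit_valued (fun=> 0) by split=> // x; rewrite lexx ler01.
rewrite -[e]addr0.
apply: (l1dist_ptw (tame_unit_valued tf f1) u0 uf u0 ff).
- by rewrite l1distxx.
- exact: tame_measurable.
- by apply: measurable_funB => //; exact: uf.1.
- move=> x; rewrite subrr normr0 addr0 (_ : _ - _ = - (f' x - f x)); last by ring.
  by rewrite normrN.
Qed.

Lemma approximable_lim (f_ : nat -> 'rV[R]_n -> R) f :
  (forall k, unit_valued (f_ k)) -> unit_valued f ->
  (forall k, approximable (f_ k)) -> (forall x, f_ ^~ x @ \oo --> f x) ->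
  approximable f.
Proof.
move=> uf_ uf af_ ff e e0; have e2 : 0 < e / 2 by rewrite divr_gt0.
have C (P : probability 'rV[R]_n R) : (fun k => \int[P]_x `|f_ k x - f x|) @ \oo --> 0.
  rewrite -[0 in X in _ --> X](Rintegral_probability_cst P 0).
  apply: (@Rintegral_dominated_cvg _ _ _ P (fun k x => `|f_ k x - f x|) _ (cst 1)) => //.
  - by move=> k; apply: measurableT_comp => //; apply: measurable_funB; [exact: (uf_ k).1|exact: uf.1].
  - apply: aeW => x; rewrite -(normr0 R) -(subrr (f x)).
    by apply: cvg_norm; apply: cvgB => //; exact: cvg_cst.
  - exact: finite_measure_integrable_cst.
  - move=> k x; rewrite normr_id ler_norml /=.
    by have /andP[? ?] := (uf_ k).2 x; have /andP[? ?] := uf.2 x; apply/andP; split; lra.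
have : (fun k => l1dist (f_ k) f) @ \oo --> 0 + 0 by apply: cvgD; exact: C.
rewrite addr0 => /cvgrPdist_le /(_ _ e2)[k _ /(_ k (leqnn k))] /=.
rewrite sub0r normrN => hk.
have [g [tg g1 gf]] := af_ k _ e2.
exists g; split => //; rewrite (splitr e).
apply: (l1dist_ptw (tame_unit_valued tg g1) (uf_ k) (uf_ k) uf gf).
- by rewrite (le_trans (ler_norm _)).
- exact: tame_measurable.
- exact: uf.1.
- by move=> x; exact: ler_distD.
Qed.

Lemma unit_valued_indic (A : set 'rV[R]_n) : measurable A -> unit_valued \1_A.
Proof.
by move=> mA; split=> [|x]; [exact: measurable_indic|rewrite indicE; case: (_ \in _); rewrite lexx ler01].
Qed.

Lemma approximable_halfspace i (a : R) : approximable \1_[set x : 'rV[R]_n | a < x 0 i].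
Proof.
have mA : measurable [set x : 'rV[R]_n | a < x 0 i].
  have := @measurable_coord R n i measurableT _ (measurable_itv `]a, +oo[).
  by rewrite setTI; congr measurable; apply/seteqP; split=> x /=; rewrite in_itv/= andbT.
(* The argument is k^2 (x_i - a) - k: the slope k^2 prevails where x_i > a, and the offset - k sends
   the value to 0 also on the boundary x_i = a. *)
pose f_ k (x : 'rV[R]_n) := sigmoid (k%:R ^+ 2 * x 0 i + (- (k%:R ^+ 2 * a) - k%:R)).
have uf_ k x : 0 <= f_ k x <= 1.
  by rewrite (ltW (sigmoid_gt0 _)) (ltW (sigmoid_lt1 _)).
have tf_ k : tame (f_ k) by exact: tame_sigmoid.
apply: (@approximable_lim f_).
- by move=> k; exact: tame_unit_valued.
- exact: unit_valued_indic.
- by move=> k; exact: approximable_tame.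
move=> x; rewrite indicE; have [ax|xa] := ltP a (x 0 i).
- rewrite mem_set//.
  have d0 : 0 < x 0 i - a by rewrite subr_gt0.
  apply: (@squeeze_cvgr _ _ _ _ (fun k => 1 - expR (- k%:R)) (cst 1)).
  + near=> k; apply/andP; split; last by rewrite ltW// sigmoid_lt1.
    apply: (le_trans _ (ler_sigmoid_ge _)); rewrite lerD2l lerN2 ler_expR lerN2.
    have : 2 / (x 0 i - a) < k%:R by near: k; exact: nbhs_infty_gtr.
    rewrite ltr_pdivrMr// => hk.
    have k0 : 0 <= k%:R :> R by [].
    nra.
  + rewrite -[1 in X in _ --> X]subr0; apply: cvgB; [exact: cvg_cst|exact: cvgn_expR].
  + exact: cvg_cst.
- rewrite memNset/=; last by apply/negP; rewrite -leNgt.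
  apply: (@squeeze_cvgr _ _ _ _ (cst 0) (fun k => expR (- k%:R))).
  + apply: nearW => k; apply/andP; split; first by rewrite ltW// sigmoid_gt0.
    apply: (le_trans (ler_sigmoid_le _)); rewrite ler_expR.
    have k0 : 0 <= k%:R :> R by [].
    nra.
  + exact: cvg_cst.
  + exact: cvgn_expR.
Unshelve. all: by end_near. Qed.

(** The sets with approximable indicator form a sigma-algebra: complements through 1 - f,
    intersections through products, countable unions as limits of finite ones. It contains the
    half-spaces that generate the measurable sets. *)
Lemma approximable_indic (A : set 'rV[R]_n) : measurable A -> approximable \1_A.
Proof.
pose G : set (set 'rV[R]_n) := [set A | measurable A /\ approximable \1_A].
have G0 : G set0.
  split; first exact: measurable0.
  rewrite indic0; apply: (@approximable_tame (fun=> 0)); first exact: tame_cst.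
  by move=> x; rewrite lexx ler01.
have GC B : G B -> G (~` B).
  move=> [mB aB]; split; first exact: measurableC.
  rewrite (_ : \1_(~` B) = (fun x => 1 - \1_B x)).
    by apply: approximable_onem => //; exact: unit_valued_indic.
  by apply/funext => x; rewrite !indicE in_setC; case: (_ \in _); rewrite ?subrr ?subr0.
have GU (F : (set 'rV[R]_n)^nat) : (forall k, G (F k)) -> G (\bigcup_k F k).
  move=> GF; split; first by apply: bigcup_measurable => k _; exact: (GF k).1.
  pose u_ k := \1_(\bigcup_(j < k) F j) : 'rV[R]_n -> R.
  have mU k : measurable (\bigcup_(j < k) F j).
    by apply: bigcup_measurable => j _; exact: (GF j).1.
  apply: (@approximable_lim u_).
  - by move=> k; exact: unit_valued_indic.
  - by apply: unit_valued_indic; apply: bigcup_measurable => k _; exact: (GF k).1.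
  - elim=> [|k IH].
      rewrite /u_ (_ : \bigcup_(j < 0) F j = set0); first exact: G0.2.
      by apply/seteqP; split=> x // -[].
    have : approximable \1_(~` (~` (\bigcup_(j < k) F j) `&` ~` F k)).
      have [_ a1] := GC _ (conj (mU k) IH); have [_ a2] := GC _ (GF k).
      have mI : measurable (~` (\bigcup_(j < k) F j) `&` ~` F k).
        by apply: measurableI; apply: measurableC; [exact: mU|exact: (GF k).1].
      apply: (GC _ (conj mI _)).2.
      rewrite (_ : \1_(_ `&` _) = (fun x => \1_(~` (\bigcup_(j < k) F j)) x * \1_(~` F k) x)).
        apply: approximable_mul => //; apply: unit_valued_indic; apply: measurableC; [exact: mU|exact: (GF k).1].
      by rewrite indicI.
    rewrite setCI !setCK; congr (approximable \1__).
    apply/seteqP; split=> x /=.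
      by move=> [[j /= jk Fj]|Fk]; [exists j => //=; rewrite ltnS ltnW|exists k => /=].
    move=> [j /=]; rewrite ltnS leq_eqVlt => /predU1P[-> Fk|jk Fj]; [by right|left; exists j => //].
  - move=> x; rewrite indicE; have [[k _ Fk]|nF] := pselect ((\bigcup_k F k) x).
      rewrite mem_set; last by exists k.
      apply: cvg_near_cst; exists k.+1 => // j /= kj; rewrite /u_ indicE mem_set//.
      by exists k.
    rewrite memNset//; apply: cvg_near_cst; apply: nearW => k.
    rewrite /u_ indicE memNset// => -[j _ Fj]; apply: nF; by exists j.
move=> mA; suff : measurable `<=` G by move=> /(_ _ mA)[].
apply: smallest_sub.
  by split => // B; rewrite setTD; exact: GC.
move=> B; rewrite -bigcup_seq/= => -[i _ [C mC <-]].
rewrite setTI.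
have : (fun C : set R => G ((fun x : 'rV[R]_n => x 0 i) @^-1` C)) C; last by [].
have : <<s (@RGenOInfty.G R) >> C.
  by have := mC; rewrite -[measurable]/(R.-ocitv.-measurable.-sigma.-measurable) RGenOInfty.measurableE.
suff : <<s (@RGenOInfty.G R) >> `<=` [set C | G ((fun x : 'rV[R]_n => x 0 i) @^-1` C)] by apply.
apply: smallest_sub.
  split.
  - by rewrite /= preimage_set0.
  - by move=> D; rewrite /= setTD preimage_setC; exact: GC.
  - by move=> F GF; rewrite /= preimage_bigcup; exact: GU.
move=> D [a ->] /=; split.
  by rewrite -[X in measurable X]setTI; exact: measurable_coord.
rewrite (_ : _ @^-1` _ = [set x : 'rV[R]_n | a < x 0 i]); first exact: approximable_halfspace.
by apply/seteqP; split=> x /=; rewrite in_itv/= andbT.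
Qed.

Lemma approximable_conv f g (c : R) : 0 <= c <= 1 -> unit_valued f -> unit_valued g ->
  approximable f -> approximable g -> approximable (fun x => (1 - c) * f x + c * g x).
Proof.
move=> /andP[c0 c1] uf ug af ag e e0; have e2 : 0 < e / 2 by rewrite divr_gt0.
have [f' [tf f1 ff]] := af _ e2; have [g' [tg g1 gg]] := ag _ e2.
have t1 : tame (fun x => (1 - c) * f' x + c * g' x).
  by apply: tame_add; apply: tame_mul => //; exact: tame_cst.
exists (fun x => (1 - c) * f' x + c * g' x); split => //.
  by move=> x; have /andP[? ?] := f1 x; have /andP[? ?] := g1 x; apply/andP; split; nra.
rewrite (splitr e).
apply: (l1dist_ptw (tame_unit_valued tf f1) (tame_unit_valued tg g1) uf ug ff gg).
- exact: tame_measurable.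
- by apply: measurable_funD; apply: measurable_funM => //; [exact: uf.1|exact: ug.1].
move=> x; rewrite (_ : _ - _ = (1 - c) * (f' x - f x) + c * (g' x - g x)); last by ring.
rewrite (le_trans (ler_normD _ _))// !normrM lerD//.
  by rewrite ler_piMl// ger0_norm ?subr_ge0// gerBl.
by rewrite ler_piMl// ger0_norm.
Qed.

(** f is the uniform limit of averages of indicators of the sets {f >= (k + 1) / (N + 1)}; averages,
    being convex combinations, remain in [0, 1]. *)
Lemma approximable_unit_valued f : unit_valued f -> approximable f.
Proof.
move=> [mf f1].
pose A N k := [set x : 'rV[R]_n | k.+1%:R <= f x * N.+1%:R].
have mA N k : measurable (A N k).
  have m1 : measurable_fun setT (fun x => f x * N.+1%:R) by exact: measurable_funM.
  have := m1 measurableT _ (measurable_itv `[k.+1%:R, +oo[).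
  by rewrite setTI; congr measurable; apply/seteqP; split=> x /=; rewrite in_itv/= andbT.
pose s_ N x := N.+1%:R^-1 * \sum_(k < N.+1) \1_(A N k) x : R.
have sE N x : f x - N.+1%:R^-1 <= s_ N x <= f x.
  have /andP[f0 fle1] := f1 x.
  have [_ ] := @count_le R (f x * N.+1%:R) N.+1 (mulr_ge0 f0 (ler0n _ _)).
  have h : f x * N.+1%:R <= N.+1%:R by rewrite ler_piMl.
  have E : \sum_(k < N.+1) \1_(A N k) x = \sum_(k < N.+1) (k.+1%:R <= f x * N.+1%:R)%R%:R :> R.
    by apply: eq_bigr => k _; rewrite indicE; congr (_%:R); congr nat_of_bool; apply/idP/idP; rewrite inE.
  move=> /(_ h); rewrite /s_ E.
  have N0 : 0 < N.+1%:R :> R by [].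
  move=> /andP[h1 h2]; apply/andP; split.
    rewrite mulrC ler_pdivlMr// mulrBl mulVf ?gt_eqF//.
  by rewrite mulrC ler_pdivrMr.
have us N : unit_valued (s_ N).
  split.
    by apply: measurable_funM => //; apply: measurable_sum => k; exact: measurable_indic.
  move=> x; have /andP[_ h] := sE N x; have /andP[_ h1] := f1 x.
  by rewrite (le_trans h h1) andbT mulr_ge0// sumr_ge0.
apply: (@approximable_lim s_) => // [|x].
- move=> N; rewrite /s_.
  have uA m : unit_valued (fun x => m.+1%:R^-1 * \sum_(k < m.+1) \1_(A N k) x : R).
    split.
      by apply: measurable_funM => //; apply: measurable_sum => k; exact: measurable_indic.
    move=> x; rewrite mulr_ge0 ?sumr_ge0//= mulrC ler_pdivrMr// mul1r.
    apply: (@le_trans _ _ (\sum_(k < m.+1) 1)); last by rewrite sumr_const card_ord.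
    by apply: ler_sum => k _; case/andP: ((unit_valued_indic (mA N k)).2 x).
  (* The averages are built one set at a time as convex combinations; the level N stays fixed while
     the number of averaged sets grows. *)
  suff avg m : approximable (fun x => m.+1%:R^-1 * \sum_(k < m.+1) \1_(A N k) x) by exact: avg.
  elim: m => [|m IH].
    rewrite (_ : (fun x => _) = \1_(A N 0%N)); first exact: approximable_indic.
    by apply/funext => x; rewrite big_ord1 invr1 mul1r.
  rewrite (_ : (fun x => _) = (fun x => (1 - m.+2%:R^-1) * (m.+1%:R^-1 * \sum_(k < m.+1) \1_(A N k) x) +
      m.+2%:R^-1 * \1_(A N m.+1) x)).
    apply: approximable_conv => //.
    - by rewrite invr_ge0 ler0n invf_le1// ler1n.
    - exact: unit_valued_indic.
    - exact: approximable_indic.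
  apply/funext => x; rewrite big_ord_recr/= mulrDr; congr (_ + _).
  rewrite mulrA; congr (_ * _).
  have -> : m.+2%:R = m.+1%:R + 1 :> R by rewrite natr1.
  by field; rewrite gt_eqF//= gt_eqF// addr_gt0.
- apply/cvgrPdist_le => e e0.
  have := @cvg_harmonic R => /cvgrPdist_le /(_ _ e0); apply: filterS => N /=.
  rewrite sub0r normrN ger0_norm// => h; rewrite ler_norml.
  move: (sE N x) h; move: (N.+1%:R^-1) => z /andP[? ?] h; apply/andP; split; lra.
Qed.

(** The positive lower bound on g keeps its real powers within the tame class. *)
Definition tame_harnack (p c : R) := forall g, tame g ->
  (exists2 e, 0 < e & forall x, e <= g x) ->
  (\int[nu]_x g x) `^ p <= c * \int[mu]_x (g x `^ p).

Lemma powR_lipschitz (p M a b : R) : 1 <= p -> 0 <= a <= M -> 0 <= b <= M ->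
  `|a `^ p - b `^ p| <= p * M `^ (p - 1) * `|a - b|.
Proof.
move=> p1; wlog ab : a b / b <= a.
  move=> h a1 b1; have [|/ltW] := leP b a; first by move=> ?; exact: h.
  by move=> ba; rewrite distrC [`|a - b|]distrC; exact: h.
move=> /andP[a0 aM] /andP[b0 bM].
have p0 : 0 < p by rewrite (lt_le_trans ltr01).
have pm : 0 <= p - 1 by rewrite subr_ge0.
have mono : b `^ p <= a `^ p by rewrite ge0_ler_powR ?nnegrE// ltW.
rewrite !ger0_norm ?subr_ge0//.
have M1 y : 0 <= y -> y <= M -> p * y `^ (p - 1) <= p * M `^ (p - 1).
  by move=> y0 yM; rewrite ler_pM2l// ge0_ler_powR ?nnegrE// (le_trans y0).
(* The mean value theorem below needs b > 0 to differentiate the power; for b = 0 the identity a^p =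
   a a^(p-1) is enough. *)
move: b0; rewrite le_eqVlt => /predU1P[b0|b0].
  rewrite -b0 powR0 ?gt_eqF// !subr0 -(@mulr_powRB1 _ a p)// mulrC ler_wpM2r//.
  rewrite (le_trans _ (M1 a a0 aM))// ler_peMl// powR_ge0 //.
have [||c] := @MVT_segment R (fun y => y `^ p) (fun y => p * y `^ (p - 1)) b a ab.
- by move=> y; rewrite in_itv/= => /andP[y1 _]; apply: is_derive1_powR; rewrite (lt_trans b0).
- apply: derivable_within_continuous => y; rewrite in_itv/= => /andP[y1 _].
  by apply: derivable_powR; rewrite in_itv/= andbT (lt_le_trans b0).
rewrite in_itv/= => /andP[bc ca] ->; rewrite ler_wpM2r ?subr_ge0//.
by apply: M1; [rewrite (le_trans (ltW b0))|rewrite (le_trans ca)].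
Qed.

(** Tame approximants in L^1(mu + nu), raised by 1 / (k + 1) to be bounded below, take values in
    [0, 2]; the p-th power is Lipschitz there, so both sides converge. *)
Lemma tame_harnack_bounded p c f : 1 < p -> 0 <= c -> tame_harnack p c ->
  unit_valued f -> (\int[nu]_x f x) `^ p <= c * \int[mu]_x (f x `^ p).
Proof.
move=> p1 c0 H uf; have p0 : 0 < p by rewrite (lt_trans _ p1).
have [mf f1] := uf.
have /choice[g hg] : forall k, exists g, [/\ tame g, forall x, 0 <= g x <= 1 & l1dist g f <= k.+1%:R^-1].
  by move=> k; apply: approximable_unit_valued => //; rewrite invr_gt0.
pose G k x := g k x + k.+1%:R^-1.
have tg k : tame (g k) by case: (hg k).
have g1 k : forall x, 0 <= g k x <= 1 by case: (hg k).
have gf k : l1dist (g k) f <= k.+1%:R^-1 by case: (hg k).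
have tG k : tame (G k) by apply: tame_add => //; exact: tame_cst.
have k1 k : 0 < (k.+1%:R^-1 : R) <= 1 by rewrite invr_gt0 ltr0n invf_le1// ler1n.
have G0 k x : 0 <= G k x <= 2.
  move: (g1 k x) (k1 k); rewrite /G; move: (g k x) (k.+1%:R^-1) => y z.
  by move=> /andP[? ?] /andP[? ?]; apply/andP; split; lra.
have HG k : (\int[nu]_x G k x) `^ p <= c * \int[mu]_x (G k x `^ p).
  apply: H => //; exists k.+1%:R^-1; first by case/andP: (k1 k).
  by move=> x; rewrite lerDr; case/andP: (g1 k x).
have mG k : measurable_fun setT (G k) by exact: tame_measurable.
have iG k (P : probability 'rV[R]_n R) : P.-integrable setT (EFin \o G k).
  by apply: (@bounded_integrable _ _ _ _ _ 2) => // x; rewrite ger0_norm; case/andP: (G0 k x).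
have i_f (P : probability 'rV[R]_n R) : P.-integrable setT (EFin \o f).
  by apply: (@bounded_integrable _ _ _ _ _ 1) => // x; rewrite ger0_norm; case/andP: (f1 x).
have mpow (h : 'rV[R]_n -> R) : measurable_fun [set: 'rV[R]_n] h -> measurable_fun setT (fun x => h x `^ p).
  by move=> mh; exact: measurableT_comp (@measurable_powR R p) mh.
have ipow (P : probability 'rV[R]_n R) (h : 'rV[R]_n -> R) : measurable_fun [set: 'rV[R]_n] h -> (forall x, 0 <= h x <= 2) ->
    P.-integrable setT (EFin \o (fun x => h x `^ p)).
  move=> mh h2; apply: (@bounded_integrable _ _ _ _ _ (2 `^ p)); first exact: mpow.
  by move=> x; have /andP[? ?] := h2 x; rewrite ger0_norm ?powR_ge0// ge0_ler_powR ?nnegrE// ltW.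
have f2 x : 0 <= f x <= 2 by have /andP[? ?] := f1 x; apply/andP; split; lra.
have dist1 (P : probability 'rV[R]_n R) k : \int[P]_x `|g k x - f x| <= l1dist (g k) f ->
    \int[P]_x `|G k x - f x| <= 2 * k.+1%:R^-1.
  move=> h; have ig := integrable_unit_valued_dist P (tame_unit_valued (tg k) (g1 k)) uf.
  have ik : P.-integrable setT (EFin \o (cst (k.+1%:R^-1 : R))) by exact: finite_measure_integrable_cst.
  apply: (@le_trans _ _ (\int[P]_x (`|g k x - f x| + k.+1%:R^-1))).
    apply: le_Rintegral => //; last first.
    + move=> x _; rewrite (_ : G k x - f x = (g k x - f x) + k.+1%:R^-1); last by rewrite /G addrAC.
      by rewrite (le_trans (ler_normD _ _))// lerD2l ger0_norm// ltW//; case/andP: (k1 k).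
    + exact: (integrableD measurableT ig ik).
    + by have := integrable_norm (integrableB measurableT (iG k P) (i_f P)).
  rewrite RintegralD// Rintegral_probability_cst.
  rewrite mulrDl mul1r lerD2r; exact: (le_trans h (gf k)).
have lm k : \int[mu]_x `|g k x - f x| <= l1dist (g k) f by rewrite lerDl Rintegral_ge0.
have ln k : \int[nu]_x `|g k x - f x| <= l1dist (g k) f by rewrite lerDr Rintegral_ge0.
have h0 : (fun k => 2 * k.+1%:R^-1 : R) @ \oo --> 0.
  by rewrite -(mulr0 2); apply: cvgM; [exact: cvg_cst|exact: cvg_harmonic].
have C1 : (fun k => \int[nu]_x G k x) @ \oo --> \int[nu]_x f x.
  apply/cvgrPdist_le => e e0; move: h0 => /cvgrPdist_le /(_ _ e0); apply: filterS => k.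
  rewrite sub0r normrN => /(le_trans (ler_norm _)); apply: le_trans.
  rewrite distrC; apply: (le_trans (ler_Rintegral_dist (iG k nu) (i_f nu))).
  exact: dist1.
have C2 : (fun k => \int[mu]_x (G k x `^ p)) @ \oo --> \int[mu]_x (f x `^ p).
  pose L := p * 2 `^ (p - 1).
  have L0 : 0 <= L by rewrite mulr_ge0 ?powR_ge0// ltW.
  have {}h0 : (fun k => L * (2 * k.+1%:R^-1) : R) @ \oo --> 0.
    by rewrite -(mulr0 L); apply: cvgM => //; exact: cvg_cst.
  apply/cvgrPdist_le => e e0; move: h0 => /cvgrPdist_le /(_ _ e0); apply: filterS => k.
  rewrite sub0r normrN => /(le_trans (ler_norm _)); apply: le_trans.
  have iGf := integrableB measurableT (ipow mu (G k) (mG k) (G0 k)) (ipow mu f mf f2).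
  have iGd : mu.-integrable setT (EFin \o (fun x => `|G k x - f x|)).
    by have := integrable_norm (integrableB measurableT (iG k mu) (i_f mu)).
  rewrite distrC.
  apply: (le_trans (ler_Rintegral_dist (ipow mu _ (mG k) (G0 k)) (ipow mu _ mf f2))).
  apply: (@le_trans _ _ (\int[mu]_x (L * `|G k x - f x|))).
    apply: le_Rintegral => //.
    + by have := integrable_norm iGf.
    + by have := integrableZl measurableT L iGd.
    + by move=> x _; apply: powR_lipschitz => //; exact: ltW.
  rewrite RintegralZl// ler_wpM2l//; exact: dist1.
have {}C1 : (fun k => (\int[nu]_x G k x) `^ p) @ \oo --> (\int[nu]_x f x) `^ p.
  apply: powR_cvg => // k; apply: Rintegral_ge0 => x _; by case/andP: (G0 k x).
have {}C2 : (fun k => c * \int[mu]_x (G k x `^ p)) @ \oo --> c * \int[mu]_x (f x `^ p).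
  by apply: cvgM => //; exact: cvg_cst.
by apply: (ler_cvg_to C1 C2); exact: nearW.
Qed.

(** Both sides are homogeneous of degree p, so a function truncated at k + 1 can be rescaled to
    [0, 1]; Fatou's lemma then removes the truncation. *)
Lemma tame_harnack_harnack p c : 1 < p -> 0 <= c -> tame_harnack p c -> harnack mu nu p c.
Proof.
move=> p1 c0 H f mf f0; have p0 : 0 < p by rewrite (lt_trans _ p1).
have mfp : measurable_fun setT (fun x => f x `^ p).
  exact: measurableT_comp (@measurable_powR R p) mf.
pose h k x := Num.min (f x) k.+1%:R.
have h0 k x : 0 <= h k x by rewrite le_min ler0n ltW.
have hk k x : h k x <= k.+1%:R by rewrite ge_min lexx orbT.
have mh k : measurable_fun setT (h k).
  exact: (@measurable_minr _ _ _ setT f (cst k.+1%:R)).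
have mhp k : measurable_fun setT (fun x => h k x `^ p).
  exact: measurableT_comp (@measurable_powR R p) (mh k).
have ih k : nu.-integrable setT (EFin \o h k).
  by apply: (@bounded_integrable _ _ _ _ _ k.+1%:R) => // x; rewrite ger0_norm.
have ihp k : mu.-integrable setT (EFin \o (fun x => h k x `^ p)).
  apply: (@bounded_integrable _ _ _ _ _ (k.+1%:R `^ p)) => // x.
  by rewrite ger0_norm ?powR_ge0// ge0_ler_powR ?nnegrE// ltW.
have Hh k : (\int[nu]_x h k x) `^ p <= c * \int[mu]_x (h k x `^ p).
  have k0 : 0 < k.+1%:R :> R by [].
  have u : unit_valued (fun x => k.+1%:R^-1 * h k x).
    split=> [|x]; first exact: measurable_funM.
    by rewrite mulr_ge0//= mulrC ler_pdivrMr// mul1r.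
  have := tame_harnack_bounded p1 c0 H u.
  have I0 : 0 <= \int[nu]_x h k x by apply: Rintegral_ge0.
  have ki : 0 <= k.+1%:R^-1 :> R by rewrite invr_ge0.
  rewrite (RintegralZl _ measurableT (ih k)) (powRM _ ki I0).
  have -> : \int[mu]_x ((k.+1%:R^-1 * h k x) `^ p) = k.+1%:R^-1 `^ p * \int[mu]_x (h k x `^ p).
    rewrite -(RintegralZl _ measurableT (ihp k)).
    by apply: eq_Rintegral => x _; rewrite powRM.
  by rewrite [c * _]mulrCA ler_pM2l// powR_gt0// invr_gt0.
have := leey (c%:E * \int[mu]_x (f x `^ p)%:E)%E.
rewrite le_eqVlt => /orP[/eqP ->|Ky]; first by rewrite leey.
have K0 : (0 <= c%:E * \int[mu]_x (f x `^ p)%:E)%E.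
  by rewrite mule_ge0// integral_ge0// => x _; rewrite lee_fin powR_ge0.
have Kfin : (c%:E * \int[mu]_x (f x `^ p)%:E)%E \is a fin_num by rewrite ge0_fin_numE.
set K := fine (c%:E * \int[mu]_x (f x `^ p)%:E)%E.
have KE : (c%:E * \int[mu]_x (f x `^ p)%:E)%E = K%:E by rewrite /K fineK.
have HK k : \int[nu]_x h k x <= K `^ p^-1.
  have hhK : (\int[nu]_x h k x) `^ p <= K.
    rewrite -lee_fin -KE; apply: (@le_trans _ _ (c * \int[mu]_x (h k x `^ p))%:E).
      by rewrite lee_fin.
    rewrite EFinM -(integral_Rintegral (ihp k)); apply: lee_wpmul2l; first by rewrite lee_fin.
    apply: ge0_le_integral => //.
    - by move=> x _; rewrite lee_fin powR_ge0.
    - exact/measurable_EFinP.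
    - exact/measurable_EFinP.
    - by move=> x _; rewrite lee_fin ge0_ler_powR ?nnegrE ?(ltW p0) ?(ltW (f0 x))// ge_min lexx.
  have I0 : 0 <= \int[nu]_x h k x by apply: Rintegral_ge0.
  rewrite -[leLHS]powRr1// -(@mulfV _ p) ?gt_eqF// powRrM.
  by rewrite ge0_ler_powR ?nnegrE ?invr_ge0 ?powR_ge0 ?(ltW p0)// fine_ge0.
have : (\int[nu]_x (f x)%:E <= (K `^ p^-1)%:E)%E.
  apply: (@fatou_le _ _ _ nu h f (cst (K `^ p^-1))) => //.
  - move=> x; apply: cvg_near_cst; apply: filterS (nbhs_infty_gtr (f x)) => k hn.
    by apply/min_idPl/ltW/(lt_le_trans hn); rewrite ler_nat.
  - by move=> k; rewrite integral_Rintegral// lee_fin.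
  - exact: cvg_cst.
rewrite KE => hI.
have I0 : (0 <= \int[nu]_x (f x)%:E)%E.
  by apply: integral_ge0 => x _; rewrite lee_fin ltW.
have := @gt0_ler_poweR R p (ltW p0) _ _ _ _ hI.
rewrite !in_itv/= !leey !andbT lee_fin powR_ge0 => /(_ I0 isT) /le_trans; apply.
by rewrite lee_fin -powRrM mulVf ?gt_eqF// powRr1// fine_ge0.
Qed.

End tame_density.

Lemma Rintegral_sum d (T : measurableType d) (R : realType) (P : probability T R)
    (I : Type) (s : seq I) (f : I -> T -> R) :
  (forall i, P.-integrable setT (EFin \o f i)) ->
  P.-integrable setT (EFin \o (fun x => \sum_(i <- s) f i x)) /\
  \int[P]_x (\sum_(i <- s) f i x) = \sum_(i <- s) \int[P]_x f i x.
Proof.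
move=> fi; elim: s => [|i s [IH1 IH2]].
  rewrite (_ : (fun x => _) = cst 0); last by apply/funext => x; rewrite big_nil.
  split; first exact: finite_measure_integrable_cst.
  by rewrite big_nil Rintegral_probability_cst.
rewrite (_ : (fun x => _) = (fun x => f i x + \sum_(j <- s) f j x)); last first.
  by apply/funext => x; rewrite big_cons.
split; first by apply: (integrableD measurableT (fi i) IH1).
by rewrite (RintegralD measurableT (fi i) IH1) IH2 big_cons.
Qed.

Lemma ler_norm_ln (R : realType) (e M a : R) : 0 < e -> e <= a -> a <= M ->
  `|ln a| <= `|ln M| + `|ln e|.
Proof.
move=> e0 ea aM; have a0 : 0 < a by rewrite (lt_le_trans e0).
have M0 : 0 < M by rewrite (lt_le_trans a0).
have : ln e <= ln a by rewrite ler_ln ?posrE.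
have : ln a <= ln M by rewrite ler_ln ?posrE.
have := ler_norm (ln M); have := ler_norm (- ln e); rewrite normrN.
have := normr_ge0 (ln M); have := normr_ge0 (ln e).
by move=> *; rewrite ler_norml; apply/andP; split; lra.
Qed.

Lemma is_derive_Rintegral d (T : measurableType d) (R : realType) (P : probability T R)
    (f df : R -> T -> R) (a u v M : R) : u < a < v ->
  (forall s, u < s < v -> P.-integrable setT (EFin \o f s)) ->
  (forall s y, u < s < v -> is_derive s 1 (f ^~ y) (df s y)) ->
  (forall s y, u < s < v -> `|df s y| <= M) ->
  is_derive a 1 (fun s => \int[P]_y f s y) (\int[P]_y df a y).
Proof.
move=> uav fi fD fM.
have Ia : `]u, v[%classic a by rewrite /= in_itv/=.
have If s : `]u, v[%classic s -> P.-integrable setT (EFin \o f s).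
  by rewrite /= in_itv/=; exact: fi.
have Id s y : `]u, v[%classic s -> setT y -> derivable (f ^~ y) s 1.
  by rewrite /= in_itv/= => h _; exact: (@ex_derive _ _ _ _ _ _ _ (fD s y h)).
have dE s y : u < s < v -> partial1of2 f s y = df s y.
  by move=> h; rewrite partial1of2E; exact: (@derive_val _ _ _ _ _ _ _ (fD s y h)).
have IM s y : `]u, v[%classic s -> setT y -> `|partial1of2 f s y| <= cst `|M| y.
  rewrite /= in_itv/= => h _; rewrite dE// (le_trans (fM _ _ h))// ler_norm //.
have iM : P.-integrable setT (EFin \o (cst `|M| : T -> R)).
  exact: finite_measure_integrable_cst.
have M0 (y : T) : 0 <= cst `|M| y :> R by [].
split; first exact: (derivable_under_integral measurableT Ia If Id M0 iM IM).
rewrite -derive1E (differentiation_under_integral measurableT Ia If Id M0 iM IM).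
by apply: eq_Rintegral => y _; exact: dE.
Qed.

(** * Local gradient-entropy bounds and shift Harnack inequalities *)

Section gradient_entropy.
Context {R : realType} {n : nat} {dO : measure_display}
  {Omega : measurableType dO} {P : probability Omega R}.
Variables (X : 'rV[R]_n -> R -> {RV P >-> 'rV[R]_n}) (beta : R).
Implicit Types (x v y : 'rV[R]_n) (t : R) (f g : 'rV[R]_n -> R).

Lemma continuous_measurable_rV f : continuous f -> measurable_fun setT f.
Proof.
move=> fc; apply: (measurability (@RGenOpens.G R)).
  exact: (@RGenOpens.measurableE R).
move=> _ [_ [a [b ->]] <-]; rewrite setTI measurable_rVE.
apply: sub_sigma_algebra; apply: open_comp; last exact: interval_open.
by move=> y _; exact: fc.
Qed.

Lemma measurable_euclid_norm (F : 'rV[R]_n -> 'rV[R]_n) :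
  (forall i, measurable_fun setT (fun y => F y 0 i)) ->
  measurable_fun setT (fun y => euclid_norm (F y)).
Proof.
move=> mF; rewrite (_ : (fun y => _) = (fun y => (\sum_(i < n) F y 0 i ^+ 2) `^ 2^-1)).
  apply: (measurableT_comp (@measurable_powR R _)).
  by apply: measurable_sum => i; exact: measurable_funX.
apply/funext => y; rewrite powR12_sqrt//; apply: sumr_ge0 => i _; exact: sqr_ge0.
Qed.

Lemma PsgE t f x : Psg X t f x = (\int[P]_w (f (X x t w))%:E)%E.
Proof. by rewrite /Psg unlock. Qed.

Lemma integrable_law t f x : measurable_fun setT f ->
  (P.-integrable setT (EFin \o (f \o X x t)) <-> (law X x t).-integrable setT (EFin \o f)).
Proof.
move=> mf; split=> h.
  apply/integrableP; split; first exact/measurable_EFinP.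
  move/integrableP : h => [_]; apply: le_lt_trans.
  rewrite (@ge0_integral_distribution _ _ _ _ _ _ _ (abse \o (EFin \o f)))//.
    by apply: measurableT_comp => //; exact/measurable_EFinP.
  by move=> y; exact: abse_ge0.
apply/integrableP; split; first by apply/measurable_EFinP; exact: measurableT_comp.
move/integrableP : h => [_]; apply: le_lt_trans.
rewrite (@ge0_integral_distribution _ _ _ _ _ _ _ (abse \o (EFin \o f)))//.
  by apply: measurableT_comp => //; exact/measurable_EFinP.
by move=> y; exact: abse_ge0.
Qed.

Lemma Psgr_law t f x : measurable_fun setT f -> (law X x t).-integrable setT (EFin \o f) ->
  Psgr X t f x = \int[law X x t]_y f y.
Proof.
move=> mf /(integrable_law t x mf) h; rewrite /Psgr PsgE /Rintegral.
rewrite (@integral_distribution _ _ _ _ _ _ _ (EFin \o f))//.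
exact/measurable_EFinP.
Qed.

Lemma Psg_bounded t f x M : measurable_fun setT f -> (forall y, 0 <= f y <= M) ->
  (Psg X t f x < +oo)%E.
Proof.
move=> mf fM; rewrite Psg_law//; last by move=> y; case/andP: (fM y).
rewrite integral_Rintegral ?ltry//; apply: (@bounded_integrable _ _ _ _ _ M) => // y.
by have /andP[? ?] := fM y; rewrite ger0_norm.
Qed.

Lemma Psgr_tame t f x : tame f -> Psgr X t f x = \int[law X x t]_y f y.
Proof.
move=> tf; have [M _ fM] := tame_bounded tf; have mf := tame_measurable tf.
by apply: Psgr_law => //; exact: (@bounded_integrable _ _ _ _ _ M).
Qed.

Lemma integrable_tame (Q : probability 'rV[R]_n R) f : tame f -> Q.-integrable setT (EFin \o f).
Proof.
move=> tf; have [M _ fM] := tame_bounded tf; have mf := tame_measurable tf.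
exact: (@bounded_integrable _ _ _ _ _ M).
Qed.

Definition entropy (Q : probability 'rV[R]_n R) f : R :=
  \int[Q]_y (f y * ln (f y)) - \int[Q]_y f y * ln (\int[Q]_y f y).

Definition grad_mean (Q : probability 'rV[R]_n R) f : 'rV[R]_n :=
  \row_i \int[Q]_y partial i f y.

Lemma LGE_constE t : 2 * beta / (1 - expR (- (2 * beta * t))) = 4 * shift_cost beta t.
Proof. by rewrite /shift_cost invfM; move: (_^-1) => k; field. Qed.

Lemma shift_cost_gt0 t : 0 < beta -> 0 < t -> 0 < shift_cost beta t.
Proof.
move=> b0 t0; rewrite divr_gt0// mulr_gt0// subr_gt0 expR_lt1 oppr_lt0.
by rewrite !mulr_gt0.
Qed.

(* Completing the square in [w / l]. *)
Lemma young_entropy (k a l w b H p : R) : 0 < k -> 0 < a -> 0 < l -> 0 < p ->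
  w ^+ 2 / l <= k * H -> - (k * b ^+ 2 / (4 * p)) <= (p * H / a - w * b) / (a * l).
Proof.
move=> k0 a0 l0 p0 h.
rewrite ler_pdivlMr ?mulr_gt0// -subr_ge0.
have -> : p * H / a - w * b - - (k * b ^+ 2 / (4 * p)) * (a * l) =
   p / (k * a) * (k * H - w ^+ 2 / l) + p / (k * a * l) * (w - k * b * a * l / (2 * p)) ^+ 2.
  by field; rewrite !gt_eqF.
by rewrite addr_ge0// mulr_ge0 ?sqr_ge0 ?subr_ge0// divr_ge0 ?mulr_ge0 ?ltW.
Qed.

(** A tame function bounded below has bounded gradient and bounded logarithm, which settles the
    finiteness conditions in [LGE]. *)
Lemma LGE_tame t f x (e : R) : LGE X beta -> 0 < t -> tame f -> 0 < e -> (forall y, e <= f y) ->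
  euclid_norm (grad_mean (law X x t) f) ^+ 2 / \int[law X x t]_y f y <=
  4 * shift_cost beta t * entropy (law X x t) f.
Proof.
move=> H t0 tf e0 fe; have f0 y : 0 < f y by rewrite (lt_le_trans e0).
have [M M0 fM] := tame_bounded tf; have mf := tame_measurable tf.
have mlf : measurable_fun setT (fun y => f y * ln (f y)).
  by apply: measurable_funM => //; exact: measurableT_comp (@measurable_ln R) mf.
have lnM y : `|ln (f y)| <= `|ln M| + `|ln e|.
  rewrite ler_norml; have fyM : f y <= M by rewrite (le_trans (ler_norm _)).
  have : ln e <= ln (f y) by rewrite ler_ln ?posrE.
  have : ln (f y) <= ln M by rewrite ler_ln ?posrE.
  have := ler_norm (ln M); have := ler_norm (- ln e); rewrite normrN.
  have := normr_ge0 (ln M); have := normr_ge0 (ln e).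
  by move=> *; apply/andP; split; lra.
have flM y : `|f y * ln (f y)| <= M * (`|ln M| + `|ln e|) by rewrite normrM ler_pM.
have := H t f t0 (tame_smooth tf) f0.
have /choice[K hK] : forall i : 'I_n, exists K : R, forall y, `|partial i f y| <= K.
  by move=> i; have [K _ hK] := tame_bounded (tame_partial i tf); exists K.
move=> /(_ _ _ _ x) h; have {h} := h _ _ _.
have -> : Psgv X t (grad f) x = grad_mean (law X x t) f.
  apply/rowP => i; rewrite !mxE.
  rewrite (_ : (fun y => grad f y 0 i) = partial i f); last by apply/funext => y; rewrite mxE.
  exact/Psgr_tame/tame_partial.
rewrite Psgr_tame// Psgr_law//; last exact: (@bounded_integrable _ _ _ _ _ (M * (`|ln M| + `|ln e|))).
rewrite LGE_constE.
apply.
- move=> y; apply: (@Psg_bounded _ _ _ (\sum_i K i)).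
    apply: measurable_euclid_norm => i.
    rewrite (_ : (fun y => grad f y 0 i) = partial i f); last by apply/funext => z; rewrite mxE.
    by apply: tame_measurable; exact: tame_partial.
  move=> z; rewrite euclid_norm_ge0/= (le_trans (euclid_norm_le_sum _))//.
  by apply: ler_sum => i _; rewrite mxE.
- by move=> y; apply: (@Psg_bounded _ _ _ M) => // z; rewrite (ltW (f0 z)) (le_trans (ler_norm _)).
- move=> y; apply: (@Psg_bounded _ _ _ (M * (`|ln M| + `|ln e|))).
    apply: measurable_funM => //; apply: measurableT_comp => //.
    exact: measurableT_comp (@measurable_ln R) mf.
  move=> z; rewrite mulr_ge0 ?(ltW (f0 z))//= ler_pM ?(ltW (f0 z))//.
  by rewrite (le_trans (ler_norm _)).
Qed.

Lemma ler_rescale_cost (p l0 l1 c w : R) : 1 < p -> l0 - c * w / (p - 1) <= l1 / p ->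
  p * l0 <= c * (p / (p - 1)) * w + l1.
Proof.
move=> p1; have p0 : 0 < p by rewrite (lt_trans _ p1).
move=> /(ler_wpM2l (ltW p0)); rewrite mulrBr [p * (l1 / p)]mulrC divfK ?gt_eqF// lerBlDl.
by have -> : c * (p / (p - 1)) * w = p * (c * w / (p - 1)) by move: (_^-1) => u; ring.
Qed.

Lemma is_derive_shift f w y i : (forall z, derivable f z (delta_mx 0 i)) ->
  is_derive y (delta_mx 0 i) (fun y => f (y + w)) (partial i f (y + w)).
Proof. by move=> fd; rewrite -partial_shift; split => //; exact: derivable_addr. Qed.

(* The derivative of [s |-> log (P_t f_s) / a s] with [a s = 1 + s (p - 1)] and
   [f_s = f (. + (1 - s) v) ^ (a s)] is bounded below by (LGE) for [f_s]. *)
Lemma LGE_tame_harnack p x v t : 0 < beta -> LGE X beta -> 1 < p -> 0 < t ->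
  tame_harnack (law X x t) (convolution (law X x t) (\d_v)) p
    (expR (shift_cost beta t * (p / (p - 1)) * euclid_norm v ^+ 2)).
Proof.
move=> b0 H p1 t0 f tf [e e0 fe].
have p0 : 0 < p by rewrite (lt_trans _ p1).
have p10 : 0 < p - 1 by rewrite subr_gt0.
set mu := law X x t; set nu := convolution _ _.
have f0 y : 0 < f y by rewrite (lt_le_trans e0).
have [M M0 fM] := tame_bounded tf.
have fltM y : f y <= M by rewrite (le_trans (ler_norm _)).
pose Lb := `|ln M| + `|ln e|.
have Lb0 : 0 <= Lb by rewrite addr_ge0.
have lnL y : `|ln (f y)| <= Lb by exact: ler_norm_ln.
(* At s = 0 the family is f(. + v) with exponent 1, at s = 1 it is f with exponent p. Hence [psi 0]
   and [psi 1] below are the logarithms of the two integrals in (SH_p), the second divided by p. *)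
pose a (s : R) := 1 + s * (p - 1).
pose z (s : R) y := y + (1 - s) *: v.
pose F (s : R) y := f (z s y) `^ (a s).
pose Df (s : R) y := \sum_i v 0 i * partial i f (z s y).
pose dF (s : R) y := F s y * ((p - 1) * ln (f (z s y)) - a s * (Df s y / f (z s y))).
have FE s y : F s y = expR (a s * ln (f (z s y))) by rewrite /F /powR gt_eqF.
have tF s : tame (F s) by apply: (@tame_powR _ _ _ e) => //; exact: tame_shift.
have F0 s y : 0 < F s y by rewrite powR_gt0.
have lnF s y : ln (F s y) = a s * ln (f (z s y)) by rewrite FE expRK.
have anL s y : `|a s * ln (f (z s y))| <= `|a s| * Lb by rewrite normrM ler_wpM2l.
have Fl (s : R) : exists2 el : R, 0 < el & forall y, el <= F s y.
  exists (expR (- (`|a s| * Lb))); first exact: expR_gt0.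
  by move=> y; rewrite FE ler_expR; have := anL s y; rewrite ler_norml => /andP[].
have Fu s y : F s y <= expR (`|a s| * Lb).
  by rewrite FE ler_expR; have := anL s y; rewrite ler_norml => /andP[].
have D (s : R) y : is_derive s 1 (F^~ y) (dF s y).
  have D1 : is_derive s 1 (fun s => f (z s y)) (- Df s y).
    have := is_derive_line_C1 (y + v) (- v) s (smooth_C1 (tame_smooth tf)).
    have zE (s' : R) : y + v + s' *: - v = z s' y.
      by rewrite /z scalerN scalerBl scale1r addrA.
    rewrite (_ : (fun s => f (y + v + s *: - v)) = (fun s => f (z s y))); last first.
      by apply/funext => s'; rewrite zE.
    rewrite (_ : \sum_i _ = - Df s y)// /Df -sumrN; apply: eq_bigr => i _.
    by rewrite mxE zE mulNr.
  have D2 := @is_derive1_comp R (@ln R) _ s _ _ (is_derive1_ln (f0 (z s y))) D1.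
  have D3 : is_derive s 1 a (p - 1).
    rewrite (_ : a = (fun s : R => s * (p - 1) + 1)); first exact: is_derive_affine.
    by apply/funext => s'; rewrite /a addrC.
  have D4 := @is_deriveM _ _ _ _ _ _ _ _ D3 D2.
  have D5 := @is_derive1_comp R expR _ s _ _ (is_derive_expR _) D4.
  have -> : F^~ y = expR \o (a * (@ln R \o (fun s => f (z s y)))).
    by apply/funext => s'; rewrite FE.
  rewrite /dF FE; apply: is_derive_eq D5 _.
  rewrite /= /GRing.scale/=; congr (_ * _).
  by rewrite mulrN; move: (f _)^-1 (Df _ _) (ln _) => u1 u2 u3; ring.
have /choice[K hK] : forall i : 'I_n, exists K : R, forall y, `|partial i f y| <= K.
  by move=> i; have [K _ hK] := tame_bounded (tame_partial i tf); exists K.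
have DfK s y : `|Df s y / f (z s y)| <= (\sum_i `|v 0 i| * K i) / e.
  rewrite normrM ler_pM//; last by rewrite ger0_norm ?invr_ge0 ?(ltW (f0 _))// lef_pV2 ?posrE.
  rewrite (le_trans (ler_norm_sum _ _ _))//; apply: ler_sum => i _.
  by rewrite normrM ler_wpM2l.
pose A := 1 + 2 * (p - 1).
(* The open interval ]-1, 2[ contains [0, 1], so that the integral can be differentiated at the end
   points too; the bound on [dF] is the domination. *)
have [L FL] : exists L : R, forall (s : R) y, -1 < s < 2 -> `|dF s y| <= L.
  exists (expR (A * Lb) * ((p - 1) * Lb + A * ((\sum_i `|v 0 i| * K i) / e))) => s y s12.
  have aA : `|a s| <= A.
    move/andP: s12 => [s1 s2]; rewrite /a /A ler_norml; apply/andP; split; first by nra.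
    by rewrite lerD2l ler_pM2r// ltW.
  rewrite /dF normrM ler_pM//.
    rewrite ger0_norm ?(ltW (F0 _ _))// (le_trans (Fu _ _))// ler_expR.
    exact: ler_wpM2r.
  rewrite (le_trans (ler_normB _ _))// lerD//; last by rewrite normrM ler_pM.
  by rewrite normrM gtr0_norm// ler_pM2l.
pose I s := \int[mu]_y F s y.
have I0 s : 0 < I s.
  have [el el0 h] := Fl s; rewrite (lt_le_trans el0)// -(Rintegral_probability_cst mu el).
  by apply: le_Rintegral => //; [exact: finite_measure_integrable_cst|exact: integrable_tame].
have dI (s : R) : -1 < s < 2 -> is_derive s 1 I (\int[mu]_y dF s y).
  by move=> h; apply: (@is_derive_Rintegral _ _ _ mu F dF s (-1) 2 L) => // s' _; exact: integrable_tame.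
have a0 s : 0 <= s -> 0 < a s by move=> s0; rewrite /a ltr_pwDl// mulr_ge0// ltW.
(* This is the numerator of the derivative of [psi]. Its logarithmic terms combine into the entropy
   of [F s], and its transport term is the scalar product of v with the mean gradient of [F s];
   (LGE), Cauchy-Schwarz and [young_entropy] bound the result. *)
have lower (s : R) : 0 <= s < 2 ->
    - (4 * shift_cost beta t * euclid_norm v ^+ 2 / (4 * (p - 1))) * (a s * a s) <=
    (\int[mu]_y dF s y) / I s * a s - ln (I s) * (p - 1).
  move=> /andP[s0 _]; have as0 := a0 _ s0.
  have [el el0 elF] := Fl s.
  have dFi i y : partial i (F s) y = a s * F s y * (partial i f (z s y) / f (z s y)).
    have fd w : derivable f w (delta_mx 0 i) by exact: smooth_derivable (tame_smooth tf).
    have := is_derive_compR (is_derive_shift ((1 - s) *: v) y fd) (is_derive1_powR (a s) (f0 _)).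
    move=> /(@derive_val _ _ _ _ _ _ _).
    rewrite /partial => ->; rewrite /F -/(z s y).
    have -> : f (z s y) `^ (a s - 1) = f (z s y) `^ a s / f (z s y).
      rewrite powRB ?powRr1 ?(ltW (f0 _))//.
      by rewrite (gt_eqF (f0 _)) implybT.
    by rewrite /partial; move: (f _)^-1 (powR _ _) ('D_ _ _ _) => u1 u2 u3; ring.
  have mFl : measurable_fun setT (fun y => F s y * ln (F s y)).
    have mF := tame_measurable (tF s).
    by apply: measurable_funM => //; exact: measurableT_comp (@measurable_ln R) mF.
  have iFl : mu.-integrable setT (EFin \o (fun y => F s y * ln (F s y))).
    apply: (@bounded_integrable _ _ _ _ _ (expR (`|a s| * Lb) * (`|a s| * Lb))) => // y.
    by rewrite lnF normrM ler_pM// gtr0_norm.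
  have iFp i : mu.-integrable setT (EFin \o (fun y => v 0 i * partial i (F s) y)).
    by apply: integrable_tame; apply: tame_mul; [exact: tame_cst|exact: tame_partial].
  have [iS ES] := Rintegral_sum (index_enum 'I_n) iFp.
  have EdF : \int[mu]_y dF s y =
      (p - 1) * (\int[mu]_y (F s y * ln (F s y))) / a s - dotp (grad_mean mu (F s)) v.
    rewrite mulrAC -(RintegralZl _ measurableT iFl).
    have -> : dotp (grad_mean mu (F s)) v = \int[mu]_y \sum_i v 0 i * partial i (F s) y.
      rewrite ES; apply: eq_bigr => i _; rewrite mxE mulrC RintegralZl//.
      by apply: integrable_tame; exact: tame_partial.
    rewrite -RintegralB//; last first.
      exact: (integrableZl measurableT ((p - 1) / a s) iFl).
    apply: eq_Rintegral => y _; rewrite /dF lnF mulrBr.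
    congr (_ - _); first by move: (ln _) => u; field; rewrite gt_eqF.
    rewrite /Df !mulr_suml !mulr_sumr; apply: eq_bigr => i _; rewrite dFi.
    by move: (f _)^-1 => u; ring.
  have := LGE_tame x H t0 (tF s) el0 elF; rewrite -/mu -/(I s) => hL.
  have c0 := shift_cost_gt0 b0 t0.
  have c40 : 0 < 4 * shift_cost beta t by rewrite mulr_gt0.
  have hL' := young_entropy (euclid_norm v) c40 as0 (I0 s) p10 hL.
  rewrite EdF.
  move: hL'; rewrite ler_pdivlMr ?mulr_gt0// => hL'.
  have cs := cauchy_schwarz (grad_mean mu (F s)) v.
  rewrite -(ler_pM2r (I0 s)).
  have -> : ((((p - 1) * \int[mu]_y (F s y * ln (F s y))) / a s -
     dotp (grad_mean mu (F s)) v) / I s * a s - ln (I s) * (p - 1)) * I s =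
     ((p - 1) * entropy mu (F s) / a s - dotp (grad_mean mu (F s)) v) * a s.
    rewrite /entropy -/(I s).
    move: (\int[mu]_y (F s y * ln (F s y))) (dotp _ _) (ln (I s)) => u1 u2 u3.
    by field; rewrite !gt_eqF.
  have E (u : R) : u * (a s * a s) * I s = u * (a s * I s) * a s.
    by rewrite -!mulrA [a s * I s]mulrC.
  rewrite E ler_pM2r// (le_trans hL')//.
  by rewrite lerD2l lerN2.
pose psi (s : R) := ln (I s) / a s.
pose psi' (s : R) := ((\int[mu]_y dF s y) / I s * a s - ln (I s) * (p - 1)) / (a s * a s).
have dpsi (s : R) : 0 <= s < 2 -> is_derive s 1 psi (psi' s).
  move=> /andP[s0 s2]; have s12 : -1 < s < 2 by rewrite s2 (lt_le_trans _ s0)// ltrN10.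
  have D2 := @is_derive1_comp R (@ln R) _ s _ _ (is_derive1_ln (I0 s)) (dI s s12).
  have D3 : is_derive s 1 a (p - 1).
    rewrite (_ : a = (fun s : R => s * (p - 1) + 1)); first exact: is_derive_affine.
    by apply/funext => s'; rewrite /a addrC.
  have as0 : a s != 0 by rewrite gt_eqF// a0.
  have D4 := @is_deriveM _ _ _ _ _ _ _ _ D2 (@is_deriveV R a s _ 1 as0 D3).
  apply: is_derive_eq D4 _.
  rewrite /psi' /= /GRing.scale/=.
  move: (\int[mu]_y _) (ln (I s)) (gt_eqF (I0 s)) => u1 u2 Is0.
  by field; rewrite Is0 as0.
have hpsi : psi 0 - shift_cost beta t * euclid_norm v ^+ 2 / (p - 1) <= psi 1.
  have [||c c01] := @MVT_segment R psi psi' 0 1 ler01 _ _.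
  - move=> s; rewrite in_itv/= => /andP[s0 s1]; apply: dpsi.
    by rewrite (ltW s0)/= (lt_trans s1)// ltr1n.
  - apply: derivable_within_continuous => s; rewrite in_itv/= => /andP[s0 s1].
    apply: (@ex_derive _ _ _ _ _ _ _ (dpsi s _)).
    by rewrite s0/= (le_lt_trans s1)// ltr1n.
  rewrite subr0 mulr1 => E; have -> : psi 1 = psi 0 + psi' c by rewrite -E addrC subrK.
  rewrite lerD2l.
  move: c01; rewrite in_itv/= => /andP[c0 c1].
  have ac0 := a0 _ c0.
  rewrite /psi' ler_pdivlMr ?mulr_gt0//; apply: le_trans (lower c _); last first.
    by rewrite c0/= (le_lt_trans c1)// ltr1n.
  rewrite ler_pM2r ?mulr_gt0//.
  rewrite le_eqVlt; apply/orP; left; apply/eqP.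
  move: (shift_cost _ _) (_ ^+ 2) => u1 u2; field.
  by rewrite gt_eqF.
have a0E : a 0 = 1 by rewrite /a mul0r addr0.
have a1E : a 1 = p by rewrite /a mul1r addrC subrK.
have I0E : I 0 = \int[nu]_y f y.
  have mf := tame_measurable tf.
  have fb : forall y : 'rV[R]_n, 0 <= f y by move=> y; exact: ltW.
  have tfv := tame_shift v tf.
  have := Psg_shift X x t v mf fb.
  rewrite (Psg_law _ _ _ (tame_measurable tfv))//.
  rewrite !integral_Rintegral//; [|exact: integrable_tame..].
  move=> [] <-; apply: eq_Rintegral => y _.
  by rewrite /F a0E powRr1// /z subr0 scale1r.
have I1E : I 1 = \int[mu]_y (f y `^ p).
  by apply: eq_Rintegral => y _; rewrite /F a1E /z subrr scale0r addr0.
have P0 : psi 0 = ln (I 0) by rewrite /psi a0E divr1.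
have P1 : psi 1 = ln (I 1) / p by rewrite /psi a1E.
rewrite -I0E -I1E /powR (gt_eqF (I0 0)) -[I 1](lnK (I0 1)) -expRD ler_expR.
by rewrite P0 P1 in hpsi; exact: ler_rescale_cost hpsi.
Qed.

Lemma LGE_SH p : 0 < beta -> LGE X beta -> 1 < p -> SH X beta p.
Proof.
move=> b0 H p1; apply/SHP => // x v t t0; apply: tame_harnack_harnack => //.
exact: LGE_tame_harnack.
Qed.

End gradient_entropy.

(** * Compactly supported cutoffs of class C^1 *)

Section cutoff.
Context {R : realType} {n : nat}.
Implicit Types (f g : 'rV[R]_n -> R) (x y v : 'rV[R]_n) (i : 'I_n).

Lemma continuous_bounded_box f c (r : R) : continuous f -> 0 <= r ->
  exists2 K : R, 0 <= K & forall z, in_box c r z -> `|f z| <= K.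
Proof.
move=> fc r0.
have cA : compact [set z : 'rV[R]_n | forall i, `[c 0 i - r, c 0 i + r]%classic (z ord0 i)].
  by apply: (@rV_compact _ _ (fun i => `[c 0 i - r, c 0 i + r]%classic)) => i; exact: segment_compact.
have inE z : in_box c r z <-> [set z : 'rV[R]_n | forall i, `[c 0 i - r, c 0 i + r]%classic (z ord0 i)] z.
  by split=> h i; have := h i; rewrite /= in_itv/= ler_distl.
have [||m _ hm] := @compact_EVT_max _ _ (fun z => `|f z|) _ _ cA _.
- by exists c; apply/inE => i; rewrite subrr normr0.
- apply: continuous_subspaceT => z; apply: continuous_comp; first exact: fc.
  exact: norm_continuous.
exists `|f m| => // z /inE zA; apply: hm.
exact: mem_set.
Qed.

Lemma rV_continuousD f g : continuous f -> continuous g -> continuous (fun y => f y + g y).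
Proof. by move=> fc gc y; exact: continuousD (fc y) (gc y). Qed.

Lemma rV_continuousM f g : continuous f -> continuous g -> continuous (fun y => f y * g y).
Proof. by move=> fc gc y; exact: continuousM (fc y) (gc y). Qed.

Lemma rV_continuous_cst (a : R) : continuous (fun _ : 'rV[R]_n => a).
Proof. by move=> y; exact: cst_continuous. Qed.

Lemma rV_continuousB f g : continuous f -> continuous g -> continuous (fun y => f y - g y).
Proof. by move=> fc gc y; exact: continuousB (fc y) (gc y). Qed.

Lemma rV_continuous_coord i : continuous (fun y : 'rV[R]_n => y 0 i).
Proof. by move=> y; exact: coord_continuous. Qed.

Lemma rV_continuous_max f g : continuous f -> continuous g -> continuous (fun y => Num.max (f y) (g y)).
Proof. by move=> fc gc y; exact: continuous_max (fc y) (gc y). Qed.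

Lemma rV_continuous_sum (I : Type) (s : seq I) (F : I -> 'rV[R]_n -> R) :
  (forall j, continuous (F j)) -> continuous (fun y => \sum_(j <- s) F j y).
Proof.
move=> Fc; elim: s => [|i s IH].
  rewrite (_ : (fun y => _) = fun=> 0); first exact: rV_continuous_cst.
  by apply/funext => y; rewrite big_nil.
rewrite (_ : (fun y => _) = fun y => F i y + \sum_(j <- s) F j y).
  exact: rV_continuousD.
by apply/funext => y; rewrite big_cons.
Qed.

Lemma C1_mul f g : C1 f -> C1 g -> continuous f -> continuous g ->
  C1 (fun y => f y * g y) /\
  forall i y, partial i (fun y => f y * g y) y = f y * partial i g y + g y * partial i f y.
Proof.
move=> f1 g1 fc gc.
have D i y : is_derive y (delta_mx 0 i) (fun y => f y * g y) (f y * partial i g y + g y * partial i f y).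
  exact: (@is_deriveM _ _ _ _ _ _ _ _ (derivableP ((f1 i).1 y)) (derivableP ((g1 i).1 y))).
have E i y : partial i (fun y => f y * g y) y = f y * partial i g y + g y * partial i f y.
  exact: (@derive_val _ _ _ _ _ _ _ (D i y)).
split=> // i; split; first by move=> y; exact: (@ex_derive _ _ _ _ _ _ _ (D i y)).
rewrite (_ : partial i _ = fun y => f y * partial i g y + g y * partial i f y); last first.
  by apply/funext => y; exact: E.
by apply: rV_continuousD; apply: rV_continuousM => //; [exact: (g1 i).2|exact: (f1 i).2].
Qed.

(** Squaring smooths the corner of the positive part: the first-order remainder is quadratic, also
    across 0. *)
Lemma sqr_max0_taylor (r h : R) :
  `|Num.max 0 (r + h) ^+ 2 - Num.max 0 r ^+ 2 - 2 * Num.max 0 r * h| <= h ^+ 2.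
Proof.
rewrite ler_norml /Num.max; case: ltP => h1; case: ltP => h2; apply/andP; split; nra.
Qed.

Lemma is_derive_sqr_max0 (r : R) :
  is_derive r 1 (fun r => Num.max 0 r ^+ 2) (2 * Num.max 0 r).
Proof.
apply: is_derive_cvg; apply/cvgrPdist_le => e e0; near=> h.
have h0 : h != 0 by near: h; exact: nbhs_dnbhs_neq.
have he : `|h| <= e.
  near: h; apply: nbhs_dnbhs; apply/nbhs_ballP; exists e => //.
  by move=> h /=; rewrite /ball/= sub0r normrN => /ltW.
have := sqr_max0_taylor r h.
rewrite [h *: 1]mulr1 [h + r]addrC.
have -> : 2 * Num.max 0 r - h^-1 *: (Num.max 0 (r + h) ^+ 2 - Num.max 0 r ^+ 2) =
  - (h^-1 * (Num.max 0 (r + h) ^+ 2 - Num.max 0 r ^+ 2 - 2 * Num.max 0 r * h)).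
  by rewrite /GRing.scale/=; move: (Num.max _ _) (Num.max _ _) => a b; field.
move=> hh; rewrite normrN normrM normfV ler_pdivrMl ?normr_gt0// (le_trans hh)//.
by rewrite -real_normK ?num_real// expr2 ler_wpM2l.
Unshelve. all: by end_near. Qed.

Definition cutoff_arg (N : R) y : R := 1 - dotp y y / N.
(** Squared so as to be C^1, which suffices because Harnack inequalities are differentiated only
    once. As N grows it tends to 1, and its gradient is bounded uniformly in N >= 1. *)
Definition cutoff (N : R) y : R := Num.max 0 (cutoff_arg N y) ^+ 2.

Lemma continuous_cutoff_arg (N : R) : continuous (cutoff_arg N).
Proof.
apply: rV_continuousB; first exact: rV_continuous_cst.
apply: rV_continuousM; last exact: rV_continuous_cst.
by apply: rV_continuous_sum => i; apply: rV_continuousM; exact: rV_continuous_coord.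
Qed.

Lemma cutoff_C1 (N : R) : 0 < N ->
  C1 (cutoff N) /\
  forall i y, partial i (cutoff N) y = 2 * Num.max 0 (cutoff_arg N y) * (- 2 * y 0 i / N).
Proof.
move=> N0.
have Da i y : is_derive y (delta_mx 0 i) (cutoff_arg N) (- 2 * y 0 i / N).
  apply: is_derive_of_line.
  rewrite (_ : (fun s : R => _) =
      (fun s : R => s * (s * (- N^-1) + (- 2 * y 0 i / N)) + cutoff_arg N y)).
    have D1 := @is_deriveM _ _ _ _ _ _ _ _ (is_derive_id (0 : R) 1)
      (is_derive_affine (- N^-1) (- 2 * y 0 i / N) 0).
    have D2 := @is_deriveD _ _ _ _ _ _ _ _ _ D1 (is_derive_cst (cutoff_arg N y) (0 : R) (1 : R)).
    apply: is_derive_eq D2 _.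
    by rewrite /GRing.scale/= !mul0r !add0r mulr1 addr0.
  apply/funext => s; rewrite /cutoff_arg.
  have -> : dotp (y + s *: delta_mx 0 i) (y + s *: delta_mx 0 i) = dotp y y + 2 * s * y 0 i + s ^+ 2.
    rewrite !dotpDl [dotp y (_ + _)]dotpC [dotp (_ *: _) (_ + _)]dotpC !dotpDl.
    rewrite [dotp y (_ *: _)]dotpC !dotpZl [dotp _ (_ *: _)]dotpC !dotpZl.
    have eD (w : 'rV[R]_n) : dotp (delta_mx 0 i) w = w 0 i.
      rewrite /dotp (bigD1 i)//= big1 ?mxE ?eqxx ?mul1r ?addr0// => j ji.
      by rewrite mxE (negPf ji) mul0r.
    by rewrite !eD mxE !eqxx /=; ring.
  by move: (dotp _ _) (y 0 i) (N^-1) => a b c; ring.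
have D i y : is_derive y (delta_mx 0 i) (cutoff N) (2 * Num.max 0 (cutoff_arg N y) * (- 2 * y 0 i / N)).
  exact: is_derive_compR (Da i y) (is_derive_sqr_max0 _).
have E i y : partial i (cutoff N) y = 2 * Num.max 0 (cutoff_arg N y) * (- 2 * y 0 i / N).
  exact: (@derive_val _ _ _ _ _ _ _ (D i y)).
split=> // i; split; first by move=> y; exact: (@ex_derive _ _ _ _ _ _ _ (D i y)).
rewrite (_ : partial i _ = fun y => 2 * Num.max 0 (cutoff_arg N y) * (- 2 * y 0 i / N)); last first.
  by apply/funext => y; exact: E.
apply: rV_continuousM; last first.
  apply: rV_continuousM; last exact: rV_continuous_cst.
  by apply: rV_continuousM; [exact: rV_continuous_cst|exact: rV_continuous_coord].
apply: rV_continuousM; first exact: rV_continuous_cst.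
by apply: rV_continuous_max; [exact: rV_continuous_cst|exact: continuous_cutoff_arg].
Qed.

(** The condition N >= 1 acts through N <= N^2: one coordinate beyond N already forces |y|^2 > N. *)
Lemma cutoff_eq0 (N : R) y : 1 <= N -> ~ in_box 0 N y -> cutoff N y = 0 /\ Num.max 0 (cutoff_arg N y) = 0.
Proof.
move=> N1 yN; have N0 : 0 < N by rewrite (lt_le_trans ltr01).
have [i yi] : exists i, N < `|y 0 i|.
  apply: contrapT => h; apply: yN => i; rewrite mxE subr0 leNgt; apply/negP => yi; apply: h.
  by exists i.
have : cutoff_arg N y <= 0.
  rewrite subr_le0 ler_pdivlMr// mul1r -sqr_euclid_norm.
  rewrite (@le_trans _ _ (N ^+ 2)) ?ler_eXnr//.
  by rewrite lerXn2r ?nnegrE ?euclid_norm_ge0 ?(ltW N0)// (le_trans (ltW yi))// coord_le_euclid_norm.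
by move=> h; rewrite /cutoff max_l// expr0n.
Qed.

Lemma cutoff01 (N : R) y : 0 < N -> 0 <= cutoff N y <= 1.
Proof.
move=> N0; rewrite sqr_ge0/= exprn_ile1// ?le_max ?lexx// ge_max ler01/= /cutoff_arg.
by rewrite gerDl oppr_le0 divr_ge0 ?(ltW N0)// -sqr_euclid_norm sqr_ge0.
Qed.

End cutoff.

Lemma ln_le_subr1 (R : realType) (x : R) : 0 < x -> ln x <= x - 1.
Proof. by move=> x0; have := ge_subr_ln_div (@ler01 R) x0; rewrite ln1 mul1r; lra. Qed.

Lemma mulln_ge (R : realType) (x : R) : 0 <= x -> x - 1 <= x * ln x.
Proof. by move=> x0; have := ge_subr_ln_div x0 (@ltr01 R); rewrite ln1 subr0. Qed.

Lemma ler_norm_mulln (R : realType) (M x : R) : 0 <= x <= M -> `|x * ln x| <= 1 + M ^+ 2.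
Proof.
move=> /andP[x0 xM]; have h1 := mulln_ge x0.
have h2 : x * ln x <= M ^+ 2.
  move: x0; rewrite le_eqVlt => /orP[/eqP <-|x0]; first by rewrite mul0r sqr_ge0.
  rewrite (@le_trans _ _ (x * (x - 1)))// ?ler_pM2l// ?ln_le_subr1//; nra.
have := sqr_ge0 M; rewrite ler_norml; move: (x * ln x) (M ^+ 2) h1 h2 => u w *.
by apply/andP; split; lra.
Qed.

(** The inequality z log z >= z - 1 at z = x^e. The right-hand side tends to x log x as e tends to
    0, so it controls the growth of the p-th moment at p = 1. *)
Lemma powR_sub_le (R : realType) (x e : R) : 0 <= x -> 0 < e ->
  (x `^ (1 + e) - x) / e <= x `^ e * (x * ln x).
Proof.
rewrite le_eqVlt => /orP[/eqP <- e0|x0 e0].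
  by rewrite powR0 ?gt_eqF ?addr_gt0// subrr !mul0r mulr0.
rewrite ler_pdivrMr//.
have E : x `^ (1 + e) = x `^ e * x by rewrite addrC powRD ?powRr1 ?(ltW x0)// (gt_eqF x0) implybT.
rewrite E; have p0 : 0 < x `^ e by rewrite powR_gt0.
have := ge_subr_ln_div (ltW p0) (@ltr01 R); rewrite ln1 subr0 ln_powR => h.
rewrite -subr_ge0.
have -> : x `^ e * (x * ln x) * e - (x `^ e * x - x) = x * (x `^ e * (e * ln x) - (x `^ e - 1)) by ring.
by rewrite mulr_ge0 ?(ltW x0)// subr_ge0.
Qed.

(** Here [A], [Ae] and [B] are the integrals of g, g(. + e v) and g^(1+e), with logarithms [lA],
    [la] and [lB], and [E] is |v|^2; the cost of (SH_(1+e)) for the shift e v is c (1 + e) |v|^2 e.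
    Subtracting log A and dividing by e leaves a first-order inequality. *)
Lemma harnack_gradient_arith (R : realType) (Ae A B lA lB la e cE H c E : R) :
  0 < A -> 0 < e -> (Ae - A) / Ae <= la - lA -> lB - lA <= B / A - 1 ->
  (1 + e) * la <= c * (1 + e) * E * e + lB -> (B - A) / e <= H ->
  (Ae - A) / e / Ae + la <= c * (1 + e) * E + H / A.
Proof.
move=> A0 e0 h1 h2 h3; rewrite ler_pdivrMr// => h4.
rewrite -(ler_pM2r e0) mulrDl mulrAC divfK ?gt_eqF//.
have h5 : B / A - 1 <= H * e / A.
  by rewrite ler_pdivlMr// mulrBl divfK ?gt_eqF// mul1r.
rewrite [leRHS]mulrDl [H / A * e]mulrAC.
move: h1 h2 h3 h5; move: (_ / _) (B / A) (_ / A) (c * _ * _ * _) => u1 u2 u3 u4.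
rewrite mulrDl mul1r mulrC; move: (la * e) => u5 *; lra.
Qed.

Lemma cvg_sum_seq (R : realType) (I : Type) (s : seq I) (u : I -> nat -> R) (l : I -> R) :
  (forall i, u i @ \oo --> l i) -> (fun k => \sum_(i <- s) u i k) @ \oo --> \sum_(i <- s) l i.
Proof.
move=> ul; elim: s => [|i s IH].
  rewrite big_nil (_ : (fun k => _) = fun=> 0); first exact: cvg_cst.
  by apply/funext => k; rewrite big_nil.
rewrite big_cons (_ : (fun k => _) = fun k => u i k + \sum_(j <- s) u j k).
  by apply: cvgD => //; exact: ul.
by apply/funext => k; rewrite big_cons.
Qed.

(** * From shift Harnack inequalities to the gradient-entropy bound *)

Section harnack_gradient.
Context {R : realType} {n : nat}.
Variables (mu : probability 'rV[R]_n R) (c : R).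
Implicit Types (f g : 'rV[R]_n -> R) (v : 'rV[R]_n).

Lemma Rintegral_conv_dirac v g M : measurable_fun setT g -> (forall y, 0 <= g y <= M) ->
  \int[convolution mu (\d_v)]_y g y = \int[mu]_y g (y + v).
Proof.
move=> mg gM; rewrite /Rintegral; congr fine.
have g0 y : 0 <= g y by case/andP: (gM y).
rewrite (eq_measure_integral (pushforward mu (fun y => y + v))).
  exact: measurable_rV_addr.
  move=> mv.
  rewrite (@ge0_integral_pushforward _ _ _ _ _ _ mv _ setT (EFin \o g))//.
  - exact/measurable_EFinP.
  - by move=> y _; rewrite lee_fin.
by move=> ? A mA _; exact: (@convolution_dirac _ _ mu v A mA).
Qed.

Hypothesis mu_harnack : forall p v, 1 < p ->
  harnack mu (convolution mu (\d_v)) p (expR (c * (p / (p - 1)) * euclid_norm v ^+ 2)).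

(** The Harnack inequality is expanded at p = 1 + e for the shift e v: the cost is then of order e,
    like the variation of both integrals. The limit e -> 0 bounds the mean derivative along v by
    |v|^2 and the entropy. *)
Lemma harnack_gradient_le g v M (K : 'I_n -> R) : 0 <= c -> C1 g -> continuous g ->
  (forall y, 0 <= g y <= M) -> (forall i y, `|partial i g y| <= K i) -> 0 < \int[mu]_y g y ->
  \int[mu]_y (\sum_i v 0 i * partial i g y) <=
  c * euclid_norm v ^+ 2 * \int[mu]_y g y +
  (\int[mu]_y (g y * ln (g y)) - \int[mu]_y g y * ln (\int[mu]_y g y)).
Proof.
move=> c0 g1 gc gM gK; set A := \int[mu]_y g y => A0.
have mg := continuous_measurable_rV gc.
have M0 : 0 <= M by have /andP[h1 h2] := gM 0; exact: le_trans h2.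
pose L := \sum_i `|v 0 i| * K i.
pose ep (k : nat) : R := k.+1%:R^-1.
have ep0 k : 0 < ep k by rewrite invr_gt0.
have ep1 k : ep k <= 1 by rewrite invf_le1// ler1n.
have epc : ep @ \oo --> 0 by exact: cvg_harmonic.
pose gs (s : R) y := g (y + s *: v).
have D y (s : R) : is_derive s 1 (fun s => gs s y) (\sum_i v 0 i * partial i g (y + s *: v)).
  exact: is_derive_line_C1.
have lip y (s : R) : 0 <= s -> `|gs s y - g y| <= L * s.
  move=> s0; have [|z _] := @MVT_segment R (fun s => gs s y) _ 0 s s0 (fun r _ => D y r).
    by apply: derivable_within_continuous => r _; exact: (@ex_derive _ _ _ _ _ _ _ (D y r)).
  rewrite {2}/gs scale0r addr0 subr0 => ->; rewrite normrM (ger0_norm s0) ler_wpM2r//.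
  rewrite (le_trans (ler_norm_sum _ _ _))//; apply: ler_sum => i _.
  by rewrite normrM ler_wpM2l.
have mgs s : measurable_fun setT (gs s).
  exact: measurableT_comp mg (measurable_rV_addr _).
have igs s : mu.-integrable setT (EFin \o gs s).
  by apply: (@bounded_integrable _ _ _ _ _ M) => // y; rewrite ger0_norm; case/andP: (gM (y + s *: v)).
have ig : mu.-integrable setT (EFin \o g).
  by apply: (@bounded_integrable _ _ _ _ _ M) => // y; rewrite ger0_norm; case/andP: (gM y).
pose Ae k := \int[mu]_y gs (ep k) y.
pose q k y := (gs (ep k) y - g y) / ep k.
have mq k : measurable_fun setT (q k).
  by apply: measurable_funM => //; exact: measurable_funB.
have qL k y : `|q k y| <= L.
  by rewrite /q normrM normfV (gtr0_norm (ep0 k)) ler_pdivrMr// lip// ltW.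
pose Dg y := \sum_i v 0 i * partial i g y.
have mD : measurable_fun setT Dg.
  apply: continuous_measurable_rV; apply: rV_continuous_sum => i.
  by apply: rV_continuousM; [exact: rV_continuous_cst|exact: (g1 i).2].
have qD y : q ^~ y @ \oo --> Dg y.
  have /= [] := is_derive_C1 y v g1.
  rewrite -/(Dg y) /derivable /derive => Dd Dv.
  have : (fun h : R => h^-1 *: (g (h *: v + y) - g y)) @ 0^' --> Dg y by rewrite -Dv.
  move=> /cvgr_dnbhsP /(_ ep) H.
  rewrite (_ : q^~ y = (fun k => (ep k)^-1 *: (g (ep k *: v + y) - g y))).
    by apply: H; split => // k; rewrite gt_eqF.
  by apply/funext => k; rewrite /q /gs [_ *: _ + y]addrC mulrC.
have Eq k : \int[mu]_y q k y = (Ae k - A) / ep k.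
  rewrite /q; under eq_Rintegral do rewrite mulrC.
  rewrite RintegralZl//; last exact: (integrableB measurableT (igs _) ig).
  by rewrite RintegralB// mulrC.
have iL : mu.-integrable setT (EFin \o (cst L)) by exact: finite_measure_integrable_cst.
have qI : (fun k => (Ae k - A) / ep k) @ \oo --> \int[mu]_y Dg y.
  rewrite (_ : (fun k => _) = (fun k => \int[mu]_y q k y)); last first.
    by apply/funext => k; rewrite Eq.
  by apply: (@Rintegral_dominated_cvg _ _ _ mu q Dg (cst L)) => //; apply: aeW.
have AeA : Ae @ \oo --> A.
  have : (fun k => (Ae k - A) / ep k * ep k + A) @ \oo --> \int[mu]_y Dg y * 0 + A.
    by apply: cvgD; [apply: cvgM|exact: cvg_cst].
  rewrite mulr0 add0r (_ : (fun k => _) = Ae)//.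
  by apply/funext => k /=; rewrite divfK ?subrK// gt_eqF.
pose h k y := g y `^ ep k * (g y * ln (g y)).
have mgl : measurable_fun setT (fun y => g y * ln (g y)).
  by apply: measurable_funM => //; exact: measurableT_comp (@measurable_ln R) mg.
have mh k : measurable_fun setT (h k).
  by apply: measurable_funM => //; exact: measurableT_comp (@measurable_powR R _) mg.
pose H0 := (1 + M) * (1 + M ^+ 2).
have hH k y : `|h k y| <= H0.
  have /andP[g0 gM'] := gM y.
  rewrite normrM ler_pM ?ler_norm_mulln ?gM//.
  rewrite ger0_norm ?powR_ge0// (@le_trans _ _ ((1 + M) `^ ep k))//.
    by rewrite ge0_ler_powR ?nnegrE ?(ltW (ep0 k)) ?addr_ge0// (le_trans gM')// lerDr.
  by rewrite -[leRHS]powRr1 ?addr_ge0// ler_powR// lerDl.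
have iH0 : mu.-integrable setT (EFin \o (cst H0)) by exact: finite_measure_integrable_cst.
have hcv y : h ^~ y @ \oo --> g y * ln (g y).
  have /andP[] := gM y; rewrite le_eqVlt => /orP[/eqP g0 _|g0 _].
    rewrite -g0 mul0r (_ : h^~ y = fun=> 0); first exact: cvg_cst.
    by apply/funext => k; rewrite /h -g0 mul0r mulr0.
  rewrite -[X in _ --> X]mul1r; apply: cvgM; last exact: cvg_cst.
  rewrite (_ : (fun k => _) = (fun k => expR (ep k * ln (g y)))); last first.
    by apply/funext => k; rewrite /powR gt_eqF.
  rewrite -expR0 -(mul0r (ln (g y))).
  have : ep k * ln (g y) @[k --> \oo] --> 0 * ln (g y) by apply: cvgM => //; exact: cvg_cst.
  by move=> hc; exact: (cvg_comp _ _ hc (@continuous_expR R _)).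
have hI : (fun k => \int[mu]_y h k y) @ \oo --> \int[mu]_y (g y * ln (g y)).
  by apply: (@Rintegral_dominated_cvg _ _ _ mu h _ (cst H0)) => //; apply: aeW.
have key k : 0 < Ae k ->
    (Ae k - A) / ep k / Ae k + ln (Ae k) <= c * (1 + ep k) * euclid_norm v ^+ 2 + (\int[mu]_y h k y) / A.
  move=> Ak0; have p1 : 1 < 1 + ep k by rewrite ltrDl.
  have := harnack_bounded p1 (expR_ge0 _) (mu_harnack (ep k *: v) p1) mg
     (fun y => proj1 (andP (gM y))) (fun y => proj2 (andP (gM y))).
  rewrite (Rintegral_conv_dirac _ mg gM) -/(Ae k); set B := \int[mu]_y (g y `^ (1 + ep k)).
  move=> hB; have B0 : 0 < B.
    have := powR_gt0 (1 + ep k) Ak0; move=> /lt_le_trans /(_ hB).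
    by rewrite pmulr_rgt0// expR_gt0.
  have hBA : (B - A) / ep k <= \int[mu]_y h k y.
    have mgp : measurable_fun setT (fun y => g y `^ (1 + ep k)).
      exact: measurableT_comp (@measurable_powR R _) mg.
    have igp : mu.-integrable setT (EFin \o (fun y => g y `^ (1 + ep k))).
      apply: (@bounded_integrable _ _ _ _ _ (M `^ (1 + ep k))) => // y.
      have /andP[g0 gM'] := gM y.
      by rewrite ger0_norm ?powR_ge0// ge0_ler_powR ?nnegrE// addr_ge0// ltW.
    have iB := integrableB measurableT igp ig.
    rewrite mulrC -RintegralB// -RintegralZl//.
    apply: le_Rintegral => //.
    - exact: (integrableZl measurableT _ iB).
    - exact: (@bounded_integrable _ _ _ _ _ H0).
    - by move=> y _; rewrite mulrC powR_sub_le//; case/andP: (gM y).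
  apply: (@harnack_gradient_arith _ _ _ B (ln A) (ln B)) => //.
  - by have := ge_subr_ln_div (ltW Ak0) A0; rewrite mulrC ler_pdivrMr// mulrC.
  - have := ln_le_subr1 (divr_gt0 B0 A0).
    by rewrite ln_div ?posrE// mulrBl divff ?gt_eqF.
  - have := hB; rewrite -[_ <= _](@ler_ln R) ?posrE ?powR_gt0 ?mulr_gt0 ?expR_gt0//.
    rewrite ln_powR lnM ?posrE ?expR_gt0// expRK euclid_normZ gtr0_norm//.
    move=> {}hB; rewrite (le_trans hB)// lerD2r le_eqVlt; apply/orP; left; apply/eqP.
    rewrite [1 + _ - 1]addrC addKr; move: (euclid_norm v) => w; field.
    by rewrite gt_eqF.
have lim1 : (fun k => (Ae k - A) / ep k / Ae k + ln (Ae k)) @ \oo --> \int[mu]_y Dg y / A + ln A.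
  apply: cvgD; last exact: (cvg_comp _ _ AeA (continuous_ln A0)).
  apply: cvgM => //; apply: cvgV => //; exact: lt0r_neq0.
have lim2 : (fun k => c * (1 + ep k) * euclid_norm v ^+ 2 + (\int[mu]_y h k y) / A) @ \oo -->
    c * (1 + 0) * euclid_norm v ^+ 2 + (\int[mu]_y (g y * ln (g y))) / A.
  apply: cvgD; last by apply: cvgM => //; exact: cvg_cst.
  apply: cvgM; last exact: cvg_cst.
  by apply: cvgM; [exact: cvg_cst|apply: cvgD => //; exact: cvg_cst].
have : \int[mu]_y Dg y / A + ln A <=
    c * (1 + 0) * euclid_norm v ^+ 2 + (\int[mu]_y (g y * ln (g y))) / A.
  apply: (ler_cvg_to lim1 lim2).
  near=> k; apply: key.
  have : `|A - Ae k| < A by near: k; move/cvgrPdist_lt : AeA; apply.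
  by rewrite ltr_distlC; case/andP; rewrite subrr.
rewrite addr0 mulr1 -/A => hh; rewrite -/(Dg _).
have E (a b l s : R) : a / A + l <= s + b / A -> a <= s * A + (b - A * l).
  rewrite -lerBrDr ler_pdivrMr// => /le_trans; apply.
  by rewrite mulrBl mulrDl divfK ?gt_eqF// addrA [l * A]mulrC.
exact: E hh.
Unshelve. all: by end_near. Qed.

(** A positive function with zero integral would vanish almost everywhere, which a probability
    measure excludes. *)
Lemma Rintegral_gt0 f : measurable_fun setT f -> mu.-integrable setT (EFin \o f) ->
  (forall y, 0 < f y) -> 0 < \int[mu]_y f y.
Proof.
move=> mf ih f0; rewrite lt_neqAle Rintegral_ge0 ?andbT; last by move=> y _; exact: ltW.
apply/negP => /eqP h.
have : (\int[mu]_y `|(EFin \o f) y| = 0)%E.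
  under eq_integral do rewrite /= gtr0_norm//.
  by rewrite integral_Rintegral// -h.
have mEf : measurable_fun setT (EFin \o f) by exact/measurable_EFinP.
move=> /(ae_eq_integral_abs mu measurableT mEf) [A [mA A0 sA]].
have AT : A = setT.
  by apply/seteqP; split => // y _; apply: sA => /= /(_ I) [] /eqP; rewrite gt_eqF.
move: A0; rewrite AT [LHS]probability_setT => /eqP.
by rewrite eqe oner_eq0.
Qed.

(** Cutoffs of f are admissible in [harnack_gradient_le], and the three integrability assumptions
    dominate the limit. The resulting bound G.v <= c |v|^2 A + entropy holds for every v and is then
    optimized in v. *)
Lemma harnack_gradient_entropy f : 0 < c -> smooth f -> (forall y, 0 < f y) ->
  mu.-integrable setT (EFin \o (fun y => euclid_norm (grad f y))) ->
  mu.-integrable setT (EFin \o f) ->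
  mu.-integrable setT (EFin \o (fun y => f y * `|ln (f y)|)) ->
  euclid_norm (grad_mean mu f) ^+ 2 / \int[mu]_y f y <= 4 * c * entropy mu f.
Proof.
move=> c0 sf f0 inf i_f ifl.
have fc := smooth_continuous sf; have f1 := smooth_C1 sf.
have mf := continuous_measurable_rV fc.
pose N (k : nat) : R := k.+1%:R.
have N0 k : 0 < N k by rewrite ltr0n.
have N1 k : 1 <= N k by rewrite ler1n.
pose m k (y : 'rV[R]_n) : R := Num.max 0 (cutoff_arg (N k) y).
pose chi k := cutoff (N k) : 'rV[R]_n -> R.
have chiE k y : chi k y = m k y ^+ 2 by [].
have chi01 k y : 0 <= chi k y <= 1 by exact: cutoff01.
have m01 k y : 0 <= m k y <= 1.
  rewrite le_max lexx/= ge_max ler01/= /cutoff_arg.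
  by rewrite gerDl oppr_le0 divr_ge0 ?(ltW (N0 k))// -sqr_euclid_norm sqr_ge0.
have mc y : (fun k => m k y) @ \oo --> (1 : R).
  have h : (fun k => 1 - dotp y y * (N k)^-1) @ \oo --> 1 - dotp y y * 0.
    apply: cvgB; first exact: cvg_cst.
    by apply: cvgM; [exact: cvg_cst|exact: cvg_harmonic].
  rewrite mulr0 subr0 in h.
  apply: (@squeeze_cvgr _ _ _ _ (fun k => 1 - dotp y y / N k) (fun=> 1) (fun k => m k y) _ _ h (cvg_cst _)).
  apply: nearW => k.
  by rewrite /m le_max lexx orbT/=; case/andP: (m01 k y).
have chic y : (fun k => chi k y) @ \oo --> (1 : R).
  rewrite -[X in _ --> X](mulr1 1) (_ : chi^~ y = (fun k => m k y * m k y)).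
    exact: cvgM.
  by apply/funext => k; rewrite chiE expr2.
have chi1 k := @cutoff_C1 R n _ (N0 k).
have cchi k : continuous (chi k).
  rewrite (_ : chi k = fun y => m k y * m k y); last by apply/funext => y; rewrite chiE expr2.
  by apply: rV_continuousM; apply: rV_continuous_max;
    [exact: rV_continuous_cst|exact: continuous_cutoff_arg|exact: rV_continuous_cst|exact: continuous_cutoff_arg].
pose g k y := f y * chi k y.
have gc k : continuous (g k) by exact: rV_continuousM.
have g1 k := C1_mul f1 (chi1 k).1 fc (cchi k).
have dgE k i y : partial i (g k) y =
    f y * (2 * m k y * (- 2 * y 0 i / N k)) + chi k y * partial i f y.
  by rewrite (g1 k).2 (chi1 k).2.
have mK k : measurable_fun setT (g k) by exact: continuous_measurable_rV.
have g0 k y : 0 <= g k y by rewrite mulr_ge0 ?(ltW (f0 y))//; case/andP: (chi01 k y).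
have gf k y : g k y <= f y by rewrite ger_pMr//; case/andP: (chi01 k y).
have out k y : ~ in_box 0 (N k) y -> chi k y = 0 /\ m k y = 0 by exact: cutoff_eq0.
have /choice[M hM] : forall k, exists M : R, forall y, g k y <= M.
  move=> k; have [M M0 h] := continuous_bounded_box 0 (gc k) (ltW (N0 k)).
  exists M => y; have [yb|yb] := pselect (in_box 0 (N k) y).
    by rewrite (le_trans (ler_norm _)) ?h.
  by rewrite /g (out _ _ yb).1 mulr0.
have hK k : exists K : 'I_n -> R, forall i y, `|partial i (g k) y| <= K i.
  have /choice[K hK] : forall i, exists K : R, forall y, `|partial i (g k) y| <= K; last by exists K.
  move=> i.
  have [K K0 h] := continuous_bounded_box 0 ((g1 k).1 i).2 (ltW (N0 k)).
  exists K => y; have [yb|yb] := pselect (in_box 0 (N k) y); first exact: h.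
  by rewrite dgE (out _ _ yb).1 (out _ _ yb).2 mulr0 !mul0r mulr0 addr0 normr0.
set A := \int[mu]_y f y.
have A0 : 0 < A by exact: Rintegral_gt0.
pose Ak k := \int[mu]_y g k y.
have gcv y : g ^~ y @ \oo --> f y.
  by rewrite -[X in _ --> X]mulr1; apply: cvgM; [exact: cvg_cst|exact: chic].
have AkA : Ak @ \oo --> A.
  apply: (@Rintegral_dominated_cvg _ _ _ mu g f f) => //; first exact: aeW.
  by move=> k y; rewrite ger0_norm.
have Akln : (fun k => Ak k * ln (Ak k)) @ \oo --> A * ln A.
  by apply: cvgM => //; exact: (cvg_comp _ _ AkA (continuous_ln A0)).
have mln (h : 'rV[R]_n -> R) : measurable_fun [set: 'rV[R]_n] h -> measurable_fun [set: 'rV[R]_n] (fun y => h y * ln (h y)).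
  by move=> mh; apply: measurable_funM => //; exact: measurableT_comp (@measurable_ln R) mh.
have Hcv : (fun k => \int[mu]_y (g k y * ln (g k y))) @ \oo --> \int[mu]_y (f y * ln (f y)).
  (* The extra f in the dominating function accounts for chi log chi, which lies between - 1 and
     0. *)
  apply: (@Rintegral_dominated_cvg _ _ _ mu (fun k y => g k y * ln (g k y)) _ (fun y => f y * `|ln (f y)| + f y)) => //.
  - by move=> k; exact: mln.
  - exact: mln.
  - apply: aeW => y; apply: cvgM; first exact: gcv.
    exact: (cvg_comp _ _ (gcv y) (continuous_ln (f0 y))).
  - exact: (integrableD measurableT ifl i_f).
  move=> k y; have /andP[] := chi01 k y; rewrite le_eqVlt => /orP[/eqP h _|h0 h1].
    by rewrite /g -h mulr0 mul0r normr0 addr_ge0 ?mulr_ge0 ?(ltW (f0 y)).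
  rewrite /g lnM ?posrE// mulrDr (le_trans (ler_normD _ _))// lerD//.
    rewrite -mulrA normrM (gtr0_norm (f0 y)) ler_pM2l// normrM ler_piMl//.
    by rewrite ger0_norm// ltW.
  rewrite -mulrA normrM (gtr0_norm (f0 y)) ger_pMr//.
  have hl := mulln_ge (ltW h0); have hn := ln_le0 h1.
  rewrite ler_norml; apply/andP; split; first by rewrite (le_trans _ hl)// lerBrDl subrr ltW.
  by rewrite (le_trans _ ler01)// mulr_ge0_le0// ltW.
pose G := grad_mean mu f.
have idf i : mu.-integrable setT (EFin \o partial i f).
  apply: (le_integrable measurableT _ _ inf).
    by apply/measurable_EFinP; apply: continuous_measurable_rV; exact: (f1 i).2.
  move=> y _; rewrite /= lee_fin [leRHS]ger0_norm ?euclid_norm_ge0//.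
  by have := coord_le_euclid_norm (grad f y) i; rewrite mxE.
have Gv v : dotp G v <= c * euclid_norm v ^+ 2 * A + entropy mu f.
  have Gcv : (fun k => \int[mu]_y (\sum_i v 0 i * partial i (g k) y)) @ \oo -->
      \int[mu]_y (\sum_i v 0 i * partial i f y).
    (* The term 4 f dominates f times a partial derivative of the cutoff, which is at most 2 times 2
       on the box outside which the cutoff vanishes. *)
    apply: (@Rintegral_dominated_cvg _ _ _ mu (fun k y => \sum_i v 0 i * partial i (g k) y) _
       (fun y => (\sum_i `|v 0 i|) * (4 * f y + euclid_norm (grad f y)))).
    - move=> k; apply: continuous_measurable_rV; apply: rV_continuous_sum => i.
      by apply: rV_continuousM; [exact: rV_continuous_cst|exact: ((g1 k).1 i).2].
    - apply: continuous_measurable_rV; apply: rV_continuous_sum => i.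
      by apply: rV_continuousM; [exact: rV_continuous_cst|exact: (f1 i).2].
    - apply: aeW => y; apply: cvg_sum_seq => i; apply: cvgM; first exact: cvg_cst.
      rewrite (_ : (fun k => _) = (fun k => f y * (2 * m k y * (- 2 * y 0 i * (N k)^-1)) + chi k y * partial i f y)).
        rewrite [X in _ --> X](_ : partial i f y =
            f y * (2 * 1 * (- 2 * y 0 i * 0)) + 1 * partial i f y); last first.
          by rewrite !mulr0 add0r mul1r.
        apply: cvgD; last by apply: cvgM; [exact: chic|exact: cvg_cst].
        apply: cvgM; first exact: cvg_cst.
        apply: cvgM; first by apply: cvgM; [exact: cvg_cst|exact: mc].
        by apply: cvgM; [exact: cvg_cst|exact: cvg_harmonic].
      by apply/funext => k; rewrite dgE.
    - have i5 := integrableD measurableT (integrableZl measurableT 4 i_f) inf.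
      exact: (integrableZl measurableT (\sum_i `|v 0 i|) i5).
    - move=> k y; rewrite (le_trans (ler_norm_sum _ _ _))// mulr_suml; apply: ler_sum => i _.
      rewrite normrM ler_wpM2l// dgE (le_trans (ler_normD _ _))// lerD//.
        rewrite normrM (gtr0_norm (f0 y)) mulrC ler_pM2r//.
        have [yb|yb] := pselect (in_box 0 (N k) y); last first.
          by rewrite (out _ _ yb).2 mulr0 mul0r normr0.
        have := yb i; rewrite mxE subr0 => yi.
        have /andP[m0 m1] := m01 k y.
        have hz : `|- 2 * y 0 i / N k| <= 2.
          by rewrite normrM normfV (gtr0_norm (N0 k)) ler_pdivrMr// normrM normrN normr_nat ler_pM2l.
        have h2 : `|2 * m k y| <= 2 by rewrite ger0_norm ?mulr_ge0// ler_piMr.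
        by rewrite normrM (le_trans (ler_pM _ _ h2 hz))// -natrM.
      have /andP[h0 h1] := chi01 k y.
      rewrite normrM (ger0_norm h0) (le_trans (ler_piMl _ h1))//.
      by have := coord_le_euclid_norm (grad f y) i; rewrite mxE.
  have GE : \int[mu]_y (\sum_i v 0 i * partial i f y) = dotp G v.
    have ivf i : mu.-integrable setT (EFin \o (fun y => v 0 i * partial i f y)).
      exact: (integrableZl measurableT _ (idf i)).
    rewrite (Rintegral_sum _ ivf).2; apply: eq_bigr => i _.
    by rewrite RintegralZl// mxE mulrC.
  rewrite -GE; apply: (ler_cvg_to Gcv).
    apply: cvgD; first by apply: cvgM; [exact: cvg_cst|exact: AkA].
    exact: (cvgB Hcv Akln).
  near=> k; have [K hKk] := hK k.
  apply: (harnack_gradient_le v (ltW c0) (g1 k).1 (gc k) _ hKk).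
    by move=> y; rewrite g0/=; exact: hM.
  have : `|A - Ak k| < A by near: k; move/cvgrPdist_lt : AkA; apply.
  by rewrite ltr_distlC; case/andP; rewrite subrr.
(* The maximizer of G.v - c A |v|^2, with value |G|^2 / (4 c A). *)
have := Gv ((2 * c * A)^-1 *: G).
rewrite dotpC dotpZl -sqr_euclid_norm euclid_normZ gtr0_norm ?invr_gt0 ?mulr_gt0//.
rewrite -/G; move: (euclid_norm G) (entropy mu f) => w H.
rewrite -lerBlDl => hh; rewrite (le_trans _ (ler_wpM2l _ hh)) ?mulr_ge0 ?(ltW c0)//.
by rewrite le_eqVlt; apply/orP; left; apply/eqP; field; rewrite !gt_eqF.
Unshelve. all: by end_near. Qed.

End harnack_gradient.

Lemma SH_LGE (R : realType) (n : nat) (dO : measure_display) (Omega : measurableType dO)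
    (P : probability Omega R) (X : 'rV[R]_n -> R -> {RV P >-> 'rV[R]_n}) (beta : R) :
  0 < beta -> (forall p, 1 < p -> SH X beta p) -> LGE X beta.
Proof.
move=> b0 H t f t0 sf f0 h1 h2 h3 x.
have mf := continuous_measurable_rV (smooth_continuous sf).
have mdf i : measurable_fun setT (partial i f).
  by apply: continuous_measurable_rV; exact: (smooth_C1 sf i).2.
have mnf : measurable_fun setT (fun y => euclid_norm (grad f y)).
  apply: measurable_euclid_norm => i.
  by rewrite (_ : (fun y => _) = partial i f)//; apply/funext => y; rewrite mxE.
have mlf : measurable_fun setT (fun y => ln (f y)) by exact: measurableT_comp (@measurable_ln R) mf.
have int (g : 'rV[R]_n -> R) : measurable_fun setT g -> (forall y, 0 <= g y) -> (Psg X t g x < +oo)%E ->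
    (law X x t).-integrable setT (EFin \o g).
  move=> mg g0; rewrite Psg_law// => hg; apply/integrableP; split; first exact/measurable_EFinP.
  by under eq_integral do rewrite /= ger0_norm//.
have mfl : measurable_fun setT (fun y => f y * `|ln (f y)|).
  by apply: measurable_funM => //; exact: measurableT_comp.
have fl0 y : 0 <= f y * `|ln (f y)| by rewrite mulr_ge0 ?(ltW (f0 y)).
have inf := int _ mnf (fun y => euclid_norm_ge0 _) (h1 x).
have i_f := int _ mf (fun y => ltW (f0 y)) (h2 x).
have ifl := int _ mfl fl0 (h3 x).
have mu_harnack p v : 1 < p -> harnack (law X x t) (convolution (law X x t) (\d_v)) p
    (expR (shift_cost beta t * (p / (p - 1)) * euclid_norm v ^+ 2)).
  by move=> p1; exact: (proj1 (SHP X beta p1) (H p p1)).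
have := harnack_gradient_entropy mu_harnack (shift_cost_gt0 b0 t0) sf f0 inf i_f ifl.
have mfl' : measurable_fun setT (fun y => f y * ln (f y)) by exact: measurable_funM.
rewrite LGE_constE Psgr_law// Psgr_law//; last first.
  apply: (le_integrable measurableT _ _ ifl); first exact/measurable_EFinP.
  by move=> y _; rewrite /= lee_fin [leRHS]ger0_norm// normrM (gtr0_norm (f0 y)).
suff -> : Psgv X t (grad f) x = grad_mean (law X x t) f by [].
apply/rowP => i; rewrite !mxE.
rewrite (_ : (fun y => grad f y 0 i) = partial i f); last by apply/funext => y; rewrite mxE.
apply: Psgr_law => //.
apply: (le_integrable measurableT _ _ inf); first exact/measurable_EFinP.
move=> y _; rewrite /= lee_fin [leRHS]ger0_norm ?euclid_norm_ge0//.
by have := coord_le_euclid_norm (grad f y) i; rewrite mxE.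
Qed.

(** * Chains driven by independent noise *)

Definition mfun_of {d1 d2} {T1 : measurableType d1} {T2 : measurableType d2}
    (f : T1 -> T2) (mf : measurable_fun setT f) : {mfun T1 >-> T2} :=
  HB.pack f (isMeasurableFun.Build _ _ _ _ f mf).

Lemma powR_bounds (R : realType) (e a M r : R) : 0 < r -> 0 < e -> e <= a <= M ->
  e `^ r <= a `^ r <= M `^ r.
Proof.
move=> r0 e0 /andP[h1 h2]; have a0 : 0 <= a by rewrite (le_trans (ltW e0)).
by rewrite !ge0_ler_powR ?nnegrE ?(ltW r0) ?(ltW e0) ?a0 ?h1 ?h2 ?(le_trans a0 h2).
Qed.

Section chain.
Context d1 d2 d3 (S : measurableType d1) (T : measurableType d2) (Omega : measurableType d3)
  (R : realType) (P : probability Omega R) (nu : probability T R).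
Variables (m : nat) (xi : nat -> Omega -> T) (F : nat -> S * T -> S) (x0 : S).
Hypothesis mxi : forall j, measurable_fun setT (xi j).
Hypothesis mF : forall j, measurable_fun setT (F j).
Hypothesis indep : forall A : nat -> set T, (forall j, measurable (A j)) ->
  P [set w | forall j, (j < m)%N -> A j (xi j w)] = (\prod_(j < m) nu (A j))%E.

Fixpoint chain (j : nat) (w : Omega) : S :=
  if j is j'.+1 then F j' (chain j' w, xi j' w) else x0.

Lemma measurable_chain j : measurable_fun setT (chain j).
Proof.
elim: j => [|j IH]; first exact: measurable_cst.
by apply: measurableT_comp (mF j) _; exact: measurable_fun_pair.
Qed.

(** The noises from index k up to the horizon m. Carrying such events along is what allows the
    independence of [chain k] from the later noise to be proved by induction on k. *)
Definition future k (A : nat -> set T) : set Omega :=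
  [set w | forall j, (k <= j < m)%N -> A j (xi j w)].

Lemma measurable_future k A : (forall j, measurable (A j)) -> measurable (future k A).
Proof.
move=> mA; rewrite /future.
rewrite (_ : mkset _ = \bigcap_(j in [set j | (k <= j < m)%N]) (xi j @^-1` A j)).
  apply: bigcap_measurableType => j _; rewrite -[X in measurable X]setTI.
  exact: mxi.
by apply/seteqP; split=> w h j; exact: h.
Qed.

Let pair k w := (chain k w, xi k w).

Let measurable_pair k : measurable_fun setT (pair k).
Proof. by apply: measurable_fun_pair => //; exact: measurable_chain. Qed.

Definition chain_law k : probability S R := distribution P (mfun_of (measurable_chain k)).

Let indep_at k := forall (D : set S) (A : nat -> set T), measurable D ->
  (forall j, measurable (A j)) ->
  P (chain k @^-1` D `&` future k A) = (P (chain k @^-1` D) * \prod_(k <= j < m) nu (A j))%E.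

(** For a rectangle C this is the independence at k with the constraint on [xi k] added to the
    future. Uniqueness of product measures, for the image of P restricted to the future event and
    the scaled product, extends it to every measurable C. *)
Let pair_law k (A : nat -> set T) (C : set (S * T)) : (k < m)%N -> indep_at k ->
  (forall j, measurable (A j)) -> measurable C ->
  P (pair k @^-1` C `&` future k.+1 A) =
  (\prod_(k.+1 <= j < m) nu (A j) * (chain_law k \x nu) C)%E.
Proof.
move=> km IH mA mC.
pose E := future k.+1 A.
have mE : measurable E by exact: measurable_future.
pose c := \prod_(k.+1 <= j < m) fine (nu (A j)).
have cE : (\prod_(k.+1 <= j < m) nu (A j) = c%:E)%E.
  rewrite /c -prodEFin; apply: eq_bigr => j _.
  by rewrite fineK// fin_num_measure.
have c0 : 0 <= c by apply: prodr_ge0 => j _; exact: fine_ge0.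
pose rho := mrestr P mE.
have rect (D' : set S) (B : set T) : measurable D' -> measurable B ->
    P (pair k @^-1` (D' `*` B) `&` E) = (c%:E * chain_law k D' * nu B)%E.
  move=> mD' mB; pose A' j := if j == k then B else A j.
  have mA' j : measurable (A' j) by rewrite /A'; case: ifP.
  have := IH D' A' mD' mA'.
  have AkE : A' k = B by rewrite /A' eqxx.
  rewrite big_ltn// AkE.
  rewrite (@eq_big_nat _ _ _ _ _ _ (fun j => nu (A j))); last first.
    by move=> j /andP[kj _]; rewrite /A' gtn_eqF.
  rewrite cE [(_ * c%:E)%E]muleC muleCA muleA => <-; congr (P _).
  apply/seteqP; split=> w [].
    move=> [Dw Bw] Ew; split => // j /andP[kj jm]; rewrite /A'; case: eqP => [->//|/eqP jk].
    by apply: Ew; rewrite jm andbT ltn_neqAle eq_sym jk.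
  move=> Dw h; split; first by split => //; have := h k; rewrite leqnn km /A' eqxx; apply.
  move=> j /andP[kj jm]; have := h j; rewrite jm (ltnW kj) /A' gtn_eqF//; apply => //.
pose m' := measure_function_pushforward__canonical__measure_function_Measure rho (@measurable_pair k).
have U := @product_measure_unique _ _ _ _ R (mscale (NngNum c0) (chain_law k)) nu m' rect C mC.
rewrite cE; transitivity (m' C); first by [].
rewrite -U.
rewrite /product_measure1 ge0_integral_mscale//.
exact: measurable_fun_xsection.
Qed.

(** [chain k.+1] is a function of [pair k], so [pair_law] for a preimage under [F k] yields the
    independence at the next index. *)
Let chain_indep k : (k <= m)%N -> indep_at k.
Proof.
elim: k => [|k IH] km D A mD mA.
  have [Dx|Dx] := pselect (D x0).
    rewrite (_ : chain 0 @^-1` D = setT); last by apply/seteqP; split.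
    by rewrite setTI probability_setT mul1e big_mkord -indep.
  rewrite (_ : chain 0 @^-1` D = set0); last by apply/seteqP; split.
  by rewrite set0I measure0 mul0e.
have mC : measurable (F k @^-1` D) by rewrite -[X in measurable X]setTI; exact: mF.
have := pair_law km (IH (ltnW km)) (fun=> measurableT) mC.
rewrite (_ : future _ _ = setT); last by apply/seteqP; split.
rewrite setIT big1 ?mul1e; last by move=> j _; exact: probability_setT.
have := pair_law km (IH (ltnW km)) mA mC.
by move=> + h; rewrite -h muleC.
Qed.

Implicit Types (g : S -> R) (M e : R).

Definition chain_op k (g : S -> R) (y : S) : R := \int[nu]_z g (F k (y, z)).

Lemma measurable_chain_op k g M : measurable_fun setT g -> (forall y, 0 <= g y <= M) ->
  measurable_fun setT (chain_op k g).
Proof.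
move=> mg gM; apply: measurableT_comp => //.
apply: (@measurable_fun_fubini_tonelli_F _ _ _ _ _ nu (fun x => (g (F k x))%:E)).
  by apply/measurable_EFinP; exact: measurableT_comp mg (mF k).
by move=> x; rewrite lee_fin; case/andP: (gM (F k x)).
Qed.

Lemma measurable_section k y : measurable_fun setT (fun z => F k (y, z)).
Proof. by apply: measurableT_comp (mF k) _; exact: measurable_fun_pair. Qed.

(** The Markov property, in extended integrals so that it also applies to exponential moments, not
    known to be finite beforehand. *)
Lemma ge0_chain_step k (g : S -> \bar R) : (k < m)%N -> measurable_fun setT g ->
  (forall y, 0 <= g y)%E ->
  (\int[P]_w g (chain k.+1 w) = \int[P]_w \int[nu]_z g (F k (chain k w, z)))%E.
Proof.
move=> km mg g0.
have mgF : measurable_fun setT (fun x => g (F k x)) by exact: measurableT_comp mg (mF k).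
transitivity (\int[chain_law k \x nu]_x g (F k x))%E.
  rewrite (eq_measure_integral (pushforward P (pair k))); last first.
    move=> C mC _ /=.
    have := pair_law km (chain_indep (ltnW km)) (fun=> measurableT) mC.
    rewrite (_ : future _ _ = setT); last by apply/seteqP; split.
    rewrite setIT big1 ?mul1e//; move=> j _; exact: probability_setT.
  by rewrite (@ge0_integral_pushforward _ _ _ _ _ _ (@measurable_pair k))//.
rewrite fubini_tonelli1//.
rewrite ge0_integral_distribution//; last first.
- by move=> y; apply: integral_ge0.
- exact: measurable_fun_fubini_tonelli_F.
Qed.

Lemma chain_step k g M : (k < m)%N -> measurable_fun setT g -> (forall y, 0 <= g y <= M) ->
  \int[P]_w g (chain k.+1 w) = \int[P]_w chain_op k g (chain k w).
Proof.
move=> km mg gM; rewrite /Rintegral; congr fine.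
have mEg : measurable_fun setT (EFin \o g) by exact/measurable_EFinP.
have g0 y : (0 <= (EFin \o g) y)%E by rewrite /= lee_fin; case/andP: (gM y).
rewrite (ge0_chain_step km mEg g0).
apply: eq_integral => w _; rewrite /= integral_Rintegral//.
apply: (@bounded_integrable _ _ _ _ _ M).
  exact: measurableT_comp mg (measurable_section k _).
by move=> z; have /andP[? ?] := gM (F k (chain k w, z)); rewrite ger0_norm.
Qed.

(** For l <= m, the conditional expectation of g at the final time m given the state of the chain at
    time m - l. *)
Fixpoint backward g (l : nat) : S -> R :=
  if l is l'.+1 then chain_op (m - l'.+1) (backward g l') else g.

Lemma bounded_pos_integrable d (U : measurableType d) (Q : probability U R) (h : U -> R) e M :
  0 < e -> measurable_fun setT h -> (forall y, e <= h y <= M) ->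
  Q.-integrable setT (EFin \o h).
Proof.
move=> e0 mh hM; apply: (@bounded_integrable _ _ _ _ _ M) => // y.
by have /andP[h1 h2] := hM y; rewrite ger0_norm// (le_trans (ltW e0)).
Qed.

Lemma Rintegral_bounds d (U : measurableType d) (Q : probability U R) (h : U -> R) e M :
  0 < e -> measurable_fun setT h -> (forall y, e <= h y <= M) -> e <= \int[Q]_y h y <= M.
Proof.
move=> e0 mh hM; have ih := bounded_pos_integrable Q e0 mh hM.
have ic (a : R) : Q.-integrable setT (EFin \o (fun=> a)) by exact: finite_measure_integrable_cst.
rewrite -{1}(Rintegral_probability_cst Q e) -(Rintegral_probability_cst Q M).
by apply/andP; split; apply: le_Rintegral => // y _; case/andP: (hM y).
Qed.

Lemma backward_bounds g e M l : 0 < e -> measurable_fun setT g -> (forall y, e <= g y <= M) ->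
  measurable_fun setT (backward g l) /\ forall y, e <= backward g l y <= M.
Proof.
move=> e0 mg gM; elim: l => [//|l [IH1 IH2]] /=; split.
  apply: (@measurable_chain_op _ _ M) => // y.
  by have /andP[h1 h2] := IH2 y; rewrite h2 (le_trans (ltW e0)).
move=> y; apply: Rintegral_bounds => //.
exact: measurableT_comp IH1 (measurable_section _ _).
Qed.

Lemma backwardE g e M : 0 < e -> measurable_fun setT g -> (forall y, e <= g y <= M) ->
  \int[P]_w g (chain m w) = backward g m x0.
Proof.
move=> e0 mg gM.
have H l : (l <= m)%N -> \int[P]_w g (chain m w) = \int[P]_w backward g l (chain (m - l) w).
  elim: l => [|l IH] lm; first by rewrite subn0.
  have [h1 h2] := backward_bounds l e0 mg gM.
  rewrite (IH (ltnW lm)) /= -(@chain_step _ _ M) ?subnSK ?leq_subr//.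
  by move=> y; have /andP[h3 h4] := h2 y; rewrite h4 (le_trans (ltW e0)).
by rewrite (H m)// subnn /= Rintegral_probability_cst.
Qed.

(* One step transports the inequality at time [j.+1] to time [j]: apply the
   one-step Harnack inequality to the [p]-th root of [G_(j+1)]. *)
Lemma chain_harnack p (theta : nat -> S -> S) (cost : nat -> R) g e M : 1 < p ->
  (forall j, measurable_fun setT (theta j)) ->
  (forall j y (phi : S -> R) e' M', (j < m)%N -> 0 < e' -> measurable_fun [set: S] phi ->
    (forall x, e' <= phi x <= M') ->
    (\int[nu]_z phi (theta j.+1 (F j (y, z)))) `^ p <=
    expR (cost j) * \int[nu]_z (phi (F j (theta j y, z)) `^ p)) ->
  theta 0%N x0 = x0 ->
  0 < e -> measurable_fun setT g -> (forall x, e <= g x <= M) ->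
  (\int[P]_w g (theta m (chain m w))) `^ p <=
  expR (\sum_(j < m) cost j) * \int[P]_w (g (chain m w) `^ p).
Proof.
move=> p1 mth step th0 e0 mg gM.
have p0 : 0 < p by rewrite (lt_trans _ p1).
have g0 x : 0 < g x by case/andP: (gM x) => /(lt_le_trans e0).
have gpM x : e `^ p <= g x `^ p <= M `^ p.
  exact: powR_bounds.
have mgp : measurable_fun setT (fun x => g x `^ p).
  exact: measurableT_comp (@measurable_powR R p) mg.
have mgt : measurable_fun setT (fun x => g (theta m x)) by exact: measurableT_comp mg (mth m).
have gtM x : e <= g (theta m x) <= M by [].
have ep0 : 0 < e `^ p by rewrite powR_gt0.
rewrite (backwardE e0 mgt gtM) (backwardE ep0 mgp gpM).
have H l : (l <= m)%N -> forall y, backward (fun x => g (theta m x)) l y `^ p <=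
    expR (\sum_(m - l <= j < m) cost j) * backward (fun x => g x `^ p) l (theta (m - l)%N y).
  elim: l => [|l IH] lm y.
    by rewrite subn0 big_geq// expR0 mul1r.
  have [mH HM] := backward_bounds l e0 mgt gtM.
  have [mG GM] := backward_bounds l ep0 mgp gpM.
  set k := (m - l.+1)%N; have kE : (m - l)%N = k.+1 by rewrite /k subnSK.
  have km : (k < m)%N by rewrite ltn_subrL (leq_ltn_trans _ lm).
  pose G := backward (fun x => g x `^ p) l.
  pose phi x := G x `^ p^-1.
  have G0 x : 0 < G x by case/andP: (GM x) => /(lt_le_trans ep0).
  have phiM x : (e `^ p) `^ p^-1 <= phi x <= (M `^ p) `^ p^-1.
    by apply: powR_bounds => //; rewrite invr_gt0.
  have mphi : measurable_fun setT phi by exact: measurableT_comp (@measurable_powR R _) mG.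
  have e'0 : 0 < (e `^ p) `^ p^-1 by rewrite !powR_gt0.
  have phiP x : phi x `^ p = G x.
    by rewrite /phi -powRrM mulVf ?gt_eqF// powRr1// ltW.
  have := step k y phi _ _ km e'0 mphi phiM.
  under [in X in _ <= X]eq_Rintegral do rewrite phiP.
  rewrite -/(chain_op k G (theta k y)) => hs.
  (* The cost accumulated at later times with the p-th root already taken, so that it leaves the
     integral as a constant factor. *)
  pose C := expR ((\sum_(k.+1 <= j < m) cost j) / p).
  have CP : C `^ p = expR (\sum_(k.+1 <= j < m) cost j).
    by rewrite /C -expRM divfK ?gt_eqF.
  have hH x : backward (fun x => g (theta m x)) l x <= C * phi (theta k.+1 x).
    have := IH (ltnW lm) x; rewrite kE => h.
    have /andP[hx _] := HM x; have hx0 := lt_le_trans e0 hx.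
    have h' : (backward (fun x => g (theta m x)) l x `^ p) `^ p^-1 <=
       (expR (\sum_(k.+1 <= j < m) cost j) * G (theta k.+1 x)) `^ p^-1.
      by rewrite ge0_ler_powR ?nnegrE ?invr_ge0 ?mulr_ge0 ?expR_ge0 ?powR_ge0// ltW.
    move: h'; rewrite -powRrM mulfV ?gt_eqF// powRr1 ?(ltW hx0)// powRM ?expR_ge0 ?(ltW (G0 _))//.
    by rewrite -expRM.
  have mpt : measurable_fun setT (fun z => phi (theta k.+1 (F k (y, z)))).
    by apply: measurableT_comp mphi _; apply: measurableT_comp (mth _) _; exact: measurable_section.
  have ipt := bounded_pos_integrable nu e'0 mpt (fun z => phiM _).
  have int_le : chain_op k (backward (fun x => g (theta m x)) l) y <=
      C * \int[nu]_z phi (theta k.+1 (F k (y, z))).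
    rewrite -RintegralZl//; apply: le_Rintegral.
    - exact: measurableT.
    - apply: (bounded_pos_integrable nu e0 _ (fun z => HM _)).
      by apply: measurableT_comp mH _; exact: measurable_section.
    - exact: (integrableZl measurableT C ipt).
    - by move=> z _; exact: hH.
  rewrite big_ltn// expRD /=.
  apply: (@le_trans _ _ ((C * \int[nu]_z phi (theta k.+1 (F k (y, z)))) `^ p)).
    have /andP[h3 _] := (backward_bounds l.+1 e0 mgt gtM).2 y.
    have h4 : 0 <= chain_op k (backward (fun x => g (theta m x)) l) y by exact: le_trans (ltW e0) h3.
    by rewrite ge0_ler_powR ?nnegrE ?(ltW p0)//; exact: le_trans h4 int_le.
  have i0 : 0 <= \int[nu]_z phi (theta k.+1 (F k (y, z))).
    by apply: Rintegral_ge0 => z _; case/andP: (phiM (theta k.+1 (F k (y, z)))) => /(lt_le_trans e'0)/ltW.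
  rewrite powRM ?expR_ge0// CP [X in _ <= X * _]mulrC -mulrA ler_pM2l ?expR_gt0//.
have := H m (leqnn m) x0; rewrite subnn th0 big_mkord; exact.
Qed.

End chain.

(** * Gaussian measures and Brownian increments *)

Section gaussian.
Context {R : realType}.
Local Notation leb := (@lebesgue_measure R).
Implicit Types (f : R -> R) (s w : R).

Lemma lebesgue_measure_shift w (A : set R) : measurable A ->
  pushforward leb ((fun x => x + w) : _ -> measurableTypeR R) A = leb A.
Proof.
move=> mA; apply/esym/lebesgue_measure_unique => //= [|mw _ [[a b]] _ <-].
  exact: measurable_funD.
rewrite /pushforward.
have -> : (fun x => x + w) @^-1` `]a, b]%classic = `]a - w, b - w]%classic.
  by apply/seteqP; split=> x /=; rewrite !in_itv/= ltrBlDr lerBrDr.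
rewrite !lebesgue_measure_itv/= !lte_fin ltrD2r; case: ifP => // _.
by rewrite -!EFinB; congr EFin; ring.
Qed.

Lemma ge0_integral_lebesgue_shift (f : R -> \bar R) w : measurable_fun setT f ->
  (forall x, 0 <= f x)%E -> (\int[leb]_x f (x + w)%R = \int[leb]_x f x)%E.
Proof.
move=> mf f0.
have mw : measurable_fun [set: measurableTypeR R] ((fun x : R => x + w) : _ -> measurableTypeR R).
  exact: measurable_funD.
rewrite [RHS](eq_measure_integral (pushforward leb ((fun x => x + w) : _ -> measurableTypeR R))).
  by rewrite (ge0_integral_pushforward mw).
by move=> A mA _; exact/esym/lebesgue_measure_shift.
Qed.

Lemma ge0_integral_normal_prob (f : R -> \bar R) (m s : R) : measurable_fun setT f ->
  (forall x, 0 <= f x)%E ->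
  (\int[normal_prob m s]_x f x = \int[leb]_x (f x * (normal_pdf m s x)%:E))%E.
Proof.
move=> mf f0; have dom := normal_prob_dominates m s.
rewrite -(Radon_Nikodym_SigmaFinite.change_of_variables dom f0)//.
have iRN := Radon_Nikodym_SigmaFinite.f_integrable dom.
have mpdf : measurable_fun setT (fun x : measurableTypeR R => (normal_pdf m s x)%:E).
  by apply/measurable_EFinP; exact: measurable_normal_pdf.
apply: ae_eq_integral => //.
- by apply: emeasurable_funM => //; exact: measurable_int iRN.
- exact: emeasurable_funM.
- apply: ae_eqe_mul2l.
  apply: integral_ae_eq => //.
  by move=> E _ mE; rewrite -Radon_Nikodym_SigmaFinite.f_integral.
Qed.

Lemma normal_pdf_shift m s x w : s != 0 ->
  normal_pdf m s (x - w) = normal_pdf m s x * expR ((2 * (x - m) * w - w ^+ 2) / (2 * s ^+ 2)).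
Proof.
move=> s0; rewrite !normal_pdfE//= /normal_fun -[RHS]mulrA -expRD; congr (_ * expR _).
by rewrite -mulr_natl; field.
Qed.

(* Translating the standard Gaussian multiplies its density by this factor. *)
Definition gauss_tilt s w (z : R) : R := expR ((2 * z * w - w ^+ 2) / (2 * s ^+ 2)).

Lemma measurable_gauss_tilt s w : measurable_fun setT (gauss_tilt s w).
Proof.
apply: measurableT_comp (@measurable_expR R) _; apply: measurable_funM => //.
by apply: measurable_funB => //; apply: measurable_funM => //; exact: measurable_funM.
Qed.

Lemma normal_prob_shift f s w : s != 0 -> measurable_fun setT f -> (forall x, 0 <= f x) ->
  (\int[normal_prob 0 s]_z (f (z + w))%:E =
   \int[normal_prob 0 s]_z (f z * gauss_tilt s w z)%:E)%E.
Proof.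
move=> s0 mf f0.
have mw : measurable_fun [set: measurableTypeR R] (fun x : R => x + w) by exact: measurable_funD.
have mE := measurable_gauss_tilt s w.
rewrite !ge0_integral_normal_prob//; last 4 first.
- by apply/measurable_EFinP; exact: measurable_funM.
- by move=> x; rewrite lee_fin mulr_ge0// expR_ge0.
- by apply/measurable_EFinP; exact: measurableT_comp mf mw.
- by move=> x; rewrite lee_fin.
have mh : measurable_fun setT (fun x : R => ((f (x + w))%:E * (normal_pdf 0 s x)%:E)%E).
  apply: emeasurable_funM; first by apply/measurable_EFinP; exact: measurableT_comp mf mw.
  by apply/measurable_EFinP; exact: measurable_normal_pdf.
have h0 x : (0 <= (f (x + w))%:E * (normal_pdf 0 s x)%:E)%E.
  by rewrite mule_ge0// lee_fin// normal_pdf_ge0.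
rewrite -(ge0_integral_lebesgue_shift (- w) mh h0).
apply: eq_integral => x _; rewrite subrK normal_pdf_shift// -!EFinM; congr EFin.
by rewrite /gauss_tilt subr0; ring.
Qed.

Lemma normal_prob_mean f s w : s != 0 -> measurable_fun setT f -> (forall x, 0 <= f x) ->
  (\int[normal_prob w s]_z (f z)%:E = \int[normal_prob 0 s]_z (f (z + w))%:E)%E.
Proof.
move=> s0 mf f0.
have mw : measurable_fun [set: measurableTypeR R] (fun x : R => x + w) by exact: measurable_funD.
have mfw : measurable_fun setT (fun x : R => f (x + w)) by exact: measurableT_comp mf mw.
have mEf := (measurable_EFinP _ _).2 mf.
have mEfw := (measurable_EFinP _ _).2 mfw.
have f1 x : (0 <= (EFin \o f) x)%E by rewrite /= lee_fin.
have f2 x : (0 <= (EFin \o (fun x : R => (f (x + w))%R)) x)%E by rewrite /= lee_fin.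
rewrite (ge0_integral_normal_prob _ _ mEf f1) (ge0_integral_normal_prob _ _ mEfw f2).
have mh : measurable_fun setT (fun x : R => ((f x)%:E * (normal_pdf w s x)%:E)%E).
  apply: emeasurable_funM; first exact/measurable_EFinP.
  by apply/measurable_EFinP; exact: measurable_normal_pdf.
have h0 x : (0 <= (f x)%:E * (normal_pdf w s x)%:E)%E.
  by rewrite mule_ge0// lee_fin// normal_pdf_ge0.
rewrite -(ge0_integral_lebesgue_shift w mh h0).
apply: eq_integral => x _; congr (_ * _%:E)%E.
by rewrite !normal_pdfE//= /normal_fun addrK subr0.
Qed.

(** No Gaussian integral is computed: translating the constant 1 shows that [gauss_tilt] has mean 1,
    and exp(l z) is a multiple of the tilt for w = l s^2. *)
Lemma integral_expR_normal s (l : R) : s != 0 ->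
  (\int[normal_prob 0 s]_z (expR (l * z))%:E = (expR (l ^+ 2 * s ^+ 2 / 2))%:E)%E.
Proof.
move=> s0; have := normal_prob_shift (l * s ^+ 2) s0 (@measurable_cst _ _ R R setT 1) (fun=> @ler01 R).
rewrite integral_probability_cst => h.
have mel : measurable_fun setT (fun z : R => expR (l * z)).
  by apply: measurableT_comp (@measurable_expR R) _; exact: measurable_funM.
have E : (\int[normal_prob 0 s]_z (expR (l * z))%:E =
    (expR (l ^+ 2 * s ^+ 2 / 2))%:E * \int[normal_prob 0 s]_z (1 * gauss_tilt s (l * s ^+ 2) z)%:E)%E.
  have mt : measurable_fun setT (fun z => (1 * gauss_tilt s (l * s ^+ 2) z)%:E).
    by apply/measurable_EFinP; apply: measurable_funM => //; exact: measurable_gauss_tilt.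
  have t0 z : (0 <= (1 * gauss_tilt s (l * s ^+ 2) z)%:E)%E by rewrite lee_fin mul1r expR_ge0.
  have e0 : (0 <= (expR (l ^+ 2 * s ^+ 2 / 2))%:E)%E by rewrite lee_fin expR_ge0.
  apply: (etrans _ (ge0_integralZl (normal_prob 0 s) measurableT mt (fun z _ => t0 z) e0)).
  apply: eq_integral => z _; rewrite -EFinM; congr EFin.
  by rewrite mul1r /gauss_tilt -expRD; congr expR; field.
by rewrite E -h mule1.
Qed.

(** The density of the translated Gaussian is [gauss_tilt], whose moment of order p / (p - 1) is
    again an exponential moment; the criterion [harnackP] holds with equality. *)
Lemma normal_harnack p s w : 1 < p -> s != 0 ->
  harnack (normal_prob 0 s) (normal_prob w s) p (expR (p / (p - 1) * w ^+ 2 / (2 * s ^+ 2))).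
Proof.
move=> p1 s0.
have p10 : 0 < p - 1 by rewrite subr_gt0.
have dens : is_density (normal_prob 0 s) (normal_prob w s) (gauss_tilt s w).
  split; first exact: measurable_gauss_tilt.
    by move=> z; exact: expR_ge0.
  move=> f mf f0; rewrite (normal_prob_mean w s0 mf f0).
  exact: normal_prob_shift.
apply/(harnackP p1 (expR_gt0 _) dens).
have q0 : p / (p - 1) - 1 = (p - 1)^-1 by field; rewrite gt_eqF.
have E z : gauss_tilt s w z `^ (p / (p - 1)) =
    expR (- (p / (p - 1) * w ^+ 2 / (2 * s ^+ 2))) * expR (p / (p - 1) * w / s ^+ 2 * z).
  by rewrite /gauss_tilt -expRM -expRD; congr expR; field; rewrite s0/= gt_eqF.
under eq_integral do rewrite E EFinM.
have mex : measurable_fun setT (fun z : R => (expR (p / (p - 1) * w / s ^+ 2 * z))%:E).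
  apply/measurable_EFinP; apply: measurableT_comp (@measurable_expR R) _.
  exact: measurable_funM.
have ex0 z : (0 <= (expR (p / (p - 1) * w / s ^+ 2 * z))%:E)%E by rewrite lee_fin expR_ge0.
rewrite (ge0_integralZl (normal_prob 0 s) measurableT mex) ?lee_fin ?expR_ge0//.
rewrite integral_expR_normal// -EFinM -expRD lee_fin -expRM ler_expR.
rewrite le_eqVlt; apply/orP; left; apply/eqP.
by field; rewrite s0/= gt_eqF.
Qed.

Lemma normal_harnack_bounded p s w (phi : R -> R) e M : 1 < p -> s != 0 -> 0 < e ->
  measurable_fun setT phi -> (forall z, e <= phi z <= M) ->
  (\int[normal_prob 0 s]_z phi (z + w)) `^ p <=
  expR (p / (p - 1) * w ^+ 2 / (2 * s ^+ 2)) * \int[normal_prob 0 s]_z (phi z `^ p).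
Proof.
move=> p1 s0 e0 mphi phiM.
have phi0 z : 0 <= phi z by case/andP: (phiM z) => /(le_trans (ltW e0)).
have := harnack_bounded p1 (expR_ge0 _) (normal_harnack w p1 s0) mphi phi0
   (fun z => proj2 (andP (phiM z))).
have -> // : \int[normal_prob w s]_z phi z = \int[normal_prob 0 s]_z phi (z + w).
by rewrite /Rintegral (normal_prob_mean w s0 mphi phi0).
Qed.

End gaussian.

(** * Gaussian vectors, treated one coordinate at a time *)

Section gaussian_vector.
Context {R : realType} {n : nat}.
Implicit Types (z y w l : 'rV[R]_n) (gam : probability 'rV[R]_n R) (s : R).

(** Prescribed on rectangles only, the form in which [brownian] provides it; [gaussian_law_unique]
    shows that this determines the measure. *)
Definition gaussian_law gam s := forall A : 'I_n -> set R, (forall i, measurable (A i)) ->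
  gam [set z | forall i, A i (z 0 i)] = (\prod_(i < n) normal_prob 0 s (A i))%E.

(** Coordinates are indexed by [nat], with value 0 beyond the dimension, so that they can serve as
    the noise sequence of a chain. *)
Definition nth_coord (j : nat) z : R := oapp (fun i => z 0 i) 0 (insub j).

Definition nth_delta (j : nat) : 'rV[R]_n := oapp (fun i => delta_mx 0 i) 0 (insub j).

Lemma nth_coordE (i : 'I_n) z : nth_coord i z = z 0 i.
Proof. by rewrite /nth_coord valK. Qed.

Lemma nth_deltaE j i : nth_delta j 0 i = (j == i)%:R.
Proof.
rewrite /nth_delta; case: insubP => [k kn <-|jn] /=; first by rewrite mxE eqxx eq_sym.
by rewrite mxE; case: eqP => // jE; rewrite jE ltn_ord in jn.
Qed.

Lemma measurable_nth_coord j : measurable_fun setT (nth_coord j).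
Proof.
rewrite /nth_coord; case: insubP => [k _ _|_] /=; first exact: measurable_coord.
exact: measurable_cst.
Qed.

Lemma nth_coord_indep gam s : gaussian_law gam s ->
  forall A : nat -> set R, (forall j, measurable (A j)) ->
  gam [set w | forall j, (j < n)%N -> A j (nth_coord j w)] =
  (\prod_(j < n) normal_prob 0 s (A j))%E.
Proof.
move=> H A mA; rewrite -(H (fun i => A i))//; congr (gam _).
apply/seteqP; split=> z h /=; first by move=> i; rewrite -nth_coordE; exact: h.
by move=> j jn; have := h (Ordinal jn); rewrite -nth_coordE.
Qed.

Definition coord_step (j : nat) (x : 'rV[R]_n * R) : 'rV[R]_n := x.1 + x.2 *: nth_delta j.

Lemma coord_stepE j y r i : coord_step j (y, r) 0 i = y 0 i + r * (j == i)%:R.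
Proof. by rewrite !mxE nth_deltaE. Qed.

Lemma measurable_coord_step j : measurable_fun setT (coord_step j).
Proof.
apply: measurable_fun_rV => i.
rewrite (_ : (fun x => _) = (fun x : 'rV[R]_n * R => x.1 0 i + x.2 * (j == i)%:R)).
  apply: measurable_funD.
    by apply: measurableT_comp (measurable_coord i) _; exact: measurable_fst.
  by apply: measurable_funM => //; exact: measurable_snd.
by apply/funext => -[y r]; rewrite coord_stepE.
Qed.

(** A vector is rebuilt from 0 as a chain driven by its own coordinates, so that the results on
    chains become statements about product Gaussian laws. *)
Lemma chain_coord_step z : chain nth_coord coord_step 0 n z = z.
Proof.
have chainE j : chain nth_coord coord_step 0 j z = \row_i (if (i < j)%N then z 0 i else 0).
  elim: j => [|j IH] /=; first by apply/rowP => i; rewrite !mxE.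
  apply/rowP => i; rewrite coord_stepE IH !mxE ltnS [(i <= j)%N]leq_eqVlt [i == j :> nat]eq_sym.
  case: eqP => [->|_] /=; last by rewrite mulr0 addr0.
  by rewrite ltnn add0r mulr1 nth_coordE.
by rewrite chainE; apply/rowP => i; rewrite mxE ltn_ord.
Qed.

Lemma gaussian_law_unique gam gam' s : gaussian_law gam s -> gaussian_law gam' s ->
  forall A, measurable A -> gam A = gam' A.
Proof.
(* The summand 1 provides the positive lower bound that [backwardE] asks for. *)
move=> H H' A mA; pose g (z : 'rV[R]_n) : R := 1 + \1_A z.
have mg : measurable_fun setT g by apply: measurable_funD => //; exact: measurable_indic.
have gM z : 1 <= g z <= 2.
  have /andP[h0 h1] : 0 <= (\1_A z : R) <= 1 by rewrite indicE ler0n lern1 leq_b1.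
  by rewrite /g lerDl h0/= (_ : (2 : R) = 1 + 1)// lerD2l.
have E (Q : probability 'rV[R]_n R) : gaussian_law Q s -> (Q A = (\int[Q]_z g z - 1)%:E)%E.
  move=> _; have iA : Q.-integrable setT (EFin \o \1_A).
    by apply: (@bounded_integrable _ _ _ _ _ 1) => // z; rewrite indicE normr_nat lern1 leq_b1.
  have i1 : Q.-integrable setT (EFin \o (fun=> 1)) by exact: finite_measure_integrable_cst.
  rewrite (RintegralD measurableT i1 iA) Rintegral_probability_cst addrC addKr.
  by rewrite -(integral_Rintegral iA) integral_indic// setIT.
rewrite (E _ H) (E _ H'); congr ((_ - 1)%:E).
have I (Q : probability 'rV[R]_n R) : gaussian_law Q s ->
    \int[Q]_z g z = backward (normal_prob 0 s) n coord_step g n 0.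
  move=> HQ.
  have -> : \int[Q]_z g z = \int[Q]_z g (chain nth_coord coord_step 0 n z).
    by apply: eq_Rintegral => z _; rewrite chain_coord_step.
  apply: (@backwardE _ _ _ _ _ _ R Q (normal_prob 0 s) n _ _ (0 : 'rV[R]_n) measurable_nth_coord
    measurable_coord_step (nth_coord_indep HQ) g 1 2 ltr01 mg gM).
by rewrite !I.
Qed.

(** Tensorization: [theta j] has shifted the coordinates before j, each step shifts one more, and
    the one-dimensional costs add up to |w|^2. *)
Lemma gaussian_harnack gam s p w (g : 'rV[R]_n -> R) e M : gaussian_law gam s -> s != 0 -> 1 < p ->
  0 < e -> measurable_fun setT g -> (forall y, e <= g y <= M) ->
  (\int[gam]_z g (z + w)) `^ p <=
  expR (p / (p - 1) * euclid_norm w ^+ 2 / (2 * s ^+ 2)) * \int[gam]_z (g z `^ p).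
Proof.
move=> H s0 p1 e0 mg gM.
pose F := coord_step; have mF := measurable_coord_step; have FE := coord_stepE.
pose theta (j : nat) y : 'rV[R]_n := y + \row_i (if (i < j)%N then w 0 i else 0).
have chainn := chain_coord_step.
pose cost (j : nat) := p / (p - 1) * nth_coord j w ^+ 2 / (2 * s ^+ 2).
have thn y : theta n y = y + w.
  by congr (_ + _); apply/rowP => i; rewrite mxE ltn_ord.
have th0 : theta 0%N 0 = 0.
  by rewrite /theta add0r; apply/rowP => i; rewrite !mxE.
have mth j : measurable_fun setT (theta j) by exact: measurable_rV_addr.
have step j y (phi : 'rV[R]_n -> R) e' M' : (j < n)%N -> 0 < e' ->
    measurable_fun [set: 'rV[R]_n] phi -> (forall x, e' <= phi x <= M') ->
    (\int[normal_prob 0 s]_r phi (theta j.+1 (F j (y, r)))) `^ p <=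
    expR (cost j) * \int[normal_prob 0 s]_r (phi (F j (theta j y, r)) `^ p).
  move=> jn e'0 mphi phiM.
  have mpsi : measurable_fun setT (fun r : R => phi (F j (theta j y, r))).
    apply: measurableT_comp mphi _; apply: measurableT_comp (mF j) _.
    exact: measurable_fun_pair.
  have := normal_harnack_bounded (nth_coord j w) p1 s0 e'0 mpsi (fun r => phiM _).
  have -> // : \int[normal_prob 0 s]_r phi (theta j.+1 (F j (y, r))) =
     \int[normal_prob 0 s]_r phi (F j (theta j y, r + nth_coord j w)).
  apply: eq_Rintegral => r _; congr phi; apply/rowP => i.
  rewrite FE !mxE nth_deltaE ltnS [(i <= j)%N]leq_eqVlt [i == j :> nat]eq_sym.
  case: eqP => [->|_] /=; last by rewrite !mulr0 !addr0.
  by rewrite ltnn addr0 !mulr1 nth_coordE addrA.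
have := @chain_harnack _ _ _ _ _ _ R gam (normal_prob 0 s) n _ _ _ measurable_nth_coord mF (nth_coord_indep H) _ _ _ _ _ _ p1 mth step th0 e0 mg gM.
have -> : \int[gam]_z g (theta n (chain nth_coord F 0 n z)) = \int[gam]_z g (z + w).
  by apply: eq_Rintegral => z _; rewrite thn chainn.
have -> : \int[gam]_z (g (chain nth_coord F 0 n z) `^ p) = \int[gam]_z (g z `^ p).
  by apply: eq_Rintegral => z _; rewrite chainn.
have -> // : \sum_(j < n) cost j = p / (p - 1) * euclid_norm w ^+ 2 / (2 * s ^+ 2).
rewrite sqr_euclid_norm /dotp /cost -!mulr_suml -mulr_sumr; congr (_ * _ * _).
by apply: eq_bigr => i _; rewrite nth_coordE expr2.
Qed.

(** The state of the chain is the partial scalar product with l, and each coordinate multiplies the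
    exponential moment by its own factor. *)
Lemma gaussian_expR gam s l : gaussian_law gam s -> s != 0 ->
  (\int[gam]_z (expR (dotp l z))%:E = (expR (euclid_norm l ^+ 2 * s ^+ 2 / 2))%:E)%E.
Proof.
move=> H s0.
pose F (j : nat) (x : R * R) : R := x.1 + x.2 * nth_coord j l.
have mF j : measurable_fun setT (F j).
  by apply: measurable_funD; [exact: measurable_fst|apply: measurable_funM => //; exact: measurable_snd].
have E (j : nat) : (j <= n)%N -> (\int[gam]_z (expR (chain nth_coord F 0 j z))%:E =
   (expR ((\sum_(k < j) nth_coord k l ^+ 2) * s ^+ 2 / 2))%:E)%E.
  elim: j => [|j IH] jn.
    by rewrite /= big_ord0 !mul0r integral_probability_cst.
  have mex : measurable_fun setT (fun y : R => (expR y)%:E).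
    by apply/measurable_EFinP; exact: measurable_expR.
  have ex0 (y : R) : (0 <= (expR y)%:E)%E by rewrite lee_fin expR_ge0.
  rewrite (@ge0_chain_step _ _ _ _ _ _ R gam (normal_prob 0 s) n _ _ _ measurable_nth_coord mF (nth_coord_indep H) _ _ jn mex ex0).
  pose u := nth_coord j l; pose C := expR (u ^+ 2 * s ^+ 2 / 2).
  have inner (y : R) : (\int[normal_prob 0 s]_r (expR (F j (y, r)))%:E = C%:E * (expR y)%:E)%E.
    have meu : measurable_fun setT (fun r : R => (expR (u * r))%:E).
      apply/measurable_EFinP; apply: measurableT_comp (@measurable_expR R) _.
      exact: measurable_funM.
    rewrite muleC -(integral_expR_normal u s0).
    apply: (etrans _ (ge0_integralZl (normal_prob 0 s) measurableT meu _ _)) => //.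
      by apply: eq_integral => r _; rewrite -EFinM -expRD /F/= mulrC.
  under eq_integral do rewrite inner.
  have mec : measurable_fun setT (fun z => (expR (chain nth_coord F 0 j z))%:E).
    apply: measurableT_comp mex _; apply: measurable_chain => //.
    exact: measurable_nth_coord.
  rewrite (ge0_integralZl gam measurableT mec) ?lee_fin ?expR_ge0//.
  rewrite (IH (ltnW jn)) -EFinM -expRD big_ord_recr/=; congr ((expR _)%:E).
  by rewrite addrC -!mulrDl.
have chainE j z : chain nth_coord F 0 j z = \sum_(k < j) nth_coord k l * nth_coord k z.
  by elim: j => [|j IH] /=; [rewrite big_ord0|rewrite IH big_ord_recr/= /F /= mulrC].
have := E n (leqnn n).
have -> : \sum_(k < n) nth_coord k l ^+ 2 = euclid_norm l ^+ 2.
  by rewrite sqr_euclid_norm; apply: eq_bigr => i _; rewrite nth_coordE expr2.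
move=> <-; apply: eq_integral => z _; congr ((expR _)%:E).
by rewrite chainE; apply: eq_bigr => i _; rewrite !nth_coordE.
Qed.

End gaussian_vector.

(** * Brownian increments along a regular grid *)

Section brownian_increments.
Context {R : realType} {n : nat} {dO : measure_display}
  {Omega : measurableType dO} {P : probability Omega R}.
Variable B : R -> {RV P >-> 'rV[R]_n}.
Implicit Types (h s t : R).

Lemma measurable_rV_sub d (T : measurableType d) (f g : T -> 'rV[R]_n) :
  measurable_fun setT f -> measurable_fun setT g -> measurable_fun setT (fun w => f w - g w).
Proof.
move=> mf mg; apply: measurable_fun_rV => i.
rewrite (_ : (fun w => _) = (fun w => f w 0 i - g w 0 i)); last first.
  by apply/funext => w; rewrite !mxE.
by apply: measurable_funB; apply: measurableT_comp (measurable_coord i) _.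
Qed.

Definition incr s t w : 'rV[R]_n := B t w - B s w.

Lemma measurable_incr s t : measurable_fun setT (incr s t).
Proof. by apply: measurable_rV_sub. Qed.

Definition incr_law h : probability 'rV[R]_n R := distribution P (mfun_of (measurable_incr 0 h)).

Hypothesis hB : brownian B.

Lemma gaussian_incr s t : 0 <= s -> s < t ->
  gaussian_law (distribution P (mfun_of (measurable_incr s t))) (Num.sqrt (t - s)).
Proof. by move=> s0 st A mA; have [_ _ H _] := hB; exact: H. Qed.

Lemma gaussian_incr_law h : 0 < h -> gaussian_law (incr_law h) (Num.sqrt h).
Proof. by move=> h0; have := gaussian_incr (lexx 0) h0; rewrite subr0. Qed.

(** Stationarity of the increments: both laws take the same values on rectangles. *)
Lemma incr_lawE s h (A : set 'rV[R]_n) : 0 <= s -> 0 < h -> measurable A ->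
  P (incr s (s + h) @^-1` A) = incr_law h A.
Proof.
move=> s0 h0 mA; have sh : s < s + h by rewrite ltrDl.
have := gaussian_incr s0 sh; rewrite [s + h]addrC addrK => H.
exact: (gaussian_law_unique H (gaussian_incr_law h0) mA).
Qed.

Definition grid_incr h (k : nat) : Omega -> 'rV[R]_n := incr (k%:R * h) (k.+1%:R * h).

Lemma measurable_grid_incr h k : measurable_fun setT (grid_incr h k).
Proof. exact: measurable_incr. Qed.

Lemma grid_incr_indep h m : 0 < h -> forall A : nat -> set 'rV[R]_n, (forall j, measurable (A j)) ->
  P [set w | forall j, (j < m)%N -> A j (grid_incr h j w)] = (\prod_(j < m) incr_law h (A j))%E.
Proof.
move=> h0 A mA; have [_ H _ _] := hB.
have t0 : 0 <= 0%:R * h by rewrite mul0r.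
have tlt k : k%:R * h < k.+1%:R * h by rewrite ltr_pM2r// ltr_nat.
have := H m (fun k => k%:R * h) t0 tlt (fun j => A j) (fun j => mA j).
have -> : (\prod_(j < m) incr_law h (A j) =
    \prod_(j < m) P ((fun w => (B (j.+1%:R * h) w - B (j%:R * h) w)%R) @^-1` A j))%E.
  apply: eq_bigr => j _; rewrite -(@incr_lawE (j%:R * h))// ?mulr_ge0// ?ltW//.
  by rewrite /incr -[in X in _ = X]natr1 mulrDl mul1r.
move=> <-; congr (P _); apply/seteqP; split=> w hw.
  by move=> j; exact: hw.
by move=> j jm; exact: (hw (Ordinal jm)).
Qed.

Lemma sum_grid_incr h m w : \sum_(k < m) grid_incr h k w = B (m%:R * h) w - B 0 w.
Proof.
have := @telescope_sumr _ 0 m (fun k => B (k%:R * h) w) (leq0n m).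
by rewrite mul0r big_mkord.
Qed.

End brownian_increments.

(** * Harnack inequalities for the Euler scheme *)

(* The shifts [euler_shift r m j] interpolate from 0 to 1 and turn a contraction
   by [r] at each step into steps of optimal total cost. *)
Section euler_shift.
Context {R : realType}.
Variables (r : R) (m : nat).
Hypothesis r01 : 0 < r < 1.

Definition euler_shift (j : nat) : R := (r ^+ (m - j) - r ^+ (m + j)) / (1 - r ^+ (2 * m)).
(** From eta_(j+1) = r eta_j + gap_j, eta_0 = 0 and eta_m = 1, the sum of r^(m-1-j) gap_j is 1. By
    Cauchy-Schwarz the sum of the squared gaps is least when they are proportional to r^(m-1-j),
    which is the present choice. *)
Definition euler_gap (j : nat) : R := r ^+ (m.-1 - j) * (1 - r ^+ 2) / (1 - r ^+ (2 * m)).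

Let r0 : 0 < r. Proof. by case/andP: r01. Qed.
Let r1 : r < 1. Proof. by case/andP: r01. Qed.

Lemma euler_shift_denom : (0 < m)%N -> 0 < 1 - r ^+ (2 * m).
Proof. by move=> m0; rewrite subr_gt0 exprn_ilt1 ?muln_eq0 -?lt0n// ltW. Qed.

Lemma euler_shift0 : euler_shift 0 = 0.
Proof. by rewrite /euler_shift subn0 addn0 subrr mul0r. Qed.

Lemma euler_shiftm : (0 < m)%N -> euler_shift m = 1.
Proof.
move=> m0; rewrite /euler_shift subnn addnn -mul2n expr0 divff// gt_eqF//.
exact: euler_shift_denom.
Qed.

Lemma euler_gapE j : (j < m)%N -> euler_gap j = euler_shift j.+1 - r * euler_shift j.
Proof.
move=> jm; rewrite /euler_gap /euler_shift.
have -> : (m.-1 - j = m - j.+1)%N by rewrite -subn1 -subnDA add1n.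
rewrite -[(m - j)%N](@subnSK j m)// addnS !exprS.
by move: (r ^+ (m - j.+1)) (r ^+ (m + j)) (_^-1) => a b c; ring.
Qed.

Lemma euler_shift_ge0 j : (0 < m)%N -> (j <= m)%N -> 0 <= euler_shift j.
Proof.
move=> m0 jm; rewrite divr_ge0 ?(ltW (euler_shift_denom m0))// subr_ge0.
by rewrite ler_wiXn2l ?ltW// (leq_trans (leq_subr _ _))// leq_addr.
Qed.

Lemma euler_shift_le j : (j < m)%N -> euler_shift j <= euler_shift j.+1.
Proof.
move=> jm; have m0 : (0 < m)%N by rewrite (leq_ltn_trans _ jm).
rewrite ler_pM2r ?invr_gt0 ?euler_shift_denom// lerB// ler_wiXn2l ?(ltW r0) ?(ltW r1)//.
  by rewrite leq_sub2l.
by rewrite leq_add2l.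
Qed.

Lemma sum_euler_gap : (0 < m)%N -> \sum_(j < m) euler_gap j ^+ 2 = (1 - r ^+ 2) / (1 - r ^+ (2 * m)).
Proof.
move=> m0; have D0 := gt_eqF (euler_shift_denom m0).
have E : (1 - r ^+ 2) * \sum_(j < m) (r ^+ 2) ^+ (m.-1 - j) = 1 - r ^+ (2 * m).
  have := subrXX (r ^+ 2) 1 m; rewrite expr1n -exprM => h.
  rewrite -[RHS]opprB h -[RHS]mulNr opprB; congr (_ * _); apply: eq_bigr => j _.
  by rewrite expr1n mulr1.
have -> : \sum_(j < m) euler_gap j ^+ 2 =
    (1 - r ^+ 2) / (1 - r ^+ (2 * m)) ^+ 2 * ((1 - r ^+ 2) * \sum_(j < m) (r ^+ 2) ^+ (m.-1 - j)).
  rewrite !mulr_sumr; apply: eq_bigr => j _; rewrite /euler_gap exprAC.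
  by move: (r ^+ (_ - _)) (1 - r ^+ 2) => a b; field; rewrite D0.
by rewrite E; move: (1 - r ^+ 2) => a; field; rewrite D0.
Qed.

(** From r = 1 - h beta follow 1 - r^2 <= 2 h beta and r^(2m) <= exp(- 2 beta m h). The bound holds
    at each step size, so the Euler scheme already satisfies the inequality with the final
    constant. *)
Lemma euler_cost_le (beta h : R) : (0 < m)%N -> 0 < beta -> 0 < h -> r = 1 - h * beta ->
  (1 - r ^+ 2) / (1 - r ^+ (2 * m)) / (4 * h) <= shift_cost beta (m%:R * h).
Proof.
move=> m0 b0 h0 rE; have D0 := euler_shift_denom m0.
have rexp : r ^+ (2 * m) <= expR (- (2 * beta * (m%:R * h))).
  have -> : - (2 * beta * (m%:R * h)) = (- (h * beta)) * (2 * m)%:R by rewrite natrM; ring.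
  rewrite expRM_natr lerXn2r ?nnegrE ?expR_ge0 ?(ltW r0)//.
  by rewrite rE expR_ge1Dx.
have E0 : 0 < 1 - expR (- (2 * beta * (m%:R * h))).
  by rewrite subr_gt0 expR_lt1 oppr_lt0 !mulr_gt0 ?ltr0n.
apply: (@le_trans _ _ (beta / 2 / (1 - r ^+ (2 * m)))).
  rewrite mulrAC ler_pM2r ?invr_gt0// ler_pdivrMr ?mulr_gt0//.
  by rewrite rE; nra.
rewrite /shift_cost invfM [leRHS]mulrA ler_pM2l ?divr_gt0// lef_pV2 ?posrE//.
by rewrite lerB.
Qed.

End euler_shift.

(** * Uniform continuity and increments of integrals on the line *)

Section real_line.
Context {R : realType}.
Local Notation leb := (@lebesgue_measure R).
Implicit Types (f : R -> R) (a b T : R).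

Lemma heine_cantor f T (e : R) : {within `[0, T], continuous f} -> 0 < e ->
  exists2 d : R, 0 < d & forall s s', 0 <= s <= T -> 0 <= s' <= T -> `|s - s'| <= d -> `|f s - f s'| <= e.
Proof.
move=> /subspace_continuousP fc e0.
pose Q (h x : R) := forall s, 0 <= s <= T -> `|s - x| <= h -> `|f s - f x| <= e.
have : \forall h \near (0 : R)^'+, `[0, T]%classic `<=` [set x | 0 <= x <= T -> Q h x].
  have /compact_near_coveringP H := @segment_compact R 0 T.
  apply: (H _ (0 : R)^'+ (fun h x => 0 <= x <= T -> Q h x)) => x xT.
  have /cvgrPdist_le /(_ (e / 2)) := fc x xT; rewrite divr_gt0// => /(_ isT).
  rewrite /prop_near1 /within /= => /nbhs_ballP [d /= d0 hd].
  have d20 : 0 < d / 2 by rewrite divr_gt0.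
  near=> x' h => x'T s sT sx'.
  have x'x : `|x - x'| < d / 2.
    near: x'; apply/nbhs_ballP; exists (d / 2) => //.
  have hd2 : h < d / 2 by near: h; exact: nbhs_right_lt.
  have b1 : `|f x - f x'| <= e / 2.
    by apply: hd; [rewrite /ball/=; lra|rewrite /= in_itv/=].
  have b2 : `|f x - f s| <= e / 2.
    apply: hd; last by rewrite /= in_itv/=.
    rewrite /ball/= (_ : x - s = (x - x') - (s - x')); last by ring.
    by rewrite (le_lt_trans (ler_normB _ _))// (splitr d) ltrD// (le_lt_trans sx').
  rewrite (_ : f s - f x' = (f x - f x') - (f x - f s)); last by ring.
  by rewrite (le_trans (ler_normB _ _))// (splitr e) lerD.
move=> H; near (0 : R)^'+ => h; exists h; first by near: h; exact: nbhs_right_gt.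
have hH : `[0, T]%classic `<=` [set x | 0 <= x <= T -> Q h x] by near: h.
by move=> s s' sT s'T ss'; apply: (hH s' _ s'T) => //; rewrite /= in_itv/=.
Unshelve. all: by end_near. Qed.

Lemma lebesgue_itvoc a b : a <= b -> leb `]a, b] = (b - a)%:E.
Proof.
rewrite lebesgue_measure_itv/= lte_fin le_eqVlt => /orP[/eqP ->|->] //=.
by rewrite ltxx subrr.
Qed.

Lemma Rintegral_cst_itvoc a b c : a <= b -> \int[leb]_(s in `]a, b]) c = c * (b - a).
Proof.
move=> ab; transitivity (c * fine (leb `]a, b]%classic)); first exact: Rintegral_cst.
by rewrite lebesgue_itvoc.
Qed.

Lemma Rintegral_increment_le f (c K a b T : R) : 0 <= a -> a <= b -> b <= T ->
  leb.-integrable `[0, T] (EFin \o f) -> (forall s, a <= s <= b -> `|f s - c| <= K) ->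
  `|\int[leb]_(s in `[0, b]) f s - \int[leb]_(s in `[0, a]) f s - (b - a) * c| <= K * (b - a).
Proof.
move=> a0 ab bT fi fK.
have fib : leb.-integrable `[0, b] (EFin \o f).
  by apply: integrableS fi => //; apply: subset_itvl; rewrite bnd_simp.
rewrite Rintegral_itvB//; [|by rewrite bnd_simp..].
have fio : leb.-integrable `]a, b] (EFin \o f).
  apply: integrableS fib => // s /=; rewrite !in_itv/= => /andP[h1 ->]; rewrite andbT.
  by rewrite (le_trans a0)// ltW.
have ic (k : R) : leb.-integrable `]a, b] (EFin \o (fun=> k)).
  apply/integrableP; split; first exact/measurable_EFinP/measurable_cst.
  by rewrite /= integral_cst//= lebesgue_itvoc// -EFinM ltry.
have mab : measurable (`]a, b]%classic : set (measurableTypeR R)) by exact: measurable_itv.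
rewrite [(b - a) * c]mulrC -(Rintegral_cst_itvoc c ab) -(Rintegral_cst_itvoc K ab).
rewrite -(RintegralB mab fio (ic c)).
have ifc := integrableB mab fio (ic c).
apply: (le_trans (le_normr_Rintegral mab ifc)).
apply: (le_Rintegral mab (integrable_norm ifc) (ic K)).
by move=> s /=; rewrite in_itv/= => /andP[h1 h2]; apply: fK; rewrite (ltW h1).
Qed.

End real_line.

(** * The Euler scheme: coupling with a shifted copy, and convergence to the diffusion *)

Section euler.
Context {R : realType} {n : nat}.
Variables (V : 'rV[R]_n -> R) (beta : R).
Hypotheses (hV : smooth V) (b0 : 0 < beta) (hC : CurvBdd beta V).
Implicit Types (h : R) (x y z v : 'rV[R]_n).
Local Notation leb := (@lebesgue_measure R).

Definition euler h (x : 'rV[R]_n * 'rV[R]_n) : 'rV[R]_n :=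
  x.1 - h *: grad V x.1 + Num.sqrt 2 *: x.2.

Lemma measurable_partial i : measurable_fun setT (partial i V).
Proof. by apply: continuous_measurable_rV; exact: (smooth_C1 hV i).2. Qed.

Lemma measurable_euler h : measurable_fun setT (euler h).
Proof.
apply: measurable_fun_rV => i.
have -> : (fun q : ('rV[R]_n * 'rV[R]_n)%type => euler h q 0 i) =
    (fun q => q.1 0 i - h * partial i V q.1 + Num.sqrt 2 * q.2 0 i).
  by apply/funext => q; rewrite !mxE.
have m1 : measurable_fun setT (fun q : 'rV[R]_n * 'rV[R]_n => q.1) by exact: measurable_fst.
have m2 : measurable_fun setT (fun q : 'rV[R]_n * 'rV[R]_n => q.2) by exact: measurable_snd.
apply: measurable_funD.
  apply: measurable_funB; first exact: measurableT_comp (measurable_coord i) m1.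
  by apply: measurable_funM => //; exact: measurableT_comp (measurable_partial i) m1.
by apply: measurable_funM => //; exact: measurableT_comp (measurable_coord i) m2.
Qed.

Lemma partial_lipschitz i y z : `|partial i V y - partial i V z| <= beta * \sum_j `|y 0 j - z 0 j|.
Proof.
have := coord_le_euclid_norm (grad V y - grad V z) i; rewrite !mxE => /le_trans; apply.
rewrite (le_trans (grad_lipschitz hV b0 _ _ hC))// ler_pM2l//.
rewrite (le_trans (euclid_norm_le_sum _))//; apply: ler_sum => j _.
by rewrite !mxE.
Qed.

Section harnack.
Context {dO : measure_display} {Omega : measurableType dO} {P : probability Omega R}.
Variable B : R -> {RV P >-> 'rV[R]_n}.
Hypothesis hB : brownian B.

Definition euler_chain h x m : Omega -> 'rV[R]_n := chain (grid_incr B h) (fun=> euler h) x m.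

Lemma measurable_euler_chain h x m : measurable_fun setT (euler_chain h x m).
Proof.
apply: measurable_chain; first exact: measurable_grid_incr.
by move=> _; exact: measurable_euler.
Qed.

(** At step j the copy shifted by eta_j v has a drift that differs by at most h beta eta_j |v|.
    Bringing the shift to eta_(j+1) v thus asks the noise for a displacement of length at most
    (eta_(j+1) - (1 - h beta) eta_j) |v|, that is [euler_gap] for r = 1 - h beta. *)
Lemma euler_harnack h m p x v (g : 'rV[R]_n -> R) e M : 0 < h -> h * beta < 1 -> (0 < m)%N ->
  1 < p -> 0 < e -> measurable_fun setT g -> (forall y, e <= g y <= M) ->
  (\int[P]_w g (euler_chain h x m w + v)) `^ p <=
  expR (shift_cost beta (m%:R * h) * (p / (p - 1)) * euclid_norm v ^+ 2) *
  \int[P]_w (g (euler_chain h x m w) `^ p).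
Proof.
move=> h0 hb m0 p1 e0 mg gM.
have p0 : 0 < p by rewrite (lt_trans _ p1).
have p10 : 0 < p - 1 by rewrite subr_gt0.
pose r := 1 - h * beta.
have r01 : 0 < r < 1 by rewrite /r subr_gt0 hb/= gtrBl mulr_gt0.
pose eta := euler_shift r m; pose gap := euler_gap r m.
pose theta (j : nat) y : 'rV[R]_n := y + eta j *: v.
pose cost (j : nat) := p / (p - 1) * (gap j * euclid_norm v) ^+ 2 / (4 * h).
have th0 : theta 0%N x = x by rewrite /theta /eta euler_shift0 scale0r addr0.
have thm y : theta m y = y + v by rewrite /theta /eta euler_shiftm// scale1r.
have mth j : measurable_fun setT (theta j) by exact: measurable_rV_addr.
have s20 : 0 < Num.sqrt 2 :> R by rewrite sqrtr_gt0.
have sh0 : Num.sqrt h != 0 by rewrite gt_eqF// sqrtr_gt0.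
have step j y (phi : 'rV[R]_n -> R) e' M' : (j < m)%N -> 0 < e' ->
    measurable_fun [set: 'rV[R]_n] phi -> (forall x, e' <= phi x <= M') ->
    (\int[incr_law B h]_z phi (theta j.+1 (euler h (y, z)))) `^ p <=
    expR (cost j) * \int[incr_law B h]_z (phi (euler h (theta j y, z)) `^ p).
  move=> jm e'0 mphi phiM.
  (* The displacement to be absorbed by the noise, which enters with factor sqrt 2 and has variance
     h per coordinate; hence the 4 h in [cost]. *)
  pose w := (eta j.+1 - eta j) *: v + h *: (grad V (theta j y) - grad V y).
  have mpsi : measurable_fun setT (fun z => phi (euler h (theta j y, z))).
    apply: measurableT_comp mphi _; apply: measurableT_comp (measurable_euler h) _.
    exact: measurable_fun_pair.
  have := gaussian_harnack ((Num.sqrt 2)^-1 *: w) (gaussian_incr_law hB h0) sh0 p1 e'0 mpsi (fun z => phiM _).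
  have -> : \int[incr_law B h]_z phi (euler h (theta j y, z + (Num.sqrt 2)^-1 *: w)) =
     \int[incr_law B h]_z phi (theta j.+1 (euler h (y, z))).
    apply: eq_Rintegral => z _; congr phi.
    rewrite /euler /= scalerDr scalerA mulfV ?gt_eqF// scale1r /w /theta.
    apply/rowP => i; rewrite !mxE; ring.
  move=> /le_trans; apply; rewrite ler_wpM2r//.
    by apply: Rintegral_ge0 => z _; exact: powR_ge0.
  rewrite ler_expR /cost.
  have -> : p / (p - 1) * euclid_norm ((Num.sqrt 2)^-1 *: w) ^+ 2 / (2 * Num.sqrt h ^+ 2) =
     p / (p - 1) * euclid_norm w ^+ 2 / (4 * h).
    rewrite euclid_normZ gtr0_norm ?invr_gt0// exprMn exprVn (sqr_sqrtr (ltW h0)) (sqr_sqrtr (ler0n R 2)).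
    by move: (euclid_norm w) => u; field; rewrite !gt_eqF.
  rewrite ler_pM2r ?invr_gt0 ?mulr_gt0// ler_pM2l ?divr_gt0//.
  have gap0 : 0 <= gap j.
    case/andP: r01 => r0 r1; rewrite /gap /euler_gap.
    apply: divr_ge0; last by apply: ltW; apply: euler_shift_denom => //; rewrite r0.
    apply: mulr_ge0; first by apply: exprn_ge0; exact: ltW.
    by rewrite subr_ge0 exprn_ile1// ltW.
  rewrite lerXn2r ?nnegrE ?euclid_norm_ge0 ?(mulr_ge0 gap0 (euclid_norm_ge0 v))//.
  rewrite (le_trans (ler_euclid_normD _ _))// /gap euler_gapE//.
  have e1 := euler_shift_le r01 jm; have e2 := euler_shift_ge0 r01 m0 (ltnW jm).
  rewrite !euclid_normZ (gtr0_norm h0) (ger0_norm (_ : 0 <= eta j.+1 - eta j)) ?subr_ge0//.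
  have := grad_lipschitz hV b0 y (theta j y) hC.
  have -> : theta j y - y = eta j *: v by rewrite /theta addrC addKr.
  rewrite euclid_normZ (ger0_norm e2) => hl.
  have hl' := ler_wpM2l (ltW h0) hl.
  apply: (le_trans (lerD (lexx _) hl')).
  rewrite le_eqVlt; apply/orP; left; apply/eqP.
  by rewrite /r /eta; ring.
have mF (j : nat) : measurable_fun setT (euler h) by exact: measurable_euler.
have := @chain_harnack _ _ _ _ _ _ R P (incr_law B h) m (grid_incr B h) (fun=> euler h) x
  (measurable_grid_incr B h) mF (@grid_incr_indep _ _ _ _ _ _ hB h m h0) _ _ cost g e M p1 mth step th0 e0 mg gM.
have -> : \int[P]_w g (theta m (chain (grid_incr B h) (fun=> euler h) x m w)) =
    \int[P]_w g (euler_chain h x m w + v).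
  by apply: eq_Rintegral => w _; rewrite thm.
move=> /le_trans; apply; rewrite ler_wpM2r//.
  by apply: Rintegral_ge0 => z _; exact: powR_ge0.
rewrite ler_expR /cost.
have -> : \sum_(j < m) (p / (p - 1) * (gap j * euclid_norm v) ^+ 2 / (4 * h)) =
   (\sum_(j < m) gap j ^+ 2) / (4 * h) * (p / (p - 1)) * euclid_norm v ^+ 2.
  by rewrite !mulr_suml; apply: eq_bigr => j _; rewrite exprMn; move: (p / _) => q; ring.
rewrite ler_wpM2r ?sqr_ge0// ler_wpM2r ?(divr_ge0 (ltW p0) (ltW p10))//.
by rewrite sum_euler_gap//; exact: euler_cost_le.
Qed.

End harnack.

(** A discrete Gronwall argument on one path: [om] bounds the oscillation of the path at scale h,
    and adding it to the error turns the recursion into multiplication by 1 + h n beta. The factor n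
    comes from measuring errors by the sum over coordinates. *)
Lemma euler_close (Xp b : R -> 'rV[R]_n) (S : nat -> 'rV[R]_n) x h T om m :
  0 < h -> 0 <= om ->
  {within `[0, T], continuous Xp} ->
  (forall t, 0 <= t -> forall i, Xp t 0 i =
     x 0 i - \int[leb]_(s in `[0, t]) grad V (Xp s) 0 i + Num.sqrt 2 * b t 0 i) ->
  b 0 = 0 -> S 0%N = x ->
  (forall k, S k.+1 = euler h (S k, b (k.+1%:R * h) - b (k%:R * h))) ->
  (forall s s', 0 <= s <= T -> 0 <= s' <= T -> `|s - s'| <= h ->
     \sum_i `|Xp s 0 i - Xp s' 0 i| <= om) ->
  m%:R * h <= T ->
  \sum_i `|Xp (m%:R * h) 0 i - S m 0 i| + om <= om * (1 + h * (n%:R * beta)) ^+ m.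
Proof.
move=> h0 om0 Xc hX b00 S0 hS hom.
have gi i : leb.-integrable `[0, T] (EFin \o (fun s => grad V (Xp s) 0 i)).
  apply: (@continuous_compact_integrable R (fun s => grad V (Xp s) 0 i)); first exact: segment_compact.
  rewrite (_ : (fun s => _) = partial i V \o Xp); last by apply/funext => s; rewrite /= mxE.
  move=> s; apply: (@continuous_comp (subspace _) _ _ Xp (partial i V) s); first exact: Xc.
  exact: (smooth_C1 hV i).2.
elim: m => [_|m IH mT].
  rewrite mul0r expr0 mulr1 big1 ?add0r// => i _.
  rewrite hX// set_itv1 Rintegral_set1 b00 S0 mxE mulr0 addr0 subr0 subrr normr0//.
have mm : m%:R * h <= m.+1%:R * h by rewrite ler_pM2r// ler_nat.
have {IH}IH := IH (le_trans mm mT).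
set D := \sum_i `|Xp (m%:R * h) 0 i - S m 0 i| in IH.
have D0 : 0 <= D by apply: sumr_ge0.
have step i : `|Xp (m.+1%:R * h) 0 i - S m.+1 0 i| <= `|Xp (m%:R * h) 0 i - S m 0 i| + h * beta * (om + D).
  have a0 : 0 <= m%:R * h by rewrite mulr_ge0// ltW.
  have mT' := le_trans mm mT.
  have hba : m.+1%:R * h - m%:R * h = h by rewrite -mulrBl -natrB// subSnn mul1r.
  pose c := partial i V (Xp (m%:R * h)).
  have gK s : m%:R * h <= s <= m.+1%:R * h -> `|grad V (Xp s) 0 i - c| <= beta * om.
    move=> /andP[s1 s2]; rewrite mxE (le_trans (partial_lipschitz _ _ _))// ler_pM2l//.
    apply: hom; rewrite ?a0 ?mT' ?(le_trans a0 s1) ?(le_trans s2 mT)//.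
    by rewrite ger0_norm ?subr_ge0// -[leRHS]hba lerD2r.
  have := Rintegral_increment_le a0 mm mT (gi i) gK; rewrite hba.
  have -> : Xp (m.+1%:R * h) 0 i - S m.+1 0 i = (Xp (m%:R * h) 0 i - S m 0 i) -
      (\int[leb]_(s in `[0, (m.+1%:R * h)]) grad V (Xp s) 0 i -
       \int[leb]_(s in `[0, (m%:R * h)]) grad V (Xp s) 0 i - h * c) -
      h * (c - partial i V (S m)).
    rewrite hX ?mulr_ge0 ?(ltW h0)// hX// hS /euler !mxE.
    by move: (\int[leb]_(_ in _) _) (\int[leb]_(_ in _) _) => u1 u2; ring.
  move=> hI; rewrite (le_trans (ler_normB _ _))// [h * beta * _]mulrDr [leRHS]addrA lerD//.
    rewrite (le_trans (ler_normB _ _))// lerD2l (le_trans hI)//.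
    by rewrite [beta * om * h]mulrC mulrA.
  rewrite normrM (gtr0_norm h0) -mulrA ler_pM2l//; exact: partial_lipschitz.
rewrite exprS mulrCA; apply: (@le_trans _ _ ((1 + h * (n%:R * beta)) * (D + om))); last first.
  by rewrite ler_wpM2l// addr_ge0// mulr_ge0 ?(ltW h0)// mulr_ge0// ltW.
apply: (@le_trans _ _ (\sum_i (`|Xp (m%:R * h) 0 i - S m 0 i| + h * beta * (om + D)) + om)).
  by rewrite lerD2r; apply: ler_sum => i _; exact: step.
rewrite big_split/= sumr_const card_ord -/D -mulr_natl.
by rewrite le_eqVlt; apply/orP; left; apply/eqP; ring.
Qed.

Section limit.
Context {dO : measure_display} {Omega : measurableType dO} {P : probability Omega R}.
Variables (B : R -> {RV P >-> 'rV[R]_n}) (X : 'rV[R]_n -> R -> {RV P >-> 'rV[R]_n}).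
Hypotheses (hB : brownian B) (hX : langevin_flow B V X).

Lemma heine_cantor_rV (Y : R -> 'rV[R]_n) T (e : R) : {within `[0, T], continuous Y} -> 0 < e ->
  exists2 d : R, 0 < d & forall s s', 0 <= s <= T -> 0 <= s' <= T -> `|s - s'| <= d ->
    \sum_i `|Y s 0 i - Y s' 0 i| <= e.
Proof.
move=> Yc e0; have e1 : 0 < e / (n%:R + 1) by rewrite divr_gt0// ltr_wpDl.
have /choice[d hd] : forall i : 'I_n, exists d : R, 0 < d /\
    forall s s', 0 <= s <= T -> 0 <= s' <= T -> `|s - s'| <= d -> `|Y s 0 i - Y s' 0 i| <= e / (n%:R + 1).
  move=> i.
  have Yic : {within `[0, T], continuous (fun s => Y s 0 i)}.
    move=> s; apply: (@continuous_comp (subspace _) _ _ Y (fun y => y 0 i) s); first exact: Yc.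
    exact: coord_continuous.
  by have [d d0 h] := heine_cantor Yic e1; exists d.
exists (\big[Num.min/1]_i d i).
  by elim/big_ind: _ => // [a b a0 b0'|i _]; [rewrite lt_min a0|exact: (hd i).1].
move=> s s' sT s'T ss'.
apply: (@le_trans _ _ (\sum_(i < n) e / (n%:R + 1))).
  apply: ler_sum => i _; apply: (hd i).2 => //; apply: (le_trans ss').
  by rewrite (bigD1 i)//= ge_min lexx.
rewrite sumr_const card_ord -[leLHS]mulr_natl mulrCA ger_pMr// ler_pdivrMr ?ltr_wpDl//.
by rewrite mul1r lerDl.
Qed.

(** Uniform continuity of almost every path makes [om] small, while the Gronwall factor stays below
    exp(t n beta). The offset [N0] leaves room to have h beta < 1 for every k. *)
Lemma euler_cvg x t N0 (f : 'rV[R]_n -> R) : 0 < t -> continuous f ->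
  let h k : R := t / (k + N0).+1%:R in
  {ae P, forall w, (fun k => f (euler_chain B (h k) x (k + N0).+1 w)) @ \oo --> f (X x t w)}.
Proof.
move=> t0 fc h; have [[cX _ eX] _] := hX x; have [B0 _ _ _] := hB.
near=> w.
have Xc : {within `[0, t], continuous (fun s => X x s w)}.
  apply: continuous_subspaceW; last by near: w; exact: cX.
  by move=> s /=; rewrite in_itv/= => /andP[].
have Xe : forall t, 0 <= t -> forall i, X x t w 0 i =
     x 0 i - \int[leb]_(s in `[0, t]) grad V (X x s w) 0 i + Num.sqrt 2 * B t w 0 i.
  by near: w; exact: eX.
have Bw : B 0 w = 0 by near: w; exact: B0.
apply/cvgrPdist_le => e e0.
have [r r0 hr] := continuous_box (fc (X x t w)) e0.
pose L := expR (t * (n%:R * beta)).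
have L0 : 0 < L by exact: expR_gt0.
have om0 : 0 < r / L by rewrite divr_gt0.
have [d d0 hd] := heine_cantor_rV Xc om0.
near=> k.
have m0 : 0 < (k + N0).+1%:R :> R by rewrite ltr0n.
have h0 : 0 < h k by rewrite divr_gt0.
have mh : (k + N0).+1%:R * h k = t by rewrite /h mulrCA mulfV ?gt_eqF// mulr1.
have hkd : h k <= d.
  rewrite /h ler_pdivrMr// mulrC -ler_pdivrMr//.
  have : t / d < k%:R by near: k; exact: nbhs_infty_gtr.
  by move=> /ltW /le_trans; apply; rewrite ler_nat (leq_trans (leq_addr N0 k)).
have := @euler_close (fun s => X x s w) (fun s => B s w) (fun m => euler_chain B (h k) x m w) x (h k) t (r / L)
  (k + N0).+1 h0 (ltW om0) Xc Xe Bw erefl (fun m => erefl) _ _.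
rewrite mh => /(_ _ (lexx t)) H.
rewrite distrC; apply: hr => i.
have {}H := H _.
have : \sum_i `|X x t w 0 i - euler_chain B (h k) x (k + N0).+1 w 0 i| <= r.
  apply: (@le_trans _ _ (r / L * (1 + h k * (n%:R * beta)) ^+ (k + N0).+1)).
    rewrite -[leLHS]addr0 (le_trans _ (H _))//; first by rewrite lerD2l ltW.
    by move=> s s' sT s'T ss'; apply: hd => //; exact: le_trans ss' hkd.
  rewrite -[leRHS](divfK (lt0r_neq0 L0)) ler_pM2l//.
  apply: (@le_trans _ _ (expR (h k * (n%:R * beta)) ^+ (k + N0).+1)).
    rewrite lerXn2r ?nnegrE ?expR_ge0 ?expR_ge1Dx// addr_ge0// mulr_ge0 ?(ltW h0)// mulr_ge0// ltW//.
  by rewrite -expRM_natr mulrAC [h k * _]mulrC mh.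
apply: le_trans; rewrite distrC (bigD1 i)//= lerDl; exact: sumr_ge0.
Unshelve. all: by end_near. Qed.

(** The final time m h of the scheme is t for every k, so the constant does not move along the
    limit; for bounded continuous functions pathwise convergence gives convergence of both
    integrals. *)
Lemma CurvBdd_tame_harnack x v t p : 0 < t -> 1 < p ->
  tame_harnack (law X x t) (convolution (law X x t) (\d_v)) p
    (expR (shift_cost beta t * (p / (p - 1)) * euclid_norm v ^+ 2)).
Proof.
move=> t0 p1 g tg [e e0 eg].
have p0 : 0 < p by rewrite (lt_trans _ p1).
have [M M0 gM'] := tame_bounded tg.
have gM y : e <= g y <= M by rewrite eg (le_trans (ler_norm _)).
have g0 y : 0 <= g y by rewrite (le_trans (ltW e0)).
have mg := tame_measurable tg.
pose N0 := Num.bound (t * beta).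
have N0E : t * beta < N0%:R by apply: archi_boundP; rewrite mulr_ge0// ltW.
pose m k := (k + N0).+1; pose h k : R := t / (m k)%:R.
have m0 k : 0 < (m k)%:R :> R by rewrite ltr0n.
have h0 k : 0 < h k by rewrite divr_gt0.
have mh k : (m k)%:R * h k = t by rewrite /h mulrCA mulfV ?gt_eqF// mulr1.
have hb k : h k * beta < 1.
  rewrite /h mulrAC ltr_pdivrMr// mul1r (lt_le_trans N0E)// ler_nat.
  by rewrite (leq_trans (leq_addl k N0)).
pose S k := euler_chain B (h k) x (m k).
have mS k : measurable_fun setT (S k) by exact: measurable_euler_chain.
have lim (f : 'rV[R]_n -> R) : tame f ->
    (fun k => \int[P]_w f (S k w)) @ \oo --> \int[P]_w f (X x t w).
  move=> tf; have [K K0 fK] := tame_bounded tf; have mf := tame_measurable tf.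
  apply: (@Rintegral_dominated_cvg _ _ _ P (fun k w => f (S k w)) _ (cst K)).
  - by move=> k; exact: measurableT_comp mf (mS k).
  - exact: measurableT_comp mf _.
  - exact: euler_cvg t0 (tame_continuous tf).
  - exact: finite_measure_integrable_cst.
  - by move=> k w.
have tgv := tame_shift v tg.
have tgp : tame (fun y => g y `^ p) by exact: tame_powR e0 eg tg.
have El (f : 'rV[R]_n -> R) : tame f -> \int[law X x t]_y f y = \int[P]_w f (X x t w).
  by move=> tf; rewrite -Psgr_tame// /Psgr PsgE.
rewrite (@Rintegral_conv_dirac _ _ (law X x t) v g M mg); last by move=> y; rewrite g0/=; case/andP: (gM y).
rewrite (El _ tgv) (El _ tgp).
have L1 := powR_cvg p0 _ (lim _ tgv).
apply: (ler_cvg_to (L1 _)).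
- by move=> k; apply: Rintegral_ge0 => w _; exact: g0.
- by apply: cvgM; [exact: cvg_cst|exact: lim tgp].
apply: nearW => k.
have := euler_harnack hB x v (h0 k) (hb k) (ltn0Sn _ : (0 < m k)%N) p1 e0 mg gM.
by rewrite mh.
Qed.

Lemma CurvBdd_SH p : 1 < p -> SH X beta p.
Proof.
move=> p1; apply/SHP => // x v t t0; apply: tame_harnack_harnack => //.
exact: CurvBdd_tame_harnack.
Qed.

End limit.

End euler.

(** * Short-time expansion of the diffusion *)

Section exponential_bounds.
Context {R : realType}.
Implicit Types (x y r s : R).

Lemma expR_ge_quad y : 0 <= y -> 1 + y + y ^+ 2 / 2 <= expR y.
Proof.
move=> y0; have c := is_cvg_series_exp_coeff y.
have -> : 1 + y + y ^+ 2 / 2 = series (exp_coeff y) 3.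
  rewrite /series/= !big_nat_recr//= big_geq// /exp_coeff/= !fact0 expr0 expr1.
  by rewrite add0r !divr1.
apply: nondecreasing_cvgn_le => //.
apply: nondecreasing_series => k _ _; exact: exp_coeff_ge0.
Qed.

Lemma expRN_le_quad y : 0 <= y -> expR (- y) <= 1 - y + y ^+ 2 / 2.
Proof.
move=> y0; have h := expR_ge_quad y0; have e0 := expR_gt0 y.
rewrite expRN -[leLHS]mul1r ler_pdivrMr//.
have p0 : 0 <= 1 - y + y ^+ 2 / 2 by nra.
apply: le_trans (ler_wpM2l p0 h); rewrite -subr_ge0.
have -> : (1 - y + y ^+ 2 / 2) * (1 + y + y ^+ 2 / 2) - 1 = (y ^+ 2) ^+ 2 / 4 by field.
by rewrite divr_ge0// sqr_ge0.
Qed.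

(** A form of the expansion 1 / (1 - exp(- y)) = 1 / y + 1 / 2 + O(y) at y = 2 beta t. The term 1 /
    2 produces beta / 4, from which the curvature bound is read off. *)
Lemma shift_cost_sqr_le (beta t : R) : 0 < beta -> 0 < t -> 2 * beta * t <= 1 ->
  shift_cost beta t * t ^+ 2 <= t / 4 + beta * t ^+ 2 / 4 + beta ^+ 2 * t ^+ 3.
Proof.
move=> b0 t0 h; set y := 2 * beta * t in h *.
have y0 : 0 < y by rewrite !mulr_gt0.
have he := expRN_le_quad (ltW y0).
have d0 : 0 < y - y ^+ 2 / 2 by nra.
have d1 : y - y ^+ 2 / 2 <= 1 - expR (- y) by lra.
have i1 : (1 - expR (- y))^-1 <= y^-1 + 2^-1 + y.
  rewrite -[leLHS]mul1r ler_pdivrMr ?(lt_le_trans d0)//.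
  apply: (@le_trans _ _ ((y^-1 + 2^-1 + y) * (y - y ^+ 2 / 2))).
    have -> : (y^-1 + 2^-1 + y) * (y - y ^+ 2 / 2) = 1 + y ^+ 2 * (3 / 4 - y / 2).
      by field; rewrite gt_eqF.
    by rewrite lerDl mulr_ge0 ?sqr_ge0//; lra.
  by rewrite ler_pM2l// !addr_gt0 ?invr_gt0.
rewrite /shift_cost -/y invfM.
have -> : beta * (2^-1 * (1 - expR (- y))^-1) * t ^+ 2 = beta * t ^+ 2 / 2 * (1 - expR (- y))^-1.
  by generalize ((1 - expR (- y))^-1) => u; field.
apply: (@le_trans _ _ (beta * t ^+ 2 / 2 * (y^-1 + 2^-1 + y))).
  by rewrite ler_wpM2l// divr_ge0// mulr_ge0 ?sqr_ge0// ltW.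
rewrite le_eqVlt; apply/orP; left; apply/eqP; rewrite /y; field.
by rewrite !gt_eqF.
Qed.

Lemma expR_le_quad x : x <= 2^-1 -> expR x <= 1 + x + 2 * x ^+ 2.
Proof.
move=> x1; have h := expR_ge1Dx (- x).
have d0 : 0 < 1 - x by lra.
have : expR x <= (1 - x)^-1 by rewrite -[expR x]opprK -[x in leLHS]opprK expRN opprK lef_pV2 ?posrE ?expR_gt0.
move/le_trans; apply; rewrite -[leLHS]mul1r ler_pdivrMr//.
rewrite -subr_ge0.
have -> : (1 + x + 2 * x ^+ 2) * (1 - x) - 1 = x ^+ 2 * (1 - 2 * x) by ring.
by rewrite mulr_ge0 ?sqr_ge0//; lra.
Qed.

(** The coefficient of r is - 1 rather than - exp y, at the price of an error of order |y| |r|. To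
    first order only the mean of r then matters, and it occurs on both sides of (SH_log). *)
Lemma expR_sub_le y r : `|y| <= 2^-1 -> `|r| <= 2^-1 ->
  expR (y - r) <= expR y - r + 2 * `|y| * `|r| + 4 * r ^+ 2.
Proof.
rewrite !ler_norml => /andP[y1 y2] /andP[r1 r2].
have hy := expR_le_quad y2; have hy' := expR_ge1Dx y.
have hr : expR (- r) <= 1 + - r + 2 * (- r) ^+ 2 by apply: expR_le_quad; lra.
rewrite expRD; apply: (le_trans (ler_wpM2l (expR_ge0 y) hr)).
have e2 : expR y <= 2 by nra.
have hn : `|(expR y - 1) * r| <= 2 * `|y| * `|r|.
  rewrite normrM ler_wpM2r// ler_norml; have := ler_norm y; have := ler_norm (- y).
  by rewrite normrN => n1 n2; apply/andP; split; nra.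
have := ler_norm (- ((expR y - 1) * r)); rewrite normrN => hn'.
have := ler_wpM2r (sqr_ge0 r) e2; move: hn hn' hy hy' e2; move: (expR y) => E.
rewrite sqrrN; lra.
Qed.

End exponential_bounds.

(* The increments of [b] at scale [h / 32 ^ m] are at most [e / 4 ^ m]; each
   refinement of the grid adds at most 31 of them. *)
Section chaining.
Context {R : realType}.
Variables (b : R -> R) (p0 h e : R).
Hypotheses (h0 : 0 < h) (p00 : 0 <= p0) (e0 : 0 <= e).
Hypothesis bc : {within [set s | 0 <= s], continuous b}.
Let pt (m i : nat) := p0 + i%:R * (h / 32 ^+ m).
Hypothesis binc : forall m i, (i < 32 ^ m)%N -> `|b (pt m i.+1) - b (pt m i)| <= e / 4 ^+ m.

Let walk m i r : (i + r <= 32 ^ m)%N -> `|b (pt m (i + r)) - b (pt m i)| <= r%:R * (e / 4 ^+ m).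
Proof.
elim: r => [|r IH] ir; first by rewrite addn0 subrr normr0 mul0r.
rewrite addnS in ir *; have h1 := binc ir; have h2 := IH (ltnW ir).
rewrite -natr1 mulrDl mul1r.
rewrite (_ : _ - _ = (b (pt m (i + r)) - b (pt m i)) + (b (pt m (i + r).+1) - b (pt m (i + r)))); last by ring.
by rewrite (le_trans (ler_normD _ _))// lerD.
Qed.

(** Induction on the level: 12 exceeds the total 1 + 31 (1/4 + 1/16 + ...) of the increments, and
    the form 12 - 11 / 4^m leaves room for 31 / 4^(m+1) at the next refinement. *)
Let grid m i : (i <= 32 ^ m)%N -> `|b (pt m i) - b p0| <= e * (12 - 11 / 4 ^+ m).
Proof.
elim: m i => [|m IH] i im.
  rewrite expn0 in im; have := @walk 0 0 i; rewrite add0n => /(_ im).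
  rewrite {2}/pt mul0r addr0 !expr0 !divr1 => /le_trans; apply.
  rewrite (_ : 12 - 11 = 1 :> R); last by ring.
  have i1 : i%:R <= 1 :> R by rewrite (ler_nat R i 1).
  by rewrite mulr1; exact: ler_piMl.
have mod32 : (i %% 32 < 32)%N by rewrite ltn_mod.
have iE := divn_eq i 32.
set q := (i %/ 32)%N in iE; set r := (i %% 32)%N in mod32 iE.
have qm : (q <= 32 ^ m)%N by rewrite -(leq_pmul2r (ltn0Sn 31)) -expnSr (leq_trans _ im)// iE leq_addr.
have ptE : pt m.+1 (q * 32) = pt m q.
  by rewrite /pt natrM exprS; congr (_ + _); field; rewrite expf_neq0.
have hq := IH q qm; rewrite -ptE in hq.
have hr : `|b (pt m.+1 i) - b (pt m.+1 (q * 32))| <= r%:R * (e / 4 ^+ m.+1).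
  by rewrite iE; apply: walk; rewrite -iE.
rewrite (_ : _ - _ = (b (pt m.+1 (q * 32)) - b p0) + (b (pt m.+1 i) - b (pt m.+1 (q * 32)))); last by ring.
rewrite (le_trans (ler_normD _ _))//; apply: (le_trans (lerD hq hr)).
have r31 : r%:R <= 31 :> R by rewrite ler_nat -ltnS.
have u0 : 0 <= e / 4 ^+ m.+1 by rewrite divr_ge0// exprn_ge0.
have -> : e * (12 - 11 / 4 ^+ m) = e * 12 - 44 * (e / 4 ^+ m.+1).
  by rewrite exprS; field; rewrite expf_neq0.
have -> : e * (12 - 11 / 4 ^+ m.+1) = e * 12 - 11 * (e / 4 ^+ m.+1) by ring.
have {r31} : r%:R * (e / 4 ^+ m.+1) <= 31 * (e / 4 ^+ m.+1) by exact: ler_wpM2r.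
lra.
Qed.

Lemma chaining_bound s : p0 <= s <= p0 + h -> `|b s - b p0| <= 12 * e.
Proof.
move=> /andP[s1 s2].
(* The last grid point of level m that is not after s; continuity carries the bound over to s. *)
pose i m := Num.truncn ((s - p0) / (h / 32 ^+ m)).
have hm m : 0 < h / 32 ^+ m by rewrite divr_gt0// exprn_gt0.
have x0 m : 0 <= (s - p0) / (h / 32 ^+ m) by rewrite divr_ge0 ?subr_ge0// ltW.
have i1 m : (i m)%:R * (h / 32 ^+ m) <= s - p0 by rewrite -ler_pdivlMr// truncn_le.
have i2 m : s - p0 < (i m).+1%:R * (h / 32 ^+ m) by rewrite -ltr_pdivrMr// truncnS_gt.
have i3 m : (i m <= 32 ^ m)%N.
  rewrite -(ler_nat R) natrX (le_trans (_ : _ <= (s - p0) / (h / 32 ^+ m)))//; first by rewrite truncn_le.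
  rewrite ler_pdivrMr// mulrCA mulfV ?expf_neq0// mulr1 lerBlDl//.
have cv : (fun m => pt m (i m)) @ \oo --> s.
  have z : (fun m => h * (32^-1) ^+ m) @ \oo --> h * 0.
    by apply: cvgM; [exact: cvg_cst|apply: cvg_expr; rewrite ger0_norm ?invr_ge0// invf_lt1 ?ltr1n].
  rewrite mulr0 in z.
  apply/cvgrPdist_le => d d0; move/cvgrPdist_le : z => /(_ _ d0); apply: filterS => m.
  rewrite sub0r normrN => /(le_trans (ler_norm _)); apply: le_trans.
  have := i1 m; have := i2 m; rewrite -natr1 mulrDl mul1r exprVn /pt.
  generalize ((i m)%:R * (h / 32 ^+ m)); generalize (h / 32 ^+ m) => u2 u1 h2 h1.
  by rewrite ger0_norm; lra.
have bcv : (fun m => b (pt m (i m))) @ \oo --> b s.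
  have ss : [set s | 0 <= s] s by exact: le_trans s1.
  have /subspace_continuousP/(_ _ ss) bs := bc.
  apply: cvg_trans bs.
  move=> U [] d /= d0 hU.
  move/cvgrPdist_lt : cv => /(_ _ d0); apply: filterS => m hm'.
  apply: hU => //=; rewrite /pt addr_ge0// mulr_ge0// ltW//.
have : (fun m => `|b (pt m (i m)) - b p0|) @ \oo --> `|b s - b p0|.
  by apply: cvg_norm; apply: cvgB => //; exact: cvg_cst.
move=> /cvgr_to_le; apply; apply: nearW => m; apply: (le_trans (grid (i3 m))).
by rewrite mulrC ler_wpM2r// gerBl divr_ge0// exprn_ge0.
Qed.

End chaining.

(** * A second-order Taylor bound on a box *)

Section taylor.
Context {R : realType} {n : nat}.
Implicit Types (f : 'rV[R]_n -> R) (x y : 'rV[R]_n).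

Lemma continuous_bounded_box_fin (I : finType) (F : I -> 'rV[R]_n -> R) x (r : R) :
  (forall i, continuous (F i)) -> 0 <= r ->
  exists2 K : R, 0 <= K & forall i z, in_box x r z -> `|F i z| <= K.
Proof.
move=> Fc r0.
have /choice[K hK] : forall i, exists K : R, 0 <= K /\ forall z, in_box x r z -> `|F i z| <= K.
  by move=> i; have [K K0 h] := continuous_bounded_box x (Fc i) r0; exists K.
exists (\sum_i K i); first by apply: sumr_ge0 => i _; exact: (hK i).1.
move=> i z zr; rewrite (le_trans ((hK i).2 z zr))// (bigD1 i)//= lerDl.
by apply: sumr_ge0 => j _; exact: (hK j).1.
Qed.

(** The mean value bound is used twice: for the first partial derivatives, whose increments are then
    linear in the radius, and for f minus its linear part. *)
Lemma taylor_quadratic f x : smooth f ->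
  exists2 C : R, 0 <= C & forall y, in_box x 1 y ->
    `|f y - f x - \sum_j partial j f x * (y 0 j - x 0 j)| <= C * (\sum_j `|y 0 j - x 0 j|) ^+ 2.
Proof.
move=> fs.
have [K K0 hK] := @continuous_bounded_box_fin _ (fun ij : 'I_n * 'I_n => partial ij.1 (partial ij.2 f)) x 1
  (fun ij => smooth_continuous (smooth_partial ij.1 (smooth_partial ij.2 fs))) ler01.
exists (K * n%:R); first by rewrite mulr_ge0.
move=> y y1; set d := \sum_j `|y 0 j - x 0 j|.
have d0 : 0 <= d by apply: sumr_ge0.
(* At most 1, so that the second derivatives are bounded on the box; at most d, to make the
   remainder quadratic; and large enough for the box to contain y. *)
pose r := Num.min d 1.
have r1 : r <= 1 by rewrite ge_min lexx orbT.
have rd : r <= d by rewrite ge_min lexx.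
have r0 : 0 <= r by rewrite le_min d0 ler01.
have yr : in_box x r y.
  move=> j; rewrite le_min y1 andbT /d (bigD1 j)//= lerDl.
  by apply: sumr_ge0.
have xr : in_box x r x by move=> j; rewrite subrr normr0.
pose a j := partial j f x.
pose g := fun z : 'rV[R]_n => f z - \sum_j a j * z 0 j.
have dg z i : is_derive z (delta_mx 0 i) g (partial i f z - a i).
  by apply: is_deriveB; [apply/derivableP/smooth_derivable|exact: derivable_linear].
have pg z i : partial i g z = partial i f z - a i.
  by have := dg z i; rewrite /partial => h; rewrite derive_val.
have bg z i : in_box x r z -> `|partial i g z| <= K * n%:R * r.
  move=> zr; rewrite pg.
  apply: (le_trans (@box_lipschitz _ _ (partial i f) x r K x z _ _ xr zr)).
  - by move=> w j; exact/smooth_derivable/smooth_partial.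
  - by move=> w j wr; apply: (hK (j, i)); exact: in_box_le wr.
  - rewrite -[leRHS]mulrA ler_wpM2l//.
    apply: (@le_trans _ _ (\sum_(i < n) r)); first by apply: ler_sum => j _; exact: zr.
    by rewrite sumr_const card_ord -[leLHS]mulr_natl.
have dgg z i : derivable g z (delta_mx 0 i) by have [] := dg z i.
have := box_lipschitz dgg bg xr yr.
have -> : g y - g x = f y - f x - \sum_j a j * (y 0 j - x 0 j).
  have -> : \sum_j a j * (y 0 j - x 0 j) = \sum_j a j * y 0 j - \sum_j a j * x 0 j.
    by rewrite -sumrB; apply: eq_bigr => j _; rewrite mulrBr.
  by rewrite /g; ring.
move=> /le_trans; apply; rewrite -/d expr2 mulrA ler_wpM2r// ler_wpM2l// mulr_ge0//.
Qed.

End taylor.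

(** * Pathwise estimates on a short time interval *)

Section short_time.
Context {R : realType} {n : nat}.
Local Notation leb := (@lebesgue_measure R).
Variables (V : 'rV[R]_n -> R) (x : 'rV[R]_n) (Xp b : R -> 'rV[R]_n) (t K e1 : R).
Hypotheses (hV : smooth V) (t0 : 0 <= t) (K0 : 0 <= K) (e10 : 0 <= e1).
Hypothesis hK : forall i z, in_box x 1 z -> `|partial i V z| <= K.
Hypothesis Xc : {within `[0, t], continuous Xp}.
Hypothesis hX : forall s, 0 <= s <= t -> forall i, Xp s 0 i =
  x 0 i - \int[leb]_(r in `[0, s]) grad V (Xp r) 0 i + Num.sqrt 2 * b s 0 i.
Hypothesis hb : forall s i, 0 <= s <= t -> `|b s 0 i| <= e1.
Hypothesis small : t * K + Num.sqrt 2 * e1 <= 2^-1.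

Lemma path_integrable (f : 'rV[R]_n -> R) : continuous f ->
  leb.-integrable `[0, t] (EFin \o (f \o Xp)).
Proof.
move=> fc; apply: (@continuous_compact_integrable R (f \o Xp)); first exact: segment_compact.
move=> s; apply: (@continuous_comp (subspace _) _ _ Xp f s); first exact: Xc.
exact: fc.
Qed.

Let drift_le s i : 0 <= s <= t -> (forall r, 0 <= r <= s -> in_box x 1 (Xp r)) ->
  `|\int[leb]_(r in `[0, s]) grad V (Xp r) 0 i| <= t * K.
Proof.
move=> /andP[s0 st] h.
have gi : leb.-integrable `[0, t] (EFin \o (fun s => grad V (Xp s) 0 i)).
  rewrite (_ : (fun s => _) = partial i V \o Xp); last by apply/funext => r; rewrite /= mxE.
  exact: path_integrable (smooth_C1 hV i).2.
have gK r : 0 <= r <= s -> `|grad V (Xp r) 0 i - 0| <= K.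
  by move=> rs; rewrite subr0 mxE; apply: hK; exact: h.
have := Rintegral_increment_le (lexx 0) s0 st gi gK.
rewrite set_itv1 Rintegral_set1 subr0 mulr0 !subr0 => /le_trans; apply.
by rewrite mulrC ler_wpM2r.
Qed.

Let disp_le s i : 0 <= s <= t -> (forall r, 0 <= r <= s -> in_box x 1 (Xp r)) ->
  `|Xp s 0 i - x 0 i| <= t * K + Num.sqrt 2 * e1.
Proof.
move=> st h; rewrite hX// addrAC addrC addrA addrC.
rewrite (_ : _ + _ = Num.sqrt 2 * b s 0 i - \int[leb]_(r in `[0, s]) grad V (Xp r) 0 i); last first.
  by generalize (\int[leb]_(r in `[0, s]) grad V (Xp r) 0 i) => u; ring.
rewrite (le_trans (ler_normB _ _))// addrC lerD ?drift_le//.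
by rewrite normrM ger0_norm ?sqrtr_ge0// ler_wpM2l ?sqrtr_ge0// hb.
Qed.

(** The gradient is bounded only on the box, so leaving it must be excluded. While the path is
    inside, its displacement is at most 1/2; uniform continuity lets it move by at most 1/2 more
    during a further time d, and induction on multiples of d concludes. *)
Lemma path_in_box s : 0 <= s <= t -> in_box x 1 (Xp s).
Proof.
have h1 : 0 < 2^-1 :> R by rewrite invr_gt0.
have [d d0 hd] := heine_cantor_rV Xc h1.
have half r i : 0 <= r <= t -> (forall r', 0 <= r' <= r -> in_box x 1 (Xp r')) -> `|Xp r 0 i - x 0 i| <= 2^-1.
  by move=> st h; exact: le_trans (disp_le _ st h) small.
suff H k : forall r, 0 <= r <= t -> r <= k%:R * d -> in_box x 1 (Xp r).
  move=> st; apply: (H (Num.truncn (s / d)).+1) => //.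
  by rewrite -ler_pdivrMr// ltW// truncnS_gt.
elim: k => [|k IH] {}s st sk i.
  have s0 : s = 0 by apply/eqP; rewrite eq_le (andP st).1 andbT; rewrite mul0r in sk.
  rewrite s0 hX ?lexx ?t0// set_itv1 Rintegral_set1 subr0 addrAC subrr add0r normrM ger0_norm ?sqrtr_ge0//.
  apply: (@le_trans _ _ (Num.sqrt 2 * e1)); first by rewrite ler_wpM2l ?sqrtr_ge0// hb// lexx.
  by rewrite (@le_trans _ _ 2^-1) ?invf_le1 ?ler1n// (le_trans _ small)// lerDr mulr_ge0.
have /andP[s0 st'] := st.
pose r := Num.max 0 (s - d).
have r0 : 0 <= r by rewrite le_max lexx.
have rs : r <= s by rewrite ge_max s0 gerBl ltW.
have rt : 0 <= r <= t by rewrite r0 (le_trans rs).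
have hr : `|Xp r 0 i - x 0 i| <= 2^-1.
  apply: half => // r' /andP[r'0 r'r]; apply: IH; first by rewrite r'0 (le_trans r'r)// (andP rt).2.
  rewrite (le_trans r'r)// ge_max mulr_ge0 ?(ltW d0)//= lerBlDr.
  by rewrite -natr1 mulrDl mul1r in sk.
have sr : `|s - r| <= d.
  by rewrite ger0_norm ?subr_ge0// lerBlDr -lerBlDl le_max lexx orbT.
have := hd s r st rt sr; rewrite (bigD1 i)//= => hsr.
have {hsr} : `|Xp s 0 i - Xp r 0 i| <= 2^-1.
  by rewrite (le_trans _ hsr)// lerDl; apply: sumr_ge0.
rewrite (_ : Xp s 0 i - x 0 i = (Xp s 0 i - Xp r 0 i) + (Xp r 0 i - x 0 i)); last by ring.
by move=> h2; rewrite (le_trans (ler_normD _ _))// (splitr 1) lerD// div1r.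
Qed.

Lemma path_close s i : 0 <= s <= t -> `|Xp s 0 i - x 0 i| <= t * K + Num.sqrt 2 * e1.
Proof.
move=> st; apply: disp_le => // r /andP[r0 rs]; apply: path_in_box.
by rewrite r0 (le_trans rs)// (andP st).2.
Qed.

(** On each mesh interval f(X_s) is replaced by its first-order Taylor polynomial at x, and X_s - x
    by sqrt 2 times the noise at the left end point. The error consists of the quadratic remainder,
    the drift displacement t K and the oscillation [e2] of the noise. *)
Lemma path_integral (f : 'rV[R]_n -> R) (C L tau e2 : R) (N : nat) :
  continuous f -> 0 <= C -> 0 <= e2 -> 0 < tau -> t = N%:R * tau ->
  (forall y, in_box x 1 y ->
    `|f y - f x - \sum_j partial j f x * (y 0 j - x 0 j)| <= C * (\sum_j `|y 0 j - x 0 j|) ^+ 2) ->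
  (forall j, `|partial j f x| <= L) ->
  (forall k s i, (k < N)%N -> k%:R * tau <= s <= k.+1%:R * tau ->
     `|b s 0 i - b (k%:R * tau) 0 i| <= e2) ->
  `|\int[leb]_(s in `[0, t]) f (Xp s) - t * f x
     - tau * \sum_(k < N) \sum_j partial j f x * (Num.sqrt 2 * b (k%:R * tau) 0 j)| <=
  t * (C * (n%:R * (t * K + Num.sqrt 2 * e1)) ^+ 2 + n%:R * (L * (t * K + Num.sqrt 2 * e2))).
Proof.
move=> fc C0 e20 tau0 tN hC hL hb2.
set E := C * _ + _.
pose c k := f x + \sum_j partial j f x * (Num.sqrt 2 * b (k%:R * tau) 0 j).
have close k s : (k < N)%N -> k%:R * tau <= s <= k.+1%:R * tau -> `|f (Xp s) - c k| <= E.
  move=> kN /andP[s1 s2].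
  have s0 : 0 <= s by rewrite (le_trans _ s1)// mulr_ge0// ltW.
  have st : 0 <= s <= t by rewrite s0 (le_trans s2)// tN ler_wpM2r ?(ltW tau0)// ler_nat.
  rewrite (_ : f (Xp s) - c k = (f (Xp s) - f x - \sum_j partial j f x * (Xp s 0 j - x 0 j)) +
     \sum_j partial j f x * (Xp s 0 j - x 0 j - Num.sqrt 2 * b (k%:R * tau) 0 j)); last first.
    have -> : \sum_j partial j f x * (Xp s 0 j - x 0 j - Num.sqrt 2 * b (k%:R * tau) 0 j) =
        \sum_j partial j f x * (Xp s 0 j - x 0 j) - \sum_j partial j f x * (Num.sqrt 2 * b (k%:R * tau) 0 j).
      by rewrite -sumrB; apply: eq_bigr => j _; rewrite mulrBr.
    by rewrite /c; ring.
  rewrite (le_trans (ler_normD _ _))// lerD//.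
    rewrite (le_trans (hC _ (path_in_box st)))// ler_wpM2l// ler_sqr ?nnegrE ?sumr_ge0//; last first.
      by rewrite mulr_ge0// addr_ge0// ?mulr_ge0// sqrtr_ge0.
    apply: (@le_trans _ _ (\sum_(i < n) (t * K + Num.sqrt 2 * e1))).
      by apply: ler_sum => i _; exact: path_close.
    by rewrite sumr_const card_ord -[leLHS]mulr_natl.
  rewrite (le_trans (ler_norm_sum _ _ _))//.
  apply: (@le_trans _ _ (\sum_(i < n) (L * (t * K + Num.sqrt 2 * e2)))); last first.
    by rewrite sumr_const card_ord -[leLHS]mulr_natl.
  apply: ler_sum => j _; rewrite normrM ler_pM//.
  rewrite hX//.
  rewrite (_ : _ - _ = Num.sqrt 2 * (b s 0 j - b (k%:R * tau) 0 j) - \int[leb]_(r in `[0, s]) grad V (Xp r) 0 j); last first.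
    have aux (p q u v : R) : p - q + u - p - v = u - v - q by ring.
    by rewrite mulrBr; exact: aux.
  rewrite (le_trans (ler_normB _ _))// addrC lerD//.
    apply: drift_le => // r /andP[r0 rs]; apply: path_in_box; rewrite r0 (le_trans rs)// (andP st).2//.
  by rewrite normrM ger0_norm ?sqrtr_ge0// ler_wpM2l ?sqrtr_ge0// hb2// s1.
pose I s := \int[leb]_(s in `[0, s]) f (Xp s).
have H m : (m <= N)%N -> `|I (m%:R * tau) - tau * \sum_(k < m) c k| <= m%:R * (tau * E).
  elim: m => [_|m IH mN].
    by rewrite big_ord0 mulr0 !mul0r /I set_itv1 Rintegral_set1 subr0 normr0.
  have a0 : 0 <= m%:R * tau by rewrite mulr_ge0// ltW.
  have ab : m%:R * tau <= m.+1%:R * tau by rewrite ler_pM2r// ler_nat.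
  have bt : m.+1%:R * tau <= t by rewrite tN ler_pM2r// ler_nat.
  have hba : m.+1%:R * tau - m%:R * tau = tau by rewrite -mulrBl -natrB// subSnn mul1r.
  have := Rintegral_increment_le a0 ab bt (path_integrable fc) (close m ^~ mN).
  rewrite hba -/(I _) -/(I _) => h.
  rewrite big_ord_recr/= mulrDr.
  rewrite (_ : _ - _ = (I (m%:R * tau) - tau * \sum_(k < m) c k) + (I (m.+1%:R * tau) - I (m%:R * tau) - tau * c m)); last by ring.
  rewrite (le_trans (ler_normD _ _))// -[in leRHS]natr1 [leRHS]mulrDl mul1r lerD ?IH 1?ltnW//.
  by rewrite [leRHS]mulrC.
have := H N (leqnn N); rewrite mulrA -tN /c => {}H.
have -> : \int[leb]_(s in `[0, t]) f (Xp s) - t * f x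
     - tau * \sum_(k < N) \sum_j partial j f x * (Num.sqrt 2 * b (k%:R * tau) 0 j) =
   I t - tau * \sum_(k < N) (f x + \sum_j partial j f x * (Num.sqrt 2 * b (k%:R * tau) 0 j)).
  rewrite big_split/= sumr_const card_ord -[f x *+ N]mulr_natl /I {2}tN.
  by generalize (\int[leb]_(s in `[0, t]) f (Xp s)) => u; ring.
exact: H.
Qed.

End short_time.

Lemma measurable_superlevel d (T : measurableType d) (R : realType) (f : T -> R) (e : R) :
  measurable_fun setT f -> measurable [set w | e < f w].
Proof.
move=> mf; rewrite (_ : mkset _ = setT `&` f @^-1` `]e, +oo[); first by apply: mf.
by rewrite setTI; apply/seteqP; split=> w; rewrite /= in_itv/= andbT.
Qed.

(** The exponential series dominates its term y^m / m!. *)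
Lemma expRN_le_poly (R : realType) (m : nat) :
  exists2 a : R, 0 <= a & forall y, 0 < y -> expR (- y) <= a / y ^+ m.
Proof.
exists m`!%:R => // y y0; have ym : 0 < y ^+ m by rewrite exprn_gt0.
rewrite expRN -invf_div lef_pV2 ?posrE ?expR_gt0 ?divr_gt0 ?ltr0n ?fact_gt0//.
have c := is_cvg_series_exp_coeff y.
apply: (@le_trans _ _ (series (exp_coeff y) m.+1)).
  rewrite /series/= big_nat_recr//= /exp_coeff/= lerDr.
  by apply: sumr_ge0 => i _; rewrite divr_ge0// exprn_ge0// ltW.
apply: nondecreasing_cvgn_le => //.
by apply: nondecreasing_series => k _ _; apply: exp_coeff_ge0; exact: ltW.
Qed.

(** * Exponential moments and oscillation of Brownian motion *)

Section brownian_estimates.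
Context {R : realType} {n : nat} {dO : measure_display} {Omega : measurableType dO}
  {P : probability Omega R}.
Variable B : R -> {RV P >-> 'rV[R]_n}.
Hypothesis hB : brownian B.

Definition grid_sum (h : R) (l : nat -> 'rV[R]_n) (m : nat) (w : Omega) : R :=
  \sum_(k < m) dotp (l k) (grid_incr B h k w).

Lemma measurable_dotp (l : 'rV[R]_n) : measurable_fun setT (dotp l).
Proof. by apply: measurable_sum => i; apply: measurable_funM => //; exact: measurable_coord. Qed.

Lemma measurable_grid_sum h l m : measurable_fun setT (grid_sum h l m).
Proof.
apply: measurable_sum => k; apply: measurableT_comp (measurable_dotp _) _.
exact: measurable_grid_incr.
Qed.

(** The grid sum is the state of a real chain driven by independent Gaussian increments; each of
    them multiplies the exponential moment by its own factor. *)
Lemma grid_sum_expR h l m : 0 < h ->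
  (\int[P]_w (expR (grid_sum h l m w))%:E =
   (expR ((\sum_(k < m) euclid_norm (l k) ^+ 2) * h / 2))%:E)%E.
Proof.
move=> h0.
pose F (j : nat) (q : R * 'rV[R]_n) : R := q.1 + dotp (l j) q.2.
have mF j : measurable_fun setT (F j).
  apply: measurable_funD; first exact: measurable_fst.
  apply: (measurableT_comp (measurable_dotp (l j))); exact: measurable_snd.
have mxi j : measurable_fun setT (grid_incr B h j) by exact: measurable_grid_incr.
have mex : measurable_fun setT (fun y : R => (expR y)%:E).
  by apply/measurable_EFinP; exact: measurable_expR.
have ex0 (y : R) : (0 <= (expR y)%:E)%E by rewrite lee_fin expR_ge0.
have s0 : Num.sqrt h != 0 by rewrite lt0r_neq0// sqrtr_gt0.
have E (j : nat) : (j <= m)%N -> (\int[P]_w (expR (chain (grid_incr B h) F 0 j w))%:E =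
   (expR ((\sum_(k < j) euclid_norm (l k) ^+ 2) * h / 2))%:E)%E.
  elim: j => [|j IH] jm.
    by rewrite /= big_ord0 !mul0r integral_probability_cst.
  rewrite (@ge0_chain_step _ _ _ _ _ _ R P (incr_law B h) m _ _ _ mxi mF (@grid_incr_indep _ _ _ _ _ _ hB h m h0) _ _ jm mex ex0).
  pose C := expR (euclid_norm (l j) ^+ 2 * h / 2).
  have inner (y : R) : (\int[incr_law B h]_r (expR (F j (y, r)))%:E = C%:E * (expR y)%:E)%E.
    have meu : measurable_fun setT (fun r : 'rV[R]_n => (expR (dotp (l j) r))%:E).
      apply/measurable_EFinP; exact: measurableT_comp (@measurable_expR R) (measurable_dotp _).
    rewrite muleC /C -(sqr_sqrtr (ltW h0)) -(gaussian_expR (l j) (gaussian_incr_law hB h0) s0) sqr_sqrtr ?(ltW h0)//.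
    apply: (etrans _ (ge0_integralZl (incr_law B h) measurableT meu _ _)) => //.
      by apply: eq_integral => r _; rewrite -EFinM -expRD.
  under eq_integral do rewrite inner.
  have mec : measurable_fun setT (fun z => (expR (chain (grid_incr B h) F 0 j z))%:E).
    by apply: measurableT_comp mex _; exact: measurable_chain.
  rewrite (ge0_integralZl P measurableT mec) ?lee_fin ?expR_ge0//.
  rewrite (IH (ltnW jm)) -EFinM -expRD big_ord_recr/=; congr ((expR _)%:E).
  by rewrite addrC -!mulrDl.
rewrite -(E m (leqnn m)); apply: eq_integral => w _; congr ((expR _)%:E).
by elim: m {E} => [|j IH] /=; [rewrite /grid_sum big_ord0|rewrite /F/= -IH /grid_sum big_ord_recr].
Qed.

Lemma grid_sumZ c h l m w : grid_sum h (fun k => c *: l k) m w = c * grid_sum h l m w.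
Proof. by rewrite mulr_sumr; apply: eq_bigr => k _; rewrite dotpZl. Qed.

Lemma grid_sum_expRZ c h l m : 0 < h ->
  (\int[P]_w (expR (c * grid_sum h l m w))%:E =
   (expR (c ^+ 2 * ((\sum_(k < m) euclid_norm (l k) ^+ 2) * h / 2)))%:E)%E.
Proof.
move=> h0; under eq_integral do rewrite -grid_sumZ.
rewrite grid_sum_expR//; congr ((expR _)%:E).
under eq_bigr do rewrite euclid_normZ exprMn real_normK ?num_real//.
by rewrite -mulr_sumr -!mulrA.
Qed.

Definition large_incr (h e : R) (k j : nat) : set Omega :=
  [set w | e < `|nth_coord j (grid_incr B h k w)|].

Lemma measurable_large_incr h e k j : measurable (large_incr h e k j).
Proof.
apply: measurable_superlevel; apply: measurableT_comp => //.
by apply: measurableT_comp (measurable_nth_coord j) _; exact: measurable_grid_incr.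
Qed.

(** Chernoff's bound for both signs, with the parameter r left free to be matched to the scale. *)
Lemma large_incr_le (h e r : R) k j : 0 < h -> 0 < r ->
  (P (large_incr h e k j) <= (2 * expR (r ^+ 2 * h / 2 - r * e))%:E)%E.
Proof.
move=> h0 r0.
have s0 : Num.sqrt h != 0 by rewrite lt0r_neq0// sqrtr_gt0.
have mA : measurable [set z : 'rV[R]_n | e < `|nth_coord j z|].
  by apply: measurable_superlevel; apply: measurableT_comp => //; exact: measurable_nth_coord.
have -> : P (large_incr h e k j) = incr_law B h [set z : 'rV[R]_n | e < `|nth_coord j z|].
  have kh : 0 <= k%:R * h by rewrite mulr_ge0// ltW.
  rewrite -(incr_lawE hB kh h0 mA) /large_incr /grid_incr -natr1 mulrDl mul1r//.
set A := [set z | _]; have G := gaussian_incr_law hB h0.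
pose l : 'rV[R]_n := r *: nth_delta j.
have lE z : dotp l z = r * nth_coord j z.
  rewrite dotpZl /nth_coord /nth_delta; congr (_ * _); case: insubP => [i _ _|_] /=.
    rewrite /dotp (bigD1 i)//= mxE !eqxx mul1r big1 ?addr0// => i' ii'.
    by rewrite mxE (negbTE ii') andbF mul0r.
  by rewrite /dotp big1// => i _; rewrite mxE mul0r.
have ln : euclid_norm l ^+ 2 <= r ^+ 2.
  rewrite sqr_euclid_norm lE /l /nth_coord /nth_delta expr2 ler_pM2l//.
  case: insubP => [i _ _|_] /=; last exact: ltW.
  by rewrite !mxE !eqxx mulr1.
have mex c : measurable_fun setT (fun z : 'rV[R]_n => (expR (dotp (c *: l) z))%:E).
  apply/measurable_EFinP; exact: measurableT_comp (@measurable_expR R) (measurable_dotp _).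
have bound c : c ^+ 2 = 1 -> (\int[incr_law B h]_z (expR (dotp (c *: l) z))%:E <= (expR (r ^+ 2 * h / 2))%:E)%E.
  move=> c1; rewrite (gaussian_expR _ G s0) lee_fin ler_expR (sqr_sqrtr (ltW h0)).
  by rewrite euclid_normZ exprMn real_normK ?num_real// c1 mul1r ler_wpM2r// ler_wpM2r// ltW.
rewrite -(setIT A) -integral_indic//.
apply: (@le_trans _ _ (\int[incr_law B h]_z ((expR (- (r * e)))%:E * ((expR (dotp (1 *: l) z))%:E + (expR (dotp (-1 *: l) z))%:E))))%E.
  apply: ge0_le_integral => //.
  - by apply/measurable_EFinP.
  - by apply: emeasurable_funM => //; exact: emeasurable_funD.
  move=> z _; rewrite -EFinD -EFinM lee_fin indicE.
  case: (boolP (z \in A)) => [|_]; last by rewrite mulr_ge0 ?addr_ge0 ?expR_ge0.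
  rewrite inE /A/= => hz; rewrite (dotpZl 1 l) (dotpZl (-1) l) !lE !mul1r mulN1r mulrDr -!expRD.
  have [z0|z0] := lerP 0 (nth_coord j z).
    rewrite ger0_norm// in hz; rewrite (@le_trans _ _ (expR (- (r * e) + r * nth_coord j z)))//; last by rewrite lerDl expR_ge0.
    by rewrite -expR0 ler_expR addrC -mulrBr mulr_ge0 ?(ltW r0)// subr_ge0 ltW.
  rewrite ltr0_norm// in hz; rewrite (@le_trans _ _ (expR (- (r * e) - r * nth_coord j z)))//; last by rewrite lerDr expR_ge0.
  by rewrite -expR0 ler_expR addrC -mulrN -mulrBr mulr_ge0 ?(ltW r0)// subr_ge0 ltW.
have E0 (c : R) (z : 'rV[R]_n) : [set: 'rV[R]_n] z -> (0 <= (expR (dotp (c *: l) z))%:E)%E.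
  by rewrite lee_fin expR_ge0.
rewrite ge0_integralZl ?lee_fin ?expR_ge0//; last first.
  by move=> z zT; apply: adde_ge0; exact: E0.
  exact: emeasurable_funD.
rewrite ge0_integralD//.
apply: (@le_trans _ _ ((expR (- (r * e)))%:E * ((expR (r ^+ 2 * h / 2))%:E + (expR (r ^+ 2 * h / 2))%:E)))%E.
  rewrite lee_wpmul2l ?lee_fin ?expR_ge0// leeD// bound// ?expr1n// sqrrN expr1n//.
rewrite -EFinD -EFinM lee_fin -mulr2n -[_ *+ 2]mulr_natl mulrCA -expRD [- _ + _]addrC//.
Qed.

Definition dyadic (l : nat) : R := (32 ^+ l)^-1.

Lemma dyadic_gt0 l : 0 < dyadic l.
Proof. by rewrite invr_gt0 exprn_gt0. Qed.

(* An increment over time [32 ^- l] exceeds [4 ^- l] with probability of order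
   [exp (- 2 ^ l / 2)], which is summable over the [32 ^ l] intervals, with room
   to spare. *)
Definition large_incr_level (J r : nat) : set Omega :=
  \big[setU/set0]_(k < 32 ^ r) \big[setU/set0]_(j < n)
    large_incr (dyadic (J + r)) (4 ^+ (J + r))^-1 k j.

Definition large_incr_event (J : nat) : set Omega := \bigcup_r large_incr_level J r.

Lemma measurable_large_incr_level J r : measurable (large_incr_level J r).
Proof.
by apply: bigsetU_measurable => k _; apply: bigsetU_measurable => j _; exact: measurable_large_incr.
Qed.

Lemma measurable_large_incr_event J : measurable (large_incr_event J).
Proof. by apply: bigcup_measurable => r _; exact: measurable_large_incr_level. Qed.

(** The exponential decay is weakened to the eleventh power of 2^(-l): this matches the order
    allowed for the remainder, and it is still summable against the 32^l = (2^l)^5 intervals. *)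
Lemma large_incr_dyadic_le : exists2 c : R, 0 <= c & forall l k j,
  (P (large_incr (dyadic l) (4 ^+ l)^-1 k j) <= (c * (2 ^+ l)^-1 ^+ 11)%:E)%E.
Proof.
have [a a0 ha] := expRN_le_poly R 11.
exists (2 * (a * 2 ^+ 11)); first by apply: mulr_ge0 => //; exact: mulr_ge0 a0 (exprn_ge0 11 (ler0n R 2)).
(* The optimal Chernoff parameter e / h = 32^l / 4^l = 8^l, which gives the exponent - 2^l / 2. *)
move=> l k j; have r0 : 0 < 8 ^+ l :> R by rewrite exprn_gt0.
apply: (le_trans (large_incr_le (4 ^+ l)^-1 k j (dyadic_gt0 l) r0)).
have p2 : 0 < 2 ^+ l :> R by rewrite exprn_gt0.
have e8 : 8 ^+ l = (2 ^+ l) ^+ 3 :> R by rewrite -exprM mulnC exprM; congr (_ ^+ _); ring.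
have e4 : 4 ^+ l = (2 ^+ l) ^+ 2 :> R by rewrite -exprM mulnC exprM; congr (_ ^+ _); ring.
have e32 : dyadic l = ((2 ^+ l) ^+ 5)^-1.
  by rewrite /dyadic -exprM mulnC exprM; congr ((_ ^+ _)^-1); ring.
have -> : (8 ^+ l) ^+ 2 * dyadic l / 2 - 8 ^+ l * (4 ^+ l)^-1 = - (2 ^+ l / 2).
  by rewrite e8 e4 e32; field; rewrite gt_eqF.
rewrite lee_fin -mulrA ler_pM2l// (le_trans (ha _ _)) ?divr_gt0//.
by rewrite expr_div_n invf_div exprVn mulrA.
Qed.

Lemma large_incr_event_le : exists2 C : R, 0 <= C &
  forall J, (P (large_incr_event J) <= (C * (2 ^+ J)^-1 ^+ 11)%:E)%E.
Proof.
have [c c0 hc] := large_incr_dyadic_le.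
exists (2 * (n%:R * c)); first by rewrite mulr_ge0// mulr_ge0.
move=> J; set q := (2 ^+ J)^-1.
have q0 : 0 <= q by rewrite invr_ge0 exprn_ge0.
have D0 : 0 <= 2 * (n%:R * c) * q ^+ 11 by rewrite mulr_ge0 ?exprn_ge0// mulr_ge0// mulr_ge0.
(* The events of this level contribute u^5 u^(-11) = u^(-6) for u = 2^r; weakening this to u^(-1)
   gives the geometric series of [epsilon_trick0]. *)
have level r : (P (large_incr_level J r) <= (2 * (n%:R * c) * q ^+ 11 / (2 ^ r.+1)%:R)%:E)%E.
  apply: (@le_trans _ _ (\sum_(k < 32 ^ r) \sum_(j < n) (c * (2 ^+ (J + r))^-1 ^+ 11)%:E)%E).
    have m1 k j : measurable (large_incr (dyadic (J + r)) (4 ^+ (J + r))^-1 k j) by exact: measurable_large_incr.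
    have m2 k : measurable (\big[setU/set0]_(j < n) large_incr (dyadic (J + r)) (4 ^+ (J + r))^-1 k j).
      by apply: bigsetU_measurable.
    apply: (le_trans (@Boole_inequality _ _ _ P (fun k => \big[setU/set0]_(j < n)
      large_incr (dyadic (J + r)) (4 ^+ (J + r))^-1 k j) (32 ^ r)%N (fun k _ => m2 k))).
    apply: lee_sum => k _; apply: (le_trans (@Boole_inequality _ _ _ P
      (fun j => large_incr (dyadic (J + r)) (4 ^+ (J + r))^-1 k j) n (fun j _ => m1 k j))).
    by apply: lee_sum => j _; exact: hc.
  under eq_bigr do rewrite sumEFin; rewrite sumEFin lee_fin.
  rewrite sumr_const card_ord sumr_const card_ord.
  set u : R := 2 ^+ r; have u1 : 1 <= u by rewrite exprn_ege1// ler1n.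
  have u0 : 0 < u by rewrite (lt_le_trans ltr01).
  have e32 : (32 ^ r)%:R = u ^+ 5 :> R by rewrite natrX -exprM mulnC exprM; congr (_ ^+ _); ring.
  have e2 : (2 ^ r.+1)%:R = u * 2 :> R by rewrite natrX exprSr.
  rewrite -[leLHS]mulr_natl -[X in _ * X <= _]mulr_natl e32 e2 exprD invfM -/u -/q.
  have -> : u ^+ 5 * (n%:R * (c * (q * u^-1) ^+ 11)) = n%:R * c * q ^+ 11 * (u^-1) ^+ 6.
    by field; rewrite gt_eqF.
  have -> : 2 * (n%:R * c) * q ^+ 11 / (u * 2) = n%:R * c * q ^+ 11 * u^-1.
    by field; rewrite gt_eqF.
  rewrite ler_wpM2l ?mulr_ge0 ?exprn_ge0// exprS ger_pMr ?invr_gt0//.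
  by rewrite exprn_ile1 ?invr_ge0 ?(ltW u0)// invf_le1.
apply: (le_trans (@measure_sigma_subadditive _ _ _ P (large_incr_event J) (large_incr_level J)
  (measurable_large_incr_level J) (measurable_large_incr_event J) (fun _ h => h))).
apply: (@le_trans _ _ (\sum_(r <oo) (2 * (n%:R * c) * q ^+ 11 / (2 ^ r.+1)%:R)%:E)%E); last exact: epsilon_trick0.
by apply: lee_nneseries => [r _ _|r _]; [exact: measure_ge0|exact: level].
Qed.

(** [chaining_bound] started at the grid point k of level J + r: the finer increments belong to the
    levels r + m of the same exceptional event, so this one event controls the path at all the
    scales needed. *)
Lemma brownian_oscillation J r k w s i : ~ large_incr_event J w ->
  {within [set t : R | 0 <= t], continuous (fun t => B t w)} -> (k < 32 ^ r)%N ->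
  k%:R * dyadic (J + r) <= s <= k.+1%:R * dyadic (J + r) ->
  `|B s w 0 i - B (k%:R * dyadic (J + r)) w 0 i| <= 12 * (4 ^+ (J + r))^-1.
Proof.
move=> hw Bc kr hs; set p0 := k%:R * _.
have bc : {within [set t : R | 0 <= t], continuous (fun t => B t w 0 i)}.
  move=> t; apply: (@continuous_comp (subspace _) _ _ (fun t => B t w) (fun y => y 0 i) t); first exact: Bc.
  exact: coord_continuous.
have p00 : 0 <= p0 by rewrite mulr_ge0// ltW// dyadic_gt0.
have e0 : 0 <= (4 ^+ (J + r))^-1 :> R by rewrite invr_ge0 exprn_ge0.
have ptE m k' : p0 + k'%:R * (dyadic (J + r) / 32 ^+ m) = (k * 32 ^ m + k')%N%:R * dyadic (J + (r + m)).
  rewrite /p0 /dyadic addnA [32 ^+ (J + r + m)]exprD natrD natrM natrX invfM.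
  by field; rewrite !expf_neq0.
apply: (@chaining_bound _ (fun s => B s w 0 i) p0 (dyadic (J + r)) _ (dyadic_gt0 _) p00 e0 bc) => [m k' k'm|].
  rewrite !ptE addnS -invfM -exprD -addnA.
  have kk : (k * 32 ^ m + k' < 32 ^ (r + m))%N.
    rewrite expnD (@leq_trans (k.+1 * 32 ^ m))%N//; last by rewrite leq_pmul2r ?expn_gt0.
    by rewrite mulSn addnC ltn_add2r.
  rewrite leNgt; apply/negP => h; apply: hw; exists (r + m)%N => //.
  rewrite /large_incr_level -(bigcup_mkord (32 ^ (r + m)) (fun k => \big[setU/set0]_(j < n)
    large_incr (dyadic (J + (r + m))) (4 ^+ (J + (r + m)))^-1 k j)); exists (k * 32 ^ m + k')%N => //=.
  rewrite -(bigcup_mkord n (fun j => large_incr (dyadic (J + (r + m))) (4 ^+ (J + (r + m)))^-1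
    (k * 32 ^ m + k') j)); exists i => //=.
  by rewrite /large_incr/= nth_coordE /grid_incr /incr !mxE.
by move: hs; rewrite -natr1 mulrDl mul1r.
Qed.

End brownian_estimates.

Lemma ler_sum_term (R : numDomainType) (I : finType) (F : I -> R) (i : I) :
  (forall j, 0 <= F j) -> F i <= \sum_j F j.
Proof. by move=> F0; rewrite (bigD1 i)//= lerDl; apply: sumr_ge0. Qed.

(** * Expansion of the diffusion in powers of the scale q *)

Section short_time_expansion.
Context {R : realType} {n : nat}.
Local Notation leb := (@lebesgue_measure R).
Variables (V : 'rV[R]_n -> R) (x a : 'rV[R]_n).
Hypothesis hV : smooth V.

(** The Hessian of [V] at [x] applied to [a]. *)
Definition hess_dir : 'rV[R]_n := \row_j \sum_i a 0 i * partial j (partial i V) x.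

Lemma sqrt2_le2 : Num.sqrt 2 <= 2 :> R.
Proof. by rewrite -[leRHS]ger0_norm// -sqrtr_sqr ler_sqrt//; lra. Qed.

Lemma expr_le_expr (q : R) (i j : nat) : 0 <= q -> q <= 1 -> (j <= i)%N -> q ^+ i <= q ^+ j.
Proof. by move=> q0 q1 ji; rewrite ler_wiXn2l. Qed.

(** Bookkeeping in powers of q at time q^5: the noise is of order q^2 and its oscillation on the
    mesh q^10 of order q^4, so the squared displacement and the mesh error are both of order q^4,
    and integration in time gives q^9. *)
Lemma short_time_expansion : exists2 K : R, 0 <= K & forall (q : R) (N : nat) (Xp b : R -> 'rV[R]_n),
  0 < q -> q <= 1 -> K * q <= 2^-1 -> q ^+ 5 = N%:R * q ^+ 10 ->
  {within `[0, q ^+ 5], continuous Xp} ->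
  (forall s, 0 <= s <= q ^+ 5 -> forall i, Xp s 0 i =
     x 0 i - \int[leb]_(r in `[0, s]) grad V (Xp r) 0 i + Num.sqrt 2 * b s 0 i) ->
  (forall s i, 0 <= s <= q ^+ 5 -> `|b s 0 i| <= 12 * q ^+ 2) ->
  (forall k s i, (k < N)%N -> k%:R * q ^+ 10 <= s <= k.+1%:R * q ^+ 10 ->
     `|b s 0 i - b (k%:R * q ^+ 10) 0 i| <= 12 * q ^+ 4) ->
  `|dotp a (Xp (q ^+ 5) - x)| <= K * q ^+ 2 /\
  `|dotp a (Xp (q ^+ 5) - x) + q ^+ 5 * dotp a (grad V x) -
     Num.sqrt 2 * (dotp a (b (q ^+ 5)) -
       q ^+ 10 * \sum_(k < N) dotp hess_dir (b (k%:R * q ^+ 10)))| <= K * q ^+ 9.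
Proof.
have [K K0 hK] := @continuous_bounded_box_fin _ _ _ (fun i => partial i V) x 1
  (fun i => (smooth_C1 hV i).2) ler01.
have /choice[Cf hCf] : forall i : 'I_n, exists C : R, 0 <= C /\ forall y, in_box x 1 y ->
    `|partial i V y - partial i V x - \sum_j partial j (partial i V) x * (y 0 j - x 0 j)|
    <= C * (\sum_j `|y 0 j - x 0 j|) ^+ 2.
  by move=> i; have [C C0 h] := taylor_quadratic x (smooth_partial i hV); exists C.
pose C := \sum_i Cf i.
have C0 : 0 <= C by apply: sumr_ge0 => i _; exact: (hCf i).1.
have hC i y : in_box x 1 y ->
    `|partial i V y - partial i V x - \sum_j partial j (partial i V) x * (y 0 j - x 0 j)|
    <= C * (\sum_j `|y 0 j - x 0 j|) ^+ 2.
  move=> yx; rewrite (le_trans ((hCf i).2 y yx))// ler_wpM2r ?sqr_ge0//.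
  by apply: ler_sum_term => j; exact: (hCf j).1.
pose L := \sum_i \sum_j `|partial j (partial i V) x|.
have hL i j : `|partial j (partial i V) x| <= L.
  apply: (@le_trans _ _ (\sum_j `|partial j (partial i V) x|)).
    exact: (@ler_sum_term R 'I_n (fun j => `|partial j (partial i V) x|)).
  apply: (@ler_sum_term R 'I_n (fun i => \sum_j `|partial j (partial i V) x|)) => i'.
  exact: sumr_ge0.
have L0 : 0 <= L by apply: sumr_ge0 => i _; apply: sumr_ge0.
pose A := \sum_i `|a 0 i|.
have A0 : 0 <= A by apply: sumr_ge0.
(* The number 24 bounds 12 sqrt 2. *)
pose K1 := K + 24.
have K10 : 0 <= K1 by rewrite addr_ge0.
pose K2 := A * (C * (n%:R * K1) ^+ 2 + n%:R * (L * K1)).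
have K20 : 0 <= K2 by rewrite mulr_ge0// addr_ge0// mulr_ge0 ?sqr_ge0// mulr_ge0.
have AK10 : 0 <= A * K1 by rewrite mulr_ge0.
exists (K1 + A * K1 + K2) => [|q N Xp b q0 q1 small tN Xc hX hb hb2]; first by rewrite !addr_ge0.
have sq2 : Num.sqrt 2 <= 2 :> R := sqrt2_le2.
have t0 : 0 <= q ^+ 5 by rewrite exprn_ge0// ltW.
have q20 : 0 <= q ^+ 2 by rewrite exprn_ge0// ltW.
have q40 : 0 <= q ^+ 4 by rewrite exprn_ge0// ltW.
have rho : q ^+ 5 * K + Num.sqrt 2 * (12 * q ^+ 2) <= K1 * q ^+ 2.
  have h1 : q ^+ 5 * K <= K * q ^+ 2 by rewrite mulrC ler_wpM2l// expr_le_expr// ltW.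
  have h2 : Num.sqrt 2 * (12 * q ^+ 2) <= 2 * (12 * q ^+ 2) by rewrite ler_wpM2r// mulr_ge0.
  by rewrite /K1; lra.
have rho2 : q ^+ 5 * K + Num.sqrt 2 * (12 * q ^+ 4) <= K1 * q ^+ 4.
  have h1 : q ^+ 5 * K <= K * q ^+ 4 by rewrite mulrC ler_wpM2l// expr_le_expr// ltW.
  have h2 : Num.sqrt 2 * (12 * q ^+ 4) <= 2 * (12 * q ^+ 4) by rewrite ler_wpM2r// mulr_ge0.
  by rewrite /K1; lra.
have small' : q ^+ 5 * K + Num.sqrt 2 * (12 * q ^+ 2) <= 2^-1.
  apply: (le_trans rho); apply: le_trans small; apply: ler_pM => //.
    by rewrite -addrA lerDl addr_ge0.
  by rewrite -[leRHS]expr1 expr_le_expr// ltW.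
have e10 : 0 <= 12 * q ^+ 2 by rewrite mulr_ge0.
have e20 : 0 <= 12 * q ^+ 4 by rewrite mulr_ge0.
have tau0 : 0 < q ^+ 10 by rewrite exprn_gt0.
have tt : 0 <= q ^+ 5 <= q ^+ 5 by rewrite t0 lexx.
split.
  rewrite /dotp (le_trans (ler_norm_sum _ _ _))//.
  apply: (@le_trans _ _ (\sum_i `|a 0 i| * (K1 * q ^+ 2))).
    apply: ler_sum => i _; rewrite normrM ler_wpM2l// !mxE (le_trans _ rho)//.
    exact: (path_close hV t0 K0 hK Xc hX hb small' i tt).
  rewrite -mulr_suml -/A mulrA ler_wpM2r// -addrA addrCA lerDl addr_ge0//.
pose I i := \int[leb]_(s in `[0, q ^+ 5]) partial i V (Xp s).
pose S i := \sum_(k < N) \sum_j partial j (partial i V) x * (Num.sqrt 2 * b (k%:R * q ^+ 10) 0 j).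
have hI i := path_integral hV t0 K0 e10 hK Xc hX hb small' (smooth_C1 hV i).2 C0 e20 tau0 tN (hC i) (hL i) hb2.
have -> : dotp a (Xp (q ^+ 5) - x) + q ^+ 5 * dotp a (grad V x) -
     Num.sqrt 2 * (dotp a (b (q ^+ 5)) -
       q ^+ 10 * \sum_(k < N) dotp hess_dir (b (k%:R * q ^+ 10))) =
   \sum_i a 0 i * - (I i - q ^+ 5 * partial i V x - q ^+ 10 * S i).
  have -> : \sum_(k < N) dotp hess_dir (b (k%:R * q ^+ 10)) =
      \sum_i a 0 i * \sum_(k < N) \sum_j partial j (partial i V) x * b (k%:R * q ^+ 10) 0 j.
    under [RHS]eq_bigr do rewrite mulr_sumr; rewrite [RHS]exchange_big/=; apply: eq_bigr => k _.
    under [RHS]eq_bigr do rewrite mulr_sumr; rewrite [RHS]exchange_big/=; apply: eq_bigr => j _.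
    by rewrite mxE mulr_suml; apply: eq_bigr => i _; rewrite mulrA.
  rewrite /dotp !mulr_sumr -sumrB mulr_sumr -big_split -sumrB/=; apply: eq_bigr => i _.
  have -> : S i = Num.sqrt 2 * \sum_(k < N) \sum_j partial j (partial i V) x * b (k%:R * q ^+ 10) 0 j.
    rewrite mulr_sumr; apply: eq_bigr => k _; rewrite mulr_sumr; apply: eq_bigr => j _.
    by rewrite mulrCA.
  have -> : I i = \int[leb]_(s in `[0, q ^+ 5]) grad V (Xp s) 0 i.
    by apply: eq_Rintegral => s _; rewrite mxE.
  rewrite !mxE hX//.
  have aux (a' x' I' s b' t' g' tau' S' : R) : a' * (x' - I' + s * b' - x') + t' * (a' * g') -
     s * (a' * b' - tau' * (a' * S')) = a' * - (I' - t' * g' - tau' * (s * S')) by ring.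
  exact: aux.
rewrite (le_trans (ler_norm_sum _ _ _))//.
have E1 : C * (n%:R * (q ^+ 5 * K + Num.sqrt 2 * (12 * q ^+ 2))) ^+ 2 +
    n%:R * (L * (q ^+ 5 * K + Num.sqrt 2 * (12 * q ^+ 4))) <=
    (C * (n%:R * K1) ^+ 2 + n%:R * (L * K1)) * q ^+ 4.
  have q4E : q ^+ 4 = (q ^+ 2) ^+ 2 by rewrite -exprM.
  rewrite [leRHS]mulrDl lerD//.
    rewrite -[leRHS]mulrA ler_wpM2l// q4E -exprMn.
    rewrite ler_sqr ?nnegrE; last 2 first.
    - by rewrite mulr_ge0// addr_ge0// mulr_ge0// sqrtr_ge0.
    - by rewrite mulr_ge0// mulr_ge0.
    by rewrite -[leRHS]mulrA ler_wpM2l.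
  by rewrite -[leRHS]mulrA ler_wpM2l// -[leRHS]mulrA ler_wpM2l.
apply: (@le_trans _ _ (\sum_i `|a 0 i| * (q ^+ 5 * ((C * (n%:R * K1) ^+ 2 + n%:R * (L * K1)) * q ^+ 4)))).
  apply: ler_sum => i _; rewrite normrM normrN ler_wpM2l//.
  by rewrite (le_trans (hI i))// ler_wpM2l.
rewrite -mulr_suml -/A.
have -> : A * (q ^+ 5 * ((C * (n%:R * K1) ^+ 2 + n%:R * (L * K1)) * q ^+ 4)) = K2 * q ^+ 9.
  by rewrite /K2; ring.
by rewrite ler_wpM2r ?exprn_ge0 ?(ltW q0)// lerDr addr_ge0.
Qed.

(** Summation by parts: the increment of index k occurs in the partial sums of lengths k + 1, ..., m
    - 1, that is m - (k + 1) times. *)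
Lemma dotp_partial_sums (tau : R) (d : nat -> 'rV[R]_n) (m : nat) :
  \sum_(k < m) dotp (Num.sqrt 2 *: (a - (tau * (m - k.+1)%:R) *: hess_dir)) (d k) =
  Num.sqrt 2 * (dotp a (\sum_(k < m) d k) - tau * \sum_(k < m) dotp hess_dir (\sum_(j < k) d j)).
Proof.
have dS u (k : nat) : dotp u (\sum_(j < k) d j) = \sum_(j < k) dotp u (d j).
  elim: k => [|k IH]; first by rewrite !big_ord0 /dotp big1// => i _; rewrite mxE mulr0.
  by rewrite !big_ord_recr/= [LHS]dotpC dotpDl ![dotp _ u]dotpC IH.
elim: m => [|m IH]; first by rewrite !big_ord0 /dotp big1 ?mulr0 ?subr0 ?mulr0// => i _; rewrite mxE mulr0.
rewrite big_ord_recr/= subnn mulr0 scale0r subr0.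
have dB (c : R) (u v : 'rV[R]_n) : dotp (a - c *: u) v = dotp a v - c * dotp u v.
  by rewrite dotpDl -scaleNr dotpZl mulNr.
have E (k : 'I_m) : dotp (Num.sqrt 2 *: (a - (tau * (m.+1 - k.+1)%:R) *: hess_dir)) (d k) =
   dotp (Num.sqrt 2 *: (a - (tau * (m - k.+1)%:R) *: hess_dir)) (d k) - Num.sqrt 2 * tau * dotp hess_dir (d k).
  rewrite (subSn (ltn_ord k)) -[(m - k.+1).+1%:R]natr1 !dotpZl !dB; ring.
under eq_bigr do rewrite E.
rewrite sumrB -mulr_sumr IH dotpZl !dS !big_ord_recr/= dS; ring.
Qed.

End short_time_expansion.

Section weights.
Context {R : realType} {n : nat}.
Implicit Types (a g : 'rV[R]_n).

Lemma sum_rev_nat (m : nat) : \sum_(k < m) (m - k.+1)%:R = m%:R * (m%:R - 1) / 2 :> R.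
Proof.
elim: m => [|m IH]; first by rewrite big_ord0 !mul0r.
rewrite big_ord_recl/= subSS subn0.
under eq_bigr do rewrite /bump/= add1n subSS.
by rewrite IH -[m.+1%:R]natr1; field.
Qed.

(** The left-hand side is half the variance of the discretized U, a Riemann sum for the integral of
    |a - (t - s) g|^2. Only the term in |g|^2 is estimated; the others are exact, including the mesh
    correction t tau. *)
Lemma sum_weights_le a g (t tau : R) (m : nat) : 0 <= tau -> t = m%:R * tau ->
  (\sum_(k < m) euclid_norm (Num.sqrt 2 *: (a - (tau * (m - k.+1)%:R) *: g)) ^+ 2) * tau / 2 <=
  t * euclid_norm a ^+ 2 - (t ^+ 2 - t * tau) * dotp a g + t ^+ 3 * euclid_norm g ^+ 2.
Proof.
move=> tau0 tE.
have nE (c : R) : euclid_norm (Num.sqrt 2 *: (a - c *: g)) ^+ 2 =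
   2 * (euclid_norm a ^+ 2 - 2 * c * dotp a g + c ^+ 2 * euclid_norm g ^+ 2).
  rewrite euclid_normZ exprMn real_normK ?num_real// sqr_sqrtr// !sqr_euclid_norm.
  have dB (c' : R) (u v w : 'rV[R]_n) : dotp (w - c' *: u) v = dotp w v - c' * dotp u v.
    by rewrite dotpDl -scaleNr dotpZl mulNr.
  by rewrite dB ![dotp _ (_ - _)]dotpC !dB [dotp g a]dotpC; ring.
apply: (@le_trans _ _ ((\sum_(k < m) (2 * (euclid_norm a ^+ 2 + (tau * m%:R) ^+ 2 * euclid_norm g ^+ 2)
    - 4 * tau * dotp a g * (m - k.+1)%:R)) * tau / 2)).
  rewrite ler_wpM2r// ler_wpM2r//; apply: ler_sum => k _; rewrite nE.
  have : (tau * (m - k.+1)%:R) ^+ 2 * euclid_norm g ^+ 2 <= (tau * m%:R) ^+ 2 * euclid_norm g ^+ 2.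
    rewrite ler_wpM2r ?sqr_ge0// ler_sqr ?nnegrE ?mulr_ge0// ler_wpM2l// ler_nat leq_subr//.
  by lra.
rewrite sumrB sumr_const card_ord -mulr_sumr sum_rev_nat -[_ *+ m]mulr_natl tE.
by rewrite le_eqVlt; apply/orP; left; apply/eqP; field.
Qed.

End weights.

(** * Expansion of the log-Harnack inequality around a Gaussian variable *)

Section entropy_expansion.
Context d (T : measurableType d) (R : realType).
Variable P : probability T R.
Implicit Types (f g : T -> R).

Lemma Rintegral_affine2 (a b r : R) f g :
  P.-integrable setT (EFin \o f) -> P.-integrable setT (EFin \o g) ->
  P.-integrable setT (EFin \o (fun w => a * f w + b * g w + r)) /\
  \int[P]_w (a * f w + b * g w + r) = a * \int[P]_w f w + b * \int[P]_w g w + r.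
Proof.
move=> fi gi.
have afi : P.-integrable setT (EFin \o (fun w => a * f w)) by exact: (integrableZl measurableT a fi).
have bgi : P.-integrable setT (EFin \o (fun w => b * g w)) by exact: (integrableZl measurableT b gi).
have si : P.-integrable setT (EFin \o (fun w => a * f w + b * g w)) by exact: (integrableD measurableT afi bgi).
have ri : P.-integrable setT (EFin \o (fun w : T => r)) by exact: finite_measure_integrable_cst.
split; first exact: (integrableD measurableT si ri).
by rewrite RintegralD// RintegralD// !RintegralZl// Rintegral_probability_cst.
Qed.

(* [c], [U] and [D] are the truncated [a.(X_t - x)], its Gaussian approximation
   and the deterministic drift term; [N] is the exceptional event.  The
   bound [(expR (- mu * U) - 1) / mu] of [- U] is used in its place, so that only
   exponential moments of [U] are needed. *)
Lemma log_harnack_expansion (c f U : T -> R) (N : set T) (s D mu E M dl kap : R) :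
  measurable_fun setT c -> measurable_fun setT f -> measurable_fun setT U -> measurable N ->
  (forall w, `|c w| <= 1) -> (forall w, `|f w| <= 3) ->
  0 < mu -> mu <= 2^-1 -> 0 <= s -> s <= 1 ->
  (\int[P]_w (expR (U w))%:E = (expR s)%:E)%E ->
  (\int[P]_w (expR (- mu * U w))%:E = (expR (mu ^+ 2 * s))%:E)%E ->
  \int[P]_w f w <= ln (\int[P]_w expR (2 + c w)) + kap ->
  (forall w, expR (c w + D - s) <=
     expR (U w - s) + (expR (- mu * U w) - 1) / mu + c w + D + E + M * \1_N w) ->
  (forall w, 2 + c w + dl - M * \1_N w <= f w) ->
  dl <= s + kap + 2 * mu + E + 2 * M * fine (P N).
Proof.
move=> mc mf mU mN c1 f3 mu0 mu1 s0 s1 EU EmU hlog hpt hf.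
have ci := bounded_integrable P mc c1.
have fi := bounded_integrable P mf f3.
have mI : measurable_fun setT (\1_N : T -> R) by exact: measurable_indic.
have Ii : P.-integrable setT (EFin \o (\1_N : T -> R)).
  by apply: (bounded_integrable P mI (M := 1)) => w; rewrite indicE; case: (w \in N); rewrite ?normr1 ?normr0.
have IN : \int[P]_w (\1_N w : R) = fine (P N) by rewrite /Rintegral integral_indic// setIT.
have mexp (h : T -> R) : measurable_fun setT h -> measurable_fun setT (fun w => expR (h w)).
  by move=> mh; exact: measurableT_comp (@measurable_expR R) mh.
have eUi : P.-integrable setT (EFin \o (fun w => expR (U w))).
  apply: (@ge0_integral_le_integrable _ _ _ _ _ (expR s)); first exact: mexp.
    by move=> w; exact: expR_ge0.
  by rewrite EU.
have emUi : P.-integrable setT (EFin \o (fun w => expR (- mu * U w))).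
  apply: (@ge0_integral_le_integrable _ _ _ _ _ (expR (mu ^+ 2 * s))).
  - by apply: mexp; exact: measurable_funM.
  - by move=> w; exact: expR_ge0.
  - by rewrite EmU.
have eU : \int[P]_w expR (U w) = expR s by rewrite /Rintegral EU.
have emU : \int[P]_w expR (- mu * U w) = expR (mu ^+ 2 * s) by rewrite /Rintegral EmU.
have [i1 E1] := Rintegral_affine2 (expR (- s)) (mu^-1) (- mu^-1 + D + E) eUi emUi.
have [i2 E2] := Rintegral_affine2 1 M 0 ci Ii.
have [i3 E3] := Rintegral_affine2 1 1 0 i1 i2.
have cm : measurable_fun setT (fun w => c w + D - s) by apply: measurable_funB => //; exact: measurable_funD.
pose I := \int[P]_w expR (c w + D - s).
have ii : P.-integrable setT (EFin \o (fun w => expR (c w + D - s))).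
  apply: (@bounded_integrable _ _ _ _ _ (expR (1 + D - s))); first exact: mexp.
  move=> w; rewrite ger0_norm ?expR_ge0// ler_expR lerD2r lerD2r.
  exact: le_trans (ler_norm _) (c1 w).
(* The mean of exp(U - s) is 1, since s is the logarithm of the exponential moment of U; the terms
   in exp(- mu U) contribute at most 2 mu. *)
have HI : I <= 1 + 2 * mu + \int[P]_w c w + D + E + M * fine (P N).
  apply: (@le_trans _ _ (\int[P]_w (1 * (expR (- s) * expR (U w) + mu^-1 * expR (- mu * U w) + (- mu^-1 + D + E))
     + 1 * (1 * c w + M * \1_N w + 0) + 0))).
    apply: le_Rintegral => // w _; apply: (le_trans (hpt w)).
    rewrite expRD [expR (U w) * _]mulrC.
    by rewrite le_eqVlt; apply/orP; left; apply/eqP; field; rewrite gt_eqF.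
  rewrite E3 E1 E2 eU emU IN -expRD addNr expR0.
  have x0 : 0 <= mu ^+ 2 * s by rewrite mulr_ge0 ?sqr_ge0.
  have x1 : mu ^+ 2 * s <= mu ^+ 2 by rewrite ler_piMr ?sqr_ge0.
  have x2 : mu ^+ 2 <= 4^-1 by nra.
  have x3 : expR (mu ^+ 2 * s) <= 1 + mu ^+ 2 * s + 2 * (mu ^+ 2 * s) ^+ 2.
    by apply: expR_le_quad; lra.
  have x4 : mu^-1 * expR (mu ^+ 2 * s) <= mu^-1 + 2 * mu.
    rewrite mulrC ler_pdivrMr// mulrDl mulVf ?gt_eqF//; nra.
  by lra.
(* Centering by D - s makes log I <= I - 1 efficient: D cancels, and the mean of c contained in the
   bound for I cancels against the one in the lower bound for f. *)
have lnE : ln (\int[P]_w expR (2 + c w)) <= 2 - D + s + (I - 1).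
  have I0 : 0 < I.
    apply: (@lt_le_trans _ _ (expR (-1 + D - s))); first exact: expR_gt0.
    rewrite -(Rintegral_probability_cst P (expR (-1 + D - s))); apply: le_Rintegral => //.
      exact: finite_measure_integrable_cst.
    move=> w _; rewrite ler_expR lerD2r lerD2r.
    by have := c1 w; rewrite ler_norml => /andP[].
  have -> : \int[P]_w expR (2 + c w) = expR (2 - D + s) * I.
    rewrite -RintegralZl//; apply: eq_Rintegral => w _; rewrite -expRD; congr expR; ring.
  rewrite lnM ?posrE ?expR_gt0// expRK lerD2l; exact: ln_le_subr1.
have [i4 E4] := Rintegral_affine2 1 (- M) (2 + dl) ci Ii.
have HF : 2 + \int[P]_w c w + dl - M * fine (P N) <= \int[P]_w f w.
  rewrite (_ : 2 + _ + _ - _ = \int[P]_w (1 * c w + - M * \1_N w + (2 + dl))).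
    by apply: le_Rintegral => // w _; apply: le_trans (hf w); rewrite le_eqVlt; apply/orP; left; apply/eqP; ring.
  by rewrite E4 IN; ring.
lra.
Qed.

End entropy_expansion.

Section pointwise.
Context {R : realType}.
Implicit Types (c D s U mu E M : R).

(** No moment of X_t is available, so the linear test function is truncated to [-1, 1]; adding 2
    then makes it positive. *)
Definition clip (r : R) : R := Num.max (-1) (Num.min 1 r).

Lemma clip_bounds r : -1 <= clip r <= 1.
Proof. by rewrite le_max lexx/= ge_max ge_min lexx/= andbT; lra. Qed.

Lemma clipE r : `|r| <= 1 -> clip r = r.
Proof.
rewrite ler_norml => /andP[r1 r2].
by rewrite /clip (min_idPr r2) (max_idPr r1).
Qed.

Lemma measurable_clip d (T : measurableType d) (f : T -> R) :
  measurable_fun setT f -> measurable_fun setT (clip \o f).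
Proof.
by move=> mf; apply: measurable_maxr => //; apply: measurable_minr.
Qed.

Lemma linear_le_expR U mu : 0 < mu -> - U <= (expR (- mu * U) - 1) / mu.
Proof.
move=> mu0; rewrite ler_pdivlMr//.
by have := expR_ge1Dx (- mu * U); lra.
Qed.

(** Off the exceptional event: [expR_sub_le] is used around U - s with increment U - c - D, and the
    resulting - U is replaced by its bound through exp(- mu U). *)
Lemma expR_tilt_good c D s U mu E : 0 < mu -> `|U - s| <= 2^-1 -> `|c + D - U| <= 2^-1 ->
  2 * `|U - s| * `|c + D - U| + 4 * (c + D - U) ^+ 2 <= E ->
  expR (c + D - s) <= expR (U - s) + (expR (- mu * U) - 1) / mu + c + D + E.
Proof.
move=> mu0 h1 h2 h3; have h4 := linear_le_expR U mu0.
have := expR_sub_le h1 (r := U - (c + D)); rewrite distrC => /(_ h2).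
rewrite (_ : U - s - (U - (c + D)) = c + D - s); last by ring.
rewrite (_ : (U - (c + D)) ^+ 2 = (c + D - U) ^+ 2); last by ring.
by lra.
Qed.

(** On the exceptional event U is not controlled, but it cancels between the tangent-line bounds
    exp(U - s) >= 1 + U - s and (exp(- mu U) - 1) / mu >= - U; M makes up for the remaining
    constants. *)
Lemma expR_tilt_bad c D s U mu E M : 0 < mu -> `|c| <= 1 -> `|D| <= 1 -> 0 <= s -> s <= 1 -> 0 <= E ->
  expR 2 + 3 <= M ->
  expR (c + D - s) <= expR (U - s) + (expR (- mu * U) - 1) / mu + c + D + E + M.
Proof.
rewrite !ler_norml => mu0 /andP[c1 c2] /andP[D1 D2] s0 s1 E0 M0.
have h4 := linear_le_expR U mu0; have h5 := expR_ge1Dx (U - s).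
have h6 : expR (c + D - s) <= expR 2 by rewrite ler_expR; lra.
lra.
Qed.

End pointwise.

Lemma dyadicE (R : realType) (J : nat) : dyadic J = (2 ^+ J)^-1 ^+ 5 :> R.
Proof. by rewrite /dyadic exprVn -exprM mulnC exprM; congr ((_ ^+ _)^-1); ring. Qed.

(** * The log-Harnack inequality at the times q^5 with q = 2^(-J) *)

Section dyadic_time.
Context {R : realType} {n : nat} {dO : measure_display} {Omega : measurableType dO}
  {P : probability Omega R}.
Local Notation leb := (@lebesgue_measure R).
Variables (V : 'rV[R]_n -> R) (B : R -> {RV P >-> 'rV[R]_n}) (X : 'rV[R]_n -> R -> {RV P >-> 'rV[R]_n}).
Hypotheses (hV : smooth V) (hB : brownian B) (hX : langevin_flow B V X).
Variables (x a : 'rV[R]_n).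

Definition regular_paths (w : Omega) : Prop :=
  [/\ {within [set t : R | 0 <= t], continuous (fun t => X x t w)},
      {within [set t : R | 0 <= t], continuous (fun t => B t w)}, B 0 w = 0 &
      forall t, 0 <= t -> forall i, X x t w 0 i =
        x 0 i - \int[leb]_(s in `[0, t]) grad V (X x s w) 0 i + Num.sqrt 2 * B t w 0 i].

(** The null set is taken measurable, so that it can be joined to the event of large increments. *)
Lemma ae_regular_paths : exists Z : set Omega,
  [/\ measurable Z, P Z = 0%E & forall w, ~ Z w -> regular_paths w].
Proof.
have [[cX _ eX] _] := hX x; have [B0 _ _ cB] := hB.
have [Z [mZ PZ hZ]] : {ae P, forall w, regular_paths w}.
  by near=> w; split; near: w.
exists Z; split=> // w; apply: contra_notP => h; exact: hZ.
Unshelve. all: by end_near. Qed.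

(* The discretization of [U] with time step [q ^ 10] on [0, q ^ 5] is the sum
   of the scalar products of the increments with these weights. *)
Definition weight (q : R) (J k : nat) : 'rV[R]_n :=
  Num.sqrt 2 *: (a - (q ^+ 10 * (32 ^ J - k.+1)%:R) *: hess_dir V x a).

Lemma dyadic_expansion : exists2 K : R, 0 <= K & forall J w, let q := (2 ^+ J)^-1 in
  K * q <= 2^-1 -> ~ large_incr_event B J w -> regular_paths w ->
  `|dotp a (X x (q ^+ 5) w - x)| <= K * q ^+ 2 /\
  `|dotp a (X x (q ^+ 5) w - x) + q ^+ 5 * dotp a (grad V x)
     - grid_sum B (q ^+ 10) (weight q J) (32 ^ J) w| <= K * q ^+ 9.
Proof.
have [K K0 hK] := short_time_expansion x a hV; exists K => // J w q small hw [cX cB B0 eX].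
have q0 : 0 < q by rewrite invr_gt0 exprn_gt0.
have q1 : q <= 1 by rewrite invf_le1 ?exprn_gt0// exprn_ege1// ler1n.
have d1 : dyadic (J + 0) = q ^+ 5 by rewrite addn0 dyadicE.
have d2 : dyadic (J + J) = q ^+ 10.
  by rewrite dyadicE exprD invfM exprMn -exprD.
have f1 : (4 ^+ (J + 0))^-1 = q ^+ 2.
  by rewrite addn0 exprVn -exprM mulnC exprM; congr ((_ ^+ _)^-1); ring.
have f2 : (4 ^+ (J + J))^-1 = q ^+ 4.
  by rewrite exprD invfM -[in (4 ^+ J)^-1](addn0 J) f1 -exprD.
have tN : q ^+ 5 = (32 ^ J)%N%:R * q ^+ 10.
  rewrite (exprD q 5 5) mulrA natrX -[X in _ = _ * X * _]dyadicE /dyadic.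
  by rewrite mulfV ?mul1r// expf_neq0.
have := hK q (32 ^ J)%N (fun s => X x s w) (fun s => B s w) q0 q1 small tN.
case.
- by apply: continuous_subspaceW cX => s /=; rewrite in_itv/= => /andP[].
- by move=> s /andP[s0 _]; exact: eX.
(* Level r = 0: the single interval [0, q^5]. *)
- move=> s i s5; have := @brownian_oscillation _ _ _ _ _ B J 0 0 w s i hw cB isT.
  by rewrite mul0r mul1r d1 f1 B0 mxE subr0; apply.
(* Level r = J: the mesh intervals of length q^10. *)
- move=> k s i kN; have := @brownian_oscillation _ _ _ _ _ B J J k w s i hw cB kN.
  by rewrite d2 f2; apply.
move=> h1 h2; split => //.
rewrite /grid_sum /weight (dotp_partial_sums V x a (q ^+ 10) (fun k => grid_incr B (q ^+ 10) k w)) sum_grid_incr -tN B0 subr0.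
have E k : \sum_(j < k) grid_incr B (q ^+ 10) j w = B (k%:R * q ^+ 10) w by rewrite sum_grid_incr B0 subr0.
under eq_bigr do rewrite E.
exact: h2.
Qed.

(** The test function is 2 + clip(a.(y - x)) and the shift t u, at t = q^5. The shift raises the
    left-hand side by t a.u, against half the variance of U and the cost on the right; all other
    contributions are O(q^11). *)
Lemma SHlog_dyadic (beta : R) (u : 'rV[R]_n) : SHlog X beta ->
  exists2 C : R, 0 <= C & forall J, let q := (2 ^+ J)^-1 in C * q <= 2^-1 ->
  q ^+ 5 * dotp a u <= q ^+ 5 * euclid_norm a ^+ 2
    - ((q ^+ 5) ^+ 2 - q ^+ 5 * q ^+ 10) * dotp a (hess_dir V x a)
    + (q ^+ 5) ^+ 3 * euclid_norm (hess_dir V x a) ^+ 2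
    + shift_cost beta (q ^+ 5) * ((q ^+ 5) ^+ 2 * euclid_norm u ^+ 2) + C * q ^+ 11.
Proof.
move=> hS; have [K K0 hK] := dyadic_expansion; have [C1 C10 hC1] := large_incr_event_le hB.
have [Z [mZ PZ hZ]] := ae_regular_paths.
pose g := hess_dir V x a; pose A1 := `|dotp a (grad V x)|; pose Au := `|dotp a u|.
pose K4 := euclid_norm a ^+ 2 + `|dotp a g| + euclid_norm g ^+ 2.
have A10 : 0 <= A1 by exact: normr_ge0.
have Au0 : 0 <= Au by exact: normr_ge0.
have K40 : 0 <= K4 by rewrite !addr_ge0 ?sqr_ge0// normr_ge0.
pose Ky := 2 * K + A1 + K4; have Ky0 : 0 <= Ky by rewrite /Ky; lra.
pose E0 := 2 * Ky * K + 4 * K ^+ 2.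
have E00 : 0 <= E0 by have := mulr_ge0 Ky0 K0; have := sqr_ge0 K; rewrite /E0; lra.
pose M : R := expR 2 + 3; have M0 : 0 <= M by have := expR_ge0 (2 : R); rewrite /M; lra.
pose M1 := 2 * M * C1; have M10 : 0 <= M1 by have := mulr_ge0 M0 C10; rewrite /M1; lra.
(* The sum of all the constants, so that C q <= 1/2 implies every smallness condition below and C
   q^11 absorbs every remainder. *)
pose C := 2 + K + A1 + K4 + Au + Ky + E0 + M1.
have C0 : 0 <= C by rewrite /C; lra.
have [oneC KC A1C K4C [AuC KyC]] : [/\ 1 <= C, K <= C, A1 <= C, K4 <= C & Au <= C /\ Ky <= C].
  by rewrite /C; split; [lra|lra|lra|lra|split; lra].
exists C => // J q small.
have q0 : 0 < q by rewrite invr_gt0 exprn_gt0.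
have q1 : q <= 1 by rewrite invf_le1 ?exprn_gt0// exprn_ege1// ler1n.
have qn m : 0 <= q ^+ m by rewrite exprn_ge0// ltW.
have sm k m : 0 <= k -> k <= C -> (0 < m)%N -> k * q ^+ m <= 2^-1.
  move=> k0 kC m0; apply: le_trans small; apply: ler_pM => //.
  by rewrite -[leRHS]expr1 expr_le_expr// ltW.
have half1 : 2^-1 <= 1 :> R by lra.
pose t := q ^+ 5; pose tau := q ^+ 10.
have t0 : 0 < t by rewrite exprn_gt0.
have tau0 : 0 < tau by rewrite exprn_gt0.
have tN : t = (32 ^ J)%N%:R * tau.
  rewrite /tau (exprD q 5 5) mulrA natrX -[X in _ = _ * X * _]dyadicE /dyadic.
  by rewrite mulfV ?mul1r// expf_neq0.
pose U := grid_sum B tau (weight q J) (32 ^ J).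
pose s := (\sum_(k < 32 ^ J) euclid_norm (weight q J k) ^+ 2) * tau / 2.
have s0 : 0 <= s.
  by rewrite /s divr_ge0// mulr_ge0 ?(ltW tau0)//; apply: sumr_ge0 => k _; exact: sqr_ge0.
have sS : s <= t * euclid_norm a ^+ 2 - (t ^+ 2 - t * tau) * dotp a g + t ^+ 3 * euclid_norm g ^+ 2.
  exact: sum_weights_le (ltW tau0) tN.
have t1 : t <= 1 by rewrite exprn_ile1// ltW.
have tau1 : tau <= 1 by rewrite exprn_ile1// ltW.
have taut : tau = t ^+ 2 by rewrite /tau /t -exprM.
have sK4 : s <= K4 * q ^+ 5.
  apply: (le_trans sS); rewrite /K4 -/t.
  have h1 : - ((t ^+ 2 - t * tau) * dotp a g) <= `|dotp a g| * t.
    rewrite -mulNr (le_trans (ler_norm _))// normrM normrN mulrC ler_wpM2l//.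
    by rewrite ger0_norm; [|rewrite subr_ge0]; rewrite taut; nra.
  have h2 : t ^+ 3 * euclid_norm g ^+ 2 <= euclid_norm g ^+ 2 * t.
    by rewrite mulrC ler_wpM2l ?sqr_ge0// -[leRHS]expr1 expr_le_expr// ltW.
  by lra.
pose c w := clip (dotp a (X x t w - x)).
pose v := t *: u.
pose F (y : 'rV[R]_n) : R := 2 + clip (dotp a (y - x)).
pose f w := F (X x t w + v).
pose D := t * dotp a (grad V x).
have mF : measurable_fun setT F.
  apply: measurable_funD => //; apply: measurable_clip; apply: (measurableT_comp (measurable_dotp a)).
  by apply: measurable_rV_sub.
have mX : measurable_fun setT (X x t) by exact: measurable_funPT.
have mc : measurable_fun setT c.
  apply: measurable_clip; apply: (measurableT_comp (measurable_dotp a)).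
  exact: measurable_rV_sub.
have mf : measurable_fun setT f.
  by apply: measurableT_comp mF _; apply: measurableT_comp (measurable_rV_addr v) _.
have mU : measurable_fun setT U by exact: measurable_grid_sum.
have c1 w : `|c w| <= 1 by rewrite ler_norml clip_bounds.
have F13 y : 1 <= F y <= 3.
  by rewrite /F; have /andP[h1 h2] := clip_bounds (dotp a (y - x)); apply/andP; split; lra.
have f3 w : `|f w| <= 3.
  by have /andP[h1 h2] := F13 (X x t w + v); rewrite ger0_norm// (le_trans ler01).
pose N := large_incr_event B J `|` Z.
have mN : measurable N by apply: measurableU => //; exact: measurable_large_incr_event.
have PN : fine (P N) <= C1 * q ^+ 11.
  rewrite -lee_fin fineK ?fin_num_measure//.
  apply: (le_trans (measureU2 _ _ _)) => //; first exact: measurable_large_incr_event.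
  rewrite -[leRHS]adde0 -[X in (_ <= _ + X)%E]PZ; apply: leeD; [exact: hC1|exact: lexx].
(* The parameter mu of [log_harnack_expansion] is q^11, so that the loss 2 mu is among the
   remainders. *)
have mu0 : 0 < q ^+ 11 by rewrite exprn_gt0.
have mu1 : q ^+ 11 <= 2^-1.
  by rewrite -[leLHS]mul1r; exact: sm.
have s1 : s <= 1.
  by apply: (le_trans sK4); apply: le_trans half1; exact: sm.
have EU : (\int[P]_w (expR (U w))%:E = (expR s)%:E)%E by exact: grid_sum_expR.
have EmU : (\int[P]_w (expR (- q ^+ 11 * U w))%:E = (expR ((q ^+ 11) ^+ 2 * s))%:E)%E.
  by rewrite (grid_sum_expRZ hB) ?sqrrN.
pose kap := shift_cost beta t * (t ^+ 2 * euclid_norm u ^+ 2).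
have hlog : \int[P]_w f w <= ln (\int[P]_w expR (2 + c w)) + kap.
  have := hS v t F t0 mF (fun y => lt_le_trans ltr01 (andP (F13 y)).1) x.
  rewrite !PsgE.
  have fi := bounded_integrable P mf f3.
  have mec : measurable_fun setT (fun w => expR (2 + c w)).
    by apply: measurableT_comp (@measurable_expR R) _; exact: measurable_funD.
  have ec3 w : `|expR (2 + c w)| <= expR 3.
    by rewrite ger0_norm ?expR_ge0// ler_expR; have := (andP (clip_bounds (dotp a (X x t w - x)))).2; rewrite -/(c w); lra.
  have eci := bounded_integrable P mec ec3.
  rewrite (integral_Rintegral fi) (integral_Rintegral eci) lne_EFin; last first.
    apply: (@lt_le_trans _ _ (expR 1)); first exact: expR_gt0.
    rewrite -(Rintegral_probability_cst P (expR 1)); apply: le_Rintegral => //.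
      exact: finite_measure_integrable_cst.
    by move=> w _; rewrite ler_expR; have := (andP (clip_bounds (dotp a (X x t w - x)))).1; rewrite -/(c w); lra.
  rewrite -EFinD lee_fin; congr (_ <= _ + _).
  rewrite /kap /shift_cost /v euclid_normZ exprMn real_normK ?num_real//; ring.
have Y0 w : ~ N w -> `|dotp a (X x t w - x)| <= 2^-1.
  move=> hN; have wE : ~ large_incr_event B J w by move=> h; apply: hN; left.
  have wZ : ~ Z w by move=> h; apply: hN; right.
  have small' : K * q <= 2^-1 by rewrite -[q in X in X <= _]expr1; exact: sm.
  have [h1 _] := hK J w small' wE (hZ w wZ).
  by apply: (le_trans h1); exact: sm.
have hD : `|D| <= A1 * q ^+ 5 by rewrite normrM ger0_norm ?(ltW t0)// mulrC.
have D1 : `|D| <= 1.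
  by apply: (le_trans hD); apply: le_trans half1; exact: sm.
have hpt w : expR (c w + D - s) <= expR (U w - s) + (expR (- q ^+ 11 * U w) - 1) / q ^+ 11 + c w + D
    + E0 * q ^+ 11 + M * \1_N w.
  have E110 : 0 <= E0 * q ^+ 11 by rewrite mulr_ge0.
  have [wN|wN] := pselect (N w).
    by rewrite indicE mem_set// mulr1; exact: expR_tilt_bad.
  rewrite indicE memNset// mulr0 addr0.
  have wE : ~ large_incr_event B J w by move=> h; apply: wN; left.
  have wZ : ~ Z w by move=> h; apply: wN; right.
  have small' : K * q <= 2^-1 by rewrite -[q in X in X <= _]expr1; exact: sm.
  have [h1 h2] := hK J w small' wE (hZ w wZ).
  rewrite -/q -/t -/tau -/D -/(U w) in h1 h2.
  have cE : c w = dotp a (X x t w - x).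
    by rewrite /c clipE// (le_trans (Y0 w wN)).
  rewrite -cE in h1 h2.
  have hy : `|U w - s| <= Ky * q ^+ 2.
    have e5 : q ^+ 5 <= q ^+ 2 by rewrite expr_le_expr// ltW.
    have e9 : q ^+ 9 <= q ^+ 2 by rewrite expr_le_expr// ltW.
    have e1 := ler_wpM2l K0 e9; have e2 := ler_wpM2l A10 e5; have e3 := ler_wpM2l K40 e5.
    rewrite (_ : U w - s = - (c w + D - U w) + c w + D - s); last by ring.
    rewrite (le_trans (ler_normB _ _))// (ger0_norm s0).
    have := le_trans (ler_normD (- (c w + D - U w) + c w) D) (lerD (ler_normD _ _) (lexx _)).
    by rewrite normrN /Ky; lra.
  apply: expR_tilt_good => //.
  - by apply: (le_trans hy); exact: sm.
  - by apply: (le_trans h2); exact: sm.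
  - have e1 : `|U w - s| * `|c w + D - U w| <= Ky * K * q ^+ 11.
      rewrite (_ : Ky * K * q ^+ 11 = (Ky * q ^+ 2) * (K * q ^+ 9)); last by ring.
      exact: ler_pM.
    have e2 : (c w + D - U w) ^+ 2 <= K ^+ 2 * q ^+ 11.
      rewrite -real_normK ?num_real// (le_trans (_ : _ <= (K * q ^+ 9) ^+ 2))//.
        by rewrite ler_sqr ?nnegrE// mulr_ge0.
      by rewrite exprMn ler_wpM2l ?sqr_ge0// -exprM expr_le_expr// ltW.
    by rewrite /E0 mulrDl -!mulrA; move: e1 e2; rewrite -!mulrA; lra.
have hdl : `|t * dotp a u| <= 2^-1.
  by rewrite normrM (ger0_norm (ltW t0)) mulrC; exact: sm.
have hf w : 2 + c w + t * dotp a u - M * \1_N w <= f w.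
  have [wN|wN] := pselect (N w).
    rewrite indicE mem_set// mulr1; have := (andP (F13 (X x t w + v))).1; rewrite -/(f w).
    have := c1 w; have := hdl; rewrite !ler_norml => /andP[_ h1] /andP[_ h2].
    by have := expR_ge1Dx (2 : R); rewrite /M; lra.
  rewrite indicE memNset// mulr0 subr0 /f /F -addrA lerD2l.
  have -> : dotp a (X x t w + v - x) = dotp a (X x t w - x) + t * dotp a u.
    by rewrite addrAC dotpC dotpDl dotpZl dotpC [dotp u a]dotpC.
  have h1 := Y0 w wN; rewrite /c clipE; last exact: le_trans h1 half1.
  rewrite clipE// (le_trans (ler_normD _ _))// (splitr 1) div1r lerD//.
have H := log_harnack_expansion mc mf mU mN c1 f3 mu0 mu1 s0 s1 EU EmU hlog hpt hf.
apply: (le_trans H); rewrite -/t -/tau -/g -/kap.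
have e1 : 2 * M * fine (P N) <= M1 * q ^+ 11.
  by rewrite /M1 -[leRHS]mulrA ler_wpM2l// mulr_ge0.
have e2 : (2 + E0 + M1) * q ^+ 11 <= C * q ^+ 11 by rewrite ler_wpM2r// /C; lra.
lra.
Qed.

End dyadic_time.

(** Here [nu] is |u|^2, [Q] the Hessian form at u and [k] the shift cost, for a = u / 2. The terms
    of order q^5 cancel because nu / 2 = nu / 4 + nu / 4; division by q^10 isolates the terms of
    order t^2, with errors of order q. *)
Lemma small_time_limit (R : realType) (beta Q G C nu k q : R) :
  0 < q -> q <= 1 -> 0 <= G -> 0 <= C -> 0 <= nu ->
  k * (q ^+ 5) ^+ 2 <= q ^+ 5 / 4 + beta * (q ^+ 5) ^+ 2 / 4 + beta ^+ 2 * (q ^+ 5) ^+ 3 ->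
  q ^+ 5 * (nu / 2) <= q ^+ 5 * (nu / 4) - ((q ^+ 5) ^+ 2 - q ^+ 5 * q ^+ 10) * (Q / 4)
    + (q ^+ 5) ^+ 3 * G + k * ((q ^+ 5) ^+ 2 * nu) + C * q ^+ 11 ->
  Q <= beta * nu + (`|Q| + 4 * G + 4 * (beta ^+ 2 * nu) + 4 * C) * q.
Proof.
move=> q0 q1 G0 C0 n0 hk h.
have h1 := ler_wpM2r n0 hk.
have q100 : 0 < q ^+ 10 by rewrite exprn_gt0.
have q5 : q ^+ 5 <= q by rewrite -[leRHS]expr1 expr_le_expr// ltW.
have h2 : q ^+ 10 * Q <= q ^+ 10 * (beta * nu + (Q + 4 * G + 4 * (beta ^+ 2 * nu)) * q ^+ 5 + 4 * C * q).
  rewrite -subr_ge0; move: h1 h; rewrite -subr_ge0 => h1; rewrite -subr_ge0 => h.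
  have := addr_ge0 h1 h; rewrite -(pmulr_rge0 _ (ltr0n R 4)).
  by congr (0 <= _); field.
rewrite ler_pM2l// in h2; apply: (le_trans h2); rewrite -addrA lerD2l 3![in leRHS]mulrDl.
rewrite lerD2r 2![in leLHS]mulrDl; apply: lerD; first apply: lerD.
- apply: (le_trans (ler_norm _)); rewrite normrM (ger0_norm (exprn_ge0 5 (ltW q0))).
  by rewrite ler_wpM2l.
- by rewrite ler_wpM2l// mulr_ge0.
- by rewrite ler_wpM2l// mulr_ge0// mulr_ge0// sqr_ge0.
Qed.

(** * The curvature upper bound *)

Section curvature_upper_bound.
Context {R : realType} {n : nat} {dO : measure_display} {Omega : measurableType dO}
  {P : probability Omega R}.
Variables (V : 'rV[R]_n -> R) (B : R -> {RV P >-> 'rV[R]_n}) (X : 'rV[R]_n -> R -> {RV P >-> 'rV[R]_n}).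
Hypotheses (hV : smooth V) (hB : brownian B) (hX : langevin_flow B V X).

Lemma SHlog_CurvUB (beta : R) : 0 < beta -> SHlog X beta -> CurvUB beta V.
Proof.
move=> b0 hS x u; rewrite loewner_scalarEN subr_ge0; set Q := \sum_i _.
(* The maximizer of a.u - |a|^2: its value |u|^2 / 4 equals the leading coefficient of the cost, so
   (SH_log) is sharp at order t and the terms of order t^2 can be compared. *)
pose a := 2^-1 *: u.
have [C C0 hC] := SHlog_dyadic hV hB hX x a u hS.
have au : dotp a u = euclid_norm u ^+ 2 / 2 by rewrite dotpZl sqr_euclid_norm mulrC.
have aa : euclid_norm a ^+ 2 = euclid_norm u ^+ 2 / 4.
  by rewrite euclid_normZ exprMn real_normK ?num_real//; field.
have aQ : dotp a (hess_dir V x a) = Q / 4.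
  rewrite /Q mulr_suml; apply: eq_bigr => i _; rewrite !mxE.
  have -> : \sum_j a 0 j * partial i (partial j V) x = (\sum_j hessian V x i j * u 0 j) / 2.
    by rewrite mulr_suml; apply: eq_bigr => j _; rewrite !mxE; field.
  by field.
pose G := euclid_norm (hess_dir V x a) ^+ 2.
pose C2 := `|Q| + 4 * G + 4 * (beta ^+ 2 * euclid_norm u ^+ 2) + 4 * C.
have G0 : 0 <= G by exact: sqr_ge0.
have C20 : 0 <= C2.
  have h1 := normr_ge0 Q; have h2 := mulr_ge0 (sqr_ge0 beta) (sqr_ge0 (euclid_norm u)).
  by rewrite /C2; lra.
have K0 : 0 <= C + 2 * beta + C2 by have := ltW b0; lra.
apply/ler_addgt0Pr => e e0.
have : (fun J : nat => (C + 2 * beta + C2) * 2^-1 ^+ J) @ \oo --> (C + 2 * beta + C2) * 0.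
  apply: cvgM; [exact: cvg_cst|apply: cvg_expr].
  by rewrite ger0_norm ?invr_ge0// invf_lt1// ltr1n.
(* One J is chosen for which C q and 2 beta q are at most 1/2 and the error C2 q is at most e. *)
rewrite mulr0 => /cvgrPdist_le/(_ (Num.min e 2^-1)).
rewrite lt_min e0 invr_gt0 ltr0n => /(_ isT)[J _ /(_ J (leqnn J))] /=.
rewrite sub0r normrN ger0_norm ?mulr_ge0 ?exprn_ge0 ?invr_ge0// exprVn.
set q := (2 ^+ J)^-1; rewrite le_min => /andP[he hh].
have q0 : 0 < q by rewrite invr_gt0 exprn_gt0.
have q1 : q <= 1 by rewrite invf_le1 ?exprn_gt0// exprn_ege1// ler1n.
have d1 : C * q <= 2^-1 by apply: le_trans hh; rewrite ler_pM2r// -addrA lerDl addr_ge0// mulr_ge0// ltW.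
have d2 : 2 * beta * q <= 2^-1 by apply: le_trans hh; rewrite ler_pM2r// addrAC lerDr addr_ge0.
have d3 : C2 * q <= e by apply: le_trans he; rewrite ler_pM2r// lerDr addr_ge0// mulr_ge0// ltW.
have t0 : 0 < q ^+ 5 by rewrite exprn_gt0.
have bt : 2 * beta * q ^+ 5 <= 1.
  apply: (@le_trans _ _ (2 * beta * q)); last by apply: (le_trans d2); lra.
  by rewrite ler_pM2l ?mulr_gt0// -[leRHS]expr1 expr_le_expr// ltW.
have := hC J d1; rewrite -/q au aa aQ => h.
have := small_time_limit q0 q1 G0 C0 (sqr_ge0 (euclid_norm u)) (shift_cost_sqr_le b0 t0 bt) h.
by move=> /le_trans; apply; rewrite lerD2l.
Qed.

End curvature_upper_bound.

(** Conjugation of exponents is an involution of ]1, oo[, so quantifiers over p and over q can be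
    exchanged in both directions. *)
Lemma conjugate_exponent (R : realFieldType) (p : R) : 1 < p ->
  1 < p / (p - 1) /\ p / (p - 1) / (p / (p - 1) - 1) = p.
Proof.
move=> p1; have d0 : 0 < p - 1 by rewrite subr_gt0.
split; first by rewrite ltr_pdivlMr// mul1r gtrBl ltr01.
by field; rewrite !gt_eqF//; lra.
Qed.

Theorem theorem1p1 (R : realType) (d : nat) (dO : measure_display)
    (Omega : measurableType dO) (P : probability Omega R)
    (B : R -> {RV P >-> 'rV[R]_d}) (V : 'rV[R]_d -> R)
    (X : 'rV[R]_d -> R -> {RV P >-> 'rV[R]_d}) (beta : R)
    (hB : brownian B) (hV : smooth V) (hX : langevin_flow B V X)
    (hbeta : 0 < beta) :
  (CurvBdd beta V -> LGE X beta) /\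
  (LGE X beta <-> forall p, 1 < p -> SH X beta p) /\
  ((forall p, 1 < p -> SH X beta p) -> exists2 p, 1 < p & SH X beta p) /\
  ((exists2 p, 1 < p & SH X beta p) -> SHlog X beta) /\
  (SHlog X beta -> CurvUB beta V) /\
  ((forall p, 1 < p -> SH X beta p) <-> (forall q, 1 < q -> SRT X beta q)) /\
  ((exists2 p, 1 < p & SH X beta p) <-> (exists2 q, 1 < q & SRT X beta q)) /\
  (SHlog X beta <-> SRT1 X beta) /\
  ((forall q, 1 < q -> SRT X beta q) -> exists2 q, 1 < q & SRT X beta q) /\
  ((exists2 q, 1 < q & SRT X beta q) -> SRT1 X beta).
Proof.
have two1 : 1 < 2 :> R by rewrite ltr1n.
have SRT_SH q : 1 < q -> SRT X beta q <-> SH X beta (q / (q - 1)).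
  by move=> /conjugate_exponent[q1 {1}<-]; rewrite SH_SRT.
have some : (exists2 p, 1 < p & SH X beta p) <-> (exists2 q, 1 < q & SRT X beta q).
  split=> -[p p1 h]; exists (p / (p - 1)); try by case: (conjugate_exponent p1).
    exact/SH_SRT.
  exact/SRT_SH.
have some_log : (exists2 p, 1 < p & SH X beta p) -> SHlog X beta by case=> p p1; exact: SH_SHlog.
split; [|split; [split|split; [|split; [|split; [|split; [split|split; [|split; [|split]]]]]]]].
(* The curvature bound yields (SH_p) for every p > 1, and (LGE) is recovered from these. *)
- by move=> hC; apply: (SH_LGE hbeta) => p p1; exact: (CurvBdd_SH hV hbeta hC hB hX).
- by move=> h p p1; exact: LGE_SH.
- exact: SH_LGE.
- by move=> h; exists 2 => //; exact: h.
- exact: some_log.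
- exact: (SHlog_CurvUB hV hB hX hbeta).
- move=> h q q1; apply/(SRT_SH _ q1)/h; exact: (conjugate_exponent q1).1.
- move=> h p p1; apply/(SH_SRT _ _ p1)/h; exact: (conjugate_exponent p1).1.
- exact: some.
- exact: SHlog_SRT1.
- by move=> h; exists 2 => //; exact: h.
- by move=> /some/some_log/SHlog_SRT1.
Qed.
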